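(* Let $f:(0,\infty)\to\mathbb{R}$ be a smooth function with $f(R)\neq0$ for all $R>0$, and let $M=\mathbb{R}^3\setminus\{0\}$ carry the Poisson bivector field $\alpha^{ij}(x)=f(|x|)\,\epsilon^{ij}{}_k\,x^k$, where $|\ |$ is the Euclidean norm and $\epsilon$ is the totally antisymmetric symbol. Let $A(R)=4\pi R/f(R)$ (the symplectic area of the sphere of radius $R$). Then the phase space $\mathcal{G}$ of the Poisson sigma model with target $(M,\alpha)$ is singular if and only if $A$ is non-constant and has critical points.
   Context: Phase space. Let $I=[0,1]$. $\mathcal{C}$ is the Banach manifold of pairs $(X,\eta)$, $X\in C^1(I,M)$, $\eta$ a continuous 1-form on $I$ with values in $X^*(T^*M)$, satisfying $\mathrm{d}X^i+\alpha^{ij}(X)\eta_j=0$. Infinitesimal gauge transformations: for $\beta$ a $C^1$ section of $X^*(T^*M)$ vanishing at $u=0,1$, $\delta X^i=-\alpha^{ij}(X)\beta_j$, $\delta\eta_i=\mathrm{d}_u\beta_i+\partial_i\alpha^{jk}(X)\eta_j\beta_k$. These span an integrable distribution on $\mathcal{C}$ of codimension $2\dim M$, and $\mathcal{G}$ is the space of leaves of the corresponding foliation: two solutions define the same point of $\mathcal{G}$ iff they are joined by a path in $\mathcal{C}$ whose velocity is at each time an infinitesimal gauge transformation. $\mathcal{G}$ is called singular if it is not a smooth manifold, i.e. if there do not exist a smooth manifold $N$ and a smooth submersion $\mathcal{C}\to N$ whose fibres are exactly the leaves. *)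

(* Defs.v *)
From HB Require Import structures.
From mathcomp Require Import all_boot all_order all_algebra.
From mathcomp Require Import all_classical all_reals all_analysis.

Set Implicit Arguments.
Unset Strict Implicit.
Unset Printing Implicit Defensive.

Import Order.TTheory GRing.Theory Num.Theory.
Import numFieldNormedType.Exports.

Local Open Scope classical_set_scope.
Local Open Scope ring_scope.

Definition itv01 {R : realType} : set R := `[0, 1].

Section ContinuousPaths.
Context {R : realType}.

(* A path on I = [0, 1] is a function on all of R that is extended by zero
   outside I; the extension carries no information, it only makes the sup norm
   over I separate points. *)
Definition C0path (V : normedModType R) : {pred R -> V} :=
  mem [set g : R -> V | {within itv01, continuous g} /\
                        (forall u, ~ itv01 u -> g u = 0)].

Record C0 (V : normedModType R) := MkC0 {
  C0fun :> R -> V ;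
  _ : C0fun \in @C0path V }.

HB.instance Definition _ V := [isSub for @C0fun V].
HB.instance Definition _ V := [Choice of C0 V by <:].

Context {V : normedModType R}.

Lemma C0path_submod : submod_closed (@C0path V).
Proof.
split.
  by rewrite inE; split=> // x; exact: cvg_cst.
move=> a f g; rewrite !inE => -[cf f0] [cg g0]; split.
  move=> x; apply: (@cvgD _ _ (subspace itv01)); last exact: cg.
  by apply: cvgZl_tmp; exact: cf.
by move=> u Iu; rewrite /GRing.add/= /GRing.scale/= f0// g0// scaler0 addr0.
Qed.

HB.instance Definition _ := GRing.isSubmodClosed.Build R (R -> V) (@C0path V)
  C0path_submod.
HB.instance Definition _ := [SubChoice_isSubLmodule of C0 V by <:].

Definition C0norm (g : C0 V) : R := sup [set `|g u| | u in itv01].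

Lemma C0norm_has_sup (g : C0 V) : has_sup [set `|g u| | u in itv01].
Proof.
split.
  by exists `|g 0|; exists 0 => //; rewrite /itv01/= in_itv/= lexx ler01.
have := valP g; rewrite inE => -[cg _].
have : {within `[0, 1], continuous (fun u => `|g u|)}.
  by move=> x; apply: cvg_norm; exact: cg.
move=> /(EVT_max ler01)[c _ cmax].
by exists `|g c| => _ [u Iu <-]; exact: cmax.
Qed.

Lemma C0norm_ub (g : C0 V) u : itv01 u -> `|g u| <= C0norm g.
Proof.
by move=> Iu; apply: sup_upper_bound; [exact: C0norm_has_sup|exists u].
Qed.

Lemma C0norm_le (g : C0 V) (K : R) :
  (forall u, itv01 u -> `|g u| <= K) -> C0norm g <= K.
Proof.
move=> gK; apply: ge_sup; first by case: (C0norm_has_sup g).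
by move=> _ [u Iu <-]; exact: gK.
Qed.

Lemma itv01_0 : itv01 (0 : R).
Proof. by rewrite /itv01/= in_itv/= lexx ler01. Qed.

Lemma C0normD (f g : C0 V) : C0norm (f + g) <= C0norm f + C0norm g.
Proof.
apply: C0norm_le => u Iu; rewrite (le_trans (ler_normD _ _))//.
by rewrite lerD// C0norm_ub.
Qed.

Lemma C0normZ (a : R) (g : C0 V) : C0norm (a *: g) = `|a| * C0norm g.
Proof.
have le_Z b (h : C0 V) : C0norm (b *: h) <= `|b| * C0norm h.
  apply: C0norm_le => u Iu.
  by rewrite -[(b *: h) u]/(b *: h u) normrZ ler_wpM2l// C0norm_ub.
apply/le_anti; rewrite le_Z/=.
have [->|a0] := eqVneq a 0.
  by rewrite normr0 mul0r (le_trans _ (C0norm_ub _ itv01_0)).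
rewrite -ler_pdivlMl ?normr_gt0// -normfV.
by rewrite -[in leLHS](scalerK a0 g) le_Z.
Qed.

Lemma C0norm0_eq0 (g : C0 V) : C0norm g = 0 -> g = 0.
Proof.
move=> g0; apply/val_inj/funext => u /=.
have [Iu|Iu] := pselect (itv01 u).
  by apply/eqP; rewrite -normr_le0 -g0; exact: C0norm_ub.
by have := valP g; rewrite inE => -[_ ->].
Qed.

HB.instance Definition _ :=
  Lmodule_isNormed.Build R (C0 V) C0normD C0normZ C0norm0_eq0.

End ContinuousPaths.

Section C1Paths.
Context {R : realType}.

(* A C^1 path is stored with its velocity, so that the norm inherited from
   C0 V * C0 V is max(sup |X|, sup |X'|).  Derivatives are taken within I,
   hence are one-sided at 0 and 1. *)
Definition C1path (V : normedModType R) : {pred C0 V * C0 V} :=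
  mem [set p : C0 V * C0 V | forall u, itv01 u ->
    (w - u)^-1 *: (p.1 w - p.1 u) @[w --> within itv01 u^'] --> p.2 u].

Record C1 (V : normedModType R) := MkC1 {
  C1pair : C0 V * C0 V ;
  _ : C1pair \in @C1path V }.

HB.instance Definition _ V := [isSub for @C1pair V].
HB.instance Definition _ V := [Choice of C1 V by <:].

Definition C1fun (V : normedModType R) (X : C1 V) : R -> V := (C1pair X).1.
Definition velocity (V : normedModType R) (X : C1 V) : R -> V := (C1pair X).2.

Context {V : normedModType R}.

Lemma C1path_submod : submod_closed (@C1path V).
Proof.
split.
  rewrite inE => u Iu /=.
  by under eq_fun do rewrite subr0 scaler0; exact: cvg_cst.
move=> a f g; rewrite !inE => cf cg u Iu.
have -> : (fun w => (w - u)^-1 *: ((a *: f + g).1 w - (a *: f + g).1 u)) =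
    (fun w => a *: ((w - u)^-1 *: (f.1 w - f.1 u)) +
              (w - u)^-1 *: (g.1 w - g.1 u)).
  apply/funext => w; rewrite -[(a *: f + g).1 w]/(a *: f.1 w + g.1 w).
  rewrite -[(a *: f + g).1 u]/(a *: f.1 u + g.1 u).
  by rewrite scalerA mulrC -scalerA -scalerDr opprD addrACA scalerBr.
apply: (@cvgD _ _ _ (within itv01 u^')); last exact: cg.
by apply: cvgZl_tmp; exact: cf.
Qed.

HB.instance Definition _ := GRing.isSubmodClosed.Build R (C0 V * C0 V)%type
  (@C1path V) C1path_submod.
HB.instance Definition _ := [SubChoice_isSubLmodule of C1 V by <:].

Definition C1norm (X : C1 V) : R := `|C1pair X|.

Lemma C1normD (X Y : C1 V) : C1norm (X + Y) <= C1norm X + C1norm Y.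
Proof. exact: ler_normD. Qed.

Lemma C1normZ (a : R) (X : C1 V) : C1norm (a *: X) = `|a| * C1norm X.
Proof. exact: normrZ. Qed.

Lemma C1norm0_eq0 (X : C1 V) : C1norm X = 0 -> X = 0.
Proof. by move/normr0_eq0 => X0; exact: val_inj. Qed.

HB.instance Definition _ :=
  Lmodule_isNormed.Build R (C1 V) C1normD C1normZ C1norm0_eq0.

End C1Paths.

Coercion C1fun : C1 >-> Funclass.

Section Smooth.
Context {R : realType}.

(* C^infinity in the Frechet sense.  [D x [:: v1; ...; vn]] is the n-th
   derivative at x, a bounded n-linear map; the last clause is Frechet
   differentiability of the n-th derivative in the operator norm of n-linear
   maps, with the direction of the new derivative in front. *)
Definition smooth_on (E F : normedModType R) (U : set E) (g : E -> F) : Prop :=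
  open U /\ exists D : E -> seq E -> F,
  [/\ forall x, U x -> D x [::] = g x,
      forall x, U x -> forall (s t : seq E) (a : R) (v w : E),
        D x (s ++ (a *: v + w) :: t) =
        a *: D x (s ++ v :: t) + D x (s ++ w :: t),
      forall x, U x -> forall n, exists K : R, forall s : seq E, size s = n ->
        `|D x s| <= K * \prod_(v <- s) `|v|
    & forall x, U x -> forall n (e : R), 0 < e -> \forall h \near (0 : E),
        forall s : seq E, size s = n ->
        `|D (x + h) s - D x s - D x (h :: s)|
          <= e * `|h| * \prod_(v <- s) `|v| ].

Record chart (N : topologicalType) (n : nat) := Chart {
  chart_dom : set N ;
  chart_map : N -> 'rV[R]_n ;
  chart_inv : 'rV[R]_n -> N }.

Definition chart_img N n (c : chart N n) : set 'rV[R]_n :=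
  chart_map c @` chart_dom c.

Definition is_chart N n (c : chart N n) : Prop :=
  [/\ open (chart_dom c), open (chart_img c),
      {in chart_dom c, cancel (chart_map c) (chart_inv c)},
      {within chart_dom c, continuous (chart_map c)}
    & {within chart_img c, continuous (chart_inv c)}].

Record smooth_manifold := SmoothManifold {
  mfd_space :> topologicalType ;
  mfd_dim : nat ;
  mfd_atlas : set (chart mfd_space mfd_dim) ;
  mfd_hausdorff : hausdorff_space mfd_space ;
  mfd_second_countable : @second_countable mfd_space ;
  mfd_cover : forall y, exists2 c, mfd_atlas c & chart_dom c y ;
  mfd_charts : forall c, mfd_atlas c -> is_chart c ;
  mfd_compat : forall c d, mfd_atlas c -> mfd_atlas d ->
    smooth_on (chart_map c @` (chart_dom c `&` chart_dom d))
              (chart_map d \o chart_inv c) }.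

Context {E : normedModType R}.

(* Tangent space at p of a submanifold S of E: velocities of curves in S. *)
Definition tangent (S : set E) (p : E) : set E :=
  [set v | exists gamma : R -> E,
    [/\ gamma 0 = p, \forall t \near (0 : R), S (gamma t)
      & is_derive (0 : R) 1 gamma v]].

(* S is a submanifold of E, so a map on S is smooth iff it extends locally to
   a smooth map on an open subset of E.  As N has finite dimension, the kernel
   of the differential automatically has a closed complement. *)
Definition smooth_submersion (S : set E) (N : smooth_manifold) (pr : E -> N)
    : Prop :=
  forall p, S p -> forall c, mfd_atlas c -> chart_dom c (pr p) ->
  exists (U : set E) (g : E -> 'rV[R]_(mfd_dim N)),
  [/\ U p, smooth_on U g,
      forall q, S q -> U q ->
        chart_dom c (pr q) /\ chart_map c (pr q) = g q
    & forall w, exists2 v, tangent S p v & 'd g p v = w].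

End Smooth.

Arguments smooth_manifold : clear implicits.

Section PoissonSigmaModel.
Context {R : realType} {m : nat}.
(* The target is an open subset M of R^m, with its global coordinates. *)
Variables (M : set 'rV[R]_m) (alpha : 'rV[R]_m -> 'M[R]_m).

Definition fields : normedModType R := (C1 'rV[R]_m * C0 'rV[R]_m)%type.

Definition solutions : set fields :=
  [set p : fields | forall u, itv01 u ->
    M (p.1 u) /\
    forall i, velocity p.1 u 0 i + \sum_j alpha (p.1 u) i j * p.2 u 0 j = 0].

Definition gauge_vector (p : fields) : set fields :=
  [set v : fields | exists beta : C1 'rV[R]_m,
    [/\ beta 0 = 0, beta 1 = 0 & forall u, itv01 u -> forall i,
      v.1 u 0 i = - \sum_j alpha (p.1 u) i j * beta u 0 j /\
      v.2 u 0 i = velocity beta u 0 i +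
        \sum_j \sum_k 'D_(delta_mx 0 i) (fun x => alpha x j k) (p.1 u)
                      * p.2 u 0 j * beta u 0 k]].

Definition same_leaf (p q : fields) : Prop :=
  exists gamma : C1 fields,
    [/\ gamma 0 = p, gamma 1 = q & forall t, itv01 t ->
      solutions (gamma t) /\ gauge_vector (gamma t) (velocity gamma t)].

(* Surjectivity of pr says that no fibre is empty. *)
Definition singular_phase_space : Prop :=
  ~ exists (N : smooth_manifold R) (pr : fields -> N),
    [/\ smooth_submersion solutions pr,
        forall y, exists2 p, solutions p & pr p = y
      & forall p q, solutions p -> solutions q ->
          (pr p = pr q <-> same_leaf p q)].

End PoissonSigmaModel.

Section Target.
Context {R : realType}.

(* epsilon_{012} = 1 *)
Definition levi_civita (i j k : 'I_3) : R :=
  (j%:R - i%:R) * (k%:R - j%:R) * (k%:R - i%:R) / 2.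

Definition euclid_norm (x : 'rV[R]_3) : R := Num.sqrt (\sum_i x 0 i ^+ 2).

Definition radial_bivector (f : R -> R) (x : 'rV[R]_3) : 'M[R]_3 :=
  \matrix_(i, j) (f (euclid_norm x) * \sum_k levi_civita i j k * x 0 k).

Definition symplectic_area (f : R -> R) (r : R) : R := 4 * pi * r / f r.

End Target.

(* Main.v *)
(* A solution keeps r = |X| constant and has the form X = q^-1 X(0) q for a path
   q of unit quaternions with q(0) = 1.  Put h(r) = r / f(r), so that A = 4 pi h.

   If h'(r) <> 0, a suitable combination of eta and of its radial component is
   the angular velocity of such a path q and transforms under gauge
   transformations as a connection; hence q(1) is constant along the leaves.  As
   the unit quaternions are simply connected, (X(0), q(1)) determines the leaf.
   When h' has no zero these pairs form a manifold, an open subset of R^6.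

   If h'(r) = 0, the radial component of eta decouples: the integral of eta . X
   is constant along the leaves.  When h' = 0 identically, the leaf is determined
   by X(0), X(1) and this integral, which again range over an open subset of R^6.

   If h' vanishes at r0 but takes nonzero values arbitrarily close to r0, let n be
   a unit vector.  For h'(r) <> 0 and every integer j, the full turns around n show
   that the configurations (r n, 0) and (r n, 4 pi j h'(r) n) lie on one leaf.
   Letting r tend to r0 with j h'(r) tending to 1, a Hausdorff leaf space would
   identify (r0 n, 0) with (r0 n, 4 pi n), although the integral of eta . X
   separates them. *)

(* The number 4 pi h'(r) of the overview is A'(r). Over X = r n the leaves determine the radial
   component of eta only modulo the period group A'(r) Z. This group has rank 1 near a radius with
   A'(r) nonzero and rank 0 when A is constant; the phase space is singular exactly when the rank
   jumps.

   Two obstacles shape the regular cases. A submersion on a space of paths has to be smooth in the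
   Frechet sense, so the end value q(1) of a differential equation needs derivatives of every order
   in the configuration; for this reason all estimates are kept uniform in the path parameter u.
   Moreover an actual manifold has to be exhibited: in each case the invariants are packed into an
   open subset of R^6, so that a single chart suffices. Surjectivity of the differential is then
   read off explicit curves of solutions.

   Joining two configurations inside a leaf requires a C^1 curve in the Banach space of fields,
   hence a homotopy of unit quaternion paths that is smooth in the homotopy parameter uniformly in
   u; a merely continuous null-homotopy would not be enough. *)
Require Import Defs.
From HB Require Import structures.
From mathcomp Require Import all_boot all_order all_algebra.
From mathcomp Require Import all_classical all_reals all_analysis.
From mathcomp Require Import ring lra zify.

Import Order.TTheory GRing.Theory Num.Theory.
Import numFieldNormedType.Exports.

Set Implicit Arguments.
Unset Strict Implicit.
Unset Printing Implicit Defensive.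

Local Open Scope classical_set_scope.
Local Open Scope ring_scope.

(** * Calculus on the unit interval *)

Section RealLine.
Context {R : realType}.
Implicit Types (f g F G : R -> R) (u a b : R).

Lemma itv01P u : itv01 u <-> 0 <= u <= 1.
Proof. by rewrite /itv01/= in_itv. Qed.

Lemma itv01_1 : itv01 (1 : R).
Proof. by apply/itv01P; rewrite ler01 lexx. Qed.

(** Projection onto [0,1]. Composing with it extends a function continuous on [0,1] to a continuous
    function on the line, so that derivatives at 0 and 1 can be two-sided. *)
Definition clamp u : R := Num.max 0 (Num.min 1 u).

Lemma clamp_id u : itv01 u -> clamp u = u.
Proof.
move/itv01P => /andP[u0 u1]; rewrite /clamp.
by rewrite (min_idPr u1) (max_idPr u0).
Qed.

Lemma clamp01 u : itv01 (clamp u).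
Proof.
apply/itv01P; rewrite /clamp le_max lexx/= ge_max ler01/=.
by rewrite ge_min lexx.
Qed.

Lemma clamp_lip u v : `|clamp u - clamp v| <= `|u - v|.
Proof.
rewrite /clamp /Num.max /Num.min.
rewrite ler_norml.
case: (lerP 0 (u - v)) => h; [rewrite (ger0_norm h)|rewrite (ltr0_norm h)];
case: (ltP 1 u) => ?; case: (ltP 1 v) => ?; case: ltP => ?; case: ltP => ?; lra.
Qed.

Lemma continuous_clamp : continuous clamp.
Proof.
move=> x; apply/cvgrPdist_lt => e e0; near=> y.
apply: le_lt_trans (clamp_lip _ _) _.
by near: y; apply: cvgr_dist_lt => //; exact: cvg_id.
Unshelve. all: by end_near. Qed.

Lemma dv_add f g u a b : is_derive u 1 f a -> is_derive u 1 g b ->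
  is_derive u 1 (fun x => f x + g x) (a + b).
Proof. by move=> ? ?; exact: is_deriveD. Qed.

Lemma dv_sub f g u a b : is_derive u 1 f a -> is_derive u 1 g b ->
  is_derive u 1 (fun x => f x - g x) (a - b).
Proof. by move=> ? ?; exact: is_deriveB. Qed.

Lemma dv_opp f u a : is_derive u 1 f a -> is_derive u 1 (fun x => - f x) (- a).
Proof. by move=> ?; exact: is_deriveN. Qed.

Lemma dv_mul f g u a b : is_derive u 1 f a -> is_derive u 1 g b ->
  is_derive u 1 (fun x => f x * g x) (a * g u + f u * b).
Proof.
move=> df dg; have := @is_deriveM _ _ f g u 1 a b df dg.
by move/(@is_derive_eq _ _ _ _ _ _ _ _); apply; rewrite /GRing.scale/=; ring.
Qed.

Lemma dv_cst u (c : R) : is_derive u 1 (fun=> c) 0.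
Proof. exact: is_derive_cst. Qed.

Lemma dv_id u : is_derive u 1 (fun x : R => x) 1.
Proof. exact: is_derive_id. Qed.

Lemma dv_cmul (c : R) f u a : is_derive u 1 f a ->
  is_derive u 1 (fun x => c * f x) (c * a).
Proof. by move=> ?; exact: is_deriveZ. Qed.

Lemma dv_comp f g u a b : is_derive (g u) 1 f a -> is_derive u 1 g b ->
  is_derive u 1 (fun x => f (g x)) (a * b).
Proof. by move=> ? ?; exact: is_derive1_comp. Qed.

Lemma dv_inv f u a : f u != 0 -> is_derive u 1 f a ->
  is_derive u 1 (fun x => (f x)^-1) (- a / (f u) ^+ 2).
Proof.
move=> fu df; have := is_deriveV fu df.
by move/(@is_derive_eq _ _ _ _ _ _ _ _); apply; rewrite /GRing.scale/=; field.
Qed.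

Lemma dv_cont f u a : is_derive u 1 f a -> {for u, continuous f}.
Proof. by case=> /derivable1_diffP/differentiable_continuous. Qed.

Lemma dv_eq f u a b : is_derive u 1 f a -> a = b -> is_derive u 1 f b.
Proof. by move=> + <-. Qed.

(** The derivatives are two-sided also at 0 and 1; paths known on [0,1] only are first extended past
    the ends, as in [prim], [fext] and [path_ext]. *)
Definition der01 f (f' : R -> R) := forall u, itv01 u -> is_derive u 1 f (f' u).
Definition cont01 f := forall u, itv01 u -> {for u, continuous f}.

Lemma cont01_within f : cont01 f -> {within itv01, continuous f}.
Proof.
move=> cf; apply/continuous_within_itvP => //; split.
- move=> x /[!in_itv]/= /andP[x0 x1]; apply: cf.
  by apply/itv01P; rewrite !ltW.
- by apply: cvg_at_right_filter; apply: cf; exact: itv01_0.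
- by apply: cvg_at_left_filter; apply: cf; exact: itv01_1.
Qed.

Lemma mvt01 f f' a b : der01 f f' -> itv01 a -> itv01 b ->
  exists2 c, itv01 c & f b - f a = f' c * (b - a).
Proof.
move=> df; wlog ab : a b / a <= b => [wl ia ib|].
  have [/wl|/ltW/wl] := leP a b; first exact.
  move=> /(_ ib ia)[c ic e]; exists c => //.
  by rewrite -opprB e; ring.
move=> /itv01P /andP[a0 a1] /itv01P /andP[b0 b1].
have [||c] := @MVT_segment _ f f' a b ab.
- move=> x /[!in_itv]/= /andP[ax xb]; apply: df; apply/itv01P.
  by rewrite (le_trans a0 (ltW ax)) (le_trans (ltW xb)).
- have [eab|neab] := eqVneq a b.
    rewrite eab set_itv1; exact: continuous_subspace1.
  have ltab : a < b by rewrite lt_neqAle neab.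
  have ic x : a <= x <= b -> {for x, continuous f}.
    move=> /andP[ax xb]; have /df/dv_cont// : itv01 x.
    by apply/itv01P; rewrite (le_trans a0 ax) (le_trans xb).
  apply/continuous_within_itvP => //; split.
  + by move=> x /[!in_itv]/= /andP[ax xb]; apply: ic; rewrite !ltW.
  + by apply: cvg_at_right_filter; apply: ic; rewrite lexx ltW.
  + by apply: cvg_at_left_filter; apply: ic; rewrite lexx ltW.
rewrite in_itv/= => /andP[ac cb] e; exists c => //.
by apply/itv01P; rewrite (le_trans a0 ac) (le_trans cb).
Qed.
Arguments mvt01 {f f'} a b.

Lemma mvt01_le f f' (K : R) a b : der01 f f' ->
  (forall u, itv01 u -> `|f' u| <= K) -> itv01 a -> itv01 b ->
  `|f b - f a| <= K * `|b - a|.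
Proof.
move=> df fK ia ib; have [c ic ->] := mvt01 a b df ia ib.
by rewrite normrM ler_wpM2r// fK.
Qed.

Lemma der01_cst f : der01 f (fun=> 0) -> forall u, itv01 u -> f u = f 0.
Proof.
move=> df u iu; have [c _] := mvt01 _ _ df itv01_0 iu.
by rewrite mul0r => /eqP; rewrite subr_eq0 => /eqP.
Qed.

Lemma der01_cont f f' : der01 f f' -> cont01 f.
Proof. by move=> df u /df /dv_cont. Qed.

Lemma cont01_clamp f : {within itv01, continuous f} ->
  continuous (fun u => f (clamp u)).
Proof.
move=> /subspace_continuousP cf x.
apply: cvg_trans (cf _ (clamp01 x)) => A nA.
have [B nB BA] : exists2 B, nbhs (clamp x) B & forall y, B y -> itv01 y -> A (f y).
  by exists (fun y => itv01 y -> A (f y)).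
have /= := continuous_clamp nB; rewrite !nbhs_simpl/=; apply: filterS => y By.
by apply: BA => //; exact: clamp01.
Qed.

(** The integral starts at -1, so that 0 is an interior point and the primitive has a two-sided
    derivative there. Outside [0,1] the integrand is continued by its end values. *)
Definition prim f u : R :=
  \int[lebesgue_measure]_(s in `[-1, u]) f (clamp s) -
  \int[lebesgue_measure]_(s in `[-1, 0]) f (clamp s).

Lemma prim0 f : prim f 0 = 0.
Proof. exact: subrr. Qed.

Lemma prim_der f : {within itv01, continuous f} -> der01 (prim f) f.
Proof.
move=> cf u iu; have /itv01P /andP[u0 u1] := iu.
have cc : continuous (fun s => f (clamp s)) by exact: cont01_clamp.
have [||||d e] := @continuous_FTC1_closed R (fun s => f (clamp s)) (-1) u (u + 1).
- by rewrite ltrDl.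
- apply: continuous_compact_integrable; first exact: segment_compact.
  exact: continuous_subspaceT.
- by rewrite (lt_le_trans _ u0)// ltrN10.
- exact: cc.
rewrite -[f u]subr0 -{2}(clamp_id iu) -e derive1E.
by apply: dv_sub (dv_cst _ _); exact: derivableP.
Qed.

Lemma prim_unique f F : {within itv01, continuous f} -> der01 F f ->
  forall u, itv01 u -> prim f u = F u - F 0.
Proof.
move=> cf dF u iu; have dp := prim_der cf.
have : der01 (fun x => prim f x - F x) (fun=> 0).
  by move=> x ix; apply: dv_eq; [exact: dv_sub (dp _ ix) (dF _ ix)|rewrite subrr].
by move/der01_cst/(_ _ iu); rewrite prim0; lra.
Qed.

Lemma eq_prim f g : (forall u, itv01 u -> f u = g u) -> prim f = prim g.
Proof.
move=> fg; apply/funext => u; rewrite /prim.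
by have -> : (fun s => f (clamp s)) = (fun s => g (clamp s));
  [apply/funext => s; rewrite fg//; exact: clamp01|].
Qed.

Lemma prim_le f (K : R) : {within itv01, continuous f} ->
  (forall u, itv01 u -> `|f u| <= K) -> forall u, itv01 u -> `|prim f u| <= K.
Proof.
move=> cf fK u iu.
have K0 : 0 <= K by apply: le_trans (fK _ iu).
have := mvt01_le (prim_der cf) fK itv01_0 iu; rewrite prim0 subr0 => /le_trans; apply.
have /itv01P /andP[u0 u1] := iu.
by rewrite subr0 ger0_norm// ler_piMr.
Qed.

Lemma cont01_prim f : {within itv01, continuous f} -> cont01 (prim f).
Proof. by move/prim_der/der01_cont. Qed.

Lemma within01D f g : {within itv01, continuous f} ->
  {within itv01, continuous g} -> {within itv01, continuous (fun u => f u + g u)}.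
Proof. by move=> cf cg x; apply: cvgD; [exact: cf|exact: cg]. Qed.

Lemma within01M f g : {within itv01, continuous f} ->
  {within itv01, continuous g} -> {within itv01, continuous (fun u => f u * g u)}.
Proof. by move=> cf cg x; apply: cvgM; [exact: cf|exact: cg]. Qed.

Lemma within01_cst (c : R) : {within itv01, continuous (fun _ : R => c)}.
Proof. by move=> x; exact: cvg_cst. Qed.

Lemma primD f g : {within itv01, continuous f} -> {within itv01, continuous g} ->
  forall u, itv01 u -> prim (fun u => f u + g u) u = prim f u + prim g u.
Proof.
move=> cf cg u iu.
rewrite (@prim_unique _ (fun u => prim f u + prim g u) _ _ _ iu).
- by rewrite !prim0 !addr0 subr0.
- exact: within01D.
- by move=> x ix; apply: dv_add; exact: prim_der.
Qed.

Lemma primZ (c : R) f : {within itv01, continuous f} ->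
  forall u, itv01 u -> prim (fun u => c * f u) u = c * prim f u.
Proof.
move=> cf u iu.
rewrite (@prim_unique _ (fun u => c * prim f u) _ _ _ iu).
- by rewrite !prim0 mulr0 subr0.
- by apply: within01M => //; exact: within01_cst.
- by move=> x ix; apply: dv_cmul; exact: prim_der.
Qed.

End RealLine.

(** * Families of functions that are smooth uniformly in a parameter *)

Section SmoothFamilies.
Context {R : realType} {E : normedModType R}.
Variable U : set E.

(* A family [G x v u] is a function of a point [x] of [U], of the vectors
   [v j] for [j] in a list [J], and of a parameter [u] in [0, 1].  Naming the
   vector arguments instead of ordering them makes products and derivatives of
   families multilinear without any reindexing. *)
Definition mfamily := E -> (nat -> E) -> R -> R.
Implicit Types (G : mfamily) (J : seq nat) (v : nat -> E) (x y z h w : E).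

Definition pnorm v J : R := \prod_(j <- J) `|v j|.

Definition upd v (j : nat) w : nat -> E := fun i => if i == j then w else v i.

Lemma pnorm_ge0 v J : 0 <= pnorm v J.
Proof. by apply: prodr_ge0. Qed.

Lemma pnorm_cons v j J : pnorm v (j :: J) = `|v j| * pnorm v J.
Proof. exact: big_cons. Qed.

Lemma pnorm_cat v J1 J2 : pnorm v (J1 ++ J2) = pnorm v J1 * pnorm v J2.
Proof. exact: big_cat. Qed.

Lemma pnorm_eq v v' J : {in J, v =1 v'} -> pnorm v J = pnorm v' J.
Proof. by move=> vv'; apply: eq_big_seq => j /vv' ->. Qed.

Lemma upd_notin v j w J : j \notin J -> {in J, upd v j w =1 v}.
Proof. by move=> jJ i iJ; rewrite /upd; case: eqP iJ jJ => // -> ->. Qed.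

Lemma updE v j w : upd v j w j = w.
Proof. by rewrite /upd eqxx. Qed.

Lemma pnorm_upd v j w J : j \notin J -> pnorm (upd v j w) (j :: J) = `|w| * pnorm v J.
Proof. by move=> jJ; rewrite pnorm_cons updE (pnorm_eq (upd_notin _ _ jJ)). Qed.

Definition loc_bounded J G x := exists r K : R, [/\ 0 < r, 0 <= K &
  forall y, `|y - x| < r -> U y /\ forall v u, itv01 u -> `|G y v u| <= K * pnorm v J].

(* [G'] is the derivative of [G] in the direction of the new argument [v j], with
   a quadratic remainder that is uniform in the parameter [u]. *)
Definition loc_deriv j J G G' x := exists r K : R, [/\ 0 < r, 0 <= K &
  forall y z, `|y - x| < r -> `|z - x| < r -> forall v u, itv01 u ->
    `|G z v u - G y v u - G' y (upd v j (z - y)) u| <= K * `|z - y| ^+ 2 * pnorm v J].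

(** No continuity in the point is required here: it follows from one derivative, see
    [cls_lipschitz]. *)
Record cls0 J G : Prop := Cls0 {
  cls_uniq : uniq J ;
  cls_dep : forall x v v' u, U x -> itv01 u -> {in J, v =1 v'} -> G x v u = G x v' u ;
  cls_linear : forall x v j a w1 w2 u, U x -> itv01 u -> j \in J ->
    G x (upd v j (a *: w1 + w2)) u = a * G x (upd v j w1) u + G x (upd v j w2) u ;
  cls_bounded : forall x, U x -> loc_bounded J G x ;
  cls_within : forall x v, U x -> {within itv01, continuous (G x v)} }.

(** Smoothness is [cls n] for all n; finitely many orders at a time suit inductions on n.
    Derivatives are requested under every fresh name, because both factors of a product have to be
    differentiated under the same name. *)
Fixpoint cls n J G : Prop := cls0 J G /\
  match n with
  | 0 => True
  | n'.+1 => forall j, j \notin J ->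
      exists2 G', cls n' (j :: J) G' & forall x, U x -> loc_deriv j J G G' x
  end.

Lemma cls_cls0 n J G : cls n J G -> cls0 J G.
Proof. by case: n => [|n] []. Qed.

Lemma cls_deriv n J G j : cls n.+1 J G -> j \notin J ->
  exists2 G', cls n (j :: J) G' & forall x, U x -> loc_deriv j J G G' x.
Proof. by case=> _; exact. Qed.

Lemma cls_pred n J G : cls n.+1 J G -> cls n J G.
Proof.
elim: n J G => [|n IHn] J G; first by case.
case=> G0 dG; split=> // j /dG[G' G'n dG']; exists G' => //.
exact: IHn.
Qed.

Lemma cls_leq m n J G : (m <= n)%N -> cls n J G -> cls m J G.
Proof.
move=> /subnK <-; elim: (n - m)%N => // k IHk; rewrite addSn => /cls_pred.
exact: IHk.
Qed.

Lemma pnorm_perm v J J' : perm_eq J J' -> pnorm v J = pnorm v J'.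
Proof. by move=> JJ'; apply: perm_big. Qed.

(** The Leibniz rule leaves the new argument in the middle of the list of names. *)
Lemma cls_perm n J J' G : perm_eq J J' -> cls n J G -> cls n J' G.
Proof.
elim: n J J' G => [|n IHn] J J' G JJ' [[Ju Gd Gl Gb Gc] dG]; (split; first split).
all: try by rewrite -(perm_uniq JJ').
all: try by move=> x v v' u Ux iu vv'; apply: Gd => // j; rewrite (perm_mem JJ'); exact: vv'.
all: try by move=> x v j a w1 w2 u Ux iu; rewrite -(perm_mem JJ'); exact: Gl.
all: try by move=> x Ux; have [r [K [r0 K0 GK]]] := Gb _ Ux; exists r, K; split=> // y /GK[Uy yK]; split=> // v u iu; rewrite -(pnorm_perm _ JJ') yK.
all: try by [].
move=> j; rewrite -(perm_mem JJ') => /dG[G' G'n dG']; exists G'.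
  by apply: IHn G'n; rewrite perm_cons.
move=> x /dG'[r [K [r0 K0 GK]]]; exists r, K; split=> // y z yr zr v u iu.
by rewrite -(pnorm_perm _ JJ') GK.
Qed.

Lemma cls_ext n J G1 G2 :
  (forall x v u, U x -> itv01 u -> G1 x v u = G2 x v u) -> cls n J G1 -> cls n J G2.
Proof.
move=> G12; have ext0 : cls0 J G1 -> cls0 J G2.
  case=> Ju Gd Gl Gb Gc; split=> //.
  - by move=> x v v' u Ux iu vv'; rewrite -!G12//; exact: Gd.
  - by move=> x v j a w1 w2 u Ux iu jJ; rewrite -!G12//; exact: Gl.
  - move=> x Ux; have [r [K [r0 K0 GK]]] := Gb _ Ux; exists r, K; split=> // y /GK[Uy yK].
    by split=> // v u iu; rewrite -G12// yK.
  - move=> x v Ux; have := Gc x v Ux; apply: subspace_eq_continuous => u /set_mem iu /=.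
    by rewrite /from_subspace G12.
case: n => [|n] [G0 dG]; (split; first exact: ext0) => // j jJ.
have [G' G'n dG'] := dG _ jJ; exists G' => // x Ux.
have [r [K [r0 K0 GK]]] := dG' _ Ux.
have [r' [K' [r'0 _ U']]] := cls_bounded G0 Ux.
exists (Num.min r r'), K; split=> [|//|y z]; rewrite ?lt_min ?r0//.
by move=> /andP[yr /U'[Uy _]] /andP[zr /U'[Uz _]] v u iu; rewrite -!G12//; exact: GK.
Qed.

(** The derivative is locally bounded, and on a ball of radius r the quadratic remainder is at most
    2 r times a linear one. The name [j] only has to be fresh. *)
Lemma cls_lipschitz n J G x : cls n.+1 J G -> U x ->
  exists r K : R, [/\ 0 < r, 0 <= K & forall y z, `|y - x| < r -> `|z - x| < r ->
    forall v u, itv01 u -> `|G z v u - G y v u| <= K * `|z - y| * pnorm v J].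
Proof.
move=> Gn Ux; pose j := (\max_(i <- J) i).+1.
have jJ : j \notin J.
  by apply/negP => /(@leq_bigmax_seq _ _ predT id)/(_ isT); rewrite ltnn.
have [G' /cls_cls0 G'0 dG'] := cls_deriv Gn jJ.
have [r [K [r0 K0 GK]]] := dG' _ Ux.
have [r' [K' [r'0 K'0 GK']]] := cls_bounded G'0 Ux.
exists (Num.min r r'), (K * (r + r) + K'); split.
- by rewrite lt_min r0.
- by rewrite addr_ge0// mulr_ge0// addr_ge0// ltW.
move=> y z; rewrite !lt_min => /andP[yr yr'] /andP[zr zr'] v u iu.
have := GK _ _ yr zr v u iu.
have := (GK' _ yr').2 (upd v j (z - y)) u iu.
rewrite pnorm_upd//; set a := G z v u - _; set b := G' _ _ _; set p := pnorm _ _.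
move=> bK abK; have zy : `|z - y| <= r + r.
  have -> : z - y = (z - x) - (y - x) by rewrite opprB addrA subrK.
  by rewrite (le_trans (ler_normB _ _))// lerD// ltW.
have p0 : 0 <= p by exact: pnorm_ge0.
have -> : a = (a - b) + b by rewrite subrK.
rewrite (le_trans (ler_normD _ _))// mulrDl mulrDl lerD//; last by rewrite -mulrA.
by rewrite (le_trans abK)// ler_wpM2r// expr2 mulrA ler_wpM2r// ler_wpM2l.
Qed.

Lemma cls0_zero J : open U -> uniq J -> cls0 J (fun _ _ _ => 0).
Proof.
move=> oU Ju; split=> //.
- by move=> *; rewrite mulr0 addr0.
- move=> x Ux; have /nbhs_ballP[r r0 rU] := open_nbhs_nbhs (conj oU Ux).
  exists r, 0; split=> // y yr; split; first by apply: rU; rewrite -ball_normE/= distrC.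
  by move=> v u iu; rewrite normr0 mul0r.
- by move=> x v Ux; exact: within01_cst.
Qed.

Lemma cls_zero n J : open U -> uniq J -> cls n J (fun _ _ _ => 0).
Proof.
move=> oU; elim: n J => [|n IHn] J Ju; (split; first exact: cls0_zero) => //.
move=> j jJ; exists (fun _ _ _ => 0); first by apply: IHn; rewrite /= jJ.
move=> x Ux; exists 1, 0; split=> // y z _ _ v u iu.
by rewrite !subr0 normr0 !mul0r.
Qed.

Lemma cls0_add J G1 G2 : cls0 J G1 -> cls0 J G2 ->
  cls0 J (fun x v u => G1 x v u + G2 x v u).
Proof.
move=> [Ju Gd Gl Gb Gc] [_ Gd2 Gl2 Gb2 Gc2]; split=> //.
- by move=> x v v' u Ux iu vv'; rewrite (Gd x v v')// (Gd2 x v v').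
- by move=> x v j a w1 w2 u Ux iu jJ; rewrite Gl// Gl2//; ring.
- move=> x Ux; have [r [K [r0 K0 GK]]] := Gb _ Ux.
  have [r' [K' [r'0 K'0 GK']]] := Gb2 _ Ux.
  exists (Num.min r r'), (K + K'); split; rewrite ?lt_min ?r0 ?addr_ge0// => y.
  rewrite lt_min => /andP[/GK[Uy yK] /GK'[_ yK']]; split=> // v u iu.
  by rewrite (le_trans (ler_normD _ _))// mulrDl lerD// ?yK ?yK'.
- by move=> x v Ux; apply: within01D; [exact: Gc|exact: Gc2].
Qed.

Lemma cls_add n J G1 G2 : cls n J G1 -> cls n J G2 ->
  cls n J (fun x v u => G1 x v u + G2 x v u).
Proof.
elim: n J G1 G2 => [|n IHn] J G1 G2 [G10 dG] [G20 dG2];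
  (split; first exact: cls0_add) => //.
move=> j jJ; have [G' G'n dG'] := dG _ jJ; have [G2' G2'n dG2'] := dG2 _ jJ.
exists (fun x v u => G' x v u + G2' x v u); first exact: IHn.
move=> x Ux; have [r [K [r0 K0 GK]]] := dG' _ Ux.
have [r' [K' [r'0 K'0 GK']]] := dG2' _ Ux.
exists (Num.min r r'), (K + K'); split; rewrite ?lt_min ?r0 ?addr_ge0// => y z.
rewrite !lt_min => /andP[yr yr'] /andP[zr zr'] v u iu.
have -> a b c d e f : a + b - (c + d) - (e + f) = (a - c - e) + (b - d - f) :> R by ring.
by rewrite (le_trans (ler_normD _ _))// mulrDl mulrDl lerD// ?GK ?GK'.
Qed.

Lemma cls0_mul J1 J2 G1 G2 : uniq (J1 ++ J2) -> cls0 J1 G1 -> cls0 J2 G2 ->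
  cls0 (J1 ++ J2) (fun x v u => G1 x v u * G2 x v u).
Proof.
move=> J12 [J1u Gd Gl Gb Gc] [J2u Gd2 Gl2 Gb2 Gc2].
have dis j : j \in J1 -> j \notin J2.
  move: J12; rewrite cat_uniq => /and3P[_ /hasPn J21 _] j1.
  by apply/negP => /J21; rewrite j1.
split=> //.
- move=> x v v' u Ux iu vv'; rewrite (Gd x v v')// 1?(Gd2 x v v')// => j jJ;
  by apply: vv'; rewrite mem_cat jJ ?orbT.
- move=> x v j a w1 w2 u Ux iu; rewrite mem_cat => /orP[j1|j2].
    by rewrite Gl// !(Gd2 x (upd _ _ _) v)//; [ring|exact: upd_notin (dis _ j1)..].
  have j1 : j \notin J1 by apply/negP => /dis; rewrite j2.
  by rewrite Gl2// !(Gd x (upd _ _ _) v)//; [ring|exact: upd_notin..].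
- move=> x Ux; have [r [K [r0 K0 GK]]] := Gb _ Ux.
  have [r' [K' [r'0 K'0 GK']]] := Gb2 _ Ux.
  exists (Num.min r r'), (K * K'); split; rewrite ?lt_min ?r0 ?mulr_ge0// => y.
  rewrite lt_min => /andP[/GK[Uy yK] /GK'[_ yK']]; split=> // v u iu.
  by rewrite normrM pnorm_cat mulrACA ler_pM// ?yK ?yK'.
- by move=> x v Ux; apply: within01M; [exact: Gc|exact: Gc2].
Qed.

Lemma cls_mul n J1 J2 G1 G2 : uniq (J1 ++ J2) -> cls n J1 G1 -> cls n J2 G2 ->
  cls n (J1 ++ J2) (fun x v u => G1 x v u * G2 x v u).
Proof.
elim: n J1 J2 G1 G2 => [|n IHn] J1 J2 G1 G2 J12 Gn1 Gn2;
  have G10 := cls_cls0 Gn1; have G20 := cls_cls0 Gn2;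
  (split; first exact: cls0_mul) => // j.
have [J1u Gd Gl Gb Gc] := G10; have [J2u Gd2 Gl2 Gb2 Gc2] := G20.
rewrite mem_cat negb_or => /andP[jJ1 jJ2].
have [G' G'n dG'] := cls_deriv Gn1 jJ1; have [G2' G2'n dG2'] := cls_deriv Gn2 jJ2.
exists (fun x v u => G' x v u * G2 x v u + G1 x v u * G2' x v u).
  apply: cls_add.
    rewrite -cat_cons; apply: IHn => //; last exact: cls_pred.
    by rewrite /= J12 mem_cat negb_or jJ1 jJ2.
  apply: (@cls_perm _ (J1 ++ j :: J2)); first by rewrite perm_sym -cat1s perm_catCA.
  apply: IHn => //; last exact: cls_pred.
  by rewrite uniq_catC /= mem_cat negb_or jJ1 jJ2 uniq_catC.
move=> x Ux.
have [r1 [K1 [r10 K10 GK1]]] := dG' _ Ux.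
have [r2 [K2 [r20 K20 GK2]]] := dG2' _ Ux.
have [r3 [K3 [r30 K30 GK3]]] := Gb _ Ux.
have [r4 [K4 [r40 K40 GK4]]] := Gb2 _ Ux.
have [r5 [K5 [r50 K50 GK5]]] := cls_bounded (cls_cls0 G'n) Ux.
have [r6 [K6 [r60 K60 GK6]]] := cls_lipschitz Gn2 Ux.
exists (Num.min r1 (Num.min r2 (Num.min r3 (Num.min r4 (Num.min r5 r6))))).
exists (K1 * K4 + K5 * K6 + K3 * K2); split.
- by rewrite !lt_min r10 r20 r30 r40 r50 r60.
- by rewrite !addr_ge0// mulr_ge0.
move=> y z; rewrite !lt_min => /and5P[y1 y2 y3 y4 /andP[y5 y6]].
move=> /and5P[z1 z2 z3 z4 /andP[z5 z6]] v u iu.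
have := GK1 _ _ y1 z1 v u iu; have := GK2 _ _ y2 z2 v u iu.
have Uy := (GK3 _ y3).1.
have := (GK3 _ y3).2 v u iu; have := (GK4 _ z4).2 v u iu.
have := (GK5 _ y5).2 (upd v j (z - y)) u iu; rewrite pnorm_upd//.
have := GK6 _ _ y6 z6 v u iu.
rewrite (Gd2 y (upd v j (z - y)) v)//; last exact: upd_notin.
rewrite (Gd y (upd v j (z - y)) v)//; last exact: upd_notin.
rewrite pnorm_cat; move: (pnorm_ge0 v J1) (pnorm_ge0 v J2) (normr_ge0 (z - y)).
move: (pnorm v J1) (pnorm v J2) `|z - y| => p1 p2 h p10 p20 h0.
set D := G2 z v u - G2 y v u; set d1 := G' _ _ _; set d2 := G2' _ _ _.
set g1 := G1 y v u; set g1z := G1 z v u; set g2z := G2 z v u; set R2 := D - d2.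
set R1 := g1z - g1 - d1 => hD hd1 hg2 hg1 hR2 hR1.
(* The three terms are of second order for different reasons: [R1] and [R2] are the remainders of
   the factors, and [d1 * D] is a product of two first order terms. *)
have -> : g1z * g2z - g1 * G2 y v u - (d1 * G2 y v u + g1 * d2) =
    R1 * g2z + d1 * D + g1 * R2 by rewrite /R1 /R2 /D -/g2z; ring.
have -> : (K1 * K4 + K5 * K6 + K3 * K2) * h ^+ 2 * (p1 * p2) =
  (K1 * h ^+ 2 * p1) * (K4 * p2) + (K5 * (h * p1)) * (K6 * h * p2) +
  (K3 * p1) * (K2 * h ^+ 2 * p2) by ring.
by rewrite (le_trans (ler_normD _ _))// lerD ?(le_trans (ler_normD _ _))//
  ?lerD// normrM ler_pM.
Qed.

Lemma cls0_prim J G : cls0 J G -> cls0 J (fun x v => prim (G x v)).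
Proof.
move=> [Ju Gd Gl Gb Gc]; split=> //.
- by move=> x v v' u Ux iu vv'; congr (_ u); apply: eq_prim => s si; exact: Gd.
- move=> x v j a w1 w2 u Ux iu jJ.
  have cw (w : nat -> E) : {within itv01, continuous (G x w)} by exact: Gc.
  rewrite -primZ// -primD//; last by apply: within01M => //; exact: within01_cst.
  by congr (_ u); apply: eq_prim => s si; exact: Gl.
- move=> x Ux; have [r [K [r0 K0 GK]]] := Gb _ Ux; exists r, K; split=> // y /GK[Uy yK].
  by split=> // v u iu; apply: prim_le => //; [exact: Gc|move=> s si; exact: yK].
- by move=> x v Ux; apply: cont01_within; apply: cont01_prim; exact: Gc.
Qed.

(** Integration commutes with the derivative because the remainder estimate is uniform in the
    parameter. *)
Lemma loc_deriv_prim j J G G' x : cls0 J G -> cls0 (j :: J) G' -> U x ->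
  loc_deriv j J G G' x -> loc_deriv j J (fun x v => prim (G x v)) (fun x v => prim (G' x v)) x.
Proof.
move=> [Ju Gd Gl Gb Gc] G'0 Ux [r [K [r0 K0 GK]]].
have [r' [K' [r'0 _ GK']]] := Gb _ Ux.
exists (Num.min r r'), K; split; rewrite ?lt_min ?r0// => y z.
rewrite !lt_min => /andP[yr /GK'[Uy _]] /andP[zr /GK'[Uz _]] v u iu.
have cz : {within itv01, continuous (G z v)} by exact: Gc.
have cy : {within itv01, continuous (G y v)} by exact: Gc.
have c' : {within itv01, continuous (G' y (upd v j (z - y)))} by exact: (cls_within G'0).
have cN (f : R -> R) : {within itv01, continuous f} ->
  {within itv01, continuous (fun s => -1 * f s)}.
  by move=> cf; apply: within01M => //; exact: within01_cst.
rewrite (_ : _ - _ - _ = prim (fun s => (G z v s + -1 * G y v s) +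
    -1 * G' y (upd v j (z - y)) s) u).
  apply: prim_le => //; first exact: within01D (within01D cz (cN _ cy)) (cN _ c').
  by move=> s si; rewrite !mulN1r GK.
rewrite (primD (within01D cz (cN _ cy)) (cN _ c') iu) (primD cz (cN _ cy) iu).
by rewrite !primZ// !mulN1r.
Qed.

Lemma cls_prim n J G : cls n J G -> cls n J (fun x v => prim (G x v)).
Proof.
elim: n J G => [|n IHn] J G [G0 dG]; (split; first exact: cls0_prim) => // j jJ.
have [G' G'n dG'] := dG _ jJ.
exists (fun x v => prim (G' x v)); first exact: IHn.
by move=> x Ux; apply: loc_deriv_prim (dG' _ Ux) => //; exact: cls_cls0 G'n.
Qed.

Lemma cls_cst n (c : R -> R) : open U -> {within itv01, continuous c} ->
  cls n [::] (fun _ _ => c).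
Proof.
move=> oU cc; have c0 : cls0 [::] (fun _ _ => c).
  have [K cK] : exists K, forall u, itv01 u -> `|c u| <= K.
    have : {within `[0, 1], continuous (fun u => `|c u|)}.
      by move=> x; apply: cvg_norm; exact: cc.
    by move=> /(EVT_max ler01)[m _ mmax]; exists `|c m| => u /mmax.
  split=> // x Ux; have /nbhs_ballP[r r0 rU] := open_nbhs_nbhs (conj oU Ux).
  exists r, K; split=> //; first by rewrite (le_trans _ (cK _ itv01_0)).
  move=> y yr; split; first by apply: rU; rewrite -ball_normE/= distrC.
  by move=> v u iu; rewrite /pnorm big_nil mulr1 cK.
case: n => [|n]; split=> // j _; exists (fun _ _ _ => 0); first exact: cls_zero.
move=> x Ux; exists 1, 0; split=> // y z _ _ v u iu.
by rewrite subrr subr0 normr0 !mul0r.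
Qed.

(** The building blocks of the families: bounded linear functions of the point, mainly the
    coordinates of a configuration at u. Their second derivative vanishes. *)
Record linear_atom (L : E -> R -> R) : Prop := LinearAtom {
  atom_linear : forall a w1 w2 u, itv01 u -> L (a *: w1 + w2) u = a * L w1 u + L w2 u ;
  atom_bounded : exists2 K : R, 0 <= K & forall w u, itv01 u -> `|L w u| <= K * `|w| ;
  atom_within : forall w, {within itv01, continuous (L w)} }.

Lemma cls_atom1 n j L : open U -> linear_atom L -> cls n [:: j] (fun _ v => L (v j)).
Proof.
move=> oU [Ll [K K0 LK] Lc].
have L0 : cls0 [:: j] (fun _ v => L (v j)).
  split=> //.
  - by move=> x v v' u Ux iu -> //; rewrite mem_head.
  - by move=> x v i a w1 w2 u Ux iu; rewrite inE => /eqP ->; rewrite !updE Ll.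
  - move=> x Ux; have /nbhs_ballP[r r0 rU] := open_nbhs_nbhs (conj oU Ux).
    exists r, K; split=> // y yr; split; first by apply: rU; rewrite -ball_normE/= distrC.
    by move=> v u iu; rewrite /pnorm big_seq1 LK.
case: n => [|n]; split=> // i ij; exists (fun _ _ _ => 0).
  by apply: cls_zero => //=; rewrite ij.
move=> x Ux; exists 1, 0; split=> // y z _ _ v u iu.
by rewrite subrr subr0 normr0 !mul0r.
Qed.

Lemma loc_deriv_atom j L x : linear_atom L ->
  loc_deriv j [::] (fun x _ => L x) (fun _ v => L (v j)) x.
Proof.
move=> [Ll _ _]; exists 1, 0; split=> // y z _ _ v u iu; rewrite updE.
have -> : L z u = L y u + L (z - y) u.
  by have := Ll 1 (z - y) y u iu; rewrite scale1r subrK mul1r addrC.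
rewrite !mul0r (_ : _ - _ = 0) ?normr0//; ring.
Qed.

Lemma cls_atom n L : open U -> linear_atom L -> cls n [::] (fun x _ => L x).
Proof.
move=> oU La; have [Ll [K K0 LK] Lc] := La.
have L0 : cls0 [::] (fun x _ => L x).
  split=> // x Ux; have /nbhs_ballP[r r0 rU] := open_nbhs_nbhs (conj oU Ux).
  exists r, (K * (`|x| + r)); split=> //; first by rewrite mulr_ge0// addr_ge0// ltW.
  move=> y yr; split; first by apply: rU; rewrite -ball_normE/= distrC.
  move=> v u iu; rewrite /pnorm big_nil mulr1 (le_trans (LK _ _ iu))// ler_wpM2l//.
  by rewrite -[y](subrK x) addrC (le_trans (ler_normD _ _))// lerD2l ltW.
case: n => [|n]; split=> // j _; exists (fun _ v => L (v j)); first exact: cls_atom1.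
by move=> x Ux; exact: loc_deriv_atom.
Qed.

End SmoothFamilies.

(** * Composition of smooth families with functions of one variable *)

Section Composition.
Context {R : realType}.

(** Two applications of the mean value theorem. The constant [M] in place of M / 2 is enough for a
    quadratic remainder. *)
Lemma taylor2 (p0 p1 p2 : R -> R) (a b M : R) :
  (forall s, a <= s <= b -> is_derive s 1 p0 (p1 s)) ->
  (forall s, a <= s <= b -> is_derive s 1 p1 (p2 s)) ->
  (forall s, a <= s <= b -> `|p2 s| <= M) ->
  forall s t, a <= s <= b -> a <= t <= b ->
    `|p0 t - p0 s - p1 s * (t - s)| <= M * `|t - s| ^+ 2.
Proof.
move=> d0 d1 p2M.
have mvt (p q : R -> R) : (forall s, a <= s <= b -> is_derive s 1 p (q s)) ->
    forall s t, a <= s <= b -> a <= t <= b -> exists c, [/\ a <= c <= b,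
      `|c - s| <= `|t - s| & p t - p s = q c * (t - s)].
  move=> dpq s t sab tab.
  have cpq x y : a <= x -> y <= b -> x <= y -> {within `[x, y], continuous p}.
    move=> ax yb xy; apply: continuous_in_subspaceT => w.
    rewrite inE/= in_itv/= => /andP[xw wy]; apply: dv_cont (dpq _ _).
    by rewrite (le_trans ax xw) (le_trans wy yb).
  have dpq' x y : a <= x -> y <= b -> forall w, w \in `]x, y[%R -> is_derive w 1 p (q w).
    move=> ax yb w; rewrite in_itv/= => /andP[xw wy]; apply: dpq.
    by rewrite (le_trans ax (ltW xw)) (le_trans (ltW wy) yb).
  move: sab tab => /andP[sa sb] /andP[ta tb]; have [st|ts] := leP s t.
    have [||c] := @MVT_segment _ p q s t st; [exact: dpq'|exact: cpq|].
    rewrite in_itv/= => /andP[sc ct] e; exists c; split=> //.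
      by rewrite (le_trans sa sc) (le_trans ct tb).
    by rewrite !ger0_norm ?subr_ge0// lerD2r.
  have [||c] := @MVT_segment _ p q t s (ltW ts); [exact: dpq'|exact: cpq (ltW ts)|].
  rewrite in_itv/= => /andP[tc cs] e; exists c; split=> //.
    by rewrite (le_trans ta tc) (le_trans cs sb).
    by rewrite !ler0_norm ?subr_le0// ?lerN2 ?lerD2r// ltW.
  by rewrite -opprB e; ring.
move=> s t sab tab; have [c [cab cs ->]] := mvt _ _ d0 _ _ sab tab.
have [e [eab _ e1]] := mvt _ _ d1 _ _ sab cab.
rewrite -mulrBl e1 !normrM expr2 mulrA ler_wpM2r// ler_pM//; exact: p2M.
Qed.

Context {E : normedModType R}.
Variable U : set E.
Implicit Types G : @mfamily R E.

(** Values confined to a compact interval of the domain bound all derivatives of the outer function,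
    which makes the remainder of a composition uniform in u. *)
Definition loc_range (dom : set R) G := forall x, U x -> exists r a b : R,
  [/\ 0 < r, `[a, b] `<=` dom &
  forall y, `|y - x| < r -> forall v u, itv01 u -> a <= G y v u <= b].

(** [phi k] stands for the k-th derivative of the outer function. The index k is part of the claim
    because the derivative of [phi k] after G is [phi k.+1] after G times the derivative of G, and
    the induction on n has to apply to that first factor. *)
Lemma cls_comp (phi : nat -> R -> R) (dom : set R) n k G :
  (forall k s, dom s -> is_derive s 1 (phi k) (phi k.+1 s)) ->
  cls U n [::] G -> loc_range dom G -> cls U n [::] (fun x v u => phi k (G x v u)).
Proof.
move=> dphi + Gdom.
have phib m a b : `[a, b] `<=` dom -> exists2 M : R, 0 <= M & forall s, a <= s <= b -> `|phi m s| <= M.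
  move=> ab; have [leab|ltba] := leP a b; last first.
    by exists 0 => // s /andP[/le_trans/[apply]]; rewrite leNgt ltba.
  have : {within `[a, b], continuous (fun u => `|phi m u|)}.
    apply: continuous_in_subspaceT => s; rewrite inE => /ab /(dphi m)/dv_cont.
    exact: cvg_norm.
  by move=> /(EVT_max leab)[c _ cmax]; exists `|phi m c|.
have comp0 m : cls0 U [::] G -> cls0 U [::] (fun x v u => phi m (G x v u)).
  case=> _ Gd Gl Gb Gc; split=> //.
  - by move=> x v v' u Ux iu vv'; rewrite (Gd x v v').
  - move=> x Ux; have [r [a [b [r0 ab rG]]]] := Gdom _ Ux.
    have [M M0 phiM] := phib m _ _ ab; have [r' [K' [r'0 _ rU]]] := Gb _ Ux.
    exists (Num.min r r'), M; split; rewrite ?lt_min ?r0// => y.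
    rewrite lt_min => /andP[yr /rU[Uy _]]; split=> // v u iu.
    by rewrite /pnorm big_nil mulr1 phiM// rG.
  - move=> x v Ux; apply/subspace_continuousP => u iu.
    have := Gc x v Ux; move/subspace_continuousP/(_ u iu) => cG.
    apply: (cvg_comp _ _ cG); have [r [a [b [r0 ab rG]]]] := Gdom _ Ux.
    apply: dv_cont (dphi m _ _); apply: ab; rewrite /= in_itv/= rG//.
    by rewrite subrr normr0.
elim: n k => [|n IHn] k Gn; have G0 := cls_cls0 Gn; (split; first exact: comp0) => // j jJ.
have [G' G'n dG'] := cls_deriv Gn jJ.
exists (fun x v u => phi k.+1 (G x v u) * G' x v u).
  by apply: (@cls_mul _ _ _ _ [::] [:: j]) => //; apply: IHn; exact: cls_pred.
move=> x Ux; have [r1 [a [b [r10 ab rG]]]] := Gdom _ Ux.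
have [M1 M10 phiM1] := phib k.+1 _ _ ab; have [M2 M20 phiM2] := phib k.+2 _ _ ab.
have [r2 [K2 [r20 K20 GK2]]] := dG' _ Ux.
have [r3 [K3 [r30 K30 GK3]]] := cls_lipschitz Gn Ux.
have [r4 [K4 [r40 _ rU]]] := cls_bounded G0 Ux.
exists (Num.min r1 (Num.min r2 (Num.min r3 r4))), (M2 * K3 ^+ 2 + M1 * K2); split.
- by rewrite !lt_min r10 r20 r30 r40.
- by rewrite addr_ge0// mulr_ge0// exprn_ge0.
move=> y z; rewrite !lt_min => /and4P[y1 y2 y3 y4] /and4P[z1 z2 z3 z4] v u iu.
have := GK2 _ _ y2 z2 v u iu; have := GK3 _ _ y3 z3 v u iu.
have [Uy _] := rU _ y4.
rewrite (cls_dep G0 (v := upd v j (z - y)) (v' := v))// /pnorm !big_nil !mulr1.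
have := @taylor2 (phi k) (phi k.+1) (phi k.+2) a b M2 _ _ phiM2 _ _
  (rG _ y1 v _ iu) (rG _ z1 v _ iu).
set g := G y v u; set gz := G z v u; set d := G' _ _ _ => taylor lip rem.
have -> : phi k gz - phi k g - phi k.+1 g * d =
  (phi k gz - phi k g - phi k.+1 g * (gz - g)) + phi k.+1 g * (gz - g - d) by ring.
rewrite (le_trans (ler_normD _ _))// mulrDl lerD//.
  apply: le_trans (taylor _ _) _ => [s sab|s sab|].
  - by apply/dphi/ab; rewrite /= in_itv.
  - by apply/dphi/ab; rewrite /= in_itv.
  - by rewrite -mulrA ler_wpM2l// -exprMn lerXn2r// nnegrE// mulr_ge0.
by rewrite normrM -mulrA ler_pM// phiM1// rG.
Qed.

End Composition.

(** * Linear differential equations on the unit interval *)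

Section LinearODE.
Context {R : realType} (n : nat) (a : 'I_n -> 'I_n -> R -> R) (y0 : 'I_n -> R).
Hypothesis ca : forall i j, {within itv01, continuous (a i j)}.

(** A bound by an integrated weight rather than by a constant, since the Picard estimate has to keep
    the factor exp (2 L u). *)
Lemma prim_le_prim (phi Psi psi : R -> R) u : {within itv01, continuous phi} ->
  der01 Psi psi -> (forall s, itv01 s -> `|phi s| <= psi s) -> itv01 u ->
  `|prim phi u| <= Psi u - Psi 0.
Proof.
move=> cphi dPsi phipsi iu; have u0 : 0 <= u by have /itv01P/andP[] := iu.
have mono (F f : R -> R) : der01 F f -> (forall s, itv01 s -> 0 <= f s) -> F 0 <= F u.
  move=> dF f0; rewrite -subr_ge0; have [c ic ->] := mvt01 dF itv01_0 iu.
  by rewrite subr0 mulr_ge0// f0.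
have := mono _ _ (fun s si => dv_sub (dPsi s si) (prim_der cphi si)).
have := mono _ _ (fun s si => dv_add (dPsi s si) (prim_der cphi si)).
rewrite prim0 addr0 subr0 => h1 h2; rewrite ler_norml; apply/andP; split.
  rewrite opprB lerBlDr addrC; apply: h1 => s /phipsi; rewrite ler_norml => /andP[]; lra.
rewrite lerBrDr addrC -lerBrDr; apply: h2 => s /phipsi; rewrite ler_norml => /andP[]; lra.
Qed.

Lemma within01_sum (m : nat) (f : 'I_m -> R -> R) :
  (forall i, {within itv01, continuous (f i)}) ->
  {within itv01, continuous (fun u => \sum_(i < m) f i u)}.
Proof.
elim: m f => [|m IHm] f cf.
  by under eq_fun do rewrite big_ord0; exact: within01_cst.
by under eq_fun do rewrite big_ord_recr/=; apply: within01D => //; exact: IHm.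
Qed.

Fixpoint picard (k : nat) (i : 'I_n) : R -> R :=
  match k with
  | 0 => fun=> y0 i
  | k'.+1 => fun u => y0 i + prim (fun s => \sum_j a i j s * picard k' j s) u
  end.

Lemma picard_within k i : {within itv01, continuous (picard k i)}.
Proof.
elim: k i => [|k IHk] i; first exact: within01_cst.
apply: within01D; first exact: within01_cst.
apply: cont01_within; apply: cont01_prim.
by apply: within01_sum => j; exact: within01M.
Qed.

Lemma coef_bound : exists2 M : R, 0 <= M & forall i j u, itv01 u -> `|a i j u| <= M.
Proof.
have bd i j : exists M : _, forall u, itv01 u -> `|a i j u| <= M.
  have : {within `[0, 1], continuous (fun u => `|a i j u|)}.
    by move=> x; apply: cvg_norm; exact: ca.
  by move=> /(EVT_max ler01)[m _ mmax]; exists `|a i j m| => u /mmax.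
have bd1 i : exists M : _, forall j, M j >= 0 /\ forall u, itv01 u -> `|a i j u| <= M j.
  have /choice[M HM] := bd i; exists M => j; split; last exact: HM.
  by rewrite (le_trans _ (HM j _ itv01_0)).
have /choice[M HM] := bd1.
exists (\sum_i \sum_j M i j).
  by apply: sumr_ge0 => i _; apply: sumr_ge0 => j _; have [] := HM i j.
move=> i j u iu; rewrite (le_trans ((HM i j).2 _ iu))//.
rewrite (bigD1 i)//= (bigD1 j)//= -addrA lerDl addr_ge0//.
  by apply: sumr_ge0 => k _; have [] := HM i k.
by apply: sumr_ge0 => k _; apply: sumr_ge0 => l _; have [] := HM k l.
Qed.

(** Picard iteration. Integrating the weight exp (2 L u) against a coefficient of size L yields at
    most half of that weight, so consecutive differences halve at every step and the iteration
    converges on all of [0,1] at once. *)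
Lemma linear_ode : exists y : 'I_n -> R -> R,
  forall i, y i 0 = y0 i /\ der01 (y i) (fun u => \sum_j a i j u * y j u).
Proof.
have [M M0 aM] := coef_bound.
(* The summand 1 keeps L positive, also for n = 0 or for zero coefficients. *)
pose L : R := n%:R * M + 1; have L0 : 0 < L by rewrite ltr_wpDl// mulr_ge0.
have sumle (y : 'I_n -> R) (B : R) i u : itv01 u -> (forall j, `|y j| <= B) ->
    `|\sum_j a i j u * y j| <= L * B.
  move=> iu yB; rewrite (le_trans (ler_norm_sum _ _ _))//.
  apply: (@le_trans _ _ (\sum_(j < n) M * B)).
    by apply: ler_sum => j _; rewrite normrM ler_pM// aM.
  rewrite sumr_const card_ord -[_ *+ _]mulr_natl mulrA.
  have B0 : 0 <= B by exact: le_trans (yB i).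
  by rewrite ler_wpM2r// /L lerDl.
have csum k i : {within itv01, continuous (fun s => \sum_j a i j s * picard k j s)}.
  by apply: within01_sum => j; apply: within01M => //; exact: picard_within.
have dpic k i : der01 (picard k.+1 i) (fun s => \sum_j a i j s * picard k j s).
  move=> s si; apply: dv_eq; first exact: dv_add (dv_cst _ _) (prim_der (csum k i) si).
  exact: add0r.
pose C : R := L * \sum_i `|y0 i|.
have yC i : `|y0 i| <= \sum_i `|y0 i| by rewrite (bigD1 i)//= lerDl sumr_ge0.
have C0 : 0 <= C by rewrite mulr_ge0 ?sumr_ge0// ltW.
pose w (u : R) := expR (2 * L * u).
have dw (u : R) : is_derive u 1 w (2 * L * w u).
  have := @dv_comp _ expR (fun u => 2 * L * u) u _ _ (is_derive_expR _)
    (dv_cmul (2 * L) (dv_id u)).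
  by move/dv_eq; apply; rewrite mulr1 mulrC.
have w1 u : itv01 u -> 1 <= w u.
  move=> /itv01P/andP[u0 _]; rewrite -expR0 ler_expR.
  by rewrite !mulr_ge0// ltW.
have diff k i u : itv01 u -> `|picard k.+1 i u - picard k i u| <= C * w u / 2 ^+ k.
  elim: k i u => [|k IHk] i u iu.
    rewrite /= addrC addKr expr0 divr1.
    apply: (@le_trans _ _ C); last by rewrite ler_peMr// w1.
    apply: prim_le => //; first exact: (csum 0%N).
    by move=> s si; exact: sumle.
  have -> : picard k.+2 i u - picard k.+1 i u =
      prim (fun s => \sum_j a i j s * (picard k.+1 j s - picard k j s)) u.
    rewrite (@prim_unique _ _ (fun u => picard k.+2 i u - picard k.+1 i u) _ _ u iu).
    - by rewrite /= !prim0 subrr subr0.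
    - by apply: within01_sum => j; apply: within01M => //; move=> x;
        apply: cvgB; exact: picard_within.
    - move=> s si; apply: dv_eq; first exact: dv_sub (dpic _ _ _ si) (dpic _ _ _ si).
      by rewrite -sumrB; apply: eq_bigr => j _; rewrite mulrBr.
  have dPsi : der01 (fun u : R => C / 2 ^+ k.+1 * w u) (fun u : R => L * (C * w u / 2 ^+ k)).
    move=> s si; refine (dv_eq (dv_cmul (C / 2 ^+ k.+1) (dw s)) _).
    by rewrite exprS; field; rewrite expf_neq0.
  apply: (@le_trans _ _ (C / 2 ^+ k.+1 * w u - C / 2 ^+ k.+1 * w 0)).
    apply: (prim_le_prim _ dPsi) => //.
      by apply: within01_sum => j; apply: within01M => //; move=> x;
        apply: cvgB; exact: picard_within.
    by move=> s si; apply: sumle => // j; exact: IHk.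
  rewrite -[X in _ <= X]mulrAC lerBlDr lerDl.
  by rewrite mulr_ge0 ?divr_ge0 ?exprn_ge0 ?expR_ge0.
(* The factor 2 sums the geometric series: the tail from k on is at most D / 2 ^ k. *)
pose D : R := C * w 1 * 2.
have D0 : 0 <= D by rewrite mulr_ge0// mulr_ge0// /w expR_ge0.
have diffD k i u : itv01 u -> `|picard k.+1 i u - picard k i u| <= D / 2 ^+ k.+1.
  move=> iu; rewrite (le_trans (diff _ _ _ iu))// exprS /D.
  have -> : C * w 1 * 2 / (2 * 2 ^+ k) = C * w 1 / 2 ^+ k.
    by field; rewrite expf_neq0.
  rewrite ler_pM2r ?invr_gt0 ?exprn_gt0// ler_wpM2l// ler_expR.
  by have /itv01P/andP[u0 u1] := iu; rewrite ler_wpM2l// mulr_ge0// ltW.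
have tele k m i u : itv01 u ->
    `|picard (m + k)%N i u - picard k i u| <= D / 2 ^+ k - D / 2 ^+ (m + k).
  move=> iu; elim: m => [|m IHm]; first by rewrite !add0n !subrr normr0.
  have -> : picard (m.+1 + k)%N i u - picard k i u =
    (picard (m + k).+1 i u - picard (m + k)%N i u) +
    (picard (m + k)%N i u - picard k i u) by rewrite addSn; ring.
  rewrite (le_trans (ler_normD _ _))//.
  rewrite (le_trans (lerD (diffD (m + k)%N i u iu) IHm))// addSn.
  have -> : D / 2 ^+ (m + k) = D / 2 ^+ (m + k).+1 * 2.
    by rewrite exprS; field; rewrite expf_neq0.
  by rewrite le_eqVlt; apply/orP; left; apply/eqP; ring.
have tele' k m i u : itv01 u -> (k <= m)%N -> `|picard m i u - picard k i u| <= D / 2 ^+ k.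
  move=> iu km; rewrite -(subnK km) (le_trans (tele _ _ _ _ iu))//.
  by rewrite lerBlDr lerDl divr_ge0// exprn_ge0.
have small (e : R) : 0 < e -> exists k, forall m, (k <= m)%N -> D / 2 ^+ m < e.
  move=> e0; have : D / 2 ^+ m @[m --> \oo] --> 0.
    rewrite -(mulr0 D); apply: cvgM; first exact: cvg_cst.
    under eq_fun do rewrite -exprVn.
    by apply: cvg_expr; rewrite ger0_norm ?invf_lt1// ltr1n.
  move=> /cvgrPdist_lt/(_ e e0)[k _ Hk]; exists k => m /Hk /=.
  by rewrite sub0r normrN ger0_norm// divr_ge0// exprn_ge0.
have cv i u : itv01 u -> cvgn (fun k => picard k i u).
  move=> iu; apply/cauchy_cvgP/cauchy_exP => e e0; have [k Hk] := small e e0.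
  exists (picard k i u); exists k => // m /= km.
  by rewrite -ball_normE/= distrC (le_lt_trans (tele' _ _ _ _ iu km))// Hk.
pose yh i u := limn (fun k => picard k i u).
have yhE k i u : itv01 u -> `|yh i u - picard k i u| <= D / 2 ^+ k.
  move=> iu; apply/ler_addgt0Pl => e e0.
  have /cvgrPdist_lt/(_ e e0)[m _ Hm] := cv i u iu.
  have := Hm (maxn m k) (leq_maxl _ _); have := tele' k (maxn m k) i u iu (leq_maxr _ _).
  rewrite /= => h1 h2.
  have -> : yh i u - picard k i u = (yh i u - picard (maxn m k) i u) +
     (picard (maxn m k) i u - picard k i u) by ring.
  by rewrite (le_trans (ler_normD _ _))// lerD// ltW.
have cyh i : {within itv01, continuous (yh i)}.
  apply/subspace_continuousP => u iu; apply/cvgrPdist_lt => e e0.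
  have [k Hk] := small (e / 3) ltac:(by rewrite divr_gt0).
  have := @picard_within k i; move/subspace_continuousP/(_ u iu).
  move=> /cvgrPdist_lt/(_ (e / 3)) /(_ ltac:(by rewrite divr_gt0)).
  rewrite !near_withinE; apply: filterS => s + si => /(_ si) h.
  have := yhE k i u iu; have := yhE k i s si; have := Hk k (leqnn k).
  rewrite [`|yh i s - _|]distrC; move: (D / _) => d de h1 h2.
  have -> : yh i u - yh i s = (yh i u - picard k i u) + (picard k i u - picard k i s) +
    (picard k i s - yh i s) by ring.
  rewrite (le_lt_trans (ler_normD _ _))// (_ : e = (e / 3 + e / 3) + e / 3); last by field.
  rewrite ltrD ?(le_lt_trans h1)// (le_lt_trans (ler_normD _ _))//.
  by rewrite ltrD ?(le_lt_trans h2).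
have csy i : {within itv01, continuous (fun s => \sum_j a i j s * yh j s)}.
  by apply: within01_sum => j; exact: within01M.
(* The limit is compared with the iterates of order k and k + 1, at a total cost of (L + 1) D / 2 ^
   k. *)
have fix_ i u : itv01 u -> y0 i + prim (fun s => \sum_j a i j s * yh j s) u = yh i u.
  move=> iu; apply/eqP; rewrite -subr_eq0 -normr_le0; apply/ler_addgt0Pl => e e0.
  rewrite addr0; have Lp : 0 < L + 1 by rewrite addr_gt0.
  have [k Hk] := small (e / (L + 1)) ltac:(by rewrite divr_gt0).
  have := Hk k (leqnn k); rewrite ltr_pdivlMr// => /ltW; apply: le_trans.
  have -> : y0 i + prim (fun s => \sum_j a i j s * yh j s) u - yh i u =
     (prim (fun s => \sum_j a i j s * yh j s) u -
      prim (fun s => \sum_j a i j s * picard k j s) u) - (yh i u - picard k.+1 i u).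
    by rewrite /=; ring.
  rewrite (le_trans (ler_normB _ _))// mulrDr mulr1 lerD//; last first.
    rewrite (le_trans (yhE _ _ _ iu))// ler_wpM2l// lef_pV2 ?posrE ?exprn_gt0//.
    by rewrite ler_weXn2l// ler1n.
  have -> : prim (fun s => \sum_j a i j s * yh j s) u -
      prim (fun s => \sum_j a i j s * picard k j s) u =
      prim (fun s => \sum_j a i j s * (yh j s - picard k j s)) u.
    apply/eqP; rewrite subr_eq -primD//.
    - apply/eqP; congr (_ u); apply: eq_prim => s si; rewrite -big_split/=.
      by apply: eq_bigr => j _; rewrite -mulrDr subrK.
    - apply: within01_sum => j; apply: within01M => // x.
      by apply: cvgB; [exact: cyh|exact: picard_within].
  apply: prim_le => //.
    apply: within01_sum => j; apply: within01M => // x.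
    by apply: cvgB; [exact: cyh|exact: picard_within].
  by move=> s si; rewrite mulrC; apply: sumle => // j; exact: yhE.
exists (fun i u => y0 i + prim (fun s => \sum_j a i j s * yh j s) u) => i; split.
  by rewrite prim0 addr0.
move=> u iu; apply: dv_eq; first by apply: dv_add (dv_cst _ _) _; exact: prim_der.
by rewrite add0r; apply: eq_bigr => j _; rewrite fix_.
Qed.

End LinearODE.

Lemma sum3 (V : nmodType) (F : 'I_3 -> V) : \sum_i F i = F 0 + F 1 + F 2.
Proof.
rewrite !big_ord_recl big_ord0 addr0 addrA.
by congr (F _ + F _ + F _); exact: val_inj.
Qed.

Lemma sum4 (V : nmodType) (F : 'I_4 -> V) : \sum_i F i = F 0 + F 1 + F 2 + F 3.
Proof.
rewrite !big_ord_recl big_ord0 addr0 !addrA.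
by congr (F _ + F _ + F _ + F _); exact: val_inj.
Qed.

Record vec (R : Type) := V3 { vx : R ; vy : R ; vz : R }.
Record quat (R : Type) := Q4 { qr : R ; qi : R ; qj : R ; qk : R }.

(** * Quaternions and rotations *)

Section Quaternions.
Context {R : realType}.
Implicit Types (x y z : vec R) (p q r : quat R) (a b c : R).

Definition vadd x y := V3 (vx x + vx y) (vy x + vy y) (vz x + vz y).
Definition vscale a x := V3 (a * vx x) (a * vy x) (a * vz x).
Definition dot x y := vx x * vx y + vy x * vy y + vz x * vz y.
Definition cross x y := V3 (vy x * vz y - vz x * vy y)
  (vz x * vx y - vx x * vz y) (vx x * vy y - vy x * vx y).

Definition qmul p q := Q4
  (qr p * qr q - qi p * qi q - qj p * qj q - qk p * qk q)
  (qr p * qi q + qi p * qr q + qj p * qk q - qk p * qj q)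
  (qr p * qj q - qi p * qk q + qj p * qr q + qk p * qi q)
  (qr p * qk q + qi p * qj q - qj p * qi q + qk p * qr q).
Definition qadd p q := Q4 (qr p + qr q) (qi p + qi q) (qj p + qj q) (qk p + qk q).
Definition qscale a p := Q4 (a * qr p) (a * qi p) (a * qj p) (a * qk p).
Definition qconj p := Q4 (qr p) (- qi p) (- qj p) (- qk p).
Definition qone : quat R := Q4 1 0 0 0.
Definition qzero : quat R := Q4 0 0 0 0.
Definition qvec x := Q4 0 (vx x) (vy x) (vz x).
Definition qim p := V3 (qi p) (qj p) (qk p).
Definition qdot p q := qr p * qr q + qi p * qi q + qj p * qj q + qk p * qk q.
Definition qn2 p := qdot p p.

(** For a unit quaternion this is q^-1 x q, so that products act in reverse order, see [rot_mul]. *)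
Definition qrot q x := qim (qmul (qmul (qconj q) (qvec x)) q).
Definition qhalf q x := qscale (1 / 2) (qmul q (qvec x)).
(* If [p] is the velocity of a path of unit quaternions at [q], this is the
   body angular velocity: [p = q * (vel q p) / 2]. *)
Definition vel q p := vscale 2 (qim (qmul (qconj q) p)).

Lemma V3_eq a b c a' b' c' : a = a' -> b = b' -> c = c' -> V3 a b c = V3 a' b' c'.
Proof. by move=> -> -> ->. Qed.

Lemma Q4_eq a b c d a' b' c' d' :
  a = a' -> b = b' -> c = c' -> d = d' -> Q4 a b c d = Q4 a' b' c' d'.
Proof. by move=> -> -> -> ->. Qed.

Lemma dot_rot q x y : dot (qrot q x) (qrot q y) = qn2 q ^+ 2 * dot x y.
Proof.
case: q x y => a b c d [x0 x1 x2] [y0 y1 y2].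
by rewrite /qrot /dot /qn2 /qdot /=; ring.
Qed.

Lemma rot_mul p q x : qrot (qmul p q) x = qrot q (qrot p x).
Proof.
case: p q x => a b c d [a' b' c' d'] [x0 x1 x2]; rewrite /qrot /qmul /=.
by apply: V3_eq; rewrite /=; ring.
Qed.

Lemma rot_one x : qrot qone x = x.
Proof. by case: x => x0 x1 x2; rewrite /qrot /=; apply: V3_eq; rewrite /=; ring. Qed.

Lemma rot_scale q a x : qrot q (vscale a x) = vscale a (qrot q x).
Proof. by rewrite /qrot /vscale /=; apply: V3_eq; rewrite /=; ring. Qed.

Lemma qmulA p q r : qmul p (qmul q r) = qmul (qmul p q) r.
Proof. by rewrite /qmul /=; apply: Q4_eq; rewrite /=; ring. Qed.

Lemma qmul1q p : qmul qone p = p.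
Proof. by case: p => a b c d; rewrite /qmul /=; apply: Q4_eq; rewrite /=; ring. Qed.

Lemma qmulq1 p : qmul p qone = p.
Proof. by case: p => a b c d; rewrite /qmul /=; apply: Q4_eq; rewrite /=; ring. Qed.

Lemma qn2_mul p q : qn2 (qmul p q) = qn2 p * qn2 q.
Proof. by rewrite /qn2 /qdot /=; ring. Qed.

Lemma qn2_conj p : qn2 (qconj p) = qn2 p.
Proof. by rewrite /qn2 /qdot /=; ring. Qed.

Lemma qn2_one : qn2 qone = 1.
Proof. by rewrite /qn2 /qdot /=; ring. Qed.

Lemma qmulKq p : qn2 p = 1 -> qmul p (qconj p) = qone.
Proof.
by rewrite /qn2 /qdot => h; rewrite /qmul /qone /=; apply: Q4_eq; rewrite /= -?h; ring.
Qed.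

Lemma qmulqK p : qn2 p = 1 -> qmul (qconj p) p = qone.
Proof.
by rewrite /qn2 /qdot => h; rewrite /qmul /qone /=; apply: Q4_eq; rewrite /= -?h; ring.
Qed.

Lemma vel_half q x : qn2 q = 1 -> vel q (qhalf q x) = x.
Proof.
case: x => x0 x1 x2 h; have -> : vel q (qhalf q (V3 x0 x1 x2)) = vscale (qn2 q) (V3 x0 x1 x2).
  by rewrite /vel /qhalf /vscale /qn2 /qdot /=; apply: V3_eq; rewrite /=; field.
by rewrite h /vscale /= !mul1r.
Qed.

Lemma half_vel q p : qn2 q = 1 -> qdot q p = 0 -> qhalf q (vel q p) = p.
Proof.
case: p => a b c d h h0; have -> : qhalf q (vel q (Q4 a b c d)) =
   qadd (qscale (qn2 q) (Q4 a b c d)) (qscale (- qdot q (Q4 a b c d)) q).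
  by rewrite /vel /qhalf /qadd /qscale /vscale /qn2 /qdot /=; apply: Q4_eq; rewrite /=; field.
by rewrite h h0 /qadd /qscale /= !mul1r !oppr0 !mul0r !addr0.
Qed.

Definition vder (X : R -> vec R) (u : R) (d : vec R) :=
  [/\ is_derive u 1 (fun s => vx (X s)) (vx d),
      is_derive u 1 (fun s => vy (X s)) (vy d)
    & is_derive u 1 (fun s => vz (X s)) (vz d)].

Definition qder (q : R -> quat R) (u : R) (d : quat R) :=
  [/\ is_derive u 1 (fun s => qr (q s)) (qr d),
      is_derive u 1 (fun s => qi (q s)) (qi d),
      is_derive u 1 (fun s => qj (q s)) (qj d)
    & is_derive u 1 (fun s => qk (q s)) (qk d)].

Definition vwithin (X : R -> vec R) :=
  [/\ {within itv01, continuous (fun s => vx (X s))},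
      {within itv01, continuous (fun s => vy (X s))}
    & {within itv01, continuous (fun s => vz (X s))}].

Definition qwithin (q : R -> quat R) :=
  [/\ {within itv01, continuous (fun s => qr (q s))},
      {within itv01, continuous (fun s => qi (q s))},
      {within itv01, continuous (fun s => qj (q s))}
    & {within itv01, continuous (fun s => qk (q s))}].

Lemma qder_mul P Q u dp dq : qder P u dp -> qder Q u dq ->
  qder (fun s => qmul (P s) (Q s)) u (qadd (qmul dp (Q u)) (qmul (P u) dq)).
Proof.
case=> p1 p2 p3 p4 [q1 q2 q3 q4]; split => /=.
- refine (dv_eq (dv_sub (dv_sub (dv_sub (dv_mul p1 q1) (dv_mul p2 q2))
    (dv_mul p3 q3)) (dv_mul p4 q4)) _); ring.
- refine (dv_eq (dv_sub (dv_add (dv_add (dv_mul p1 q2) (dv_mul p2 q1))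
    (dv_mul p3 q4)) (dv_mul p4 q3)) _); ring.
- refine (dv_eq (dv_add (dv_add (dv_sub (dv_mul p1 q3) (dv_mul p2 q4))
    (dv_mul p3 q1)) (dv_mul p4 q2)) _); ring.
- refine (dv_eq (dv_add (dv_sub (dv_add (dv_mul p1 q4) (dv_mul p2 q3))
    (dv_mul p3 q2)) (dv_mul p4 q1)) _); ring.
Qed.

Lemma qder_conj Q u dq : qder Q u dq -> qder (fun s => qconj (Q s)) u (qconj dq).
Proof. by case=> q1 q2 q3 q4; split => //=; exact: dv_opp. Qed.

Lemma qder_cst u p : qder (fun=> p) u qzero.
Proof. by split; exact: dv_cst. Qed.

Lemma dv_dot X Y u dx dy : vder X u dx -> vder Y u dy ->
  is_derive u 1 (fun s => dot (X s) (Y s)) (dot dx (Y u) + dot (X u) dy).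
Proof.
case=> p1 p2 p3 [q1 q2 q3].
refine (dv_eq (dv_add (dv_add (dv_mul p1 q1) (dv_mul p2 q2)) (dv_mul p3 q3)) _).
rewrite /dot; ring.
Qed.

Lemma dv_qdot P Q u dp dq : qder P u dp -> qder Q u dq ->
  is_derive u 1 (fun s => qdot (P s) (Q s)) (qdot dp (Q u) + qdot (P u) dq).
Proof.
case=> p1 p2 p3 p4 [q1 q2 q3 q4].
refine (dv_eq (dv_add (dv_add (dv_add (dv_mul p1 q1) (dv_mul p2 q2))
  (dv_mul p3 q3)) (dv_mul p4 q4)) _).
rewrite /qdot; ring.
Qed.

Lemma vder_eq X u d d' : vder X u d -> d = d' -> vder X u d'.
Proof. by move=> + <-. Qed.

Lemma qder_eq Q u d d' : qder Q u d -> d = d' -> qder Q u d'.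
Proof. by move=> + <-. Qed.

Lemma vder_rot Q X u w dx : qder Q u (qhalf (Q u) w) -> vder X u dx ->
  vder (fun s => qrot (Q s) (X s)) u
    (vadd (qrot (Q u) dx) (cross (qrot (Q u) (X u)) w)).
Proof.
move=> dQ [x1 x2 x3].
have dX : qder (fun s => qvec (X s)) u (qvec dx) by split=> //; exact: dv_cst.
have [_ d1 d2 d3] := qder_mul (qder_mul (qder_conj dQ) dX) dQ.
split => /=.
- by refine (dv_eq d1 _); rewrite /= /qhalf /qrot /qscale /=; field.
- by refine (dv_eq d2 _); rewrite /= /qhalf /qrot /qscale /=; field.
- by refine (dv_eq d3 _); rewrite /= /qhalf /qrot /qscale /=; field.
Qed.

Definition qsolves (a : R -> vec R) (q : R -> quat R) :=
  q 0 = qone /\ forall u, itv01 u -> qder q u (qhalf (q u) (a u)).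

(** The velocity is q times an imaginary quaternion, hence orthogonal to q. *)
Lemma qsolves_unit (w : R -> vec R) Q : qsolves w Q -> forall u, itv01 u -> qn2 (Q u) = 1.
Proof.
move=> [q0 dq] u iu; rewrite (_ : 1 = qn2 (Q 0)); last by rewrite q0 qn2_one.
apply: (@der01_cst _ (fun s => qn2 (Q s))) iu => s si.
refine (dv_eq (dv_qdot (dq s si) (dq s si)) _).
by rewrite /qdot /qhalf /=; field.
Qed.

Lemma qder01_cst (Q : R -> quat R) : (forall u, itv01 u -> qder Q u qzero) ->
  forall u, itv01 u -> Q u = Q 0.
Proof.
move=> dQ u iu.
have h (f : quat R -> R) : (forall s, itv01 s -> is_derive s 1 (fun w => f (Q w)) 0) ->
    f (Q u) = f (Q 0).
  by move=> df; exact: (@der01_cst _ (fun w => f (Q w)) df).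
have := h (@qr R) (fun s si => let: And4 d _ _ _ := dQ s si in d).
have := h (@qi R) (fun s si => let: And4 _ d _ _ := dQ s si in d).
have := h (@qj R) (fun s si => let: And4 _ _ d _ := dQ s si in d).
have := h (@qk R) (fun s si => let: And4 _ _ _ d := dQ s si in d).
by case: (Q u) (Q 0) => ? ? ? ? [? ? ? ?] /= -> -> -> ->.
Qed.

(** The quotient P Q^-1 is constant, because both velocities arise by multiplying on the right with
    the same imaginary coefficient. *)
Lemma qsolves_unique (w : R -> vec R) P Q : qsolves w P -> qsolves w Q ->
  forall u, itv01 u -> P u = Q u.
Proof.
move=> sp sq u iu; have [p0 dp] := sp; have [q0 dq] := sq.
have e : qmul (P u) (qconj (Q u)) = qone.
  rewrite (_ : qone = qmul (P 0) (qconj (Q 0))); last first.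
    by rewrite p0 q0 /qmul /qone /=; apply: Q4_eq; rewrite /=; ring.
  apply: (@qder01_cst (fun s => qmul (P s) (qconj (Q s)))) iu => s si.
  refine (qder_eq (qder_mul (dp s si) (qder_conj (dq s si))) _).
  by rewrite /qadd /qhalf /qmul /qconj /qzero /=; apply: Q4_eq; rewrite /=; ring.
by rewrite -[P u]qmulq1 -(qmulqK (qsolves_unit sq iu)) qmulA e qmul1q.
Qed.

Lemma qsolves_exists (a : R -> vec R) : vwithin a -> exists Q, qsolves a Q.
Proof.
move=> [a1 a2 a3].
pose h := 1 / 2 : R.
(* The matrix of right multiplication by a / 2 in the basis 1, i, j, k. *)
pose A (i j : 'I_4) : R -> R := fun u => match val i, val j with
  | 0%N, 1%N => - h * vx (a u) | 0%N, 2%N => - h * vy (a u) | 0%N, 3%N => - h * vz (a u)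
  | 1%N, 0%N => h * vx (a u) | 1%N, 2%N => h * vz (a u) | 1%N, 3%N => - h * vy (a u)
  | 2%N, 0%N => h * vy (a u) | 2%N, 1%N => - h * vz (a u) | 2%N, 3%N => h * vx (a u)
  | 3%N, 0%N => h * vz (a u) | 3%N, 1%N => h * vy (a u) | 3%N, 2%N => - h * vx (a u)
  | _, _ => 0 end.
have cA i j : {within itv01, continuous (A i j)}.
  rewrite /A; case: i j => -[|[|[|[|//]]]] ? [[|[|[|[|//]]]] ?] /=;
  do ?[exact: within01_cst]; (apply: within01M; [exact: within01_cst|assumption]).
have [y Hy] := linear_ode (fun i : 'I_4 => (i == 0)%:R) cA.
exists (fun u => Q4 (y 0 u) (y 1 u) (y 2 u) (y 3 u)); split.
  by rewrite !(Hy _).1 /=.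
move=> u iu; split => /=.
- apply: dv_eq; first exact: (Hy 0).2.
  by rewrite sum4 /A /=; rewrite /h; field.
- apply: dv_eq; first exact: (Hy 1).2.
  by rewrite sum4 /A /=; rewrite /h; field.
- apply: dv_eq; first exact: (Hy 2).2.
  by rewrite sum4 /A /=; rewrite /h; field.
- apply: dv_eq; first exact: (Hy 3).2.
  by rewrite sum4 /A /=; rewrite /h; field.
Qed.

(** A total function of the coefficient, so that it can be applied inside families; its value is the
    constant 1 if there is no solution. *)
Definition qsol (a : R -> vec R) : R -> quat R :=
  if pselect (exists Q, qsolves a Q) is left h then projT1 (cid h) else fun=> qone.

Lemma qsolP (a : R -> vec R) : vwithin a -> qsolves a (qsol a).
Proof.
by rewrite /qsol => /qsolves_exists ha; case: pselect => // h; case: (cid h).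
Qed.

End Quaternions.

Arguments mfamily {R} E.

(** * Smooth families of vectors and quaternions *)

Section FamilyAlgebra.
Context {R : realType} {E : normedModType R}.
Variable U : set E.
Hypothesis oU : open U.
Implicit Types (G : mfamily E) (J : seq nat).

Lemma cls_scale n J (a : R) G : cls U n J G -> cls U n J (fun x v u => a * G x v u).
Proof.
move=> Gn; apply: (@cls_mul _ _ _ _ [::] J (fun _ _ _ => a) G) => //.
  exact: cls_uniq (cls_cls0 Gn).
by apply: cls_cst => //; exact: within01_cst.
Qed.

Lemma cls_opp n J G : cls U n J G -> cls U n J (fun x v u => - G x v u).
Proof.
move=> Gn; apply: cls_ext (cls_scale (-1) Gn) => x v u _ _; exact: mulN1r.
Qed.

Lemma cls_sub n J G1 G2 : cls U n J G1 -> cls U n J G2 ->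
  cls U n J (fun x v u => G1 x v u - G2 x v u).
Proof. by move=> G1n G2n; apply: cls_add => //; exact: cls_opp. Qed.

Definition vfamily := E -> (nat -> E) -> R -> vec R.
Definition qfamily := E -> (nat -> E) -> R -> quat R.
Implicit Types (X Y : vfamily) (P Q : qfamily).

Definition vcls n J X := [/\ cls U n J (fun x v u => vx (X x v u)),
  cls U n J (fun x v u => vy (X x v u)) & cls U n J (fun x v u => vz (X x v u))].

Definition qcls n J Q := [/\ cls U n J (fun x v u => qr (Q x v u)),
  cls U n J (fun x v u => qi (Q x v u)), cls U n J (fun x v u => qj (Q x v u))
  & cls U n J (fun x v u => qk (Q x v u))].

Lemma qcls_mul n J1 J2 P Q : uniq (J1 ++ J2) -> qcls n J1 P -> qcls n J2 Q ->
  qcls n (J1 ++ J2) (fun x v u => qmul (P x v u) (Q x v u)).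
Proof.
move=> J12 [p1 p2 p3 p4] [q1 q2 q3 q4]; have m G1 G2 := @cls_mul R E U n J1 J2 G1 G2 J12; split.
- refine (cls_sub (cls_sub (cls_sub (m _ _ p1 q1) (m _ _ p2 q2))
    (m _ _ p3 q3)) (m _ _ p4 q4)).
- refine (cls_sub (cls_add (cls_add (m _ _ p1 q2) (m _ _ p2 q1))
    (m _ _ p3 q4)) (m _ _ p4 q3)).
- refine (cls_add (cls_add (cls_sub (m _ _ p1 q3) (m _ _ p2 q4))
    (m _ _ p3 q1)) (m _ _ p4 q2)).
- refine (cls_add (cls_sub (cls_add (m _ _ p1 q4) (m _ _ p2 q3))
    (m _ _ p3 q2)) (m _ _ p4 q1)).
Qed.

Lemma qcls_conj n J Q : qcls n J Q -> qcls n J (fun x v u => qconj (Q x v u)).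
Proof. by case=> q1 q2 q3 q4; split => //; exact: cls_opp. Qed.

Lemma qcls_scale n J (a : R) Q : qcls n J Q -> qcls n J (fun x v u => qscale a (Q x v u)).
Proof. by case=> q1 q2 q3 q4; split => //; exact: cls_scale. Qed.

Lemma qcls_vec n J X : vcls n J X -> qcls n J (fun x v u => qvec (X x v u)).
Proof.
by case=> x1 x2 x3; split => //; apply: cls_zero => //; exact: cls_uniq (cls_cls0 x1).
Qed.

Lemma qcls_im n J Q : qcls n J Q -> vcls n J (fun x v u => qim (Q x v u)).
Proof. by case. Qed.

Definition qprim (q : R -> quat R) (u : R) : quat R :=
  Q4 (prim (fun s => qr (q s)) u) (prim (fun s => qi (q s)) u)
     (prim (fun s => qj (q s)) u) (prim (fun s => qk (q s)) u).

Lemma eq_qprim (p q : R -> quat R) u : (forall s, itv01 s -> p s = q s) ->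
  qprim p u = qprim q u.
Proof.
by move=> pq; rewrite /qprim; apply: Q4_eq; congr (_ u); apply: eq_prim => s si;
  rewrite pq.
Qed.

Lemma qcls_prim n J Q : qcls n J Q -> qcls n J (fun x v => qprim (Q x v)).
Proof. by case=> q1 q2 q3 q4; split; [exact (cls_prim q1)|exact (cls_prim q2)|exact (cls_prim q3)|exact (cls_prim q4)]. Qed.

End FamilyAlgebra.

Arguments vfamily {R} E.
Arguments qfamily {R} E.

(** * Smooth dependence of the quaternion path on its angular velocity *)

Section OdeFamily.
Context {R : realType}.

Definition qle (q : quat R) (b : R) :=
  [/\ `|qr q| <= b, `|qi q| <= b, `|qj q| <= b & `|qk q| <= b].

(** Each coordinate of a product of quaternions is a sum of four products. *)
Lemma qle_mul p q (a b : R) : qle p a -> qle q b -> qle (qmul p q) (4 * (a * b)).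
Proof.
move=> [p1 p2 p3 p4] [q1 q2 q3 q4].
have e (s t : R) : `|s| <= a -> `|t| <= b -> `|s * t| <= a * b.
  by move=> *; rewrite normrM ler_pM.
have four (c1 c2 c3 c4 : R) : `|c1| <= a * b -> `|c2| <= a * b -> `|c3| <= a * b ->
    `|c4| <= a * b -> `|c1 + c2 + c3 + c4| <= 4 * (a * b).
  by rewrite !ler_norml => /andP[? ?] /andP[? ?] /andP[? ?] /andP[? ?]; lra.
by split; apply: four; rewrite ?normrN; exact: e.
Qed.

Lemma qle_unit (q : quat R) : qn2 q = 1 -> qle q 1.
Proof.
rewrite /qn2 /qdot -!expr2 => h.
have e (s : R) : s ^+ 2 <= 1 -> `|s| <= 1 by move=> ?; rewrite ler_norml; apply/andP; split; nra.
have h1 := sqr_ge0 (qr q); have h2 := sqr_ge0 (qi q).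
have h3 := sqr_ge0 (qj q); have h4 := sqr_ge0 (qk q).
by split; apply: e; lra.
Qed.

Lemma qle_conj (q : quat R) b : qle q b -> qle (qconj q) b.
Proof. by case=> ? ? ? ?; split; rewrite //= normrN. Qed.

Lemma qle_add (p q : quat R) a b : qle p a -> qle q b -> qle (qadd p q) (a + b).
Proof.
by case=> ? ? ? ? [? ? ? ?]; split; rewrite /= (le_trans (ler_normD _ _))// lerD.
Qed.

Lemma qle_half (q : quat R) b : qle q b -> qle (qscale (1 / 2) q) b.
Proof.
have e (s : R) : `|s| <= b -> `|1 / 2 * s| <= b.
  by rewrite !ler_norml => /andP[? ?]; lra.
by case=> ? ? ? ?; split; exact: e.
Qed.

Lemma qle_trans (q : quat R) a b : qle q a -> a <= b -> qle q b.
Proof. by case=> ? ? ? ? ab; split; exact: le_trans ab. Qed.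

Lemma qle_vec (x : vec R) b : `|vx x| <= b -> `|vy x| <= b -> `|vz x| <= b ->
  qle (qvec x) b.
Proof. by move=> h *; split=> //=; rewrite normr0 (le_trans _ h). Qed.

Lemma qder01_le (Q D : R -> quat R) (B : R) : Q 0 = qzero ->
  (forall u, itv01 u -> qder Q u (D u)) -> (forall u, itv01 u -> qle (D u) B) ->
  forall u, itv01 u -> qle (Q u) B.
Proof.
move=> Q0 dQ DB u iu; have /itv01P /andP[u0 u1] := iu.
have h (f : quat R -> R) : f qzero = 0 ->
    (forall s, itv01 s -> is_derive s 1 (fun w => f (Q w)) (f (D s))) ->
    (forall s, itv01 s -> `|f (D s)| <= B) -> `|f (Q u)| <= B.
  move=> f0 df fB; have := mvt01_le df fB itv01_0 iu; rewrite Q0 f0 !subr0 => /le_trans; apply.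
  rewrite ger0_norm// ler_piMr//.
  exact: le_trans (fB _ itv01_0).
by split; apply: h => // s si; [case: (dQ s si)|case: (DB s si)|case: (dQ s si)|
  case: (DB s si)|case: (dQ s si)|case: (DB s si)|case: (dQ s si)|case: (DB s si)].
Qed.

Lemma qder_qwithin (Q D : R -> quat R) : (forall u, itv01 u -> qder Q u (D u)) ->
  qwithin Q.
Proof.
move=> dQ; split; apply: cont01_within => u iu; have [d1 d2 d3 d4] := dQ u iu.
- exact: dv_cont d1.
- exact: dv_cont d2.
- exact: dv_cont d3.
- exact: dv_cont d4.
Qed.

Lemma qprim_der (q : R -> quat R) : qwithin q ->
  forall u, itv01 u -> qder (qprim q) u (q u).
Proof. by case=> q1 q2 q3 q4 u iu; split; exact: prim_der. Qed.

Lemma qwithin_mul (p q : R -> quat R) : qwithin p -> qwithin q ->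
  qwithin (fun u => qmul (p u) (q u)).
Proof.
have N (f : R -> R) : {within itv01, continuous f} ->
    {within itv01, continuous (fun u => - f u)}.
  by move=> cf x; apply: cvgN; exact: cf.
move=> [p1 p2 p3 p4] [q1 q2 q3 q4].
have D (f g : R -> R) := @within01D R f g; have M (f g : R -> R) := @within01M R f g.
split.
- refine (D _ _ (D _ _ (D _ _ (M _ _ p1 q1) (N _ (M _ _ p2 q2))) (N _ (M _ _ p3 q3)))
    (N _ (M _ _ p4 q4))).
- refine (D _ _ (D _ _ (D _ _ (M _ _ p1 q2) (M _ _ p2 q1)) (M _ _ p3 q4))
    (N _ (M _ _ p4 q3))).
- refine (D _ _ (D _ _ (D _ _ (M _ _ p1 q3) (N _ (M _ _ p2 q4))) (M _ _ p3 q1))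
    (M _ _ p4 q2)).
- refine (D _ _ (D _ _ (D _ _ (M _ _ p1 q4) (M _ _ p2 q3)) (N _ (M _ _ p3 q2)))
    (M _ _ p4 q1)).
Qed.

Lemma qwithin_conj (q : R -> quat R) : qwithin q -> qwithin (fun u => qconj (q u)).
Proof.
have N (f : R -> R) : {within itv01, continuous f} ->
    {within itv01, continuous (fun u => - f u)}.
  by move=> cf x; apply: cvgN; exact: cf.
by move=> [q1 q2 q3 q4]; split => //; exact: N.
Qed.

Lemma qwithin_vec (x : R -> vec R) : vwithin x -> qwithin (fun u => qvec (x u)).
Proof. by case=> ? ? ?; split=> //; exact: within01_cst. Qed.

Lemma qwithin_scale a (q : R -> quat R) : qwithin q -> qwithin (fun u => qscale a (q u)).
Proof. by case=> ? ? ? ?; split; apply: within01M => //; exact: within01_cst. Qed.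

Lemma qder_scale a Q u (d : quat R) : qder Q u d -> qder (fun s => qscale a (Q s)) u (qscale a d).
Proof. by case=> *; split; exact: dv_cmul. Qed.

Lemma qder_add P Q u (dp dq : quat R) : qder P u dp -> qder Q u dq ->
  qder (fun s => qadd (P s) (Q s)) u (qadd dp dq).
Proof. by case=> ? ? ? ? [? ? ? ?]; split; exact: dv_add. Qed.

Definition conjugated (q : quat R) (x : vec R) : quat R :=
  qscale (1 / 2) (qmul (qmul q (qvec x)) (qconj q)).

(* Second order expansion of the solution operator.  The quotient [W] of the
   two solutions takes values in the unit quaternions, which gives the
   Lipschitz bound without Gronwall's inequality. *)
Lemma qsolves_expansion (a b h : R -> vec R) (p q : R -> quat R) (d e : R) :
  qsolves a q -> qsolves b p -> vwithin h ->
  (forall s, itv01 s -> qle (qvec (vadd (b s) (vscale (-1) (a s)))) d) ->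
  (forall s, itv01 s ->
    qle (qvec (vadd (vadd (b s) (vscale (-1) (a s))) (vscale (-1) (h s)))) e) ->
  forall u, itv01 u ->
    qle (qadd (qadd (p u) (qscale (-1) (q u)))
        (qscale (-1) (qmul (qprim (fun s => conjugated (q s) (h s)) u) (q u))))
      (64 * (64 * d ^+ 2 + e)).
Proof.
move=> sq sp ch dP eP; have [q0 dq] := sq; have [p0 dp] := sp.
have uq := qsolves_unit sq; have up := qsolves_unit sp.
have uq1 s (si : itv01 s) := qle_unit (uq s si); have up1 s (si : itv01 s) := qle_unit (up s si).
pose W s := qmul (p s) (qconj (q s)).
pose delta s := vadd (b s) (vscale (-1) (a s)).
have pW s : itv01 s -> p s = qmul (W s) (q s).
  by move=> si; rewrite /W -qmulA qmulqK ?uq// qmulq1.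
have dW s : itv01 s -> qder W s (qscale (1 / 2) (qmul (qmul (p s) (qvec (delta s))) (qconj (q s)))).
  move=> si; refine (qder_eq (qder_mul (dp s si) (qder_conj (dq s si))) _).
  by rewrite /qadd /qhalf /qmul /qconj /delta /qzero /=; apply: Q4_eq; rewrite /=; field.
have W0 : W 0 = qone by rewrite /W p0 q0; apply: Q4_eq; rewrite /=; ring.
pose V s := qadd (W s) (qscale (-1) qone).
have V0 : V 0 = qzero by rewrite /V W0; apply: Q4_eq; rewrite /=; ring.
have dV s (si : itv01 s) := qder_add (dW s si) (qder_cst s (qscale (-1) qone)).
have VB s : itv01 s -> qle (V s) (16 * d).
  apply: (qder01_le V0 dV) => w wi.
  have -> c : qadd c qzero = c :> quat R.
    by case: c => c1 c2 c3 c4; apply: Q4_eq; rewrite /=; ring.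
  apply: qle_half.
  apply: qle_trans (qle_mul (qle_mul (up1 w wi) (dP w wi)) (qle_conj (uq1 w wi))) _; lra.
have cq : qwithin q by exact: qder_qwithin dq.
pose Z := qprim (fun s => conjugated (q s) (h s)).
have cZ : qwithin (fun s => conjugated (q s) (h s)).
  by apply: qwithin_scale; apply: qwithin_mul; [apply: qwithin_mul => //;
    exact: qwithin_vec|exact: qwithin_conj].
have dZ s (si : itv01 s) := qprim_der cZ si.
pose T s := qadd (V s) (qscale (-1) (Z s)).
have T0 : T 0 = qzero.
  by rewrite /T V0 /Z /qprim !prim0; apply: Q4_eq; rewrite /=; ring.
have TB s : itv01 s -> qle (T s) (16 * (64 * d ^+ 2 + e)).
  apply: (qder01_le T0 (fun s si => qder_add (dV s si) (qder_scale (-1) (dZ s si)))) => w wi.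
  (* The derivative of T is (V r + r') / 2, where V and r are of order d and r' is of order e. *)
  pose r := qmul (qmul (q w) (qvec (delta w))) (qconj (q w)).
  pose r' := qmul (qmul (q w) (qvec (vadd (delta w) (vscale (-1) (h w))))) (qconj (q w)).
  rewrite (_ : qadd _ _ = qadd (qscale (1 / 2) (qmul (V w) r)) (qscale (1 / 2) r')); last first.
    rewrite pW// /V; move: (W w) (q w) (delta w) (h w) @r @r' => [w1 w2 w3 w4] [q1 q2 q3 q4] [d1 d2 d3] [h1 h2 h3].
    by move=> r r'; apply: Q4_eq; rewrite /=; field.
  have rB : qle r (16 * d).
    apply: qle_trans (qle_mul (qle_mul (uq1 w wi) (dP w wi)) (qle_conj (uq1 w wi))) _; lra.
  have r'B : qle r' (16 * e).
    apply: qle_trans (qle_mul (qle_mul (uq1 w wi) (eP w wi)) (qle_conj (uq1 w wi))) _; lra.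
  apply: qle_trans (qle_add (qle_half (qle_mul (VB w wi) rB)) (qle_half r'B)) _.
  by rewrite le_eqVlt; apply/orP; left; apply/eqP; ring.
move=> u iu; rewrite (_ : qadd _ _ = qmul (T u) (q u)); last first.
  rewrite pW// /T /V /Z; move: (W u) (q u) (qprim _ u) => [w1 w2 w3 w4] [q1 q2 q3 q4] [z1 z2 z3 z4].
  by apply: Q4_eq; rewrite /=; ring.
apply: qle_trans (qle_mul (TB u iu) (uq1 u iu)) _.
by rewrite le_eqVlt; apply/orP; left; apply/eqP; ring.
Qed.

Context {E : normedModType R}.
Variable U : set E.
Hypothesis oU : open U.

Definition vloc_deriv j (H H' : vfamily E) x :=
  [/\ loc_deriv j [::] (fun x v u => vx (H x v u)) (fun x v u => vx (H' x v u)) x,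
      loc_deriv j [::] (fun x v u => vy (H x v u)) (fun x v u => vy (H' x v u)) x
    & loc_deriv j [::] (fun x v u => vz (H x v u)) (fun x v u => vz (H' x v u)) x].

Definition qloc_deriv j (Q Q' : qfamily E) x :=
  [/\ loc_deriv j [::] (fun x v u => qr (Q x v u)) (fun x v u => qr (Q' x v u)) x,
      loc_deriv j [::] (fun x v u => qi (Q x v u)) (fun x v u => qi (Q' x v u)) x,
      loc_deriv j [::] (fun x v u => qj (Q x v u)) (fun x v u => qj (Q' x v u)) x
    & loc_deriv j [::] (fun x v u => qk (Q x v u)) (fun x v u => qk (Q' x v u)) x].

(** Variation of constants: the derivative of the solution q of q' = q a / 2 in the direction h is
    the integral of q h q^-1 / 2, multiplied by q. *)
Definition qsol_deriv (H H' : vfamily E) : qfamily E := fun x v u =>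
  qmul (qprim (fun s => conjugated (qsol (H x v) s) (H' x v s)) u) (qsol (H x v) u).

Lemma vcls_vwithin n J (H : vfamily E) x v : vcls U n J H -> U x -> vwithin (H x v).
Proof.
move=> [h1 h2 h3] Ux; split.
- exact (@cls_within _ _ _ _ _ (cls_cls0 h1) x v Ux).
- exact (@cls_within _ _ _ _ _ (cls_cls0 h2) x v Ux).
- exact (@cls_within _ _ _ _ _ (cls_cls0 h3) x v Ux).
Qed.

Lemma qsol_dep n (H : vfamily E) x v v' u : vcls U n [::] H -> U x -> itv01 u ->
  qsol (H x v) u = qsol (H x v') u.
Proof.
move=> Hn Ux iu; have [h1 h2 h3] := Hn.
have sv := qsolP (vcls_vwithin v Hn Ux); have [q0 dq] := qsolP (vcls_vwithin v' Hn Ux).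
apply: (qsolves_unique sv) => //; split=> // s si; have := dq s si.
suff -> : H x v' s = H x v s by [].
have e (f : vec R -> R) : cls U n [::] (fun x v u => f (H x v u)) -> f (H x v' s) = f (H x v s).
  by move=> /cls_cls0/cls_dep; exact.
by have := e (@vx R) h1; have := e (@vy R) h2; have := e (@vz R) h3;
  case: (H x v' s) (H x v s) => ? ? ? [? ? ?] /= -> -> ->.
Qed.

Lemma qsol_loc_deriv n j (H H' : vfamily E) x : U x ->
  vcls U n.+1 [::] H -> vcls U 0 [:: j] H' -> vloc_deriv j H H' x ->
  qloc_deriv j (fun x v => qsol (H x v)) (qsol_deriv H H') x.
Proof.
move=> Ux Hn H'0 [d1 d2 d3]; have [h1 h2 h3] := Hn.
have [r1 [K1 [r10 K10 b1]]] := d1; have [r2 [K2 [r20 K20 b2]]] := d2.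
have [r3 [K3 [r30 K30 b3]]] := d3.
have [s1 [L1 [s10 L10 l1]]] := cls_lipschitz h1 Ux.
have [s2 [L2 [s20 L20 l2]]] := cls_lipschitz h2 Ux.
have [s3 [L3 [s30 L30 l3]]] := cls_lipschitz h3 Ux.
have [s4 [L4 [s40 L40 l4]]] := cls_bounded (cls_cls0 h1) Ux.
have key : exists r K : R, [/\ 0 < r, 0 <= K & forall y z, `|y - x| < r -> `|z - x| < r ->
    forall v u, itv01 u -> qle (qadd (qadd (qsol (H z v) u) (qscale (-1) (qsol (H y v) u)))
        (qscale (-1) (qsol_deriv H H' y (upd v j (z - y)) u))) (K * `|z - y| ^+ 2)].
  exists (Num.min (Num.min r1 (Num.min r2 r3)) (Num.min (Num.min s1 (Num.min s2 s3)) s4)).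
  exists (64 * (64 * (L1 + L2 + L3) ^+ 2 + (K1 + K2 + K3))); split.
  - by rewrite !lt_min r10 r20 r30 s10 s20 s30.
  - apply: mulr_ge0 (ler0n _ _) _; apply: addr_ge0; last by rewrite !addr_ge0.
    by apply: mulr_ge0 (ler0n _ _) _; rewrite exprn_ge0// !addr_ge0.
  move=> y z; rewrite !lt_min => /andP[/and3P[y1 y2 y3] /andP[/and3P[y4 y5 y6] y7]].
  move=> /andP[/and3P[z1 z2 z3] /andP[/and3P[z4 z5 z6] z7]] v u iu.
  have Uy := (l4 _ y7).1; have Uz := (l4 _ z7).1.
  have sy := qsolP (vcls_vwithin v Hn Uy); have sz := qsolP (vcls_vwithin v Hn Uz).
  have := @qsolves_expansion _ _ (H' y (upd v j (z - y))) _ _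
    ((L1 + L2 + L3) * `|z - y|) ((K1 + K2 + K3) * `|z - y| ^+ 2)
    sy sz (vcls_vwithin _ H'0 Uy) _ _ u iu.
  have -> : qsol_deriv H H' y (upd v j (z - y)) u =
    qmul (qprim (fun s => conjugated (qsol (H y v) s) (H' y (upd v j (z - y)) s)) u)
      (qsol (H y v) u).
    refine (f_equal2 (@qmul R) (eq_qprim u _) (qsol_dep _ _ Hn Uy iu)) => s si.
    by rewrite (qsol_dep (upd v j (z - y)) v Hn Uy si).
  move=> h; apply: qle_trans (h _ _) _.
  - move=> s si; apply: qle_vec; rewrite /= mulN1r.
    + have := l1 _ _ y4 z4 v s si; rewrite /pnorm big_nil mulr1 => /le_trans; apply.
      by rewrite ler_wpM2r// -addrA lerDl addr_ge0.
    + have := l2 _ _ y5 z5 v s si; rewrite /pnorm big_nil mulr1 => /le_trans; apply.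
      by rewrite ler_wpM2r// addrAC lerDr addr_ge0.
    + have := l3 _ _ y6 z6 v s si; rewrite /pnorm big_nil mulr1 => /le_trans; apply.
      by rewrite ler_wpM2r// lerDr addr_ge0.
  - move=> s si; apply: qle_vec; rewrite /= !mulN1r.
    + have := b1 _ _ y1 z1 v s si; rewrite /pnorm big_nil mulr1 => /le_trans; apply.
      by rewrite ler_wpM2r// ?exprn_ge0// -addrA lerDl addr_ge0.
    + have := b2 _ _ y2 z2 v s si; rewrite /pnorm big_nil mulr1 => /le_trans; apply.
      by rewrite ler_wpM2r// ?exprn_ge0// addrAC lerDr addr_ge0.
    + have := b3 _ _ y3 z3 v s si; rewrite /pnorm big_nil mulr1 => /le_trans; apply.
      by rewrite ler_wpM2r// ?exprn_ge0// lerDr addr_ge0.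
  - by rewrite le_eqVlt; apply/orP; left; apply/eqP; ring.
have [r [K [r0 K0 rK]]] := key.
split; exists r, K; split=> // y z yr zr v u iu; rewrite /pnorm big_nil mulr1;
 have [e1 e2 e3 e4] := rK y z yr zr v u iu.
- by move: e1; rewrite /= !mulN1r.
- by move: e2; rewrite /= !mulN1r.
- by move: e3; rewrite /= !mulN1r.
- by move: e4; rewrite /= !mulN1r.
Qed.

(** Bootstrap: the derivative is built from [qsol] itself by products and integrals, so n
    derivatives of the solution yield n + 1. *)
Lemma qcls_qsol n (H : vfamily E) : vcls U n [::] H ->
  qcls U n [::] (fun x v => qsol (H x v)).
Proof.
elim: n => [|n IHn] Hn.
all: have C0 : qcls U 0 [::] (fun x v => qsol (H x v)).
1,3: have [h1 h2 h3] := Hn; split; (split=> //; split=> //;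
  [by move=> x v v' u Ux iu _; rewrite (qsol_dep v v' Hn Ux iu)
  |move=> x Ux; have [r [K [r0 K0 rK]]] := cls_bounded (cls_cls0 h1) Ux;
   exists r, 1; split=> // y /rK[Uy _]; split=> // v u iu; rewrite /pnorm big_nil mulr1;
   by have [] := qle_unit (qsolves_unit (qsolP (vcls_vwithin v Hn Uy)) iu)
  |move=> x v Ux; have [_ dq] := qsolP (vcls_vwithin v Hn Ux);
   by have [] := qder_qwithin dq]).
  exact: C0.
have [h1 h2 h3] := Hn.
have Qn : qcls U n [::] (fun x v => qsol (H x v)).
  by apply: IHn; split; exact: cls_pred.
have dQ j : exists2 Q', qcls U n [:: j] Q' &
    forall x, U x -> qloc_deriv j (fun x v => qsol (H x v)) Q' x.
  have [G1 g1 dg1] := cls_deriv h1 (isT : j \notin [::]).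
  have [G2 g2 dg2] := cls_deriv h2 (isT : j \notin [::]).
  have [G3 g3 dg3] := cls_deriv h3 (isT : j \notin [::]).
  pose H' x v u := V3 (G1 x v u) (G2 x v u) (G3 x v u).
  exists (qsol_deriv H H').
    have Hv : vcls U n [:: j] H' by [].
    refine (@qcls_mul _ _ _ oU _ [:: j] [::] _ _ isT (qcls_prim (qcls_scale oU (1 / 2)
      (@qcls_mul _ _ _ oU _ [:: j] [::] _ _ isT (@qcls_mul _ _ _ oU _ [::] [:: j] _ _ isT Qn
         (qcls_vec oU Hv)) (qcls_conj oU Qn)))) Qn).
  move=> x Ux; apply: (@qsol_loc_deriv n) => //.
    by split; [exact: cls_leq g1|exact: cls_leq g2|exact: cls_leq g3].
  by split; [exact: dg1|exact: dg2|exact: dg3].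
have [c1 c2 c3 c4] := C0; split; (split; first by case: c1 c2 c3 c4 => [? _] [? _] [? _] [? _]);
 move=> j _; have [Q' [q1 q2 q3 q4] dQ'] := dQ j.
- by exists (fun x v u => qr (Q' x v u)) => // x /dQ'[].
- by exists (fun x v u => qi (Q' x v u)) => // x /dQ'[].
- by exists (fun x v u => qj (Q' x v u)) => // x /dQ'[].
- by exists (fun x v u => qk (Q' x v u)) => // x /dQ'[].
Qed.

End OdeFamily.

(** * From smooth families to Frechet derivatives and curves *)

Section Frechet.
Context {R : realType} {V W : normedModType R}.

Lemma frechet_diff (f : V -> W) (df : {linear V -> W}) (x : V) (K : R) :
  (forall h, `|df h| <= K * `|h|) ->
  (forall e : R, 0 < e -> \forall h \near (0 : V),
     `|f (x + h) - f x - df h| <= e * `|h|) ->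
  differentiable f x /\ 'd f x = df :> (V -> W).
Proof.
move=> dfK fx.
have cdf : continuous df.
  apply/linear_bounded_continuous/linear_boundedP.
  exists K; split; first exact: num_real.
  move=> r Kr h; rewrite (le_trans (dfK h))// ler_wpM2r// ltW//.
have ef : f \o shift x = cst (f x) + df +o_ 0 id.
  apply/eqaddoP => e e0; apply: filterS (fx e e0) => h; apply: le_trans.
  by rewrite !fctE /= opprD addrA [h + x]addrC.
have d := diff_unique cdf ef; split=> //.
by apply/diff_locallyP; rewrite d.
Qed.

Lemma smooth_on_diff (U : set V) (g : V -> W) (x : V) : smooth_on U g -> U x ->
  differentiable g x.
Proof.
move=> [oU [D [D0 Dlin Dbd Dder]]] Ux.
have dlin : linear (fun h => D x [:: h]).
  by move=> a v w; have := Dlin x Ux [::] [::] a v w.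
pose dL := GRing.isLinear.Build _ _ _ _ _ dlin.
pose df : {linear V -> W} := HB.pack (fun h => D x [:: h]) dL.
have [K HK] := Dbd x Ux 1%N.
have [] // := @frechet_diff g df x K.
- by move=> h; have := HK [:: h] erefl; rewrite big_seq1.
- move=> e e0; have := Dder x Ux 0%N e e0.
  have nU : \forall h \near (0 : V), U (x + h).
    have : nbhs (x + 0) U by rewrite addr0; exact: open_nbhs_nbhs.
    have /= := @continuous_comp _ _ _ (fun h => x + h) (fun z => z) 0.
    move=> _ nU; have : (x + h) @[h --> (0 : V)] --> x + 0.
      by apply: cvgD; [exact: cvg_cst|exact: cvg_id].
    exact.
  apply: filterS2 nU => h Uxh /(_ [::] erefl).
  by rewrite big_nil mulr1 !D0.
Qed.

End Frechet.

Section ChainRule.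
Context {R : realType} {V W : normedModType R}.

(** Differentials of the class maps are evaluated along curves of solutions by this lemma, which
    avoids any closed formula for them. *)
Lemma is_derive_diff (gamma : R -> V) (g : V -> W) (t : R) (v : V) (w : W) :
  is_derive t 1 gamma v -> differentiable g (gamma t) ->
  is_derive t 1 (g \o gamma) w -> 'd g (gamma t) v = w.
Proof.
move=> [/derivable1_diffP dgam egam] dg [_ eg].
rewrite -egam -eg !deriveE//; last exact: differentiable_comp.
by rewrite (diff_comp dgam dg).
Qed.

End ChainRule.

Section FamilyCurve.
Context {R : realType} {E : normedModType R}.
Variable U : set E.

Lemma cls0_diff j G G' x v u : cls0 U [:: j] G' -> U x -> itv01 u ->
  loc_deriv j [::] G G' x ->
  differentiable (fun y => G y v u) x /\
  forall h, 'd (fun y => G y v u) x h = G' x (upd v j h) u.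
Proof.
move=> G'0 Ux iu [r [K [r0 K0 GK]]].
have dlin : linear (fun h => G' x (upd v j h) u).
  by move=> a h1 h2; rewrite (cls_linear G'0)// mem_head.
pose dL := GRing.isLinear.Build _ _ _ _ _ dlin.
pose df : {linear E -> R} := HB.pack (fun h => G' x (upd v j h) u) dL.
have [r' [K' [r'0 K'0 GK']]] := cls_bounded G'0 Ux.
have [||dG e] := @frechet_diff _ _ _ (fun y => G y v u) df x K'.
- move=> h; have [|_ /(_ (upd v j h) u iu)] := GK' x; first by rewrite subrr normr0.
  by rewrite /pnorm big_seq1 updE.
- move=> e e0.
  have : \forall h \near (0 : E), `|h| < Num.min r (e / (K + 1)).
    apply/nbhs_norm0P; exists (Num.min r (e / (K + 1))) => //.
    by rewrite /= lt_min r0 divr_gt0// ltr_wpDl.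
  apply: filterS => h; rewrite lt_min => /andP[hr he].
  have := GK x (x + h) _ _ v u iu; rewrite subrr normr0 addrAC subrr add0r.
  move=> /(_ r0 hr); rewrite /pnorm big_nil mulr1 => /le_trans; apply.
  rewrite expr2 mulrA ler_wpM2r// (le_trans (ler_wpM2l K0 (ltW he)))//.
  by rewrite mulrA ler_pdivrMr ?ltr_wpDl// mulrC ler_wpM2l ?ltW// ltrDl.
by split=> // h; rewrite e.
Qed.

Lemma cls0_chain j G G' (gamma : R -> E) (t : R) (d : E) v u :
  cls0 U [:: j] G' -> U (gamma t) -> itv01 u ->
  loc_deriv j [::] G G' (gamma t) -> is_derive t 1 gamma d ->
  is_derive t 1 (fun s => G (gamma s) v u) (G' (gamma t) (upd v j d) u).
Proof.
move=> G'0 Ux iu dG dgam; have [df e] := cls0_diff v G'0 Ux iu dG.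
rewrite -e; have [/derivable1_diffP dgam' egam] := dgam.
have dfg : differentiable ((fun y => G y v u) \o gamma) t by exact: differentiable_comp.
split; first exact/derivable1_diffP.
rewrite -egam (deriveE _ dgam').
transitivity ('d ((fun y => G y v u) \o gamma) t 1); first exact: (deriveE _ dfg).
by rewrite (diff_comp dgam' df).
Qed.

End FamilyCurve.

Section SmoothRow.
Context {R : realType} {E : normedModType R} (U : set E) (m : nat).
Hypothesis oU : open U.
Variables (G : 'I_m -> mfamily E) (u : R).
Hypothesis iu : itv01 u.
Hypothesis G_cls : forall i n, cls U n [::] (G i).

(** [cls] supplies derivatives only existentially, order by order. Iterated directional derivatives
    are canonical and agree with every such choice, so one function can serve as [D] in
    [smooth_on]. *)
Definition iter_deriv (F : E -> R) (s : seq E) : E -> R :=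
  foldr (fun h F x => 'D_h F x) F s.

Fixpoint jseq (n : nat) : seq nat := if n is n'.+1 then n' :: jseq n' else [::].

Lemma mem_jseq n j : (j \in jseq n) = (j < n)%N.
Proof. by elim: n => [|n IHn] //=; rewrite in_cons IHn ltnS [in RHS]leq_eqVlt. Qed.

(** The list is reversed so that a direction keeps its name when a new one is put in front: the head
    of a list of length n + 1 gets the name n. *)
Definition envir (s : seq E) : nat -> E := nth 0 (rev s).

Lemma envir_cons h s : {in jseq (size s).+1, envir (h :: s) =1 upd (envir s) (size s) h}.
Proof.
move=> j; rewrite mem_jseq ltnS /envir rev_cons nth_rcons size_rev /upd leq_eqVlt.
by case: ltngtP.
Qed.

Lemma envir_cat s t h : envir (s ++ h :: t) = upd (envir (s ++ 0 :: t)) (size t) h.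
Proof.
apply/funext => j; rewrite /envir !rev_cat !rev_cons !cat_rcons /upd !nth_cat size_rev.
by case: ltngtP => // [lt|->]; [rewrite -(subnSK lt)|rewrite subnn].
Qed.

Lemma pnorm_envir s : pnorm (envir s) (jseq (size s)) = \prod_(h <- s) `|h|.
Proof.
elim: s => [|h s IHs]; first by rewrite /pnorm !big_nil.
rewrite (pnorm_eq (@envir_cons h s)) pnorm_upd ?mem_jseq ?ltnn//.
by rewrite IHs big_cons.
Qed.

Definition row_deriv (x : E) (s : seq E) : 'rV[R]_m :=
  \row_i iter_deriv (fun y => G i y (fun=> 0) u) s x.

Lemma iter_deriv_step i n Gn G' : cls0 U (jseq n) Gn -> cls0 U (n :: jseq n) G' ->
  (forall x, U x -> loc_deriv n (jseq n) Gn G' x) ->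
  (forall s, size s = n -> forall x, U x ->
    iter_deriv (fun y => G i y (fun=> 0) u) s x = Gn x (envir s) u) ->
  forall s, size s = n.+1 -> forall x, U x ->
    iter_deriv (fun y => G i y (fun=> 0) u) s x = G' x (envir s) u.
Proof.
move=> Gn0 G'0 dG' GnE [//|h s] [sn] x Ux; rewrite /=.
rewrite (cls_dep G'0 Ux iu (v' := upd (envir s) n h)); last first.
  by rewrite -sn; exact: envir_cons.
have [r [K [r0 K0 GK]]] := dG' _ Ux.
have [r' [K' [r'0 K'0 GK']]] := cls_bounded Gn0 Ux.
rewrite /derive; apply: cvg_lim => //; apply/cvgrPdist_le => e e0.
(* The constant of the quadratic remainder along h, increased by 1 to be positive. Dividing the
   remainder by |w| leaves an error below C |w|. *)
pose C := K * `|h| ^+ 2 * pnorm (envir s) (jseq n) + 1.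
have C0 : 0 < C by rewrite ltr_wpDl// mulr_ge0 ?pnorm_ge0// mulr_ge0 ?exprn_ge0.
pose a := Num.min (Num.min r r' / (`|h| + 1)) (e / C).
have h1 : 0 < `|h| + 1 by rewrite ltr_wpDl.
have a0 : 0 < a by rewrite !lt_min !divr_gt0// lt_min r0.
rewrite near_withinE; apply/nbhs_ballP; exists a; first exact: a0.
move=> w; rewrite -ball_normE /= sub0r normrN.
rewrite /a !lt_min ltr_pdivlMr// => /andP[]; rewrite lt_min => /andP[wr wr'] we w0.
have wh : `|w *: h| <= `|w| * (`|h| + 1) by rewrite normrZ ler_wpM2l// lerDl.
have xr : `|w *: h + x - x| < r by rewrite addrK (le_lt_trans wh).
have xr' : `|w *: h + x - x| < r' by rewrite addrK (le_lt_trans wh).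
have := GK x (w *: h + x) _ xr (envir s) u iu; rewrite subrr normr0 => /(_ r0).
rewrite (GnE s sn _ Ux) (GnE s sn _ (GK' _ xr').1).
rewrite addrK -[w *: h]addr0 (cls_linear G'0)// ?mem_head// addr0.
have -> : G' x (upd (envir s) n 0) u = 0.
  have := @cls_linear _ _ _ _ _ G'0 x (envir s) n (-1) 0 0 u Ux iu (mem_head _ _).
  by rewrite scaler0 addr0 mulN1r addNr.
rewrite addr0 normrZ exprMn; set A := Gn _ _ _; set B := Gn _ _ _; set D := G' _ _ _ => rem.
have w0' : 0 < `|w| by rewrite normr_gt0.
have -> : D - w^-1 *: (A - B) = - w^-1 * (A - B - w * D).
  by rewrite /GRing.scale/=; field.
rewrite normrM normrN normfV mulrC ler_pdivrMr//.
rewrite (le_trans rem)//.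
have -> : K * (`|w| ^+ 2 * `|h| ^+ 2) * pnorm (envir s) (jseq n) = `|w| * (C - 1) * `|w|.
  by rewrite /C; ring.
rewrite ler_wpM2r//; move: we; rewrite ltr_pdivlMr// => /ltW; apply: le_trans.
by rewrite ler_wpM2l// gerBl.
Qed.

Lemma iter_deriv_family i n k : exists2 Gn, cls U k (jseq n) Gn &
  forall s, size s = n -> forall x, U x ->
    iter_deriv (fun y => G i y (fun=> 0) u) s x = Gn x (envir s) u.
Proof.
elim: n k => [|n IHn] k.
  exists (G i); first exact: G_cls.
  by move=> [|//] _ x Ux; apply: (cls_dep (cls_cls0 (G_cls i 0%N))).
have [Gn Gnk GnE] := IHn k.+1.
have nJ : n \notin jseq n by rewrite mem_jseq ltnn.
have [G' G'k dG'] := cls_deriv Gnk nJ.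
by exists G' => //; apply: (iter_deriv_step (cls_cls0 Gnk) (cls_cls0 G'k) dG' GnE).
Qed.

Lemma row_norm_le (x : 'rV[R]_m) (K : R) : 0 <= K -> (forall i, `|x 0 i| <= K) -> `|x| <= K.
Proof.
move=> K0 xK; rewrite [leLHS]/Num.Def.normr/= mx_normrE (bigmax_le _ K0)//= => -[i j] _.
by rewrite ord1.
Qed.

Lemma cls_smooth_row : smooth_on U (fun x => \row_i G i x (fun=> 0) u).
Proof.
split=> //; exists row_deriv; split.
- by move=> x Ux; apply/rowP => i; rewrite !mxE.
- move=> x Ux s t a v w; apply/rowP => i; rewrite !mxE.
  have [Gn Gn0 GnE] := iter_deriv_family i (size s + size t).+1 0.
  have sz y : size (s ++ y :: t) = (size s + size t).+1 by rewrite size_cat /= addnS.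
  have E1 := GnE _ (sz (a *: v + w)) x Ux.
  have E2 := GnE _ (sz v) x Ux; have E3 := GnE _ (sz w) x Ux.
  rewrite E1 E2 E3 (envir_cat s t (a *: v + w)) (envir_cat s t w) (envir_cat s t v).
  by rewrite (cls_linear (cls_cls0 Gn0))// mem_jseq ltnS leq_addl.
- move=> x Ux n.
  have bd i : exists K : R, 0 <= K /\ forall s, size s = n ->
      `|row_deriv x s 0 i| <= K * \prod_(v <- s) `|v|.
    have [Gn Gn0 GnE] := iter_deriv_family i n 0.
    have [r [K [r0 K0 GK]]] := cls_bounded (cls_cls0 Gn0) Ux.
    exists K; split=> // s sn; rewrite mxE (GnE s sn)// -pnorm_envir sn.
    by have [|_] := GK x; [rewrite subrr normr0|exact].
  have /choice[K HK] := bd; exists (\sum_i K i) => s sn.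
  have K0 : 0 <= \sum_i K i by apply: sumr_ge0 => i _; have [] := HK i.
  have p0 : 0 <= \prod_(v <- s) `|v| by apply: prodr_ge0.
  apply: row_norm_le => [|i]; first by rewrite mulr_ge0.
  rewrite (le_trans ((HK i).2 s sn))// ler_wpM2r// (bigD1 i)//= lerDl.
  by apply: sumr_ge0 => j _; have [] := HK j.
- move=> x Ux n e e0.
  have nr i : \forall h \near (0 : E), forall s, size s = n ->
     `|row_deriv (x + h) s 0 i - row_deriv x s 0 i - row_deriv x (h :: s) 0 i|
       <= e * `|h| * \prod_(v <- s) `|v|.
    have [Gn Gn1 GnE] := iter_deriv_family i n 1.
    have nJ : n \notin jseq n by rewrite mem_jseq ltnn.
    have [G' G'0 dG'] := cls_deriv Gn1 nJ.
    have step := iter_deriv_step (cls_cls0 Gn1) (cls_cls0 G'0) dG' GnE.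
    have [r [K [r0 K0 GK]]] := dG' _ Ux.
    have [r' [K' [r'0 K'0 GK']]] := cls_bounded (cls_cls0 Gn1) Ux.
    have a0 : 0 < Num.min (Num.min r r') (e / (K + 1)).
      by rewrite !lt_min r0 r'0 divr_gt0// ltr_wpDl.
    apply/nbhs_norm0P; exists (Num.min (Num.min r r') (e / (K + 1))) => //= h.
    rewrite /= !lt_min => /andP[/andP[hr hr'] he] s sn.
    have xh : x + h - x = h by rewrite addrAC subrr add0r.
    have := GK x (x + h) _ _ (envir s) u iu; rewrite subrr normr0 xh => /(_ r0 hr).
    have Uxh : U (x + h) by apply: (GK' _ _).1; rewrite xh.
    rewrite !mxE (GnE s sn _ Ux) (GnE s sn _ Uxh) (step (h :: s) _ _ Ux)/=; last by rewrite sn.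
    rewrite (cls_dep (cls_cls0 G'0) Ux iu (v := envir (h :: s)) (v' := upd (envir s) n h)).
      move=> /le_trans; apply; rewrite -sn pnorm_envir ler_wpM2r ?prodr_ge0//.
      rewrite expr2 mulrA ler_wpM2r// (le_trans (ler_wpM2l K0 (ltW he)))//.
      by rewrite mulrA ler_pdivrMr ?ltr_wpDl// mulrC ler_wpM2l ?ltW// ltrDl.
    by rewrite -sn; exact: envir_cons.
  near=> h; move=> s sn.
  have H : forall i s, size s = n ->
     `|row_deriv (x + h) s 0 i - row_deriv x s 0 i - row_deriv x (h :: s) 0 i|
       <= e * `|h| * \prod_(v <- s) `|v| by near: h; apply: filter_forall.
  have p0 : 0 <= \prod_(v <- s) `|v| by apply: prodr_ge0.
  apply: row_norm_le => [|i]; first by rewrite !mulr_ge0// ltW.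
  by have := H i s sn; rewrite !mxE.
Unshelve. all: by end_near. Qed.

End SmoothRow.

(** * Paths in R^3 and C^1 paths with prescribed velocity *)

Section RowVectors.
Context {R : realType}.
Implicit Types (x : 'rV[R]_3) (a b : vec R).

Definition vrow x : vec R := V3 (x 0 0) (x 0 1) (x 0 2).

Definition rowv a : 'rV[R]_3 :=
  \row_i (if i == 0 then vx a else if i == 1 then vy a else vz a).

Lemma rowvK : cancel rowv vrow.
Proof. by case=> a b c; rewrite /vrow !mxE. Qed.

Lemma vrowK : cancel vrow rowv.
Proof.
move=> x; apply/rowP => i; rewrite !mxE.
by case: i => -[|[|[|//]]] ? /=; congr (x 0 _); exact: val_inj.
Qed.

Lemma rowv_lin (c : R) a b : rowv (vadd (vscale c a) b) = c *: rowv a + rowv b.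
Proof. by apply/rowP => i; rewrite !mxE; do 2?case: ifP. Qed.

Lemma row_norm_coord (m : nat) (x : 'rV[R]_m) i : `|x 0 i| <= `|x|.
Proof.
rewrite [leRHS]/Num.Def.normr/= mx_normrE.
exact: (le_bigmax _ (fun j : 'I_1 * 'I_m => `|x j.1 j.2|) (0, i)).
Qed.

Definition vle a (K : R) := [/\ `|vx a| <= K, `|vy a| <= K & `|vz a| <= K].

Lemma rowv_le a K : vle a K -> `|rowv a| <= K.
Proof.
move=> [a1 a2 a3]; apply: row_norm_le; first exact: le_trans a1.
by move=> i; rewrite mxE; do 2?case: ifP.
Qed.

End RowVectors.

Section PathSpaces.
Context {R : realType}.
Local Notation V := 'rV[R]_3.
Implicit Types (phi psi : R -> vec R).

Definition zero_ext phi (u : R) : V := if `[< itv01 u >] then rowv (phi u) else 0.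

(** The result is the zero path unless [phi] is continuous on [0,1]. *)
Definition mkC0 phi : C0 V := insubd (0 : C0 V) (zero_ext phi).

Lemma rowv_within phi : vwithin phi -> {within itv01, continuous (fun u => rowv (phi u))}.
Proof.
move=> [c1 c2 c3] x; apply/cvgrPdist_lt => e e0.
have h (f : R -> R) : {within itv01, continuous f} ->
    \forall t \near nbhs (x : subspace itv01), `|f x - f t| < e.
  by move=> /(_ x)/cvgrPdist_lt/(_ e e0).
near=> t; rewrite (_ : _ - _ = rowv (vadd (vscale (-1) (phi t)) (phi x))).
  apply: le_lt_trans (_ : Num.max `|vx (phi x) - vx (phi t)|
    (Num.max `|vy (phi x) - vy (phi t)| `|vz (phi x) - vz (phi t)|) < e).
    apply: rowv_le; split; rewrite /= mulN1r addrC ?le_max lexx ?orbT//.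
  rewrite !gt_max; apply/and3P; split.
  - by near: t; exact: h c1.
  - by near: t; exact: h c2.
  - by near: t; exact: h c3.
by rewrite rowv_lin scaleN1r addrC.
Unshelve. all: by end_near. Qed.

Lemma mkC0E phi u : vwithin phi -> itv01 u -> mkC0 phi u = rowv (phi u).
Proof.
move=> cphi iu; rewrite /mkC0 /insubd insubT /=; last first.
  by move=> _; rewrite /zero_ext; case: asboolP.
rewrite inE; split; last by move=> w nw; rewrite /zero_ext; case: asboolP.
have := rowv_within cphi; apply: subspace_eq_continuous => w /set_mem iw.
by rewrite /from_subspace /zero_ext; case: asboolP.
Qed.

Lemma C0_eq (f g : C0 V) : (forall u, itv01 u -> f u = g u) -> f = g.
Proof.
move=> fg; apply/val_inj/funext => u /=; have [/fg//|nu] := pselect (itv01 u).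
have := valP f; have := valP g; rewrite !inE => -[_ g0] [_ f0].
by rewrite g0// f0.
Qed.

Lemma C0_within (f : C0 V) : {within itv01, continuous f}.
Proof. by have := valP f; rewrite inE => -[]. Qed.

Lemma C1_eq (X Y : C1 V) : (forall u, itv01 u -> X u = Y u) ->
  (forall u, itv01 u -> velocity X u = velocity Y u) -> X = Y.
Proof.
move=> XY vXY; apply: val_inj => /=.
rewrite [LHS]surjective_pairing [RHS]surjective_pairing.
by congr (_, _); exact: C0_eq.
Qed.

(** Beyond the ends the path is continued along its end velocity, which turns the one-sided
    derivatives into two-sided ones. *)
Lemma C1_ext_is_derive (W : normedModType R) (X : C1 W) (u : R) : itv01 u ->
  is_derive u 1 (fun s => X (clamp s) + (s - clamp s) *: velocity X (clamp s))
    (velocity X u).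
Proof.
move=> iu; set F := fun s => _.
have dX : (w - u)^-1 *: (X w - X u) @[w --> within itv01 u^'] --> velocity X u.
  by have := valP X; rewrite inE => /(_ u iu).
have FX w : itv01 w -> F w = X w.
  by move=> iw; rewrite /F clamp_id// subrr scale0r addr0.
have lim : h^-1 *: ((F \o shift u) (h *: 1) - F u) @[h --> 0^'] --> velocity X u.
  apply/cvgrPdist_lt => e e0; have /cvgrPdist_lt/(_ e e0) := dX.
  rewrite !near_withinE => /nbhs_ballP[r r0 rX]; apply/nbhs_ballP.
  have /itv01P /andP[u0 u1] := iu.
  (* For an interior u the radius keeps h + u inside [0,1]; for an end u, the radius 1 ensures that
     [clamp] sends outside points back to u itself. *)
  pose d := Num.min r (if u == 0 then 1 else if u == 1 then 1 else Num.min u (1 - u)).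
  exists d.
    rewrite /= /d lt_min; apply/andP; split; first exact: r0.
    case: eqP => // /eqP un0; case: eqP => // /eqP un1.
    by rewrite lt_min subr_gt0 !lt_neqAle eq_sym un0 u0 un1.
  move=> h; rewrite -ball_normE /= sub0r normrN /d lt_min => /andP[hr hd] h0.
  rewrite [h *: 1]mulr1 (FX u iu).
  have [ih|nih] := pselect (itv01 (h + u)).
    have := rX (h + u); rewrite -ball_normE /= opprD addrCA subrr addr0 normrN.
    move=> /(_ hr); rewrite (FX _ ih) addrK; apply=> //.
    by rewrite -subr_eq0 addrK.
  have eu : clamp (h + u) = u.
    move: hd nih; rewrite itv01P /clamp; case: eqP => [-> |/eqP un0].
      rewrite addr0 => /ltr_normlP[h1 h2] nih.
      have hn : h < 0 by rewrite ltNge; apply/negP => hp; apply: nih; rewrite hp ltW.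
      by rewrite (min_idPr _) ?(max_idPl _)// ltW// (lt_trans hn).
    case: eqP => [->|/eqP un1].
      move=> /ltr_normlP[h1 h2] nih.
      have hp : 0 < h.
        rewrite ltNge; apply/negP => hn; apply: nih; rewrite gerDr hn andbT.
        by rewrite addrC -lerBlDl sub0r lerNl ltW.
      by rewrite (min_idPl _) ?(max_idPr _)// lerDr ltW.
    rewrite lt_min => /andP[/ltr_normlP[h1 h2] /ltr_normlP[h3 h4]] nih; exfalso.
    by apply: nih; apply/andP; split; lra.
  rewrite /F eu addrK addrAC subrr add0r scalerA mulVf// scale1r subrr normr0//.
split; first by apply/cvg_ex; exists (velocity X u).
exact: cvg_lim lim.
Qed.

Definition vprim phi (u : R) : vec R :=
  V3 (prim (fun s => vx (phi s)) u) (prim (fun s => vy (phi s)) u)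
     (prim (fun s => vz (phi s)) u).

Lemma vprim_der phi : vwithin phi -> forall u, itv01 u -> vder (vprim phi) u (phi u).
Proof. by case=> c1 c2 c3 u iu; split; exact: prim_der. Qed.

Lemma vder_within phi psi : (forall u, itv01 u -> vder phi u (psi u)) -> vwithin phi.
Proof.
move=> dphi; split; apply: cont01_within => u iu; have [d1 d2 d3] := dphi u iu.
- exact: dv_cont d1.
- exact: dv_cont d2.
- exact: dv_cont d3.
Qed.

(** Only the starting point and the velocity are prescribed; the position is a primitive, so the two
    stored components are compatible by construction. *)
Definition mkC1 (a : vec R) phi : C1 V :=
  insubd (0 : C1 V) (mkC0 (fun u => vadd a (vprim phi u)), mkC0 phi).

Lemma vder_addl a phi u d : vder phi u d -> vder (fun s => vadd a (phi s)) u d.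
Proof.
by case=> d1 d2 d3; split; apply: dv_eq (dv_add (dv_cst _ _) _) (add0r _); eassumption.
Qed.

Lemma rowv_is_derive phi u d : vder phi u d ->
  is_derive u 1 (fun s => rowv (phi s)) (rowv d).
Proof.
move=> [[d1 e1] [d2 e2] [d3 e3]].
have dM : derivable (fun s => rowv (phi s)) u 1.
  apply/derivable_mxP => i j.
  rewrite (_ : (fun x => _) = (fun x => if j == 0 then vx (phi x) else
     if j == 1 then vy (phi x) else vz (phi x))).
    by case: (j == 0); [exact: d1|case: (j == 1); [exact: d2|exact: d3]].
  by apply/funext => x; rewrite mxE.
split=> //; rewrite derive_mx//; apply/matrixP => i j; rewrite !mxE.
rewrite (_ : (fun x => _) = (fun x => if j == 0 then vx (phi x) else
     if j == 1 then vy (phi x) else vz (phi x))).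
  by case: (j == 0); [exact: e1|case: (j == 1); [exact: e2|exact: e3]].
by apply/funext => x; rewrite mxE.
Qed.

Lemma is_derive_within (W : normedModType R) (F : R -> W) (A : set R) (u : R) d :
  is_derive u 1 F d -> (w - u)^-1 *: (F w - F u) @[w --> within A u^'] --> d.
Proof.
move=> [/cvg_ex[l dF] e]; have lE : l = d by rewrite -e; apply/esym/cvg_lim.
apply/cvgrPdist_lt => r r0; move: dF; rewrite lE => /cvgrPdist_lt/(_ r r0).
rewrite !near_withinE => /nbhs_ballP[s s0 sF]; apply/nbhs_ballP; exists s => // w.
rewrite -ball_normE /= => us wu _; have := sF (w - u).
rewrite -ball_normE /= sub0r opprB [_ *: 1]mulr1 subrK; apply=> //.
by rewrite subr_eq0.
Qed.

Lemma mkC1_pair a phi : vwithin phi ->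
  C1pair (mkC1 a phi) = (mkC0 (fun u => vadd a (vprim phi u)), mkC0 phi).
Proof.
move=> cphi; rewrite /mkC1 /insubd insubT //= inE => u iu /=.
have dp s (si : itv01 s) := vder_addl a (vprim_der cphi si).
have cp := vder_within dp.
rewrite (mkC0E cphi iu); apply: cvg_trans (is_derive_within itv01 (rowv_is_derive (dp u iu))).
apply: near_eq_cvg; rewrite near_withinE; apply: nearW => w iw.
by rewrite !mkC0E.
Qed.

Lemma mkC1E a phi u : vwithin phi -> itv01 u -> mkC1 a phi u = rowv (vadd a (vprim phi u)).
Proof.
move=> cphi iu; rewrite /C1fun mkC1_pair//= mkC0E//.
by apply: vder_within => s si; exact: vder_addl (vprim_der cphi si).
Qed.

Lemma mkC1_velocity a phi u : vwithin phi -> itv01 u -> velocity (mkC1 a phi) u = rowv (phi u).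
Proof. by move=> cphi iu; rewrite /velocity mkC1_pair//= mkC0E. Qed.

Lemma vprim_unique phi psi a : (forall u, itv01 u -> vder psi u (phi u)) -> vwithin phi ->
  psi 0 = a -> forall u, itv01 u -> vadd a (vprim phi u) = psi u.
Proof.
move=> dpsi [c1 c2 c3] <- u iu; rewrite /vprim /vadd /=.
have h (f : vec R -> R) : (forall s, itv01 s -> is_derive s 1 (fun w => f (psi w)) (f (phi s))) ->
    {within itv01, continuous (fun s => f (phi s))} ->
    f (psi 0) + prim (fun s => f (phi s)) u = f (psi u).
  by move=> df cf; rewrite (prim_unique cf df iu) addrC subrK.
rewrite [RHS](_ : _ = V3 (vx (psi u)) (vy (psi u)) (vz (psi u))); last by case: (psi u).
by apply: V3_eq; apply: h => // s si; case: (dpsi s si).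
Qed.

End PathSpaces.

Section C1Builder.
Context {R : realType} {W : normedModType R}.

Lemma C0_exists (g : R -> W) : {within itv01, continuous g} ->
  exists f : C0 W, forall u, itv01 u -> f u = g u.
Proof.
move=> cg; pose h u := if `[< itv01 u >] then g u else 0.
have hP : h \in @C0path R W.
  rewrite inE; split; last by move=> w nw; rewrite /h; case: asboolP.
  have := cg; apply: subspace_eq_continuous => w /set_mem iw.
  by rewrite /from_subspace /h; case: asboolP.
by exists (MkC0 hP) => u iu /=; rewrite /h; case: asboolP.
Qed.

Lemma C1_exists (g g' : R -> W) : {within itv01, continuous g'} ->
  (forall u, itv01 u -> is_derive u 1 g (g' u)) ->
  exists X : C1 W, forall u, itv01 u -> X u = g u /\ velocity X u = g' u.
Proof.
move=> cg' dg; have [f' f'E] := C0_exists cg'.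
have cg : {within itv01, continuous g}.
  apply: continuous_in_subspaceT => u; rewrite inE => iu.
  by have [/derivable1_diffP/differentiable_continuous] := dg u iu.
have [f fE] := C0_exists cg.
have fP : (f, f') \in @C1path R W.
  rewrite inE => u iu /=; rewrite (f'E u iu).
  apply: cvg_trans (is_derive_within itv01 (dg u iu)).
  apply: near_eq_cvg; rewrite near_withinE; apply: nearW => w iw.
  by rewrite !fE.
by exists (MkC1 fP) => u iu; split; [exact: fE|exact: f'E].
Qed.

Lemma quadratic_is_derive (g : R -> W) (d : W) (t r K : R) : 0 < r ->
  (forall s, `|s - t| < r -> `|g s - g t - (s - t) *: d| <= K * `|s - t| ^+ 2) ->
  is_derive t 1 g d.
Proof.
move=> r0 gK.
have lim : h^-1 *: ((g \o shift t) (h *: 1) - g t) @[h --> 0^'] --> d.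
  apply/cvgrPdist_le => e e0; rewrite near_withinE; apply/nbhs_ballP.
  have K1 : 0 < `|K| + 1 by rewrite ltr_wpDl.
  exists (Num.min r (e / (`|K| + 1))); first by rewrite /= lt_min r0 divr_gt0.
  move=> h; rewrite -ball_normE /= sub0r normrN lt_min ltr_pdivlMr// => /andP[hr he] h0.
  have := gK (h + t); rewrite addrK => /(_ hr).
  rewrite [h *: 1]mulr1; have h0' : 0 < `|h| by rewrite normr_gt0.
  have -> : d - h^-1 *: (g (h + t) - g t) = - (h^-1 *: (g (h + t) - g t - h *: d)).
    have E (a : R) (x y : W) : a != 0 -> y - a^-1 *: x = - (a^-1 *: (x - a *: y)).
      by move=> a0; rewrite scalerBr scalerA mulVf// scale1r opprB.
    exact: E.
  rewrite normrN normrZ normfV ler_pdivrMl// => /le_trans; apply.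
  rewrite expr2 mulrA [leRHS]mulrC ler_wpM2r//.
  apply: le_trans (ltW he); rewrite mulrC ler_wpM2l//.
  by rewrite (le_trans (ler_norm _))// lerDl.
by split; [apply/cvg_ex; exists d|exact: cvg_lim lim].
Qed.

Lemma lipschitz_within (g : R -> W) :
  (forall t, itv01 t -> exists r K : R, 0 < r /\
    forall s, `|s - t| < r -> `|g s - g t| <= K * `|s - t|) ->
  {within itv01, continuous g}.
Proof.
move=> gK; apply: continuous_in_subspaceT => t; rewrite inE => /gK[r [K [r0 rK]]].
apply/cvgrPdist_le => e e0; apply/nbhs_ballP.
have K1 : 0 < `|K| + 1 by rewrite ltr_wpDl.
exists (Num.min r (e / (`|K| + 1))); first by rewrite /= lt_min r0 divr_gt0.
move=> s /=; rewrite distrC lt_min ltr_pdivlMr// => /andP[sr se].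
rewrite distrC (le_trans (rK _ sr))//; apply: le_trans (ltW se); rewrite mulrC ler_wpM2l//.
by rewrite (le_trans (ler_norm _))// lerDl.
Qed.

End C1Builder.

(** * The Banach space of configurations *)

Section FieldAtoms.
Context {R : realType}.
Local Notation Fld := (@fields R 3).
Implicit Types p q : Fld.

Lemma fields_norm_ge p u : itv01 u ->
  [/\ `|p.1 u| <= `|p|, `|velocity p.1 u| <= `|p| & `|p.2 u| <= `|p|].
Proof.
move=> iu; have e : `|p| = Num.max `|p.1| `|p.2| by rewrite prod_normE.
have e1 : `|p.1| = Num.max `|(C1pair p.1).1| `|(C1pair p.1).2|.
  by rewrite -[LHS]/(C1norm p.1) /C1norm prod_normE.
split; rewrite e le_max.
- by rewrite e1 !le_max (C0norm_ub (C1pair p.1).1 iu).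
- by rewrite e1 !le_max (C0norm_ub (C1pair p.1).2 iu) orbT.
- by rewrite (C0norm_ub p.2 iu) orbT.
Qed.

Lemma fields_norm_le p (K : R) :
  (forall u, itv01 u -> [/\ `|p.1 u| <= K, `|velocity p.1 u| <= K & `|p.2 u| <= K]) ->
  `|p| <= K.
Proof.
move=> pK; have -> : `|p| = Num.max `|p.1| `|p.2| by rewrite prod_normE.
have -> : `|p.1| = Num.max `|(C1pair p.1).1| `|(C1pair p.1).2|.
  by rewrite -[LHS]/(C1norm p.1) /C1norm prod_normE.
by rewrite !ge_max; apply/andP; split; first (apply/andP; split);
  apply: C0norm_le => u /pK[].
Qed.

Definition fpos p u : vec R := vrow (p.1 u).
Definition fvel p u : vec R := vrow (velocity p.1 u).
Definition feta p u : vec R := vrow (p.2 u).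

Lemma row_atom (F : Fld -> R -> 'rV[R]_3) i :
  (forall a p q u, itv01 u -> F (a *: p + q) u = a *: F p u + F q u) ->
  (forall p u, itv01 u -> `|F p u| <= `|p|) ->
  (forall p, {within itv01, continuous (F p)}) ->
  linear_atom (fun p u => F p u 0 i).
Proof.
move=> Fl Fb Fc; split.
- by move=> a p q u iu; rewrite Fl// !mxE.
- exists 1 => // p u iu; rewrite mul1r; apply: le_trans (Fb p u iu).
  exact: row_norm_coord.
- move=> p x; have := Fc p x => cF.
  exact: (cvg_comp _ _ cF (@coord_continuous _ _ _ _ _ _)).
Qed.

Lemma C0_lin (a : R) (f g : C0 'rV[R]_3) u : (a *: f + g) u = a *: f u + g u.
Proof. by []. Qed.

Lemma C1_lin (a : R) (X Y : C1 'rV[R]_3) u : (a *: X + Y) u = a *: X u + Y u.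
Proof. by []. Qed.

Lemma velocity_lin (a : R) (X Y : C1 'rV[R]_3) u :
  velocity (a *: X + Y) u = a *: velocity X u + velocity Y u.
Proof. by []. Qed.

Lemma atom_pos i : linear_atom (fun p u => p.1 u 0 i).
Proof.
apply: (@row_atom (fun p u => p.1 u)).
- by move=> a p q u _; exact: (C1_lin a p.1 q.1 u).
- by move=> p u iu; have [] := fields_norm_ge p iu.
- by move=> p; exact: (@C0_within _ (C1pair p.1).1).
Qed.

Lemma atom_vel i : linear_atom (fun p u => velocity p.1 u 0 i).
Proof.
apply: (@row_atom (fun p u => velocity p.1 u)).
- by move=> a p q u _; exact: (velocity_lin a p.1 q.1 u).
- by move=> p u iu; have [] := fields_norm_ge p iu.
- by move=> p; exact: (@C0_within _ (C1pair p.1).2).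
Qed.

Lemma atom_eta i : linear_atom (fun p u => p.2 u 0 i).
Proof.
apply: (@row_atom (fun p u => p.2 u)).
- by move=> a p q u _; exact: (C0_lin a p.2 q.2 u).
- by move=> p u iu; have [] := fields_norm_ge p iu.
- by move=> p; exact: (@C0_within _ p.2).
Qed.

Lemma atom_at (F : Fld -> R -> R) w : itv01 w -> linear_atom F ->
  linear_atom (fun p _ => F p w).
Proof.
move=> iw [Fl [K K0 Fb] Fc]; split.
- by move=> a p q u _; exact: Fl.
- by exists K => // p u _; exact: Fb.
- by move=> p; exact: within01_cst.
Qed.

Lemma fpos_within p : vwithin (fpos p).
Proof.
by split; [exact: (atom_within (atom_pos 0))|exact: (atom_within (atom_pos 1))
  |exact: (atom_within (atom_pos 2))].
Qed.

Lemma fvel_within p : vwithin (fvel p).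
Proof.
by split; [exact: (atom_within (atom_vel 0))|exact: (atom_within (atom_vel 1))
  |exact: (atom_within (atom_vel 2))].
Qed.

Lemma feta_within p : vwithin (feta p).
Proof.
by split; [exact: (atom_within (atom_eta 0))|exact: (atom_within (atom_eta 1))
  |exact: (atom_within (atom_eta 2))].
Qed.

Lemma atom_is_derive (L : Fld -> R -> R) (gamma : R -> Fld) (t : R) d u :
  linear_atom L -> is_derive t 1 gamma d -> itv01 u ->
  is_derive t 1 (fun s => L (gamma s) u) (L d u).
Proof.
move=> La dgam iu.
have := @cls0_chain _ _ setT 0%N (fun p _ => L p) (fun _ v => L (v 0%N)) gamma t d (fun=> 0) u.
rewrite updE; apply=> //; last exact: loc_deriv_atom.
by apply: (cls_cls0 (n := 0)); apply: cls_atom1 => //; exact: openT.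
Qed.

Lemma fpos_vder (gamma : R -> Fld) (t : R) d u : is_derive t 1 gamma d -> itv01 u ->
  vder (fun s => fpos (gamma s) u) t (fpos d u).
Proof.
by move=> dg iu; split; [exact: (atom_is_derive (atom_pos 0))
  |exact: (atom_is_derive (atom_pos 1))|exact: (atom_is_derive (atom_pos 2))].
Qed.

Lemma feta_vder (gamma : R -> Fld) (t : R) d u : is_derive t 1 gamma d -> itv01 u ->
  vder (fun s => feta (gamma s) u) t (feta d u).
Proof.
by move=> dg iu; split; [exact: (atom_is_derive (atom_eta 0))
  |exact: (atom_is_derive (atom_eta 1))|exact: (atom_is_derive (atom_eta 2))].
Qed.

(* The extension [fext p] of [fpos p] has two-sided derivatives at 0 and 1. *)
Definition fext p (u : R) : vec R :=
  vrow (p.1 (clamp u) + (u - clamp u) *: velocity p.1 (clamp u)).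

Lemma fextE p u : itv01 u -> fext p u = fpos p u.
Proof. by move=> iu; rewrite /fext clamp_id// subrr scale0r addr0. Qed.

Lemma row_is_derive (M : R -> 'rV[R]_3) (t : R) d : is_derive t 1 M d ->
  vder (fun s => vrow (M s)) t (vrow d).
Proof.
move=> [dM <-]; rewrite derive_mx//; have h i := (derivable_mxP M t 1).1 dM 0 i.
by split; rewrite /= mxE; exact: derivableP.
Qed.

Lemma fext_vder p u : itv01 u -> vder (fext p) u (fvel p u).
Proof. by move=> iu; apply: row_is_derive; exact: C1_ext_is_derive. Qed.

Definition mkF (a : vec R) (dphi psi : R -> vec R) : Fld := (mkC1 a dphi, mkC0 psi).

Lemma mkF_eta a dphi psi u : vwithin psi -> itv01 u -> feta (mkF a dphi psi) u = psi u.
Proof. by move=> c iu; rewrite /feta /= mkC0E// rowvK. Qed.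

Lemma mkF_pos a dphi psi u : vwithin dphi -> itv01 u ->
  fpos (mkF a dphi psi) u = vadd a (vprim dphi u).
Proof. by move=> c iu; rewrite /fpos /= mkC1E// rowvK. Qed.

Lemma mkF_vel a dphi psi u : vwithin dphi -> itv01 u -> fvel (mkF a dphi psi) u = dphi u.
Proof. by move=> c iu; rewrite /fvel /= mkC1_velocity// rowvK. Qed.

Lemma fields_eq p q : (forall u, itv01 u -> fpos p u = fpos q u) ->
  (forall u, itv01 u -> fvel p u = fvel q u) ->
  (forall u, itv01 u -> feta p u = feta q u) -> p = q.
Proof.
move=> h1 h2 h3; rewrite [LHS]surjective_pairing [RHS]surjective_pairing; congr (_, _).
  by apply: C1_eq => u iu; apply: (can_inj vrowK); [exact: h1|exact: h2].
by apply: C0_eq => u iu; apply: (can_inj vrowK); exact: h3.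
Qed.

Lemma within_eq (f g : R -> R) : (forall u, itv01 u -> f u = g u) ->
  {within itv01, continuous f} -> {within itv01, continuous g}.
Proof.
move=> fg; apply: subspace_eq_continuous => u /set_mem iu.
by rewrite /from_subspace fg.
Qed.

(* A one-parameter family of configurations, given by the family [Phi0] of
   starting points (evaluated at [u = 0]), the velocities [dPhi] and the
   one-forms [Psi]. *)
Section Curves.
Variable T : set R.
Hypothesis oT : open T.
Variables (Phi0 dPhi Psi : @vfamily R R).
Hypothesis Phi0_cls : vcls T 2 [::] Phi0.
Hypothesis dPhi_cls : vcls T 2 [::] dPhi.
Hypothesis Psi_cls : vcls T 2 [::] Psi.

Let v0 : nat -> R := fun=> 0.
Let e0 : nat -> R := upd v0 0%N 1.

Definition family_curve (t : R) : Fld := mkF (Phi0 t v0 0) (dPhi t v0) (Psi t v0).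

Lemma vcls_deriv n (H : @vfamily R R) : vcls T n.+1 [::] H ->
  exists2 H', vcls T n [:: 0%N] H' & forall t, T t -> vloc_deriv 0%N H H' t.
Proof.
move=> [h1 h2 h3].
have [G1 g1 dg1] := cls_deriv h1 (isT : 0%N \notin [::]).
have [G2 g2 dg2] := cls_deriv h2 (isT : 0%N \notin [::]).
have [G3 g3 dg3] := cls_deriv h3 (isT : 0%N \notin [::]).
exists (fun x v u => V3 (G1 x v u) (G2 x v u) (G3 x v u)); first by split.
by move=> t Tt; split; [exact: dg1|exact: dg2|exact: dg3].
Qed.

Lemma vcls_quadratic (H H' : @vfamily R R) t : T t -> vcls T 0 [:: 0%N] H' ->
  vloc_deriv 0%N H H' t ->
  exists r K : R, [/\ 0 < r, 0 <= K & forall s, `|s - t| < r -> forall u, itv01 u ->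
    vle (vadd (vadd (H s v0 u) (vscale (-1) (H t v0 u))) (vscale (- (s - t)) (H' t e0 u)))
      (K * `|s - t| ^+ 2)].
Proof.
move=> Tt [h1 h2 h3] [[r1 [K1 [r10 K10 d1]]] [r2 [K2 [r20 K20 d2]]] [r3 [K3 [r30 K30 d3]]]].
exists (Num.min r1 (Num.min r2 r3)), (K1 + K2 + K3).
split; [by rewrite !lt_min r10 r20 r30|by rewrite !addr_ge0|].
move=> s; rewrite !lt_min => /and3P[s1 s2 s3] u iu.
have sc (G : @mfamily R R) : cls T 0 [:: 0%N] G ->
    G t (upd v0 0%N (s - t)) u = (s - t) * G t e0 u.
  move=> /cls_cls0 Gc; have := cls_linear Gc v0 (s - t) 1 0 Tt iu (mem_head _ _).
  rewrite [_ *: _]mulr1 addr0 => ->.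
  have := cls_linear Gc v0 0 0 0 Tt iu (mem_head _ _); rewrite scale0r mul0r !add0r.
  have -> : G t (upd v0 0%N 0) u = 0.
    have := cls_linear Gc v0 (-1) 0 0 Tt iu (mem_head _ _).
    by rewrite scaler0 addr0 mulN1r addNr.
  by rewrite addr0.
have le (K : R) : 0 <= K -> K <= K1 + K2 + K3 -> K * `|s - t| ^+ 2 <= (K1 + K2 + K3) * `|s - t| ^+ 2.
  by move=> _ KK; rewrite ler_wpM2r// exprn_ge0.
split; rewrite /= mulN1r mulNr.
- have := d1 t s; rewrite subrr normr0 => /(_ r10 s1 v0 u iu).
  rewrite /pnorm big_nil mulr1 (sc _ h1) => /le_trans; apply; apply: le => //.
  by rewrite -addrA lerDl addr_ge0.
- have := d2 t s; rewrite subrr normr0 => /(_ r20 s2 v0 u iu).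
  rewrite /pnorm big_nil mulr1 (sc _ h2) => /le_trans; apply; apply: le => //.
  by rewrite addrAC lerDr addr_ge0.
- have := d3 t s; rewrite subrr normr0 => /(_ r30 s3 v0 u iu).
  rewrite /pnorm big_nil mulr1 (sc _ h3) => /le_trans; apply; apply: le => //.
  by rewrite lerDr addr_ge0.
Qed.

Lemma vcls_lipschitz (H : @vfamily R R) J t v : T t -> vcls T 1 J H ->
  exists r K : R, [/\ 0 < r, 0 <= K & forall s, `|s - t| < r -> forall u, itv01 u ->
    vle (vadd (H s v u) (vscale (-1) (H t v u))) (K * `|s - t|)].
Proof.
move=> Tt [h1 h2 h3].
have [r1 [K1 [r10 K10 d1]]] := cls_lipschitz h1 Tt.
have [r2 [K2 [r20 K20 d2]]] := cls_lipschitz h2 Tt.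
have [r3 [K3 [r30 K30 d3]]] := cls_lipschitz h3 Tt.
have p0 := pnorm_ge0 v J.
exists (Num.min r1 (Num.min r2 r3)), ((K1 + K2 + K3) * pnorm v J).
split; [by rewrite !lt_min r10 r20 r30|by rewrite mulr_ge0// !addr_ge0|].
move=> s; rewrite !lt_min => /and3P[s1 s2 s3] u iu.
have le (K : R) : K <= K1 + K2 + K3 ->
    K * `|s - t| * pnorm v J <= (K1 + K2 + K3) * pnorm v J * `|s - t|.
  by move=> KK; rewrite mulrAC ler_wpM2r// ler_wpM2r.
split; rewrite /= mulN1r.
- have := d1 t s; rewrite subrr normr0 => /(_ r10 s1 v u iu) /le_trans; apply; apply: le.
  by rewrite -addrA lerDl addr_ge0.
- have := d2 t s; rewrite subrr normr0 => /(_ r20 s2 v u iu) /le_trans; apply; apply: le.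
  by rewrite addrAC lerDr addr_ge0.
- have := d3 t s; rewrite subrr normr0 => /(_ r30 s3 v u iu) /le_trans; apply; apply: le.
  by rewrite lerDr addr_ge0.
Qed.

(** The factor 2 arises because the position is bounded by the start plus the integral of the
    velocity. *)
Lemma fields_vle (p : Fld) a dphi psi (K : R) : vwithin dphi -> vwithin psi ->
  (forall u, itv01 u -> fpos p u = vadd a (vprim dphi u)) ->
  (forall u, itv01 u -> fvel p u = dphi u) ->
  (forall u, itv01 u -> feta p u = psi u) ->
  vle a K -> (forall u, itv01 u -> vle (dphi u) K) -> (forall u, itv01 u -> vle (psi u) K) ->
  `|p| <= 2 * K.
Proof.
move=> [c1 c2 c3] cpsi pE vE eE [a1 a2 a3] dK psiK.
have K0 : 0 <= K by exact: le_trans a1.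
apply: fields_norm_le => u iu; split.
- rewrite -[p.1 u]vrowK -/(fpos p u) pE//; apply: rowv_le.
  have h (x y : R) : `|x| <= K -> `|y| <= K -> `|x + y| <= 2 * K.
    by move=> xK yK; rewrite (le_trans (ler_normD _ _))// mulr_natl mulr2n lerD.
  by split; apply: h => //; apply: prim_le => // s /dK[].
- rewrite -[velocity p.1 u]vrowK -/(fvel p u) vE//; apply: rowv_le.
  by have [? ? ?] := dK u iu; split; rewrite mulr_natl mulr2n ler_wpDr.
- rewrite -[p.2 u]vrowK -/(feta p u) eE//; apply: rowv_le.
  by have [? ? ?] := psiK u iu; split; rewrite mulr_natl mulr2n ler_wpDr.
Qed.

Lemma vwithin_comb (f g : R -> vec R) c : vwithin f -> vwithin g ->
  vwithin (fun u => vadd (f u) (vscale c (g u))).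
Proof.
move=> [f1 f2 f3] [g1 g2 g3].
by split; apply: within01D => //; apply: within01M => //; exact: within01_cst.
Qed.

Lemma vprim_comb (f g : R -> vec R) c u : vwithin f -> vwithin g -> itv01 u ->
  vprim (fun u => vadd (f u) (vscale c (g u))) u = vadd (vprim f u) (vscale c (vprim g u)).
Proof.
move=> [f1 f2 f3] [g1 g2 g3] iu; apply: V3_eq; rewrite /= primD ?primZ//;
  by apply: within01M => //; exact: within01_cst.
Qed.

Lemma vrow_comb (x y : 'rV[R]_3) c : vrow (x + c *: y) = vadd (vrow x) (vscale c (vrow y)).
Proof. by rewrite /vrow !mxE. Qed.

Lemma fields_comb (p q : Fld) c u :
  [/\ fpos (p + c *: q) u = vadd (fpos p u) (vscale c (fpos q u)),
     fvel (p + c *: q) u = vadd (fvel p u) (vscale c (fvel q u))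
   & feta (p + c *: q) u = vadd (feta p u) (vscale c (feta q u))].
Proof.
rewrite [p + _]addrC; split.
- have e : (c *: q + p).1 u = c *: q.1 u + p.1 u := C1_lin c q.1 p.1 u.
  by rewrite /fpos e addrC vrow_comb.
- have e : velocity (c *: q + p).1 u = c *: velocity q.1 u + velocity p.1 u :=
    velocity_lin c q.1 p.1 u.
  by rewrite /fvel e addrC vrow_comb.
- have e : (c *: q + p).2 u = c *: q.2 u + p.2 u := C0_lin c q.2 p.2 u.
  by rewrite /feta e addrC vrow_comb.
Qed.

(** This is what order two of the families is for: first derivatives with quadratic remainders give
    the velocity in the norm of [fields], and one more derivative makes that velocity locally
    Lipschitz. *)
Lemma family_curve_C1 : exists2 dg : R -> Fld,
  (forall t, T t -> is_derive t 1 family_curve (dg t)) &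
  (forall t, T t -> exists r K : R, 0 < r /\
    forall s, `|s - t| < r -> `|dg s - dg t| <= K * `|s - t|).
Proof.
have [A cA dA] := vcls_deriv Phi0_cls; have [B cB dB] := vcls_deriv dPhi_cls.
have [C cC dC] := vcls_deriv Psi_cls.
have low n J H : vcls T n J H -> vcls T 0 J H.
  by case=> h1 h2 h3; split; [exact: cls_leq h1|exact: cls_leq h2|exact: cls_leq h3].
have TN t : T t -> exists2 r : R, 0 < r & forall s, `|s - t| < r -> T s.
  move=> Tt; have /nbhs_ballP[r r0 rT] := open_nbhs_nbhs (conj oT Tt).
  by exists r => // s sr; apply: rT; rewrite -ball_normE /= distrC.
have wB t v : T t -> vwithin (dPhi t v) := vcls_vwithin v dPhi_cls.
have wC t v : T t -> vwithin (Psi t v) := vcls_vwithin v Psi_cls.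
have wB' t v : T t -> vwithin (B t v) := vcls_vwithin v cB.
have wC' t v : T t -> vwithin (C t v) := vcls_vwithin v cC.
have i0 : itv01 (0 : R) := itv01_0.
exists (fun t => mkF (A t e0 0) (B t e0) (C t e0)).
  move=> t Tt; have [r4 r40 r4T] := TN t Tt.
  have [r1 [K1 [r10 K10 q1]]] := vcls_quadratic Tt (low _ _ _ cA) (dA t Tt).
  have [r2 [K2 [r20 K20 q2]]] := vcls_quadratic Tt (low _ _ _ cB) (dB t Tt).
  have [r3 [K3 [r30 K30 q3]]] := vcls_quadratic Tt (low _ _ _ cC) (dC t Tt).
  apply: (@quadratic_is_derive _ _ _ _ _ (Num.min (Num.min r1 r2) (Num.min r3 r4))
     (2 * (K1 + K2 + K3))).
    by rewrite !lt_min r10 r20 r30.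
  move=> s; rewrite !lt_min => /andP[/andP[s1 s2] /andP[s3 s4]].
  have Ts := r4T s s4.
  have le (K : R) a : K <= K1 + K2 + K3 -> vle a (K * `|s - t| ^+ 2) ->
      vle a ((K1 + K2 + K3) * `|s - t| ^+ 2).
    move=> KK [? ? ?]; have h : K * `|s - t| ^+ 2 <= (K1 + K2 + K3) * `|s - t| ^+ 2.
      by rewrite ler_wpM2r// exprn_ge0.
    by split; exact: le_trans h.
  have -> : family_curve s - family_curve t - (s - t) *: mkF (A t e0 0) (B t e0) (C t e0) =
     (family_curve s + (-1) *: family_curve t) + (- (s - t)) *: mkF (A t e0 0) (B t e0) (C t e0).
    by rewrite scaleN1r scaleNr.
  rewrite -mulrA.
  apply: (fields_vle (a := vadd (vadd (Phi0 s v0 0) (vscale (-1) (Phi0 t v0 0)))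
            (vscale (- (s - t)) (A t e0 0)))
         (dphi := fun u => vadd (vadd (dPhi s v0 u) (vscale (-1) (dPhi t v0 u)))
            (vscale (- (s - t)) (B t e0 u)))
         (psi := fun u => vadd (vadd (Psi s v0 u) (vscale (-1) (Psi t v0 u)))
            (vscale (- (s - t)) (C t e0 u)))).
  - by apply: vwithin_comb; [apply: vwithin_comb|]; [exact: wB|exact: wB|exact: wB'].
  - by apply: vwithin_comb; [apply: vwithin_comb|]; [exact: wC|exact: wC|exact: wC'].
  - move=> u iu; have [-> _ _] := fields_comb (family_curve s + (-1) *: family_curve t)
      (mkF (A t e0 0) (B t e0) (C t e0)) (- (s - t)) u.
    have [-> _ _] := fields_comb (family_curve s) (family_curve t) (-1) u.
    rewrite (mkF_pos _ _ (wB s v0 Ts) iu) (mkF_pos _ _ (wB t v0 Tt) iu).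
    rewrite (mkF_pos _ _ (wB' t e0 Tt) iu).
    rewrite (vprim_comb _ (vwithin_comb _ (wB s v0 Ts) (wB t v0 Tt)) (wB' t e0 Tt) iu).
    rewrite (vprim_comb _ (wB s v0 Ts) (wB t v0 Tt) iu).
    by rewrite /vadd /vscale; apply: V3_eq; rewrite /=; ring.
  - move=> u iu; have [_ -> _] := fields_comb (family_curve s + (-1) *: family_curve t)
      (mkF (A t e0 0) (B t e0) (C t e0)) (- (s - t)) u.
    have [_ -> _] := fields_comb (family_curve s) (family_curve t) (-1) u.
    by rewrite (mkF_vel _ _ (wB s v0 Ts) iu) (mkF_vel _ _ (wB t v0 Tt) iu)
      (mkF_vel _ _ (wB' t e0 Tt) iu).
  - move=> u iu; have [_ _ ->] := fields_comb (family_curve s + (-1) *: family_curve t)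
      (mkF (A t e0 0) (B t e0) (C t e0)) (- (s - t)) u.
    have [_ _ ->] := fields_comb (family_curve s) (family_curve t) (-1) u.
    by rewrite (mkF_eta _ _ (wC s v0 Ts) iu) (mkF_eta _ _ (wC t v0 Tt) iu)
      (mkF_eta _ _ (wC' t e0 Tt) iu).
  - by apply: (le K1); [rewrite -addrA lerDl addr_ge0|exact: q1].
  - by move=> u iu; apply: (le K2); [rewrite addrAC lerDr addr_ge0|exact: q2].
  - by move=> u iu; apply: (le K3); [rewrite lerDr addr_ge0|exact: q3].
move=> t Tt; have [r4 r40 r4T] := TN t Tt.
have [r1 [K1 [r10 K10 q1]]] := vcls_lipschitz e0 Tt cA.
have [r2 [K2 [r20 K20 q2]]] := vcls_lipschitz e0 Tt cB.
have [r3 [K3 [r30 K30 q3]]] := vcls_lipschitz e0 Tt cC.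
exists (Num.min (Num.min r1 r2) (Num.min r3 r4)), (2 * (K1 + K2 + K3)); split.
  by rewrite !lt_min r10 r20 r30.
move=> s; rewrite !lt_min => /andP[/andP[s1 s2] /andP[s3 s4]].
have Ts := r4T s s4.
have le (K : R) a : K <= K1 + K2 + K3 -> vle a (K * `|s - t|) ->
    vle a ((K1 + K2 + K3) * `|s - t|).
  move=> KK [? ? ?]; have h : K * `|s - t| <= (K1 + K2 + K3) * `|s - t|.
    by rewrite ler_wpM2r.
  by split; exact: le_trans h.
rewrite -scaleN1r -mulrA.
apply: (fields_vle (a := vadd (A s e0 0) (vscale (-1) (A t e0 0)))
       (dphi := fun u => vadd (B s e0 u) (vscale (-1) (B t e0 u)))
       (psi := fun u => vadd (C s e0 u) (vscale (-1) (C t e0 u)))).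
- by apply: vwithin_comb; exact: wB'.
- by apply: vwithin_comb; exact: wC'.
- move=> u iu; have [-> _ _] := fields_comb (mkF (A s e0 0) (B s e0) (C s e0))
    (mkF (A t e0 0) (B t e0) (C t e0)) (-1) u.
  rewrite (mkF_pos _ _ (wB' s e0 Ts) iu) (mkF_pos _ _ (wB' t e0 Tt) iu).
  rewrite (vprim_comb _ (wB' s e0 Ts) (wB' t e0 Tt) iu).
  by rewrite /vadd /vscale; apply: V3_eq; rewrite /=; ring.
- move=> u iu; have [_ -> _] := fields_comb (mkF (A s e0 0) (B s e0) (C s e0))
    (mkF (A t e0 0) (B t e0) (C t e0)) (-1) u.
  by rewrite (mkF_vel _ _ (wB' s e0 Ts) iu) (mkF_vel _ _ (wB' t e0 Tt) iu).
- move=> u iu; have [_ _ ->] := fields_comb (mkF (A s e0 0) (B s e0) (C s e0))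
    (mkF (A t e0 0) (B t e0) (C t e0)) (-1) u.
  by rewrite (mkF_eta _ _ (wC' s e0 Ts) iu) (mkF_eta _ _ (wC' t e0 Tt) iu).
- by apply: (le K1); [rewrite -addrA lerDl addr_ge0|exact: q1].
- by move=> u iu; apply: (le K2); [rewrite addrAC lerDr addr_ge0|exact: q2].
- by move=> u iu; apply: (le K3); [rewrite lerDr addr_ge0|exact: q3].
Qed.

Lemma family_curve_path : (forall t, itv01 t -> T t) -> exists Gam : C1 Fld,
  forall t, itv01 t -> Gam t = family_curve t /\
    is_derive t 1 family_curve (velocity Gam t).
Proof.
move=> TI; have [dg dgP dgL] := family_curve_C1.
have cdg : {within itv01, continuous dg}.
  by apply: lipschitz_within => t /TI /dgL[r [K [r0 rK]]]; exists r, K.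
have [Gam GamE] := C1_exists cdg (fun t it => dgP t (TI t it)).
exists Gam => t it; have [e1 e2] := GamE t it.
by split; [exact: e1|rewrite e2; exact: dgP (TI t it)].
Qed.

End Curves.

(** Writing G t u as G t 0 plus the integral of dG t and differentiating under the integral, one
    gets the symmetry of the mixed derivatives from first derivatives of [G] and [dG]. The gauge
    parameter of a family of configurations is such a t-derivative and must be C^1 in u. *)
Lemma mixed_partials (T : set R) (G dG : @mfamily R R) : let v0 := fun=> 0 in
  open T -> cls T 1 [::] G -> cls T 1 [::] dG -> (forall t, T t -> der01 (G t v0) (dG t v0)) ->
  forall t, T t -> exists gt gtu : R -> R, {within itv01, continuous gtu} /\
    forall u, itv01 u -> [/\ is_derive t 1 (fun s => G s v0 u) (gt u),
      is_derive u 1 gt (gtu u) & is_derive t 1 (fun s => dG s v0 u) (gtu u)].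
Proof.
move=> v0 oT Gc dGc dGu t Tt.
have [A cA dA] := cls_deriv Gc (isT : 0%N \notin [::]).
have [B cB dB] := cls_deriv dGc (isT : 0%N \notin [::]).
pose e := upd v0 0%N (1 : R).
have i0 : itv01 (0 : R) := itv01_0.
have idd : is_derive t 1 (fun s : R => s) 1 := dv_id t.
have cB0 : {within itv01, continuous (B t e)} by exact: (cls_within (cls_cls0 cB)).
exists (fun u => A t e 0 + prim (B t e) u), (B t e); split=> // u iu; split.
- have d0 := cls0_chain v0 (cls_cls0 cA) Tt i0 (dA t Tt) idd.
  have dp := cls0_chain v0 (cls0_prim (cls_cls0 cB)) Tt iu
    (loc_deriv_prim (cls_cls0 dGc) (cls_cls0 cB) Tt (dB t Tt)) idd.
  apply: (near_eq_is_derive _ (dv_add d0 dp)).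
  apply: filterS (open_nbhs_nbhs (conj oT Tt)) => s Ts.
  by rewrite (prim_unique (cls_within (cls_cls0 dGc) Ts) (dGu s Ts) iu) addrC subrK.
- by refine (dv_eq (dv_add (dv_cst _ _) (prim_der cB0 iu)) (add0r _)).
- exact (cls0_chain v0 (cls_cls0 cB) Tt iu (dB t Tt) idd).
Qed.

End FieldAtoms.

(** * Reciprocals and products of smooth families *)

Section Reciprocal.
Context {R : realType} {E : normedModType R}.
Variable U : set E.
Hypothesis oU : open U.
Implicit Types (G : @mfamily R E) (P Q : @qfamily R E).

Definition inv_tower (k : nat) (s : R) : R := (-1) ^+ k * (k`!)%:R * (s^-1) ^+ k.+1.

Lemma inv_tower_der k (s : R) : 0 < s -> is_derive s 1 (inv_tower k) (inv_tower k.+1 s).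
Proof.
move=> s0; have s1 : s != 0 by rewrite gt_eqF.
have di := dv_inv s1 (dv_id s).
have dX : is_derive s 1 (fun x : R => (x^-1) ^+ k.+1) (k.+1%:R * (s^-1) ^+ k * (- 1 / s ^+ 2)).
  elim: k => [|k IHk].
    by rewrite expr0 !mul1r; exact: di.
  under eq_fun do rewrite exprSr.
  refine (dv_eq (dv_mul IHk di) _); rewrite (exprSr s^-1 k) -(@natr1 _ k.+1); field; exact: s1.
refine (dv_eq (dv_cmul ((-1) ^+ k * (k`!)%:R) dX) _).
rewrite /inv_tower factS natrM !exprS; field; exact: s1.
Qed.

Lemma cls_inv n G : cls U n [::] G ->
  (forall x, U x -> exists r c : R, [/\ 0 < r, 0 < c &
    forall y, `|y - x| < r -> forall v u, itv01 u -> c <= G y v u]) ->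
  cls U n [::] (fun x v u => (G x v u)^-1).
Proof.
move=> Gn Gpos.
have := @cls_comp _ _ U inv_tower [set s | 0 < s] n 0 G.
have e : (fun x v u => inv_tower 0 (G x v u)) = (fun x v u => (G x v u)^-1).
  by apply/funext => x; apply/funext => v; apply/funext => u; rewrite /inv_tower fact0 !mul1r.
rewrite e; apply=> //; first by move=> k s; exact: inv_tower_der.
move=> x Ux; have [r [c [r0 c0 rG]]] := Gpos x Ux.
have [r' [K [r'0 K0 rK]]] := cls_bounded (cls_cls0 Gn) Ux.
exists (Num.min r r'), c, K; split; first by rewrite lt_min r0.
  by move=> s /=; rewrite in_itv/= => /andP[cs _]; exact: lt_le_trans cs.
move=> y; rewrite lt_min => /andP[yr /rK[_ yK]] v u iu; rewrite rG//=.
by have := yK v u iu; rewrite /pnorm big_nil mulr1; apply: le_trans; exact: ler_norm.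
Qed.

Lemma cls_mul0 n G1 G2 : cls U n [::] G1 -> cls U n [::] G2 ->
  cls U n [::] (fun x v u => G1 x v u * G2 x v u).
Proof. by move=> c1 c2; exact: (@cls_mul _ _ _ _ [::] [::]). Qed.

Lemma cls_const n (c : R) : cls U n [::] (fun _ _ _ => c).
Proof. by apply: cls_cst => //; exact: within01_cst. Qed.

Lemma qcls_mul0 n P Q : qcls U n [::] P -> qcls U n [::] Q ->
  qcls U n [::] (fun x v u => qmul (P x v u) (Q x v u)).
Proof. by move=> c1 c2; exact: (@qcls_mul _ _ _ oU _ [::] [::]). Qed.

Lemma qcls_add n P Q : qcls U n [::] P -> qcls U n [::] Q ->
  qcls U n [::] (fun x v u => qadd (P x v u) (Q x v u)).
Proof.
by case=> p1 p2 p3 p4 [q1 q2 q3 q4]; split;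
  [exact (cls_add p1 q1)|exact (cls_add p2 q2)|exact (cls_add p3 q3)|exact (cls_add p4 q4)].
Qed.

Lemma qcls_smul n G Q : cls U n [::] G -> qcls U n [::] Q ->
  qcls U n [::] (fun x v u => qscale (G x v u) (Q x v u)).
Proof.
by move=> g [q1 q2 q3 q4]; split;
  [exact (cls_mul0 g q1)|exact (cls_mul0 g q2)|exact (cls_mul0 g q3)|exact (cls_mul0 g q4)].
Qed.

Lemma cls_qdot n P Q : qcls U n [::] P -> qcls U n [::] Q ->
  cls U n [::] (fun x v u => qdot (P x v u) (Q x v u)).
Proof.
move=> [p1 p2 p3 p4] [q1 q2 q3 q4].
exact (cls_add (cls_add (cls_add (cls_mul0 p1 q1) (cls_mul0 p2 q2)) (cls_mul0 p3 q3))
  (cls_mul0 p4 q4)).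
Qed.

Lemma qcls_cst n (q : R -> quat R) : qwithin q -> qcls U n [::] (fun _ _ => q).
Proof. by case=> c1 c2 c3 c4; split; exact: cls_cst. Qed.

End Reciprocal.

(** * Homotopies of paths on the sphere of unit quaternions *)

Section SphereHomotopy.
Context {R : realType}.
Implicit Types (p q z w : quat R).

Definition qc1 (q dq : R -> quat R) :=
  (forall u, itv01 u -> qder q u (dq u)) /\ qwithin dq.

(* A C^1 curve is Lipschitz, so its projection to a plane cannot visit the m^2
   points of an m x m grid when m is large. *)
Lemma curve_misses_point (f g : bool -> R -> R) (L : R) :
  (forall b s t, itv01 s -> itv01 t -> `|f b s - f b t| <= L * `|s - t|) ->
  (forall b s t, itv01 s -> itv01 t -> `|g b s - g b t| <= L * `|s - t|) ->
  exists x y : R, [/\ 0 <= x <= 1 / 2, 0 <= y <= 1 / 2 &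
    forall b u, itv01 u -> ~ (f b u = x /\ g b u = y)].
Proof.
move=> fL gL; apply: contrapT => nomiss.
have hit (x y : R) : 0 <= x <= 1 / 2 -> 0 <= y <= 1 / 2 ->
    exists bu : bool * R, [/\ itv01 bu.2, f bu.1 bu.2 = x & g bu.1 bu.2 = y].
  move=> xI yI; apply: contrapT => nhit; apply: nomiss; exists x, y; split=> // b u iu [fx gy].
  by apply: nhit; exists (b, u).
pose l := Num.bound `|L|.
have Ll : L < l%:R by rewrite (le_lt_trans (ler_norm _))// archi_boundP.
(* The grid has spacing 1 / (2 m), and N > 2 m L prevents a curve from visiting two grid points
   within one of its time cells. The two curves have 2 (N + 1) = 4 m l + 4 cells in all, fewer than
   the m^2 = 4 m l + 5 m grid points. *)
pose m := (4 * l + 5)%N; pose N := (2 * m * l + 1)%N.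
have m0 : 0 < m%:R :> R by rewrite ltr0n.
have N0 : 0 < N%:R :> R by rewrite ltr0n /N addn1.
pose c (i : 'I_m) : R := i%:R / (2 * m%:R).
have cI i : 0 <= c i <= 1 / 2.
  rewrite /c divr_ge0//= ?mulr_ge0// ler_pdivrMr ?mulr_gt0//.
  by rewrite mulrA divfK// mul1r ler_nat ltnW.
have cinj i j : `|c i - c j| < 1 / (2 * m%:R) -> i = j.
  rewrite /c -mulrBl normrM [`|_^-1|]ger0_norm ?invr_ge0 ?mulr_ge0//.
  rewrite ltr_pM2r ?invr_gt0 ?mulr_gt0// => h; apply: val_inj => /=; apply/eqP.
  move: h; rewrite -[i%:R]/(((i : nat)%:Z)%:~R : R) -[j%:R]/(((j : nat)%:Z)%:~R : R).
  rewrite -rmorphB/= -intr_norm -[1](mulr1z 1) ltr_int.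
  by lia.
have hit' (ij : 'I_m * 'I_m) := hit (c ij.1) (c ij.2) (cI _) (cI _).
have [bt btP] := choice hit'.
have cell ij : (Num.truncn ((bt ij).2 * N%:R) < N.+1)%N.
  have [/itv01P/andP[t0 t1] _ _] := btP ij.
  rewrite ltnS truncn_le_nat ?mulr_ge0//.
  by rewrite (le_lt_trans (ler_wpM2r _ t1))// mul1r ltr_nat.
pose F ij : bool * 'I_N.+1 := ((bt ij).1, Ordinal (cell ij)).
have Finj : injective F.
  move=> [i j] [i' j'] [eb ec].
  have [it fi gi] := btP (i, j); have [it' fi' gi'] := btP (i', j').
  move: ec fi gi fi' gi' it it'; rewrite -eb; set t := (bt (i, j)).2; set t' := (bt (i', j')).2.
  move=> ec fi gi fi' gi' it it'.
  have tt : `|t - t'| < 1 / N%:R.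
    have /itv01P/andP[t0 _] := it; have /itv01P/andP[t0' _] := it'.
    have /andP[a1 a2] := truncn_itv (mulr_ge0 t0 (ltW N0)).
    have /andP[b1 b2] := truncn_itv (mulr_ge0 t0' (ltW N0)).
    rewrite -ec in b1 b2; rewrite ltr_pdivlMr// -[N%:R]ger0_norm ?ltW// -normrM mulrBl.
    by rewrite ltr_norml; apply/andP; split; move: a1 a2 b1 b2; rewrite -!natr1; lra.
  have LN : L * `|t - t'| < 1 / (2 * m%:R).
    have [L0|L0] := leP L 0.
      by rewrite (le_lt_trans (mulr_le0_ge0 L0 (normr_ge0 _)))// divr_gt0// mulr_gt0.
    rewrite (@lt_trans _ _ (L / N%:R))//.
      by move: tt; rewrite div1r => tt; rewrite ltr_pM2l.
    rewrite ltr_pdivrMr// mulrAC ltr_pdivlMr ?mulr_gt0// mul1r.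
    apply: (@lt_trans _ _ (l%:R * (2 * m%:R))); first by rewrite ltr_pM2r// mulr_gt0.
    by rewrite -!natrM ltr_nat /N addn1 ltnS mulnC.
  congr (_, _); apply: cinj.
    by rewrite -fi -fi' (le_lt_trans (fL _ _ _ it it')).
  by rewrite -gi -gi' (le_lt_trans (gL _ _ _ it it')).
have := leq_card F Finj; rewrite !card_prod !card_ord card_bool /N /m; lia.
Qed.

Lemma qc1_lipschitz (q dq : R -> quat R) : qc1 q dq -> exists2 L : R, 0 <= L &
  forall s t, itv01 s -> itv01 t -> `|qr (q s) - qr (q t)| <= L * `|s - t| /\
    `|qi (q s) - qi (q t)| <= L * `|s - t|.
Proof.
move=> [dQ [c1 c2 _ _]].
have bd (f : R -> R) : {within itv01, continuous f} -> exists2 M : R, 0 <= M &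
    forall u, itv01 u -> `|f u| <= M.
  move=> cf; have : {within `[0, 1], continuous (fun u => `|f u|)}.
    by move=> x; apply: cvg_norm; exact: cf.
  by move=> /(EVT_max ler01)[a _ amax]; exists `|f a| => // u /amax.
have [L1 L10 h1] := bd _ c1; have [L2 L20 h2] := bd _ c2.
exists (L1 + L2) => [|s t si ti]; first exact: addr_ge0.
split.
  apply: le_trans (_ : L1 * `|s - t| <= _); last by rewrite ler_wpM2r// lerDl.
  by apply: (@mvt01_le _ (fun s => qr (q s)) (fun s => qr (dq s))) => // u iu; case: (dQ u iu).
apply: le_trans (_ : L2 * `|s - t| <= _); last by rewrite ler_wpM2r// lerDr.
by apply: (@mvt01_le _ (fun s => qi (q s)) (fun s => qi (dq s))) => // u iu; case: (dQ u iu).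
Qed.

(** Two coordinates between 0 and 1/2 can be completed to a point of the sphere, so it suffices to
    miss a point in the plane of the first two coordinates. *)
Lemma missed_pole (q0 dq0 q1 dq1 : R -> quat R) : qc1 q0 dq0 -> qc1 q1 dq1 ->
  exists2 p, qn2 p = 1 & forall u, itv01 u -> q0 u <> p /\ q1 u <> p.
Proof.
move=> /qc1_lipschitz[L0 L00 h0] /qc1_lipschitz[L1 L10 h1].
pose Q (b : bool) := if b then q1 else q0.
have hQ b s t : itv01 s -> itv01 t -> `|qr (Q b s) - qr (Q b t)| <= (L0 + L1) * `|s - t| /\
    `|qi (Q b s) - qi (Q b t)| <= (L0 + L1) * `|s - t|.
  move=> si ti; case: b; rewrite /Q.
    have [a b] := h1 s t si ti; split; [apply: le_trans a _|apply: le_trans b _];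
      by rewrite ler_wpM2r// lerDr.
  have [a b] := h0 s t si ti; split; [apply: le_trans a _|apply: le_trans b _];
    by rewrite ler_wpM2r// lerDl.
have [x [y [/andP[x0 x1] /andP[y0 y1] miss]]] :=
  @curve_misses_point (fun b s => qr (Q b s)) (fun b s => qi (Q b s)) (L0 + L1)
   (fun b s t si ti => (hQ b s t si ti).1) (fun b s t si ti => (hQ b s t si ti).2).
exists (Q4 x y (Num.sqrt (1 - x ^+ 2 - y ^+ 2)) 0).
  rewrite /qn2 /qdot /= -!expr2 sqr_sqrtr; last by nra.
  ring.
by move=> u iu; split=> e; [apply: (miss false u iu)|apply: (miss true u iu)]; rewrite /Q e.
Qed.

(** Inverse of [stereo], the stereographic projection from the pole [p] to the hyperplane orthogonal
    to [p]. *)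
Definition stereo_inv p z : quat R :=
  qscale (qn2 z + 1)^-1 (qadd (qscale 2 z) (qscale (qn2 z - 1) p)).

Definition stereo p q : quat R :=
  qscale (1 - qdot q p)^-1 (qadd q (qscale (- qdot q p) p)).

Definition stereo_inv_der p z w : quat R :=
  qadd (qscale (qn2 z + 1)^-1 (qadd (qscale 2 w) (qscale (2 * qdot z w) p)))
       (qscale (- (2 * qdot z w) * ((qn2 z + 1)^-1 * (qn2 z + 1)^-1))
          (qadd (qscale 2 z) (qscale (qn2 z - 1) p))).

Definition stereo_der p q w : quat R :=
  qadd (qscale (1 - qdot q p)^-1 (qadd w (qscale (- qdot w p) p)))
       (qscale (qdot w p * ((1 - qdot q p)^-1 * (1 - qdot q p)^-1))
          (qadd q (qscale (- qdot q p) p))).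

Lemma qn2_ge0 z : 0 <= qn2 z.
Proof. by rewrite /qn2 /qdot -!expr2 !addr_ge0// sqr_ge0. Qed.

Lemma qn2p1_neq0 z : qn2 z + 1 != 0.
Proof. by rewrite gt_eqF// ltr_wpDl// qn2_ge0. Qed.

Lemma qdot_lt1 p q : qn2 p = 1 -> qn2 q = 1 -> q <> p -> 1 - qdot q p != 0.
Proof.
move=> p1 q1 qp; apply/eqP => h; apply: qp.
have : qn2 (qadd q (qscale (-1) p)) = 0.
  have -> : qn2 (qadd q (qscale (-1) p)) = qn2 q + qn2 p - 2 * qdot q p.
    by rewrite /qn2 /qdot /=; ring.
  by rewrite p1 q1; move: h; lra.
case: p q {p1 q1 h} => a b c d [a' b' c' d'].
rewrite /qn2 /qdot /= !mulN1r -!expr2 => h.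
have h1 := sqr_ge0 (a' - a); have h2 := sqr_ge0 (b' - b).
have h3 := sqr_ge0 (c' - c); have h4 := sqr_ge0 (d' - d).
have z (x y : R) : (x - y) ^+ 2 = 0 -> x = y.
  by move/eqP; rewrite sqrf_eq0 subr_eq0 => /eqP.
by apply: Q4_eq; apply: z; lra.
Qed.

Lemma stereo_orth p q : qn2 p = 1 -> 1 - qdot q p != 0 -> qdot (stereo p q) p = 0.
Proof.
move=> p1 _; rewrite /stereo.
have -> a b : qdot (qscale a (qadd q (qscale b p))) p = a * (qdot q p + b * qn2 p).
  by rewrite /qn2 /qdot /=; ring.
by rewrite p1 mulr1 subrr mulr0.
Qed.

Lemma stereo_n2 p q : qn2 p = 1 -> qn2 q = 1 -> 1 - qdot q p != 0 ->
  qn2 (stereo p q) = (1 + qdot q p) / (1 - qdot q p).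
Proof.
move=> p1 q1 h.
have -> : qn2 (stereo p q) = (1 - qdot q p)^-1 ^+ 2 *
   (qn2 q - 2 * qdot q p * qdot q p + qdot q p ^+ 2 * qn2 p).
  rewrite /stereo; move: (1 - qdot q p)^-1 => c.
  have -> a b : qn2 (qscale a (qadd q (qscale b p))) =
     a ^+ 2 * (qn2 q + 2 * b * qdot q p + b ^+ 2 * qn2 p).
    by rewrite /qn2 /qdot /=; ring.
  by ring.
by rewrite p1 q1; field.
Qed.

Lemma stereoK p q : qn2 p = 1 -> qn2 q = 1 -> 1 - qdot q p != 0 ->
  stereo_inv p (stereo p q) = q.
Proof.
move=> p1 q1 h; rewrite /stereo_inv stereo_n2// /stereo.
move: (qdot q p) h => c h.
have e1 : (1 + c) / (1 - c) + 1 = 2 / (1 - c) by field.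
have e2 : (1 + c) / (1 - c) - 1 = 2 * c / (1 - c) by field.
rewrite e1 e2; case: p q {p1 q1} => a b c' d [a' b' c'' d'].
by rewrite /qscale /qadd /=; apply: Q4_eq; field; rewrite h.
Qed.

Lemma stereo_inv_n2 p z : qn2 p = 1 -> qdot z p = 0 -> qn2 (stereo_inv p z) = 1.
Proof.
move=> p1 zp; rewrite /stereo_inv.
have -> a b c : qn2 (qscale a (qadd (qscale b z) (qscale c p))) =
   a ^+ 2 * (b ^+ 2 * qn2 z + 2 * b * c * qdot z p + c ^+ 2 * qn2 p).
  by rewrite /qn2 /qdot /=; ring.
by rewrite p1 zp; field; exact: qn2p1_neq0.
Qed.

Lemma qder_smul (a : R -> R) (q : R -> quat R) (u : R) da dq : is_derive u 1 a da -> qder q u dq ->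
  qder (fun s => qscale (a s) (q s)) u (qadd (qscale da (q u)) (qscale (a u) dq)).
Proof. by move=> ha [? ? ? ?]; split; exact: dv_mul. Qed.

Lemma stereo_inv_qder p (z : R -> quat R) u w : qder z u w ->
  qder (fun s => stereo_inv p (z s)) u (stereo_inv_der p (z u) w).
Proof.
move=> dz; have dn : is_derive u 1 (fun s => qn2 (z s)) (2 * qdot (z u) w).
  by refine (dv_eq (dv_qdot dz dz) _); rewrite /qdot; ring.
have di := @dv_inv _ (fun s => qn2 (z s) + 1) u _ (qn2p1_neq0 (z u)) (dv_add dn (dv_cst u 1)).
have := qder_smul di (qder_add (qder_scale 2 dz)
  (qder_smul (dv_sub dn (dv_cst u 1)) (qder_cst u p))).
move/qder_eq; apply; rewrite /stereo_inv_der.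
have := qn2p1_neq0 (z u); move: (qn2 (z u)) (qdot (z u) w) => n d n1.
by case: p (z u) w {dz dn di} => a b c e [a' b' c' e'] [a'' b'' c'' e''];
  rewrite /qadd /qscale /qzero /=; apply: Q4_eq; field.
Qed.

Lemma stereo_qder p (q : R -> quat R) u w : 1 - qdot (q u) p != 0 -> qder q u w ->
  qder (fun s => stereo p (q s)) u (stereo_der p (q u) w).
Proof.
move=> h dq; have dn : is_derive u 1 (fun s => qdot (q s) p) (qdot w p).
  by refine (dv_eq (dv_qdot dq (qder_cst u p)) _); rewrite /qdot /=; ring.
have di := @dv_inv _ (fun s => 1 - qdot (q s) p) u _ h (dv_sub (dv_cst u 1) dn).
have := qder_smul di (qder_add dq (qder_smul (dv_opp dn) (qder_cst u p))).
move/qder_eq; apply; rewrite /stereo_der.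
move: (qdot (q u) p) (qdot w p) h {dn di} => n d n1.
by case: p (q u) w {dq} => a b c e [a' b' c' e'] [a'' b'' c'' e''];
  rewrite /qadd /qscale /qzero /=; apply: Q4_eq; field.
Qed.

Lemma qwithin_add (p q : R -> quat R) : qwithin p -> qwithin q ->
  qwithin (fun u => qadd (p u) (q u)).
Proof. by move=> [? ? ? ?] [? ? ? ?]; split; exact: within01D. Qed.

Lemma qwithin_smul (a : R -> R) (q : R -> quat R) : {within itv01, continuous a} ->
  qwithin q -> qwithin (fun u => qscale (a u) (q u)).
Proof. by move=> ca [? ? ? ?]; split; exact: within01M. Qed.

Lemma within_qdot (p q : R -> quat R) : qwithin p -> qwithin q ->
  {within itv01, continuous (fun u => qdot (p u) (q u))}.
Proof.
move=> [p1 p2 p3 p4] [q1 q2 q3 q4].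
exact: (within01D (within01D (within01D (within01M p1 q1) (within01M p2 q2))
  (within01M p3 q3)) (within01M p4 q4)).
Qed.

Lemma qwithin_cst p : qwithin (fun=> p).
Proof. by split; exact: within01_cst. Qed.

Lemma within_inv (f : R -> R) : (forall u, itv01 u -> f u != 0) ->
  {within itv01, continuous f} -> {within itv01, continuous (fun u => (f u)^-1)}.
Proof.
move=> f0 /subspace_continuousP cf; apply/subspace_continuousP => u iu.
by apply: cvgV; [exact: f0|exact: cf].
Qed.

Lemma stereo_qc1 p (q dq : R -> quat R) : qn2 p = 1 ->
  (forall u, itv01 u -> qn2 (q u) = 1 /\ q u <> p) -> qc1 q dq ->
  qc1 (fun u => stereo p (q u)) (fun u => stereo_der p (q u) (dq u)).
Proof.
move=> p1 qp [dQ cdq]; have cq := qder_qwithin dQ.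
have h u : itv01 u -> 1 - qdot (q u) p != 0.
  by move=> /qp[q1 q2]; exact: qdot_lt1.
split; first by move=> u iu; apply: stereo_qder; [exact: h|exact: dQ].
have N (f : R -> R) : {within itv01, continuous f} ->
    {within itv01, continuous (fun u => - f u)}.
  by move=> cf x; apply: cvgN; exact: cf.
have cqp := within_qdot cq (qwithin_cst p); have cdqp := within_qdot cdq (qwithin_cst p).
have ci : {within itv01, continuous (fun u => (1 - qdot (q u) p)^-1)}.
  by apply: within_inv h _; apply: within01D; [exact: within01_cst|exact: N].
apply: qwithin_add; apply: qwithin_smul => //.
- by apply: qwithin_add => //; apply: qwithin_smul; [exact: N|exact: qwithin_cst].
- by apply: within01M => //; exact: within01M.
- by apply: qwithin_add => //; apply: qwithin_smul; [exact: N|exact: qwithin_cst].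
Qed.

(** Both paths avoid a common pole. Projected from it, they are joined by straight segments in the
    hyperplane, which leaves the common ends fixed. The homotopy is rational in t with a denominator
    bounded below by 1, hence smooth in t uniformly in u. *)
Lemma sphere_homotopy (q0 dq0 q1 dq1 : R -> quat R) : qc1 q0 dq0 -> qc1 q1 dq1 ->
  (forall u, itv01 u -> qn2 (q0 u) = 1) -> (forall u, itv01 u -> qn2 (q1 u) = 1) ->
  q0 0 = q1 0 -> q0 1 = q1 1 ->
  exists Q dQ : R -> R -> quat R,
  [/\ forall n, qcls [set: R] n [::] (fun t _ => Q t),
      forall n, qcls [set: R] n [::] (fun t _ => dQ t),
      forall t u, itv01 u -> qn2 (Q t u) = 1,
      forall t u, itv01 u -> qder (Q t) u (dQ t u)
    & [/\ forall u, itv01 u -> Q 0 u = q0 u, forall u, itv01 u -> Q 1 u = q1 u,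
           forall t, Q t 0 = q0 0 & forall t, Q t 1 = q0 1]].
Proof.
move=> c0 c1 u0 u1 e0 e1; have [p p1 pmiss] := missed_pole c0 c1.
have s0 u (iu : itv01 u) : qn2 (q0 u) = 1 /\ q0 u <> p by split; [exact: u0|case: (pmiss u iu)].
have s1 u (iu : itv01 u) : qn2 (q1 u) = 1 /\ q1 u <> p by split; [exact: u1|case: (pmiss u iu)].
have [dz0 cdz0] := stereo_qc1 p1 s0 c0; have [dz1 cdz1] := stereo_qc1 p1 s1 c1.
pose z0 u := stereo p (q0 u); pose z1 u := stereo p (q1 u).
pose w0 u := stereo_der p (q0 u) (dq0 u); pose w1 u := stereo_der p (q1 u) (dq1 u).
pose z t u := qadd (qscale (1 - t) (z0 u)) (qscale t (z1 u)).
pose w t u := qadd (qscale (1 - t) (w0 u)) (qscale t (w1 u)).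
exists (fun t u => stereo_inv p (z t u)), (fun t u => stereo_inv_der p (z t u) (w t u)).
have oT : open [set: R] := openT.
have ct n : cls [set: R] n [::] (fun t _ _ => t).
  apply: cls_atom => //; split=> //; last by move=> t; exact: within01_cst.
  by exists 1 => // t u _; rewrite mul1r.
have c1t n : cls [set: R] n [::] (fun t _ _ => 1 - t).
  by apply: cls_sub => //; exact: cls_const.
have cz n : qcls [set: R] n [::] (fun t _ => z t).
  by apply: qcls_add; apply: qcls_smul => //; apply: qcls_cst => //;
    [exact: (qder_qwithin dz0)|exact: (qder_qwithin dz1)].
have cw n : qcls [set: R] n [::] (fun t _ => w t).
  by apply: qcls_add; apply: qcls_smul => //; exact: qcls_cst.
have cp n : qcls [set: R] n [::] (fun _ _ _ => p) by apply: qcls_cst => //; exact: qwithin_cst.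
have cn n : cls [set: R] n [::] (fun t _ u => qn2 (z t u)) by exact: cls_qdot.
have ci n : cls [set: R] n [::] (fun t _ u => (qn2 (z t u) + 1)^-1).
  have cn1 : cls [set: R] n [::] (fun t _ u => qn2 (z t u) + 1).
    by apply: cls_add => //; exact: cls_const.
  refine (cls_inv cn1 _).
  by move=> t _; exists 1, 1; split=> // s _ v u _; rewrite lerDr qn2_ge0.
have cnum n : qcls [set: R] n [::] (fun t _ u => qadd (qscale 2 (z t u)) (qscale (qn2 (z t u) - 1) p)).
  apply: qcls_add; first exact: qcls_scale.
  by apply: qcls_smul => //; apply: cls_sub => //; exact: cls_const.
have zp t u : itv01 u -> qdot (z t u) p = 0.
  move=> iu; have [a0 b0] := s0 u iu; have [a1 b1] := s1 u iu.
  have -> : qdot (z t u) p = (1 - t) * qdot (z0 u) p + t * qdot (z1 u) p.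
    by rewrite /z /qdot /=; ring.
  by rewrite !stereo_orth ?mulr0 ?addr0//; exact: qdot_lt1.
split.
- by move=> n; apply: qcls_smul.
- move=> n; have cd : cls [set: R] n [::] (fun t _ u => 2 * qdot (z t u) (w t u)).
    by apply: cls_scale => //; exact: cls_qdot.
  apply: qcls_add; apply: qcls_smul => //.
    by apply: qcls_add; [exact: qcls_scale|exact: qcls_smul].
  by apply: cls_mul0; [exact: cls_opp|exact: cls_mul0].
- by move=> t u iu; apply: stereo_inv_n2 => //; exact: zp.
- move=> t u iu; apply: stereo_inv_qder.
  by apply: qder_add; apply: qder_scale; [exact: dz0|exact: dz1].
have z00 t u : z0 u = z1 u -> z t u = z0 u.
  rewrite /z => <-; case: (z0 u) => a b c d.
  by apply: Q4_eq; rewrite /=; ring.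
have K0 u : itv01 u -> stereo_inv p (z0 u) = q0 u.
  by move=> iu; have [a b] := s0 u iu; apply: stereoK => //; exact: qdot_lt1.
have K1 u : itv01 u -> stereo_inv p (z1 u) = q1 u.
  by move=> iu; have [a b] := s1 u iu; apply: stereoK => //; exact: qdot_lt1.
split.
- move=> u iu; rewrite (_ : z 0 u = z0 u) ?K0//; rewrite /z.
  by case: (z0 u) (z1 u) => ? ? ? ? [? ? ? ?]; apply: Q4_eq; rewrite /=; ring.
- move=> u iu; rewrite (_ : z 1 u = z1 u) ?K1//; rewrite /z.
  by case: (z0 u) (z1 u) => ? ? ? ? [? ? ? ?]; apply: Q4_eq; rewrite /=; ring.
- by move=> t; rewrite z00 ?K0//; [exact: itv01_0|rewrite /z0 /z1 e0].
- by move=> t; rewrite z00 ?K0//; [exact: itv01_1|rewrite /z0 /z1 e1].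
Qed.

End SphereHomotopy.

(** * Vector algebra for smooth families and for differentiable paths *)

Section VectorFamilies.
Context {R : realType} {E : normedModType R}.
Variable U : set E.
Hypothesis oU : open U.
Implicit Types (G : @mfamily R E) (X Y : @vfamily R E) (Q : @qfamily R E).

Lemma vcls_add n X Y : vcls U n [::] X -> vcls U n [::] Y ->
  vcls U n [::] (fun x v u => vadd (X x v u) (Y x v u)).
Proof.
by case=> x1 x2 x3 [y1 y2 y3]; split;
  [exact (cls_add x1 y1)|exact (cls_add x2 y2)|exact (cls_add x3 y3)].
Qed.

Lemma vcls_smul n G X : cls U n [::] G -> vcls U n [::] X ->
  vcls U n [::] (fun x v u => vscale (G x v u) (X x v u)).
Proof.
by move=> g [x1 x2 x3]; split;
  [exact (cls_mul0 g x1)|exact (cls_mul0 g x2)|exact (cls_mul0 g x3)].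
Qed.

Lemma vcls_cross n X Y : vcls U n [::] X -> vcls U n [::] Y ->
  vcls U n [::] (fun x v u => cross (X x v u) (Y x v u)).
Proof.
case=> x1 x2 x3 [y1 y2 y3]; split.
- exact (cls_sub oU (cls_mul0 x2 y3) (cls_mul0 x3 y2)).
- exact (cls_sub oU (cls_mul0 x3 y1) (cls_mul0 x1 y3)).
- exact (cls_sub oU (cls_mul0 x1 y2) (cls_mul0 x2 y1)).
Qed.

Lemma cls_dot n X Y : vcls U n [::] X -> vcls U n [::] Y ->
  cls U n [::] (fun x v u => dot (X x v u) (Y x v u)).
Proof.
case=> x1 x2 x3 [y1 y2 y3].
exact (cls_add (cls_add (cls_mul0 x1 y1) (cls_mul0 x2 y2)) (cls_mul0 x3 y3)).
Qed.

Lemma vcls_cst n (x : R -> vec R) : vwithin x -> vcls U n [::] (fun _ _ => x).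
Proof. by case=> c1 c2 c3; split; exact: cls_cst. Qed.

Lemma vcls_rot n Q X : qcls U n [::] Q -> vcls U n [::] X ->
  vcls U n [::] (fun x v u => qrot (Q x v u) (X x v u)).
Proof.
move=> cQ cX; exact (qcls_im (qcls_mul0 oU (qcls_mul0 oU (qcls_conj oU cQ)
  (qcls_vec oU cX)) cQ)).
Qed.

Lemma vcls_vel n Q P : qcls U n [::] Q -> qcls U n [::] P ->
  vcls U n [::] (fun x v u => vel (Q x v u) (P x v u)).
Proof.
move=> cQ cP; have c2 : cls U n [::] (fun _ _ _ => 2) := cls_const oU n 2.
exact (vcls_smul c2 (qcls_im (qcls_mul0 oU (qcls_conj oU cQ) cP))).
Qed.

End VectorFamilies.

Section VectorCalculus.
Context {R : realType}.
Implicit Types (x y n w b : vec R).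

Lemma vder_add X Y (u : R) (dx dy : vec R) : vder X u dx -> vder Y u dy ->
  vder (fun s => vadd (X s) (Y s)) u (vadd dx dy).
Proof. by case=> ? ? ? [? ? ?]; split; exact: dv_add. Qed.

Lemma vder_smul (a : R -> R) X (u da : R) (dx : vec R) : is_derive u 1 a da -> vder X u dx ->
  vder (fun s => vscale (a s) (X s)) u (vadd (vscale da (X u)) (vscale (a u) dx)).
Proof. by move=> ha [? ? ?]; split; exact: dv_mul. Qed.

Lemma vder_cst u x : vder (fun=> x) u (V3 0 0 0).
Proof. by split; exact: dv_cst. Qed.

Lemma vder_vel (q p : R -> quat R) (u : R) (dq dp : quat R) : qder q u dq -> qder p u dp ->
  vder (fun s => vel (q s) (p s)) u
    (vscale 2 (qim (qadd (qmul (qconj dq) (p u)) (qmul (qconj (q u)) dp)))).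
Proof.
move=> hq hp; have [_ d1 d2 d3] := qder_mul (qder_conj hq) hp.
by split; exact: dv_cmul.
Qed.

Lemma vwithin_add (X Y : R -> vec R) : vwithin X -> vwithin Y ->
  vwithin (fun u => vadd (X u) (Y u)).
Proof. by case=> ? ? ? [? ? ?]; split; exact: within01D. Qed.

Lemma vwithin_smul (a : R -> R) (X : R -> vec R) : {within itv01, continuous a} ->
  vwithin X -> vwithin (fun u => vscale (a u) (X u)).
Proof. by move=> ca [? ? ?]; split; exact: within01M. Qed.

Lemma within_dot (X Y : R -> vec R) : vwithin X -> vwithin Y ->
  {within itv01, continuous (fun u => dot (X u) (Y u))}.
Proof.
move=> [x1 x2 x3] [y1 y2 y3].
exact: (within01D (within01D (within01M x1 y1) (within01M x2 y2)) (within01M x3 y3)).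
Qed.

Lemma vwithin_cross (X Y : R -> vec R) : vwithin X -> vwithin Y ->
  vwithin (fun u => cross (X u) (Y u)).
Proof.
have B (f g : R -> R) : {within itv01, continuous f} -> {within itv01, continuous g} ->
    {within itv01, continuous (fun u => f u - g u)}.
  by move=> cf cg x; apply: cvgB; [exact: cf|exact: cg].
by move=> [x1 x2 x3] [y1 y2 y3]; split; apply: B; exact: within01M.
Qed.

Lemma vwithin_cst x : vwithin (fun=> x).
Proof. by split; exact: within01_cst. Qed.

Lemma vwithin_vel (q p : R -> quat R) : qwithin q -> qwithin p ->
  vwithin (fun u => vel (q u) (p u)).
Proof.
move=> cq cp; have [_ c1 c2 c3] := qwithin_mul (qwithin_conj cq) cp.
by split; apply: within01M => //; exact: within01_cst.
Qed.

Definition vnorm x : R := Num.sqrt (dot x x).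

Lemma dot_ge0 x : 0 <= dot x x.
Proof. by rewrite /dot -!expr2 !addr_ge0// sqr_ge0. Qed.

Lemma vnorm_sqr x : vnorm x ^+ 2 = dot x x.
Proof. by rewrite sqr_sqrtr// dot_ge0. Qed.

Lemma vnorm_gt0 x : 0 < dot x x -> 0 < vnorm x.
Proof. by rewrite sqrtr_gt0. Qed.

Lemma vnorm_scale a x : 0 <= a -> vnorm (vscale a x) = a * vnorm x.
Proof.
move=> a0; rewrite /vnorm (_ : dot _ _ = a ^+ 2 * dot x x).
  by rewrite sqrtrM ?sqr_ge0// sqrtr_sqr ger0_norm.
by rewrite /dot /vscale /=; ring.
Qed.

Lemma dot_gt0 (x : 'rV[R]_3) : (x != 0) = (0 < dot (vrow x) (vrow x)).
Proof.
rewrite lt_neqAle dot_ge0 andbT eq_sym; apply/idP/idP; apply: contra.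
  rewrite /dot /= -!expr2 => /eqP h.
  have h0 := sqr_ge0 (x 0 0); have h1 := sqr_ge0 (x 0 1); have h2 := sqr_ge0 (x 0 2).
  have e0 : x 0 0 = 0 by apply/eqP; rewrite -sqrf_eq0; apply/eqP; lra.
  have e1 : x 0 1 = 0 by apply/eqP; rewrite -sqrf_eq0; apply/eqP; lra.
  have e2 : x 0 2 = 0 by apply/eqP; rewrite -sqrf_eq0; apply/eqP; lra.
  by rewrite -[x]vrowK /vrow e0 e1 e2; apply/eqP/rowP => i; rewrite !mxE; do 2?case: ifP.
by move=> /eqP <-; rewrite /dot /= !mxE !mul0r !addr0.
Qed.

End VectorCalculus.

(** * Solutions and gauge transformations of the radial bivector *)

Section Target.
Context {R : realType} (f : R -> R).
Hypothesis f_smooth : forall (n : nat) (r : R), 0 < r -> derivable (f^`(n))%classic r 1.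
Hypothesis f_neq0 : forall r : R, 0 < r -> f r != 0.

Local Notation Fld := (@fields R 3).
Local Notation M := [set x : 'rV[R]_3 | x != 0].
Local Notation alpha := (radial_bivector f).
Implicit Types (x y n w b : vec R) (p q : Fld).

Definition f' : R -> R := (f^`(1))%classic.

(* The derivative of [r / f r]; the symplectic area has derivative [4 pi h'], see
   [area_is_derive]. *)
Definition h' (r : R) : R := (f r - r * f' r) / f r ^+ 2.

Lemma f_tower k (r : R) : 0 < r -> is_derive r 1 (f^`(k))%classic ((f^`(k.+1))%classic r).
Proof. by move=> r0; rewrite derive1nS derive1E; apply/derivableP/f_smooth. Qed.

Lemma f_der (r : R) : 0 < r -> is_derive r 1 f (f' r).
Proof. exact: (@f_tower 0). Qed.

Lemma val3 : ((1 %% 3)%N = 1%N) * (((1 + 1) %% 3)%N = 2%N).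
Proof. by []. Qed.

Lemma radial_sum (x y : 'rV[R]_3) i :
  \sum_j alpha x i j * y 0 j =
  rowv (vscale (f (vnorm (vrow x))) (cross (vrow y) (vrow x))) 0 i.
Proof.
have e : euclid_norm x = vnorm (vrow x).
  by rewrite /euclid_norm /vnorm sum3 /dot /= !expr2.
rewrite !mxE sum3 !mxE e !sum3 /levi_civita.
by case: i => -[|[|[|//]]] ? /=; rewrite !val3; field.
Qed.

Lemma solutionsP p : solutions M alpha p <-> forall u, itv01 u ->
  0 < dot (fpos p u) (fpos p u) /\
  fvel p u = vscale (f (vnorm (fpos p u))) (cross (fpos p u) (feta p u)).
Proof.
have anti c x y : vscale c (cross x y) = vscale (-1) (vscale c (cross y x)).
  by apply: V3_eq; rewrite /=; ring.
split=> sp u iu; have [h1 h2] := sp u iu.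
  split; first by rewrite /fpos -dot_gt0.
  rewrite anti; apply: (can_inj rowvK); rewrite /fvel vrowK.
  apply/rowP => i; have := h2 i; rewrite radial_sum => /eqP; rewrite addr_eq0 => /eqP ->.
  by rewrite !mxE; do 2?case: ifP => _; rewrite /= mulN1r.
split; first by rewrite /= dot_gt0.
move=> i; rewrite radial_sum -[velocity p.1 u]vrowK -/(fvel p u) h2 anti.
by rewrite !mxE; do 2?case: ifP => _; rewrite /= mulN1r addNr.
Qed.

Lemma line_derive (F : 'rV[R]_3 -> R) (a v : 'rV[R]_3) (d : R) :
  is_derive (0 : R) 1 (fun t : R => F (t *: v + a)) d -> 'D_v F a = d.
Proof.
move=> [df <-]; rewrite /derive.
have -> : (fun h : R => h^-1 *: ((F \o shift a) (h *: v) - F a)) =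
    (fun h => h^-1 *: (((fun t : R => F (t *: v + a)) \o shift (0 : R)) (h *: 1) -
      F ((0 : R) *: v + a))).
  by apply/funext => t /=; rewrite addr0 scale0r add0r [t *: 1]mulr1.
by [].
Qed.

Lemma radial_derive (x : 'rV[R]_3) i j k : 0 < dot (vrow x) (vrow x) ->
  'D_(delta_mx 0 i) (fun z => alpha z j k) x =
  f' (vnorm (vrow x)) * (x 0 i / vnorm (vrow x)) * (\sum_l levi_civita j k l * x 0 l) +
  f (vnorm (vrow x)) * levi_civita j k i.
Proof.
move=> x0; have r0 := vnorm_gt0 x0.
apply: line_derive.
have dc l : is_derive (0 : R) 1 (fun t : R => (t *: delta_mx 0 i + x) 0 l) ((l == i)%:R).
  rewrite (_ : (fun t : R => _) = (fun t => (l == i)%:R * t + x 0 l)).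
    by refine (dv_eq (dv_add (dv_cmul _ (dv_id 0)) (dv_cst 0 (x 0 l))) _); rewrite mulr1 addr0.
  by apply/funext => t; rewrite !mxE eqxx /= mulrC.
have x0E l : ((0 : R) *: delta_mx 0 i + x) 0 l = x 0 l by rewrite scale0r add0r.
have dd : is_derive (0 : R) 1 (fun t : R => \sum_l (t *: delta_mx 0 i + x) 0 l ^+ 2) (2 * x 0 i).
  under eq_fun do rewrite sum3 !expr2.
  refine (dv_eq (dv_add (dv_add (dv_mul (dc 0) (dc 0)) (dv_mul (dc 1) (dc 1)))
     (dv_mul (dc 2) (dc 2))) _).
  rewrite !x0E; case: i {dc x0E} => -[|[|[|//]]] ?; rewrite !mulr_natl/=.
  - by rewrite (_ : Ordinal _ = 0) /=; [ring|exact: val_inj].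
  - by rewrite (_ : Ordinal _ = 1) /=; [ring|exact: val_inj].
  - by rewrite (_ : Ordinal _ = 2) /=; [ring|exact: val_inj].
have e0 : \sum_l ((0 : R) *: delta_mx 0 i + x) 0 l ^+ 2 = dot (vrow x) (vrow x).
  by rewrite sum3 !x0E /dot /= !expr2.
have dn : is_derive (0 : R) 1 (fun t : R => euclid_norm (t *: delta_mx 0 i + x))
    (x 0 i / vnorm (vrow x)).
  have ds : is_derive (\sum_l ((0 : R) *: delta_mx 0 i + x) 0 l ^+ 2) 1 Num.sqrt
     (2 * Num.sqrt (dot (vrow x) (vrow x)))^-1.
    by rewrite e0; exact: is_derive1_sqrt.
  have := @dv_comp _ Num.sqrt _ 0 _ _ ds dd; move/dv_eq; apply.
  by rewrite /vnorm; field; rewrite gt_eqF.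
have df0 : is_derive (euclid_norm ((0 : R) *: delta_mx 0 i + x)) 1 f (f' (vnorm (vrow x))).
  by rewrite /euclid_norm e0; exact: f_der.
have df := @dv_comp _ f _ 0 _ _ df0 dn.
have dl : is_derive (0 : R) 1 (fun t : R => \sum_l levi_civita j k l * (t *: delta_mx 0 i + x) 0 l)
    (levi_civita j k i).
  under eq_fun do rewrite sum3.
  refine (dv_eq (dv_add (dv_add (dv_cmul _ (dc 0)) (dv_cmul _ (dc 1)))
     (dv_cmul _ (dc 2))) _).
  case: i {dc x0E dd e0 dn df0 df} => -[|[|[|//]]] ?.
  - by rewrite (_ : Ordinal _ = 0) /=; [rewrite !(mulr1, mulr0) !addr0|exact: val_inj].
  - by rewrite (_ : Ordinal _ = 1) /=; [rewrite !(mulr1, mulr0) !addr0 add0r|exact: val_inj].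
  - by rewrite (_ : Ordinal _ = 2) /=; [rewrite !(mulr1, mulr0) !add0r|exact: val_inj].
under eq_fun do rewrite mxE.
refine (dv_eq (dv_mul df dl) _).
congr (_ * _ + _ * _); last by rewrite /euclid_norm e0.
by apply: eq_bigr => l _; rewrite x0E.
Qed.

(** The term in [f r] comes from differentiating x^k in the bivector, the radial term from
    differentiating f(|x|). *)
Definition gauge_eta (r : R) x (eta b db : vec R) : vec R :=
  vadd db (vadd (vscale (f r) (cross eta b))
                (vscale (f' r / r * dot (cross eta b) x) x)).

Lemma radial_gauge_sum (x eta b : 'rV[R]_3) i : 0 < dot (vrow x) (vrow x) ->
  \sum_j \sum_k 'D_(delta_mx 0 i) (fun z => alpha z j k) x * eta 0 j * b 0 k =
  rowv (vadd (vscale (f (vnorm (vrow x))) (cross (vrow eta) (vrow b)))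
    (vscale (f' (vnorm (vrow x)) / vnorm (vrow x) * dot (cross (vrow eta) (vrow b)) (vrow x))
       (vrow x))) 0 i.
Proof.
move=> x0; have := vnorm_gt0 x0.
under eq_bigr do under eq_bigr do rewrite radial_derive//.
rewrite !mxE !sum3 /levi_civita /dot /=.
move: (vnorm (vrow x)) => r r0; move: (f r) (f' r) => F F'.
case: i => -[|[|[|//]]] ? /=; rewrite !val3.
- by rewrite (_ : Ordinal _ = 0) /=; [field; rewrite gt_eqF|exact: val_inj].
- by rewrite (_ : Ordinal _ = 1) /=; [field; rewrite gt_eqF|exact: val_inj].
- by rewrite (_ : Ordinal _ = 2) /=; [field; rewrite gt_eqF|exact: val_inj].
Qed.

(** The gauge parameter is traded for a function with two-sided derivatives at the ends, and the
    index formulas for cross products, so that the rules for [vder] apply. *)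
Lemma gauge_vectorP p v : (forall u, itv01 u -> 0 < dot (fpos p u) (fpos p u)) ->
  gauge_vector alpha p v <-> exists b db : R -> vec R,
  [/\ forall u, itv01 u -> vder b u (db u), vwithin db, b 0 = V3 0 0 0, b 1 = V3 0 0 0
    & forall u, itv01 u ->
      fpos v u = vscale (f (vnorm (fpos p u))) (cross (fpos p u) (b u)) /\
      feta v u = gauge_eta (vnorm (fpos p u)) (fpos p u) (feta p u) (b u) (db u)].
Proof.
move=> p0.
have anti c x y : vscale c (cross x y) = vscale (-1) (vscale c (cross y x)).
  by apply: V3_eq; rewrite /=; ring.
have rowN a i : rowv (vscale (-1) a) 0 i = - rowv a 0 i.
  by rewrite !mxE; do 2?case: ifP => _; rewrite /= mulN1r.
have rowD a c i : rowv (vadd a c) 0 i = rowv a 0 i + rowv c 0 i.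
  by rewrite !mxE; do 2?case: ifP.
have z3 : vrow (0 : 'rV[R]_3) = V3 0 0 0 by rewrite /vrow !mxE.
split.
- move=> [beta [b0 b1 vE]].
  exists (fun u => vrow (beta (clamp u) + (u - clamp u) *: velocity beta (clamp u))).
  exists (fun u => vrow (velocity beta u)).
  have bE u : itv01 u -> vrow (beta (clamp u) + (u - clamp u) *: velocity beta (clamp u)) =
      vrow (beta u) by move=> iu; rewrite clamp_id// subrr scale0r addr0.
  split.
  + by move=> u iu; apply: row_is_derive; exact: C1_ext_is_derive.
  + exact: (fvel_within ((beta, 0) : Fld)).
  + by rewrite bE ?b0//; exact: itv01_0.
  + by rewrite bE ?b1//; exact: itv01_1.
  + move=> u iu; rewrite bE//; have vEu := vE u iu.
    split; apply: (can_inj rowvK); rewrite vrowK; apply/rowP => i.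
      by have [-> _] := vEu i; rewrite radial_sum anti rowN opprK.
    have [_ ->] := vEu i; rewrite (radial_gauge_sum _ _ _ (p0 u iu)) -[velocity beta u]vrowK.
    by rewrite /gauge_eta [in RHS]rowD rowvK.
- move=> [b [db [dbE cdb b0 b1 vE]]]; exists (mkC1 (V3 0 0 0) db).
  have bE u : itv01 u -> vadd (V3 0 0 0) (vprim db u) = b u by exact: vprim_unique.
  have mE u : itv01 u -> mkC1 (V3 0 0 0) db u = rowv (b u).
    by move=> iu; rewrite mkC1E// bE.
  split.
  + by rewrite mE ?b0 -?z3 ?vrowK//; exact: itv01_0.
  + by rewrite mE ?b1 -?z3 ?vrowK//; exact: itv01_1.
  + move=> u iu i; have [e1 e2] := vE u iu; split.
      by rewrite radial_sum mE// rowvK -rowN -anti -[v.1 u]vrowK -/(fpos v u) e1.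
    rewrite (radial_gauge_sum _ _ _ (p0 u iu)) mkC1_velocity// mE// rowvK.
    rewrite -[v.2 u]vrowK -/(feta v u) e2 /gauge_eta [in LHS]rowD.
    by [].
Qed.

End Target.

(** * Configurations given by a path of unit quaternions *)

Section DerivativeUniqueness.
Context {R : realType}.

(** A two-sided derivative at a point of [0,1] is determined by the values on [0,1]; thus different
    extensions past the ends lead to the same derivative. *)
Lemma der01_eq0 (g : R -> R) (u d : R) : (forall s, itv01 s -> g s = 0) -> itv01 u ->
  is_derive u 1 g d -> d = 0.
Proof.
move=> g0 iu /[dup] dg /(@is_derive_within _ _ _ itv01) lim.
apply/eqP; rewrite -normr_le0 leNgt; apply/negP => d0.
move/cvgrPdist_lt: lim => /(_ _ d0); rewrite near_withinE => /nbhs_ballP[r r0 rl].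
have /itv01P/andP[u0 u1] := iu.
pose h := Num.min (r / 2) (1 / 2).
have h0 : 0 < h by rewrite lt_min !divr_gt0.
have hr : h < r by rewrite gt_min ltr_pdivrMr// ltr_pMr// ltr1n.
have h2 : h <= 1 / 2 by rewrite ge_min lexx orbT.
(* A step towards the interior, so that w stays in [0,1] also when u is an end. *)
pose w := if u <= 1 / 2 then u + h else u - h.
have iw : itv01 w.
  by apply/itv01P; rewrite /w; case: ifP => [|/negbT]; rewrite -?ltNge => ?; apply/andP; lra.
have := rl w; rewrite -ball_normE /= (g0 u iu) (g0 w iw) subrr scaler0 subr0 ltxx.
have e : `|u - w| = h.
  rewrite /w; case: ifP => _; last by rewrite opprB addrCA subrr addr0 gtr0_norm.
  by rewrite opprD addrA subrr sub0r normrN gtr0_norm.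
rewrite e => hh; have := hh hr _ iw; rewrite -subr_eq0 -normr_gt0 distrC e h0.
by move=> /(_ isT).
Qed.

Lemma der01_unique (g k : R -> R) (u d e : R) : (forall s, itv01 s -> g s = k s) -> itv01 u ->
  is_derive u 1 g d -> is_derive u 1 k e -> d = e.
Proof.
move=> gk iu dg dk; apply/eqP; rewrite -subr_eq0; apply/eqP.
by apply: der01_eq0 iu (dv_sub dg dk) => s is'; rewrite gk// subrr.
Qed.

Lemma dv_unique (g : R -> R) (u d e : R) : is_derive u 1 g d -> is_derive u 1 g e -> d = e.
Proof. by case=> _ <- [_ <-]. Qed.

Lemma vder_unique (X : R -> vec R) (u : R) d e : vder X u d -> vder X u e -> d = e.
Proof.
case: d e => a b c [a' b' c'] [/= d1 d2 d3] [/= e1 e2 e3].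
by apply: V3_eq; [exact: dv_unique d1 e1|exact: dv_unique d2 e2|exact: dv_unique d3 e3].
Qed.

Lemma vder01_unique (X Y : R -> vec R) (u : R) d e : (forall s, itv01 s -> X s = Y s) ->
  itv01 u -> vder X u d -> vder Y u e -> d = e.
Proof.
case: d e => a b c [a' b' c'] XY iu [/= d1 d2 d3] [/= e1 e2 e3].
by apply: V3_eq; [apply: der01_unique d1 e1|apply: der01_unique d2 e2|apply: der01_unique d3 e3];
  rewrite // => s is'; rewrite XY.
Qed.

Lemma qder01_unique (P Q : R -> quat R) (u : R) d e : (forall s, itv01 s -> P s = Q s) ->
  itv01 u -> qder P u d -> qder Q u e -> d = e.
Proof.
case: d e => a b c d [a' b' c' d'] XY iu [/= d1 d2 d3 d4] [/= e1 e2 e3 e4].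
by apply: Q4_eq; [apply: der01_unique d1 e1|apply: der01_unique d2 e2|
  apply: der01_unique d3 e3|apply: der01_unique d4 e4]; rewrite // => s is'; rewrite XY.
Qed.

Lemma unit_orth (Q : R -> quat R) (u : R) d : (forall s, itv01 s -> qn2 (Q s) = 1) -> itv01 u ->
  qder Q u d -> qdot (Q u) d = 0.
Proof.
move=> Q1 iu dQ; have := der01_unique Q1 iu (dv_qdot dQ dQ) (dv_cst u 1).
by rewrite /qdot; lra.
Qed.

(** Vanishing curvature: for a two-parameter family of unit quaternions with angular velocity w in u
    and b in t, one has dw/dt = db/du + w x b. Here [d] is the velocity in u, [p] the velocity in t
    and [e] the mixed derivative. *)
Lemma vel_commutator (q p d e : quat R) : qn2 q = 1 -> qdot q p = 0 -> qdot q d = 0 ->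
  vscale 2 (qim (qadd (qmul (qconj p) d) (qmul (qconj q) e))) =
  vadd (vscale 2 (qim (qadd (qmul (qconj d) p) (qmul (qconj q) e)))) (cross (vel q d) (vel q p)).
Proof.
move=> q1 qp qd; rewrite -{1 2}(half_vel q1 qp) -{1 2}(half_vel q1 qd).
move: (vel q p) (vel q d) => b w.
transitivity (vadd (vscale 2 (qim (qadd (qmul (qconj (qhalf q w)) (qhalf q b)) (qmul (qconj q) e))))
   (vscale (qn2 q) (cross w b))); last first.
  by rewrite q1; congr vadd; rewrite /vscale /=; apply: V3_eq; rewrite /= mul1r.
by rewrite /qhalf /qn2 /qdot; apply: V3_eq; rewrite /=; field.
Qed.

End DerivativeUniqueness.

Lemma qcls_qwithin (R : realType) (E : normedModType R) (U : set E) n J (Q : @qfamily R E) x v :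
  qcls U n J Q -> U x -> qwithin (Q x v).
Proof.
move=> [h1 h2 h3 h4] Ux; split; [exact (@cls_within _ _ _ _ _ (cls_cls0 h1) x v Ux)
  |exact (@cls_within _ _ _ _ _ (cls_cls0 h2) x v Ux)
  |exact (@cls_within _ _ _ _ _ (cls_cls0 h3) x v Ux)
  |exact (@cls_within _ _ _ _ _ (cls_cls0 h4) x v Ux)].
Qed.

Section Theta.
Context {R : realType} (f : R -> R).
Hypothesis f_smooth : forall (n : nat) (r : R), 0 < r -> derivable (f^`(n))%classic r 1.
Hypothesis f_neq0 : forall r : R, 0 < r -> f r != 0.

Local Notation Fld := (@fields R 3).
Local Notation M := [set x : 'rV[R]_3 | x != 0].
Local Notation alpha := (radial_bivector f).
Local Notation f' := (f' f).
Local Notation h' := (h' f).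
Implicit Types (x y w b X : vec R) (q dq : R -> quat R).

Definition kappa (r : R) : R := - f' r / (f r ^+ 2 * r).

(** For the velocity X x w, the solution equation fixes eta up to a multiple of X. This multiple is
    split into a part determined by w and a free part [m]. *)
Definition theta_eta (r : R) X w (m : R) : vec R :=
  vadd (vscale (1 / f r) w) (vscale (kappa r * dot w X + m) X).

Definition theta_der (r : R) X dX w dw (m dm : R) : vec R :=
  vadd (vscale (1 / f r) dw) (vadd (vscale (kappa r * (dot dw X + dot w dX) + dm) X)
    (vscale (kappa r * dot w X + m) dX)).

Lemma theta_vder (r : R) (X w : R -> vec R) (m : R -> R) (u : R) dX dw (dm : R) :
  vder X u dX -> vder w u dw -> is_derive u 1 m dm ->
  vder (fun s => theta_eta r (X s) (w s) (m s)) u (theta_der r (X u) dX (w u) dw (m u) dm).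
Proof.
move=> hX hw hm.
refine (vder_eq (vder_add (vder_smul (dv_cst u (1 / f r)) hw)
  (vder_smul (dv_add (dv_cmul (kappa r) (dv_dot hw hX)) hm) hX)) _).
by rewrite /theta_der /vadd /vscale; apply: V3_eq; rewrite /=; ring.
Qed.

(* The radial coefficient [kappa] is the one for which the family [theta_eta]
   is stable under gauge transformations. *)
Lemma theta_gauge (r : R) X w b db (m nu dnu : R) : 0 < r ->
  theta_der r X (cross X b) w (vadd db (cross w b)) m dnu =
  gauge_eta f r X (theta_eta r X w m) (theta_eta r X b nu)
    (theta_der r X (cross X w) b db nu dnu).
Proof.
move=> r0; have r1 : r != 0 by rewrite gt_eqF.
rewrite /theta_der /gauge_eta /theta_eta /kappa; have := f_neq0 r0.
move: (f r) (f' r) => F F' F0; case: X w b db => [x0 x1 x2] [w0 w1 w2] [b0 b1 b2] [d0 d1 d2].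
by rewrite /vadd /vscale /dot /cross; apply: V3_eq; rewrite /=; field; rewrite r1 F0.
Qed.

Lemma cross_theta (r : R) X w b (m nu : R) : 0 < r ->
  vscale (f r) (cross X (theta_eta r X w m)) = cross X w.
Proof.
move=> r0; rewrite /theta_eta; have := f_neq0 r0.
move: (f r) (kappa r) => F K F0; case: X w => [x0 x1 x2] [w0 w1 w2].
by rewrite /vadd /vscale /dot /cross; apply: V3_eq; rewrite /=; field.
Qed.

(* The configuration with [X = q^-1 x q] and angular velocity [vel q dq]; the
   function [m] is the part of the radial component of eta that [q] leaves free. *)
Definition Theta x (q dq : R -> quat R) (m : R -> R) : Fld :=
  mkF (qrot (q 0) x) (fun u => cross (qrot (q u) x) (vel (q u) (dq u)))
    (fun u => theta_eta (vnorm x) (qrot (q u) x) (vel (q u) (dq u)) (m u)).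

Definition unit_path (q dq : R -> quat R) :=
  qc1 q dq /\ forall u, itv01 u -> qn2 (q u) = 1.

Lemma qrot_vder (Q : R -> quat R) (t : R) d x : qn2 (Q t) = 1 -> qdot (Q t) d = 0 -> qder Q t d ->
  vder (fun s => qrot (Q s) x) t (cross (qrot (Q t) x) (vel (Q t) d)).
Proof.
move=> q1 orth; rewrite -{1}(half_vel q1 orth) => dQ.
refine (vder_eq (vder_rot dQ (vder_cst t x)) _); case: cross => a b c.
by rewrite /vadd /qrot; apply: V3_eq; rewrite /=; ring.
Qed.

Lemma unit_path_rot q dq x u : unit_path q dq -> itv01 u ->
  vder (fun s => qrot (q s) x) u (cross (qrot (q u) x) (vel (q u) (dq u))).
Proof.
by move=> [[dQ _] q1] iu; apply: qrot_vder; [exact: q1|exact: unit_orth (dQ u iu)|exact: dQ].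
Qed.

Lemma qwithin_rot (q : R -> quat R) x : qwithin q -> vwithin (fun u => qrot (q u) x).
Proof.
move=> cq; have [_ c1 c2 c3] := qwithin_mul (qwithin_mul (qwithin_conj cq)
  (qwithin_vec (vwithin_cst x))) cq.
by split.
Qed.

Lemma unit_path_within q dq x : unit_path q dq ->
  vwithin (fun u => vel (q u) (dq u)) /\
  vwithin (fun u => cross (qrot (q u) x) (vel (q u) (dq u))).
Proof.
move=> [[dQ cd] _]; have cq := qder_qwithin dQ.
by split; [|apply: vwithin_cross; first exact: qwithin_rot]; exact: vwithin_vel.
Qed.

Lemma theta_eta_within (r : R) (X w : R -> vec R) (m : R -> R) : vwithin X -> vwithin w ->
  {within itv01, continuous m} -> vwithin (fun u => theta_eta r (X u) (w u) (m u)).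
Proof.
move=> cX cw cm; apply: vwithin_add; apply: vwithin_smul => //; first exact: within01_cst.
by apply: within01D => //; apply: within01M; [exact: within01_cst|exact: within_dot].
Qed.

Lemma ThetaE x q dq m u : unit_path q dq -> {within itv01, continuous m} -> itv01 u ->
  let X := qrot (q u) x in let w := vel (q u) (dq u) in
  [/\ fpos (Theta x q dq m) u = X, fvel (Theta x q dq m) u = cross X w
    & feta (Theta x q dq m) u = theta_eta (vnorm x) X w (m u)].
Proof.
move=> uq cm iu /=; have [cw cXw] := unit_path_within x uq.
split; first 1 last.
- by rewrite mkF_vel.
- by rewrite mkF_eta//; apply: theta_eta_within => //; apply/qwithin_rot/qder_qwithin/uq.1.1.
rewrite (mkF_pos _ _ cXw iu).
apply: (@vprim_unique _ _ (fun s => qrot (q s) x)); [|exact: cXw|by []|exact: iu].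
by move=> s is'; exact: unit_path_rot.
Qed.

Lemma vnorm_rot (q : quat R) x : qn2 q = 1 -> vnorm (qrot q x) = vnorm x.
Proof. by move=> q1; rewrite /vnorm dot_rot q1 expr1n mul1r. Qed.

Lemma Theta_solutions x q dq m : unit_path q dq -> {within itv01, continuous m} ->
  0 < dot x x -> solutions M alpha (Theta x q dq m).
Proof.
move=> uq cm x0; apply/solutionsP => u iu; have [-> -> ->] := ThetaE x uq cm iu.
rewrite dot_rot uq.2// expr1n mul1r; split=> //.
by rewrite vnorm_rot ?uq.2// cross_theta// vnorm_gt0.
Qed.

Lemma unit_path_unique q dq q' dq' : unit_path q dq -> unit_path q' dq' ->
  (forall u, itv01 u -> q u = q' u) -> forall u, itv01 u -> dq u = dq' u.
Proof.
by move=> [[d _] _] [[d' _] _] e u iu; exact: qder01_unique e iu (d u iu) (d' u iu).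
Qed.

Lemma Theta_eq x q dq m q' dq' m' : unit_path q dq -> unit_path q' dq' ->
  {within itv01, continuous m} ->
  (forall u, itv01 u -> q u = q' u) -> (forall u, itv01 u -> m u = m' u) ->
  Theta x q dq m = Theta x q' dq' m'.
Proof.
move=> uq uq' cm eq em; have cm' := within_eq em cm.
have ed := unit_path_unique uq uq' eq.
by apply: fields_eq => u iu; have [a1 a2 a3] := ThetaE x uq cm iu;
  have [b1 b2 b3] := ThetaE x uq' cm' iu; rewrite ?a1 ?a2 ?a3 ?b1 ?b2 ?b3 ?eq// ?ed// em.
Qed.

Lemma qmixed_partials (Q dQ : R -> R -> quat R) (t : R) :
  qcls [set: R] 1 [::] (fun t _ => Q t) -> qcls [set: R] 1 [::] (fun t _ => dQ t) ->
  (forall t u, itv01 u -> qder (Q t) u (dQ t u)) ->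
  exists Qt Qtu : R -> quat R, qwithin Qtu /\ forall u, itv01 u ->
    [/\ qder (fun s => Q s u) t (Qt u), qder Qt u (Qtu u) & qder (fun s => dQ s u) t (Qtu u)].
Proof.
move=> [q1 q2 q3 q4] [d1 d2 d3 d4] dQE.
have oT : open [set: R] := openT.
have [a1 [b1 [c1 h1]]] := mixed_partials oT q1 d1
  (fun t _ u iu => let: And4 d _ _ _ := dQE t u iu in d) (I : [set: R] t).
have [a2 [b2 [c2 h2]]] := mixed_partials oT q2 d2
  (fun t _ u iu => let: And4 _ d _ _ := dQE t u iu in d) (I : [set: R] t).
have [a3 [b3 [c3 h3]]] := mixed_partials oT q3 d3
  (fun t _ u iu => let: And4 _ _ d _ := dQE t u iu in d) (I : [set: R] t).
have [a4 [b4 [c4 h4]]] := mixed_partials oT q4 d4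
  (fun t _ u iu => let: And4 _ _ _ d := dQE t u iu in d) (I : [set: R] t).
exists (fun u => Q4 (a1 u) (a2 u) (a3 u) (a4 u)), (fun u => Q4 (b1 u) (b2 u) (b3 u) (b4 u)).
split=> [|u iu]; first by split.
have [? ? ?] := h1 u iu; have [? ? ?] := h2 u iu; have [? ? ?] := h3 u iu.
by have [? ? ?] := h4 u iu.
Qed.

Lemma qder_unique (X : R -> quat R) (u : R) d e : qder X u d -> qder X u e -> d = e.
Proof.
case: d e => a b c d [a' b' c' d'] [/= d1 d2 d3 d4] [/= e1 e2 e3 e4].
by apply: Q4_eq; [exact: dv_unique d1 e1|exact: dv_unique d2 e2|exact: dv_unique d3 e3|
  exact: dv_unique d4 e4].
Qed.

Lemma theta0 (r : R) X : theta_eta r X (V3 0 0 0) 0 = V3 0 0 0.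
Proof. by rewrite /theta_eta /vadd /vscale /dot; apply: V3_eq; rewrite /=; ring. Qed.

Lemma vel0 (q : quat R) : vel q qzero = V3 0 0 0.
Proof. by rewrite /vel /vscale; apply: V3_eq; rewrite /=; ring. Qed.

(** The gauge parameter at time t is [theta_eta] of the angular velocity in the t-direction and of
    the t-derivative of the primitive of m. It vanishes at both ends, because Q is fixed there and
    the integral of m over [0,1] does not change. *)
Lemma theta_path x (Q dQ : R -> R -> quat R) (m : R -> R -> R) : 0 < dot x x ->
  qcls [set: R] 2 [::] (fun t _ => Q t) -> qcls [set: R] 2 [::] (fun t _ => dQ t) ->
  cls [set: R] 2 [::] (fun t _ => m t) ->
  (forall t u, itv01 u -> qn2 (Q t u) = 1) ->
  (forall t u, itv01 u -> qder (Q t) u (dQ t u)) ->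
  (forall t, Q t 0 = Q 0 0) -> (forall t, Q t 1 = Q 0 1) ->
  (forall t, prim (m t) 1 = prim (m 0) 1) ->
  same_leaf M alpha (Theta x (Q 0) (dQ 0) (m 0)) (Theta x (Q 1) (dQ 1) (m 1)).
Proof.
move=> x0 cQ cdQ cm Q1 dQE e0 e1 em.
have oT : open [set: R] := openT.
have r0 := vnorm_gt0 x0; pose r := vnorm x.
have i0 : itv01 (0 : R) := itv01_0; have i1 : itv01 (1 : R) := itv01_1.
have cmt t : {within itv01, continuous (m t)}.
  exact (@cls_within _ _ _ _ _ (cls_cls0 cm) t (fun=> 0) I).
have uQ t : unit_path (Q t) (dQ t).
  split; last by move=> u iu; exact: Q1.
  split; first by move=> u iu; exact: dQE.
  exact (@qcls_qwithin _ _ _ _ _ _ t (fun=> 0) cdQ I).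
have cX : vcls [set: R] 2 [::] (fun t _ u => qrot (Q t u) x).
  by apply: vcls_rot => //; apply: vcls_cst => //; exact: vwithin_cst.
have cw : vcls [set: R] 2 [::] (fun t _ u => vel (Q t u) (dQ t u)) by exact: vcls_vel.
have cPsi : vcls [set: R] 2 [::]
    (fun t _ u => theta_eta r (qrot (Q t u) x) (vel (Q t u) (dQ t u)) (m t u)).
  apply: vcls_add; apply: vcls_smul => //; first exact: cls_const.
  by apply: cls_add => //; apply: cls_mul0; [exact: cls_const|exact: cls_dot].
have [Gam GamP] := family_curve_path oT cX (vcls_cross oT cX cw) cPsi (fun _ _ => I).
have GamE t : family_curve (fun t _ u => qrot (Q t u) x)
    (fun t _ u => cross (qrot (Q t u) x) (vel (Q t u) (dQ t u)))
    (fun t _ u => theta_eta r (qrot (Q t u) x) (vel (Q t u) (dQ t u)) (m t u)) t =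
    Theta x (Q t) (dQ t) (m t) by [].
exists Gam; split; [by have [-> _] := GamP 0 i0|by have [-> _] := GamP 1 i1|].
move=> t it; have [-> dG] := GamP t it; rewrite GamE.
split; first exact: Theta_solutions.
have Tx (s u : R) (iu : itv01 u) := ThetaE x (uQ s) (cmt s) iu.
apply/(gauge_vectorP f_smooth) => [u iu|].
  by have [-> _ _] := Tx t u iu; rewrite dot_rot Q1// expr1n mul1r.
have [Qt [Qtu [cQtu QtP]]] := qmixed_partials t
  (let: And4 a b c d := cQ in And4 (cls_pred a) (cls_pred b) (cls_pred c) (cls_pred d))
  (let: And4 a b c d := cdQ in And4 (cls_pred a) (cls_pred b) (cls_pred c) (cls_pred d)) dQE.
have [nu [nu' [cnu' nuP]]] := mixed_partials oT (cls_prim (cls_pred cm)) (cls_pred cm)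
  (fun t _ => prim_der (cmt t)) (I : [set: R] t).
have orth u (iu : itv01 u) : qdot (Q t u) (Qt u) = 0.
  have [d _ _] := QtP u iu; have := dv_unique (dv_qdot d d).
  have e : (fun s : R => qdot (Q s u) (Q s u)) = (fun=> 1).
    by apply/funext => s; exact: Q1.
  by rewrite e => /(_ _ (dv_cst t 1)); rewrite /qdot; lra.
have orthd u (iu : itv01 u) : qdot (Q t u) (dQ t u) = 0.
  exact: (unit_orth (uQ t).2 iu (dQE t u iu)).
pose bq u := vel (Q t u) (Qt u).
pose bq' u := vscale 2 (qim (qadd (qmul (qconj (dQ t u)) (Qt u)) (qmul (qconj (Q t u)) (Qtu u)))).
have Qt0 u : (forall s, Q s u = Q 0 u) -> itv01 u -> Qt u = qzero.
  move=> es iu; have [d _ _] := QtP u iu; apply: (qder_unique d).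
  have -> : (fun s : R => Q s u) = (fun=> Q 0 u) by apply/funext.
  exact: qder_cst.
have nu0 u : (forall s, prim (m s) u = prim (m 0) u) -> itv01 u -> nu u = 0.
  move=> es iu; have [d _ _] := nuP u iu; apply: (dv_unique d).
  have -> : (fun s : R => prim (m s) u) = (fun=> prim (m 0) u) by apply/funext.
  exact: dv_cst.
exists (fun u => theta_eta r (qrot (Q t u) x) (bq u) (nu u)).
exists (fun u => theta_der r (qrot (Q t u) x) (cross (qrot (Q t u) x) (vel (Q t u) (dQ t u)))
   (bq u) (bq' u) (nu u) (nu' u)).
have dQt u (iu : itv01 u) : qder Qt u (Qtu u) by have [] := QtP u iu.
have cq := qder_qwithin (uQ t).1.1; have cQt := qder_qwithin dQt.
have cQX : vwithin (fun u => qrot (Q t u) x) by exact: qwithin_rot.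
have [cw' cXw] := unit_path_within x (uQ t).
have cbq : vwithin bq by exact: vwithin_vel.
have cnu : {within itv01, continuous nu}.
  by apply: cont01_within => u iu; have [_ d _] := nuP u iu; exact: dv_cont d.
split.
- move=> u iu; apply: theta_vder; first exact: unit_path_rot.
    by apply: vder_vel; [exact: dQE|exact: dQt].
  by have [] := nuP u iu.
- have cbq' : vwithin bq'.
    have [_ c1 c2 c3] := qwithin_add (qwithin_mul (qwithin_conj (uQ t).1.2) cQt)
      (qwithin_mul (qwithin_conj cq) cQtu).
    by split; apply: within01M => //; exact: within01_cst.
  apply: vwithin_add; first by apply: vwithin_smul => //; exact: within01_cst.
  apply: vwithin_add; apply: vwithin_smul => //; apply: within01D => //; apply: within01M;
    [exact: within01_cst| |exact: within01_cst|exact: within_dot].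
  by apply: within01D; exact: within_dot.
- by rewrite /bq Qt0// vel0 nu0 ?theta0// => s; rewrite !prim0.
- by rewrite /bq Qt0// vel0 nu0 ?theta0.
move=> u iu; have [-> _ ->] := Tx t u iu; rewrite vnorm_rot ?Q1//.
have [dQt1 _ dQt2] := QtP u iu.
have dXt : vder (fun s => qrot (Q s u) x) t (cross (qrot (Q t u) x) (bq u)).
  by apply: qrot_vder; [exact: Q1|exact: orth|].
split.
  rewrite cross_theta//; apply: (vder_unique (fpos_vder dG iu)).
  rewrite (_ : (fun s => _) = (fun s => qrot (Q s u) x))//.
  by apply/funext => s; rewrite GamE; have [-> _ _] := Tx s u iu.
(* The u-derivative of [nu] is the t-derivative of m, as [theta_gauge] requires by using one [dnu]
   on both sides. *)
rewrite -theta_gauge//; apply: (vder_unique (feta_vder dG iu)).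
rewrite (_ : (fun s => _) = (fun s => theta_eta r (qrot (Q s u) x) (vel (Q s u) (dQ s u)) (m s u)));
  last by apply/funext => s; rewrite GamE; have [_ _ ->] := Tx s u iu.
apply: theta_vder; [exact: dXt| |by have [] := nuP u iu].
exact (vder_eq (vder_vel dQt1 dQt2) (vel_commutator _ (Q1 t u iu) (orth u iu) (orthd u iu))).
Qed.

(* This is where the simple connectedness of the unit quaternions enters. *)
Lemma Theta_leaf x q dq q' dq' m m' : 0 < dot x x -> unit_path q dq -> unit_path q' dq' ->
  {within itv01, continuous m} -> {within itv01, continuous m'} ->
  q 0 = q' 0 -> q 1 = q' 1 -> prim m 1 = prim m' 1 ->
  same_leaf M alpha (Theta x q dq m) (Theta x q' dq' m').
Proof.
move=> x0 uq uq' cm cm' e0 e1 em.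
have oT : open [set: R] := openT.
have [Q [dQ [cQ cdQ Q1 dQE [Q0 Q1' Qs Qe]]]] :=
  sphere_homotopy uq.1 uq'.1 uq.2 uq'.2 e0 e1.
(* Linear interpolation keeps the integral over [0,1], as it is the same for m and m'. *)
pose mt (t u : R) := (1 - t) * m u + t * m' u.
have ct n : cls [set: R] n [::] (fun t _ _ => t).
  apply: cls_atom => //; split=> //; last by move=> t; exact: within01_cst.
  by exists 1 => // t u _; rewrite mul1r.
have cmt : cls [set: R] 2 [::] (fun t _ => mt t).
  apply: cls_add; apply: cls_mul0 => //; try exact: cls_cst.
  by apply: cls_sub => //; exact: cls_const.
have pm t : prim (mt t) 1 = prim m 1.
  have Z (c : R) (g : R -> R) : {within itv01, continuous g} ->
    {within itv01, continuous (fun u => c * g u)}.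
    by move=> cg; apply: within01M => //; exact: within01_cst.
  rewrite /mt primD; [|exact: Z|exact: Z|exact: itv01_1].
  by rewrite !primZ//; [rewrite -em; ring|exact: itv01_1|exact: itv01_1].
have uQ t : unit_path (Q t) (dQ t).
  split; last by move=> u iu; exact: Q1.
  split; first by move=> u iu; exact: dQE.
  exact (@qcls_qwithin _ _ _ _ _ _ t (fun=> 0) (cdQ 0%N) I).
have := theta_path x0 (cQ 2%N) (cdQ 2%N) cmt Q1 dQE.
rewrite (@Theta_eq x q dq m (Q 0) (dQ 0) (mt 0))//; last 2 first.
- by move=> u iu; rewrite Q0.
- by move=> u iu; rewrite /mt subr0 mul1r mul0r addr0.
rewrite (@Theta_eq x q' dq' m' (Q 1) (dQ 1) (mt 1))//; last 2 first.
- by move=> u iu; rewrite Q1'.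
- by move=> u iu; rewrite /mt subrr mul1r mul0r add0r.
apply => t; first by rewrite !Qs.
  by rewrite !Qe.
by rewrite !pm.
Qed.

End Theta.

(** * An open subset of R^n as a manifold with one chart *)

Lemma near_addl (R : realType) (V : normedModType R) (U : set V) x : open U -> U x ->
  \forall h \near (0 : V), U (x + h).
Proof.
move=> oU Ux; have : (x + h) @[h --> (0 : V)] --> x + 0.
  by apply: cvgD; [exact: cvg_cst|exact: cvg_id].
by rewrite addr0 => /(_ U); apply; exact: open_nbhs_nbhs.
Qed.

Section OpenManifold.
Context {R : realType} {n : nat}.
Variable A : set 'rV[R]_n.
Hypothesis oA : open A.
Variable y0 : A.

Let incl (y : A) : 'rV[R]_n := set_val y.

(** [y0] is a default value outside A. It is needed because the projection to the phase space is a
    function on all fields, of which only the values on solutions matter. *)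
Definition retract (x : 'rV[R]_n) : A :=
  if pselect (A x) is left h then exist _ x (mem_set h) else y0.

Lemma inclP y : A (incl y).
Proof. exact: set_mem (valP y). Qed.

Lemma retractK x : A x -> incl (retract x) = x.
Proof. by rewrite /retract; case: pselect. Qed.

Lemma inclK : cancel incl retract.
Proof. by move=> y; apply: val_inj; rewrite [LHS]retractK//; exact: inclP. Qed.

Lemma rational_approximation (x : 'rV[R]_n) (e : R) : 0 < e ->
  exists q : 'rV[rat]_n, `|x - map_mx ratr q| < e.
Proof.
move=> e0; have e2 : 0 < e / 2 by rewrite divr_gt0.
have h i : exists q : rat, `|x 0 i - ratr q| <= e / 2.
  have /rat_in_itvoo[q] : x 0 i - e / 2 < x 0 i + e / 2 by rewrite ltrD2l gtrN.
  rewrite in_itv/= => /andP[q1 q2]; exists q; rewrite ler_norml; apply/andP; lra.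
have [q qE] := choice h; exists (\row_i q i).
apply: (@le_lt_trans _ _ (e / 2)); last by rewrite ltr_pdivrMr// ltr_pMr// ltr1n.
by apply: row_norm_le => [|i]; [exact: ltW|rewrite !mxE].
Qed.

(** The base consists of traces of balls with rational centre and radius. Inside a ball of radius e
    around a point, a rational radius between e/4 and e/2 and a rational centre within e/4 of the
    point will do. *)
Lemma set_type_second_countable : @second_countable A.
Proof.
pose ball_of (qe : 'rV[rat]_n * rat) : set A :=
  incl @^-1` ball (map_mx (@ratr R) qe.1) (ratr qe.2).
exists (range ball_of).
  by apply: (card_le_trans (card_image_le _ _)); exact: countableP.
split.
  move=> _ [[q d] _ <-]; exists (ball (map_mx (@ratr R) q) (ratr d)) => //.
  have [d0|d0] := ltP 0 (ratr d : R); first exact: ball_open.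
  rewrite (_ : ball _ _ = set0) ?open0//; apply/seteqP; split=> // x.
  by rewrite -ball_normE /= => /lt_le_trans/(_ d0); rewrite normr_lt0.
move=> y V [_ [[W oW <-] Wy] WV].
have /nbhs_ballP[e e0 eW] := open_nbhs_nbhs (conj oW Wy).
have /rat_in_itvoo[d] : e / 4 < e / 2.
  by rewrite ltr_pM2l// ltf_pV2 ?posrE// ltr_nat.
rewrite in_itv/= => /andP[d1 d2]; have d0 : 0 < e / 4 by rewrite divr_gt0.
have [q qy] := rational_approximation (incl y) d0.
exists (ball_of (q, d)).
  split; first by exists (q, d).
  by rewrite /ball_of /= -ball_normE /= distrC (lt_trans qy).
move=> z; rewrite /ball_of /= -ball_normE /= => qz; apply: WV; apply: eW.
rewrite -ball_normE /=; apply: le_lt_trans (ler_distD (map_mx ratr q) _ _) _.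
by rewrite (@lt_trans _ _ (e / 4 + e / 2)) ?ltrD ?(lt_trans qz)//; lra.
Qed.

Lemma set_type_hausdorff : hausdorff_space A.
Proof.
move=> x z clxz; apply: val_inj => /=; apply: (@norm_hausdorff R 'rV[R]_n).
move=> B C /= nB nC.
have cont := @initial_continuous A 'rV[R]_n set_val.
have [y [By Cy]] := clxz _ _ (cont x B nB) (cont z C nC).
by exists (incl y).
Qed.

Definition inclusion_chart : chart A n := Chart setT incl retract.

Lemma inclusion_img : incl @` [set: A] = A.
Proof.
apply/seteqP; split=> [_ [y _ <-]|x Ax]; first exact: inclP.
by exists (retract x) => //; exact: retractK.
Qed.

Lemma inclusion_is_chart : is_chart inclusion_chart.
Proof.
split => /=; rewrite /chart_img /= ?inclusion_img//.
- exact: openT.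
- by move=> y _; exact: inclK.
- by apply: continuous_subspaceT => y; exact: initial_continuous.
- apply/subspace_sigL_continuousP; rewrite (_ : sigL A retract = id).
    by move=> y; exact: cvg_id.
  by apply/funext => y; exact: inclK.
Qed.

Lemma inclusion_smooth : smooth_on A (incl \o retract).
Proof.
split=> //; exists (fun x s => match s with [::] => incl (retract x) | [:: v] => v | _ => 0 end).
split.
- by [].
- move=> x Ax [|v1 [|v2 s]] [|u1 t] a v w //=; rewrite ?scaler0 ?addr0//.
- move=> x Ax k; exists (`|incl (retract x)| + 1) => -[|v [|w s]] //= _.
  + by rewrite big_nil mulr1 lerDl.
  + by rewrite big_seq1 ler_peMl// lerDr.
  + by rewrite normr0 mulr_ge0 ?addr_ge0// prodr_ge0.
- move=> x Ax k e e0; have nA := near_addl oA Ax.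
  apply: filterS nA => h Axh [|v [|w s]] //= _.
  + by rewrite !retractK// addrAC addrK subrr normr0 big_nil mulr1 mulr_ge0 ?(ltW e0).
  + by rewrite subrr subr0 normr0 !mulr_ge0 ?prodr_ge0// ltW.
  + by rewrite !subr0 normr0 !mulr_ge0 ?prodr_ge0// ltW.
Qed.

Definition open_manifold : smooth_manifold R.
Proof.
refine (@SmoothManifold _ A n [set inclusion_chart] set_type_hausdorff
  set_type_second_countable _ _ _).
- by move=> y; exists inclusion_chart.
- by move=> c ->; exact: inclusion_is_chart.
- move=> c d -> ->; rewrite setIid /= inclusion_img; exact: inclusion_smooth.
Defined.

End OpenManifold.

(** A complete invariant of the leaves with open image and surjective differential identifies the
    phase space with that image. *)
Lemma regular_phase_space (R : realType) (m n : nat) (M : set 'rV[R]_m)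
    (alpha : 'rV[R]_m -> 'M[R]_m) (A : set 'rV[R]_n) (U : set (@fields R m))
    (g : @fields R m -> 'rV[R]_n) :
  let S := solutions M alpha in
  open A -> A !=set0 -> smooth_on U g -> S `<=` U -> (forall p, S p -> A (g p)) ->
  (forall y, A y -> exists2 p, S p & g p = y) ->
  (forall p w, S p -> exists2 v, tangent S p v & 'd g p v = w) ->
  (forall p q, S p -> S q -> (g p = g q <-> same_leaf M alpha p q)) ->
  ~ singular_phase_space M alpha.
Proof.
move=> S oA [a Aa] gs SU gA gsurj gsub gfib; apply.
pose y0 : A := exist _ a (mem_set Aa).
exists (open_manifold oA y0), (fun p => retract y0 (g p)); split.
- move=> p Sp c -> _; exists U, g; split=> //; first exact: SU.
    by move=> q Sq Uq; split=> //=; rewrite retractK//; exact: gA.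
  by move=> w; exact: gsub.
- move=> y; have [p Sp pE] := gsurj _ (inclP y); exists p => //.
  by rewrite pE; exact: inclK.
- move=> p q Sp Sq; rewrite -gfib//; split=> [|->//].
  by move=> /(congr1 set_val); rewrite !retractK//; exact: gA.
Qed.

(** * Square roots and reciprocals of smooth functions *)

Section ScalarFamilies.
Context {R : realType} {E : normedModType R}.
Variable U : set E.
Hypothesis oU : open U.
Implicit Types (G : @mfamily R E) (g : E -> R).

Lemma cls_pos_comp (phi : nat -> R -> R) n k G :
  (forall k (s : R), 0 < s -> is_derive s 1 (phi k) (phi k.+1 s)) -> cls U n [::] G ->
  (forall x, U x -> exists r c : R, [/\ 0 < r, 0 < c &
    forall y, `|y - x| < r -> forall v u, itv01 u -> c <= G y v u]) ->
  cls U n [::] (fun x v u => phi k (G x v u)).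
Proof.
move=> dphi Gn Gpos; apply: (@cls_comp _ _ U phi [set s | 0 < s]) => //.
move=> x Ux; have [r [c [r0 c0 rG]]] := Gpos x Ux.
have [r' [K [r'0 K0 rK]]] := cls_bounded (cls_cls0 Gn) Ux.
exists (Num.min r r'), c, K; split; first by rewrite lt_min r0.
  by move=> s /=; rewrite in_itv/= => /andP[cs _]; exact: lt_le_trans cs.
move=> y; rewrite lt_min => /andP[yr /rK[_ yK]] v u iu; rewrite rG//=.
by have := yK v u iu; rewrite /pnorm big_nil mulr1; apply: le_trans; exact: ler_norm.
Qed.

(** The product of the factors 1/2 - i for i < k, so that [sqrt_tower k] is the k-th derivative of
    the square root. *)
Fixpoint sqrt_coef (k : nat) : R := if k is k'.+1 then (1 / 2 - k'%:R) * sqrt_coef k' else 1.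
Definition sqrt_tower (k : nat) (s : R) : R := sqrt_coef k * (Num.sqrt s * (s^-1) ^+ k).

Lemma sqrt_tower_der k (s : R) : 0 < s -> is_derive s 1 (sqrt_tower k) (sqrt_tower k.+1 s).
Proof.
move=> s0; have s1 : s != 0 by rewrite gt_eqF.
have di := dv_inv s1 (dv_id s).
have dX j : is_derive s 1 (fun x : R => (x^-1) ^+ j) (- j%:R * (s^-1) ^+ j.+1).
  elim: j => [|j IHj].
    by refine (dv_eq (dv_cst s 1) _); rewrite oppr0 mul0r.
  under eq_fun do rewrite exprS.
  refine (dv_eq (dv_mul di IHj) _); rewrite !exprS -natr1; field; exact: s1.
have ds : is_derive s 1 Num.sqrt (Num.sqrt s * s^-1 / 2).
  refine (dv_eq (is_derive1_sqrt s0) _).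
  rewrite -{3}(sqr_sqrtr (ltW s0)); field; by rewrite gt_eqF// sqrtr_gt0.
refine (dv_eq (dv_cmul (sqrt_coef k) (dv_mul ds (dX k))) _).
rewrite /sqrt_tower /= !exprS; field; exact: s1.
Qed.

Lemma cls_sqrt n G : cls U n [::] G ->
  (forall x, U x -> exists r c : R, [/\ 0 < r, 0 < c &
    forall y, `|y - x| < r -> forall v u, itv01 u -> c <= G y v u]) ->
  cls U n [::] (fun x v u => Num.sqrt (G x v u)).
Proof.
move=> Gn Gpos; have := cls_pos_comp 0 sqrt_tower_der Gn Gpos.
rewrite (_ : (fun x v u => sqrt_tower 0 (G x v u)) = (fun x v u => Num.sqrt (G x v u)))//.
apply/funext => x; apply/funext => v; apply/funext => u.
by rewrite /sqrt_tower /= expr0 mulr1 mul1r.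
Qed.

Definition scls g := forall n, cls U n [::] (fun x _ _ => g x).

Lemma scls_lower g : scls g -> (forall x, U x -> 0 < g x) ->
  forall x, U x -> exists r c : R, [/\ 0 < r, 0 < c &
    forall y, `|y - x| < r -> forall (v : nat -> E) (u : R), itv01 u -> c <= g y].
Proof.
move=> gs gpos x Ux; have [r [K [r0 K0 rK]]] := cls_lipschitz (gs 1%N) Ux.
have gx := gpos x Ux; have K1 : 0 < K + 1 by rewrite ltr_wpDl.
exists (Num.min r (g x / 2 / (K + 1))), (g x / 2); split.
- by rewrite lt_min r0 !divr_gt0.
- by rewrite divr_gt0.
move=> y; rewrite lt_min ltr_pdivlMr// => /andP[yr yK] _ _ _.
have := rK x y; rewrite subrr normr0 => /(_ r0 yr (fun=> 0) 0 itv01_0).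
rewrite /pnorm big_nil mulr1 => /ler_normlP[h _].
have : K * `|y - x| <= `|y - x| * (K + 1) by rewrite mulrC ler_wpM2l// lerDl.
by move: yK h; lra.
Qed.

Lemma scls_comp (phi : nat -> R -> R) k g :
  (forall k (s : R), 0 < s -> is_derive s 1 (phi k) (phi k.+1 s)) -> scls g ->
  (forall x, U x -> 0 < g x) -> scls (fun x => phi k (g x)).
Proof.
by move=> dphi gs gpos n; exact (cls_pos_comp k dphi (gs n) (scls_lower gs gpos)).
Qed.

Lemma scls_sqrt g : scls g -> (forall x, U x -> 0 < g x) -> scls (fun x => Num.sqrt (g x)).
Proof. by move=> gs gpos n; exact (cls_sqrt (gs n) (scls_lower gs gpos)). Qed.

Lemma scls_mul g1 g2 : scls g1 -> scls g2 -> scls (fun x => g1 x * g2 x).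
Proof. by move=> s1 s2 n; exact (cls_mul0 (s1 n) (s2 n)). Qed.

Lemma scls_add g1 g2 : scls g1 -> scls g2 -> scls (fun x => g1 x + g2 x).
Proof. by move=> s1 s2 n; exact (cls_add (s1 n) (s2 n)). Qed.

Lemma scls_opp g : scls g -> scls (fun x => - g x).
Proof. by move=> s n; exact (cls_opp oU (s n)). Qed.

Lemma scls_cst (c : R) : scls (fun=> c).
Proof. by move=> n; exact: cls_const. Qed.

(** The sign of g is unknown, while [cls_inv] requires a positive function; hence 1/g is written as
    g / g^2. *)
Lemma scls_inv g : scls g -> (forall x, U x -> g x != 0) -> scls (fun x => (g x)^-1).
Proof.
move=> gs g0 n; have g2 := scls_mul gs gs.
have gpos x : U x -> 0 < g x * g x.
  by move=> /g0 h; rewrite -expr2 exprn_even_gt0.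
have := cls_mul0 (gs n) (cls_inv (g2 n) (scls_lower g2 gpos)).
rewrite (_ : (fun x _ _ => _) = (fun x _ _ => (g x)^-1))//.
apply/funext => x; apply/funext => v; apply/funext => u.
have [->|h] := eqVneq (g x) 0; first by rewrite mul0r invr0.
by rewrite invfM mulrA mulfV// mul1r.
Qed.

End ScalarFamilies.

Lemma scls_eq (R : realType) (E : normedModType R) (U : set E) (g k : E -> R) :
  scls U g -> g =1 k -> scls U k.
Proof. by move=> gs /funext <-. Qed.

(** * Normal form of solutions and invariants of leaves *)

Section Configurations.
Context {R : realType} (f : R -> R).
Hypothesis f_smooth : forall (n : nat) (r : R), 0 < r -> derivable (f^`(n))%classic r 1.
Hypothesis f_neq0 : forall r : R, 0 < r -> f r != 0.

Local Notation Fld := (@fields R 3).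
Local Notation M := [set x : 'rV[R]_3 | x != 0].
Local Notation alpha := (radial_bivector f).
Local Notation f' := (f' f).
Local Notation h' := (h' f).
Local Notation S := (solutions M alpha).
Implicit Types (x y w b X : vec R) (p : Fld) (q dq : R -> quat R).

Definition start p := fpos p 0.
Definition nonzero_start : set Fld := [set p | 0 < dot (start p) (start p)].
Definition flux p := prim (fun u => dot (feta p u) (fpos p u)) 1.

Lemma solution_start p : S p -> nonzero_start p.
Proof. by move=> /solutionsP/(_ 0 itv01_0)[]. Qed.

Lemma dv_const_norm (X : R -> vec R) (w : R -> vec R) :
  (forall u, itv01 u -> vder X u (cross (X u) (w u))) ->
  forall u, itv01 u -> dot (X u) (X u) = dot (X 0) (X 0).
Proof.
move=> dX; apply: der01_cst => u iu.
refine (dv_eq (dv_dot (dX u iu) (dX u iu)) _).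
by rewrite /dot /cross /=; ring.
Qed.

Lemma solution_norm p u : S p -> itv01 u ->
  dot (fpos p u) (fpos p u) = dot (start p) (start p).
Proof.
move=> /solutionsP Sp iu.
have := @dv_const_norm (fext p) (fun u => vscale (f (vnorm (fpos p u))) (feta p u)) _ u iu.
rewrite (fextE p iu) (fextE p itv01_0); apply=> s si; have [_ e] := Sp s si.
refine (vder_eq (fext_vder p si) _); rewrite e fextE//.
by rewrite /cross /vscale; apply: V3_eq; rewrite /=; ring.
Qed.

Lemma solution_vnorm p u : S p -> itv01 u -> vnorm (fpos p u) = vnorm (start p).
Proof. by move=> Sp iu; rewrite /vnorm solution_norm. Qed.

(** This is where h' enters. If it is nonzero at r, the radial part of eta can be absorbed into w
    with m = 0; if it is zero, the radial part is r^2 m, whatever w is. *)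
Lemma dot_theta (r : R) X w (m : R) : 0 < r -> dot X X = r ^+ 2 ->
  dot (theta_eta f r X w m) X = h' r * dot w X + r ^+ 2 * m.
Proof.
move=> r0 XX; have r1 : r != 0 by rewrite gt_eqF.
have -> : dot (theta_eta f r X w m) X = 1 / f r * dot w X + (kappa f r * dot w X + m) * dot X X.
  by rewrite /theta_eta /dot /=; ring.
by rewrite XX /kappa /h'; field; rewrite r1 f_neq0.
Qed.

Lemma dot_eq0 x : dot x x = 0 -> x = V3 0 0 0.
Proof.
case: x => a b c; rewrite /dot /= -!expr2 => h.
have h1 := sqr_ge0 a; have h2 := sqr_ge0 b; have h3 := sqr_ge0 c.
have z (x : R) : x ^+ 2 = 0 -> x = 0 by move/eqP; rewrite sqrf_eq0 => /eqP.
by apply: V3_eq; apply: z; lra.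
Qed.

Lemma vsub_eq0 x y : vadd x (vscale (-1) y) = V3 0 0 0 -> x = y.
Proof. by case: x y => a b c [a' b' c'] [h1 h2 h3]; apply: V3_eq; lra. Qed.

(** The equation is linear in X and preserves norms, so the difference of two solutions keeps its
    initial norm 0. *)
Lemma rotation_unique (X Y w : R -> vec R) : X 0 = Y 0 ->
  (forall u, itv01 u -> vder X u (cross (X u) (w u))) ->
  (forall u, itv01 u -> vder Y u (cross (Y u) (w u))) ->
  forall u, itv01 u -> X u = Y u.
Proof.
move=> e dX dY u iu; apply/vsub_eq0/dot_eq0.
rewrite (@dv_const_norm (fun u => vadd (X u) (vscale (-1) (Y u))) w _ u iu).
  by rewrite e /dot /=; ring.
move=> s si; refine (vder_eq (vder_add (dX s si) (vder_smul (dv_cst s (-1)) (dY s si))) _).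
by rewrite /cross /vadd /vscale; apply: V3_eq; rewrite /=; ring.
Qed.

Lemma qsol_unit_path (w : R -> vec R) : vwithin w ->
  unit_path (qsol w) (fun u => qhalf (qsol w u) (w u)).
Proof.
move=> cw; have sw := qsolP cw; have [_ dq] := sw.
split; last exact: qsolves_unit sw.
split=> //; apply: qwithin_scale; apply: qwithin_mul; last exact: qwithin_vec.
exact: qder_qwithin dq.
Qed.

(** Once eta is split into w and m, the path satisfies X' = X x w and is therefore its starting
    point rotated by [qsol w]. *)
Lemma solution_Theta p (w : R -> vec R) (m : R -> R) : S p -> vwithin w -> {within itv01, continuous m} ->
  (forall u, itv01 u -> theta_eta f (vnorm (start p)) (fpos p u) (w u) (m u) = feta p u) ->
  p = Theta f (start p) (qsol w) (fun u => qhalf (qsol w u) (w u)) m /\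
  forall u, itv01 u -> fpos p u = qrot (qsol w u) (start p).
Proof.
move=> Sp cw cm etaE; have uq := qsol_unit_path cw; have r0 := vnorm_gt0 (solution_start Sp).
have velE u (iu : itv01 u) : vel (qsol w u) (qhalf (qsol w u) (w u)) = w u.
  by apply: vel_half; exact: uq.2.
have fvelE u (iu : itv01 u) : fvel p u = cross (fpos p u) (w u).
  have /solutionsP/(_ u iu)[_ ->] := Sp.
  by rewrite solution_vnorm// -etaE// cross_theta.
have posE u (iu : itv01 u) : fpos p u = qrot (qsol w u) (start p).
  rewrite -(fextE p iu).
  apply: (@rotation_unique (fext p) (fun u => qrot (qsol w u) (start p)) w) iu.
  - by rewrite (fextE p itv01_0) (qsolP cw).1 rot_one.
  - by move=> s si; refine (vder_eq (fext_vder p si) _); rewrite fvelE ?fextE.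
  - by move=> s si; have := unit_path_rot (start p) uq si; rewrite velE.
split=> //; apply: fields_eq => u iu; have [a1 a2 a3] := ThetaE f (start p) uq cm iu.
- by rewrite a1 posE.
- by rewrite a2 velE// -posE// fvelE.
- by rewrite a3 velE// -posE// etaE.
Qed.

Lemma flux_Theta x q dq m : 0 < dot x x -> unit_path q dq -> {within itv01, continuous m} ->
  h' (vnorm x) = 0 -> flux (Theta f x q dq m) = dot x x * prim m 1.
Proof.
move=> x0 uq cm h0; have r0 := vnorm_gt0 x0; rewrite /flux -primZ//; last exact: itv01_1.
rewrite (@eq_prim _ _ (fun u => dot x x * m u))// => u iu.
have [a1 _ a3] := ThetaE f x uq cm iu.
have XX : dot (qrot (q u) x) (qrot (q u) x) = vnorm x ^+ 2.
  by rewrite dot_rot uq.2// expr1n mul1r vnorm_sqr.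
by rewrite a1 a3 dot_theta// h0 mul0r add0r vnorm_sqr.
Qed.

Lemma vder01_cst (X : R -> vec R) : (forall u, itv01 u -> vder X u (V3 0 0 0)) ->
  forall u, itv01 u -> X u = X 0.
Proof.
move=> dX u iu.
have h (k : vec R -> R) : (forall s, itv01 s -> is_derive s 1 (fun z : R => k (X z)) 0) ->
    k (X u) = k (X 0).
  by move=> dk; exact: (@der01_cst _ (fun z : R => k (X z)) dk).
have := h (@vx R) (fun s si => let: And3 d _ _ := dX s si in d).
have := h (@vy R) (fun s si => let: And3 _ d _ := dX s si in d).
have := h (@vz R) (fun s si => let: And3 _ _ d := dX s si in d).
by case: (X u) (X 0) => ? ? ? [? ? ?] /= -> -> ->.
Qed.

Definition path_ext (gamma : C1 Fld) (t : R) : Fld :=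
  gamma (clamp t) + (t - clamp t) *: velocity gamma (clamp t).

Lemma path_extE gamma (t : R) : itv01 t -> path_ext gamma t = gamma t.
Proof. by move=> it; rewrite /path_ext clamp_id// subrr scale0r addr0. Qed.

Lemma path_ext_der gamma (t : R) : itv01 t ->
  is_derive t 1 (path_ext gamma) (velocity gamma t).
Proof. exact: C1_ext_is_derive. Qed.

(* The gauge parameter vanishes at the two ends of the interval. *)
Lemma leaf_endpoint (gamma : C1 Fld) u : u = 0 \/ u = 1 -> (forall t, itv01 t ->
    S (gamma t) /\ gauge_vector alpha (gamma t) (velocity gamma t)) ->
  forall t, itv01 t -> fpos (gamma t) u = fpos (gamma 0) u.
Proof.
move=> u01 gP t it; have iu : itv01 u.
  by case: u01 => ->; [exact: itv01_0|exact: itv01_1].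
rewrite -(path_extE gamma it) -(path_extE gamma itv01_0).
apply: (@vder01_cst (fun t => fpos (path_ext gamma t) u)) it => s si.
have [Ss /(gauge_vectorP f_smooth)[|b [db [_ _ b0 b1 bP]]]] := gP s si.
  by move=> w iw; have /solutionsP/(_ w iw)[] := Ss.
refine (vder_eq (fpos_vder (path_ext_der gamma si) iu) _).
have [-> _] := bP u iu; rewrite (_ : b u = V3 0 0 0); last by case: u01 => ->.
by rewrite /vscale /cross; apply: V3_eq; rewrite /=; ring.
Qed.

Lemma leaf_start (p q : Fld) : same_leaf M alpha p q -> start p = start q /\ fpos p 1 = fpos q 1.
Proof.
move=> [gamma [<- <- gP]]; split; apply/esym.
- by apply: leaf_endpoint gP _ itv01_1; left.
- by apply: leaf_endpoint gP _ itv01_1; right.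
Qed.

(** By h' r = 0 one has f r = r f' r. The radial term of the gauge variation of eta then contributes
    f (eta x b) . X, which cancels the contribution of the variation of X. What remains is the
    u-derivative of b . X. *)
Lemma flux_variation (r : R) X eta b db : 0 < r -> dot X X = r ^+ 2 -> h' r = 0 ->
  dot (gauge_eta f r X eta b db) X + dot eta (vscale (f r) (cross X b)) =
  dot db X + dot b (vscale (f r) (cross X eta)).
Proof.
move=> r0 XX h0; have r1 : r != 0 by rewrite gt_eqF.
have fr : f r = r * f' r.
  have : f r ^+ 2 * h' r = 0 by rewrite h0 mulr0.
  by rewrite /h' mulrC divfK ?sqrf_eq0 ?f_neq0// => /eqP; rewrite subr_eq0 => /eqP.
have -> : dot (gauge_eta f r X eta b db) X = dot db X + f r * dot (cross eta b) X +
    f' r / r * dot (cross eta b) X * dot X X by rewrite /gauge_eta /dot /=; ring.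
rewrite XX (_ : f' r / r * dot (cross eta b) X * r ^+ 2 = f r * dot (cross eta b) X).
  by rewrite /dot /cross /=; ring.
by rewrite fr; field.
Qed.

(** Along a leaf the integrand of the flux varies by the u-derivative of b . X, whose integral
    vanishes because b is zero at the ends. The condition on h' concerns the radius of this leaf
    alone, so the lemma also serves at a single critical radius. *)
Lemma leaf_flux (p q : Fld) : same_leaf M alpha p q -> h' (vnorm (start p)) = 0 ->
  flux p = flux q.
Proof.
move=> [gamma [g0 <- gP]] h0; rewrite -g0.
pose L t := flux (path_ext gamma t).
rewrite /flux -(path_extE gamma itv01_0) -(path_extE gamma itv01_1).
apply/esym/(@der01_cst _ L); last exact: itv01_1.
move=> t it; have [St /(gauge_vectorP f_smooth)[|b [db [dbE cdb b0 b1 bP]]]] := gP t it.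
  by move=> w iw; have /solutionsP/(_ w iw)[] := St.
have dg := path_ext_der gamma it.
have cx : vcls [set: Fld] 1 [::] (fun p _ u => fpos p u).
  by split; apply: cls_atom => //; (try exact: openT); exact: atom_pos.
have ce : vcls [set: Fld] 1 [::] (fun p _ u => feta p u).
  by split; apply: cls_atom => //; (try exact: openT); exact: atom_eta.
have cG := cls_dot ce cx; have [G' cG' dG'] := cls_deriv cG (isT : 0%N \notin [::]).
have dL := cls0_chain (fun=> 0) (cls0_prim (cls_cls0 cG')) I itv01_1
  (loc_deriv_prim (cls_cls0 cG) (cls_cls0 cG') I (dG' (path_ext gamma t) I)) dg.
refine (dv_eq dL _).
pose d : R -> R := fun u => dot (db u) (fpos (gamma t) u) + dot (b u) (fvel (gamma t) u).
have r0 := vnorm_gt0 (solution_start St).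
have sE : start (gamma t) = start p.
  by rewrite -g0; apply: leaf_endpoint gP _ it; left.
rewrite (@eq_prim _ _ d); last first.
  move=> u iu; have h := cls0_chain (fun=> 0) (cls_cls0 cG') I iu (dG' (path_ext gamma t) I) dg.
  rewrite (dv_unique h (dv_dot (feta_vder dg iu) (fpos_vder dg iu))) /d path_extE//.
  have /solutionsP/(_ u iu)[_ ->] := St; have [-> ->] := bP u iu.
  rewrite solution_vnorm//; apply: flux_variation => //; last by rewrite sE.
  by rewrite solution_norm// vnorm_sqr.
have dF u (iu : itv01 u) : is_derive u 1 (fun s => dot (b s) (fext (gamma t) s)) (d u).
  by refine (dv_eq (dv_dot (dbE u iu) (fext_vder (gamma t) iu)) _); rewrite fextE.
have cb := vder_within dbE.
have cd : {within itv01, continuous d}.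
  apply: within01D; apply: within_dot => //; [exact: fpos_within|exact: fvel_within].
rewrite (prim_unique cd dF itv01_1) b0 b1.
by rewrite /dot /=; ring.
Qed.

End Configurations.

(** * Curves of solutions through a given solution *)

Section Normalization.
Context {R : realType}.
Implicit Types (z w e q : quat R).

Definition qinvn z : R := (Num.sqrt (qn2 z))^-1.
Definition qnorm z : quat R := qscale (qinvn z) z.
Definition qnorm_der z w : quat R :=
  qadd (qscale (qinvn z) w) (qscale (- (qinvn z * (qinvn z * qinvn z)) * qdot z w) z).

Lemma qinvn_sqr z : 0 < qn2 z -> qinvn z * qinvn z * qn2 z = 1.
Proof.
move=> z0; rewrite /qinvn -invfM -expr2 sqr_sqrtr ?ltW// mulVf//.
by rewrite gt_eqF.
Qed.

Lemma qn2_scale (a : R) z : qn2 (qscale a z) = a * a * qn2 z.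
Proof. by rewrite /qn2 /qdot /=; ring. Qed.

Lemma qn2_norm z : 0 < qn2 z -> qn2 (qnorm z) = 1.
Proof. by move=> z0; rewrite qn2_scale qinvn_sqr. Qed.

Lemma qnorm_unit z : qn2 z = 1 -> qnorm z = z.
Proof.
move=> z1; rewrite /qnorm /qinvn z1 sqrtr1 invr1.
by case: z {z1} => a b c d; rewrite /qscale /= !mul1r.
Qed.

Lemma qnorm_vder (z : R -> quat R) (u : R) w : 0 < qn2 (z u) -> qder z u w ->
  qder (fun s => qnorm (z s)) u (qnorm_der (z u) w).
Proof.
move=> z0 dz; have s0 : 0 < Num.sqrt (qn2 (z u)) by rewrite sqrtr_gt0.
have dn : is_derive u 1 (fun s => qn2 (z s)) (2 * qdot (z u) w).
  by refine (dv_eq (dv_qdot dz dz) _); rewrite /qdot; ring.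
have ds := @dv_comp _ Num.sqrt _ u _ _ (is_derive1_sqrt z0) dn.
have di := @dv_inv _ (fun s => Num.sqrt (qn2 (z s))) u _ (lt0r_neq0 s0) ds.
refine (qder_eq (qder_smul di dz) _); rewrite /qnorm_der /qinvn.
move: (Num.sqrt _) (qdot _ _) (lt0r_neq0 s0) => s d sn {ds di dn dz}.
by case: (z u) w => a b c d' [a' b' c' d'']; rewrite /qadd /qscale; apply: Q4_eq; rewrite /=; field.
Qed.

(** As |q + e|^2 and |q - e|^2 are nonnegative, |2 q . e| is at most 1 + |e|^2. This is the origin
    of the radius of the interval [T] on which deformations are considered. *)
Lemma qn2_shift q e (s : R) : qn2 q = 1 -> `|s| * (1 + qn2 e) <= 1 / 2 ->
  1 / 2 <= qn2 (qadd q (qscale s e)).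
Proof.
move=> q1 se; have -> : qn2 (qadd q (qscale s e)) = qn2 q + s * (2 * qdot q e) + s * s * qn2 e.
  by rewrite /qn2 /qdot /=; ring.
have h1 := qn2_ge0 (qadd q e); have h2 := qn2_ge0 (qadd q (qscale (-1) e)).
have e1 : qn2 (qadd q e) = qn2 q + 2 * qdot q e + qn2 e by rewrite /qn2 /qdot /=; ring.
have e2 : qn2 (qadd q (qscale (-1) e)) = qn2 q - 2 * qdot q e + qn2 e.
  by rewrite /qn2 /qdot /=; ring.
have h : `|s * (2 * qdot q e)| <= `|s| * (1 + qn2 e).
  by rewrite normrM ler_wpM2l// ler_norml; move: h1 h2; rewrite e1 e2 q1 => *; apply/andP; lra.
have h3 : 0 <= s * s * qn2 e by rewrite mulr_ge0 ?qn2_ge0// -expr2 sqr_ge0.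
move: h => /ler_normlP[h _]; rewrite q1; lra.
Qed.

End Normalization.

Section Deformation.
Context {R : realType} (f : R -> R).
Hypothesis f_smooth : forall (n : nat) (r : R), 0 < r -> derivable (f^`(n))%classic r 1.
Hypothesis f_neq0 : forall r : R, 0 < r -> f r != 0.

Local Notation Fld := (@fields R 3).
Local Notation M := [set x : 'rV[R]_3 | x != 0].
Local Notation alpha := (radial_bivector f).

Lemma scls_target (E : normedModType R) (U : set E) (r : E -> R) : open U -> scls U r ->
  (forall x, U x -> 0 < r x) ->
  [/\ scls U (fun x => f (r x)), scls U (fun x => f' f (r x)) & scls U (fun x => (f (r x))^-1)].
Proof.
move=> oU cr r0.
have c0 : scls U (fun x => f (r x)) := scls_comp 0 (f_tower f_smooth) cr r0.
split=> //; first exact: (scls_comp 1 (f_tower f_smooth) cr r0).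
by apply: scls_inv => // x Ux; exact/f_neq0/r0.
Qed.

Lemma scls_kappa (E : normedModType R) (U : set E) (r : E -> R) : open U -> scls U r ->
  (forall x, U x -> 0 < r x) -> scls U (fun x => kappa f (r x)).
Proof.
move=> oU cr r0; have [_ c1 c2] := scls_target oU cr r0.
have c3 : scls U (fun x => (r x)^-1) by apply: scls_inv => // x /r0/lt0r_neq0.
apply: (scls_eq (scls_mul (scls_opp oU c1) (scls_mul (scls_mul c2 c2) c3))) => x.
by rewrite /kappa expr2 !invfM.
Qed.

Variables (x : R -> vec R) (q dq : R -> quat R) (m : R -> R) (e : quat R) (mu : R).
Hypothesis uq : unit_path q dq.
Hypothesis cm : {within itv01, continuous m}.

Let T : set R := ball (0 : R) (1 / 2 / (1 + qn2 e)).
Hypothesis x_cls : forall n, vcls T n [::] (fun t _ _ => x t).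
Hypothesis x_gt0 : forall t, T t -> 0 < dot (x t) (x t).

(** The perturbation t u e is zero at u = 0 and t e at u = 1: the path keeps its start, and its end
    moves in the direction e. Together with the moving base point [x t] and the term t mu, this
    varies start, holonomy and flux independently. *)
Definition deformed (t u : R) : quat R := qnorm (qadd (q u) (qscale t (qscale u e))).
Definition deformed_der (t u : R) : quat R :=
  qnorm_der (qadd (q u) (qscale t (qscale u e))) (qadd (dq u) (qscale t e)).
Definition deformation (t : R) : Fld :=
  Theta f (x t) (deformed t) (deformed_der t) (fun u => m u + t * mu).

Let oT : open T.
Proof. by apply: ball_open; rewrite !divr_gt0// ltr_wpDr ?qn2_ge0. Qed.

Let T0 : T 0.
Proof. by apply: ballxx; rewrite !divr_gt0// ltr_wpDr ?qn2_ge0. Qed.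

Lemma deformed_ge t u : T t -> itv01 u -> 1 / 2 <= qn2 (qadd (q u) (qscale t (qscale u e))).
Proof.
move=> Tt /[dup] iu /itv01P/andP[u0 u1].
have -> : qscale t (qscale u e) = qscale (t * u) e.
  by rewrite /qscale; apply: Q4_eq; rewrite /=; ring.
apply: qn2_shift; first exact: uq.2.
have p : 0 < 1 + qn2 e by rewrite ltr_wpDr ?qn2_ge0.
move: Tt; rewrite /T -ball_normE /= sub0r normrN ltr_pdivlMr// => h.
apply: (le_trans _ (ltW h)); rewrite ler_wpM2r ?(ltW p)// normrM (ger0_norm u0).
by rewrite ler_piMr.
Qed.

Lemma deformed_unit_path t : T t -> unit_path (deformed t) (deformed_der t).
Proof.
move=> Tt; have zp u (iu : itv01 u) : 0 < qn2 (qadd (q u) (qscale t (qscale u e))).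
  by apply: lt_le_trans (deformed_ge Tt iu); rewrite divr_gt0.
have [dQ cdq] := uq.1; have cq := qder_qwithin dQ.
have cu : {within itv01, continuous (fun u : R => u)} by apply: continuous_subspaceT => u; exact: cvg_id.
have cz : qwithin (fun u => qadd (q u) (qscale t (qscale u e))).
  apply: qwithin_add => //; apply: qwithin_scale; apply: qwithin_smul => //.
  exact: qwithin_cst.
have cw : qwithin (fun u => qadd (dq u) (qscale t e)).
  by apply: qwithin_add => //; exact: qwithin_cst.
have ci : {within itv01, continuous (fun u => qinvn (qadd (q u) (qscale t (qscale u e))))}.
  apply: within_inv => [u iu|]; first by rewrite lt0r_neq0// sqrtr_gt0 zp.
  have := within_qdot cz cz; apply: within_continuous_comp => z _; exact: sqrt_continuous.
split; last by move=> u iu; apply: qn2_norm; exact: zp.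
split.
  move=> u iu; apply: (@qnorm_vder _ (fun u => qadd (q u) (qscale t (qscale u e)))); first exact: zp.
  apply: qder_add; first exact: dQ.
  apply: qder_scale; refine (qder_eq (qder_smul (dv_id u) (qder_cst u e)) _).
  by case: e => a b c d; rewrite /qadd /qscale; apply: Q4_eq; rewrite /=; ring.
apply: qwithin_add; apply: qwithin_smul => //; apply: within01M; last exact: within_qdot.
have N (k : R -> R) : {within itv01, continuous k} -> {within itv01, continuous (fun u => - k u)}.
  by move=> ck y; apply: cvgN; exact: ck.
by apply: N; apply: within01M => //; exact: within01M.
Qed.

Lemma deformed0 u : itv01 u -> deformed 0 u = q u.
Proof.
move=> iu; rewrite /deformed; have -> : qadd (q u) (qscale 0 (qscale u e)) = q u.
  by case: (q u) => a b c d; rewrite /qadd /qscale; apply: Q4_eq; rewrite /=; ring.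
by rewrite qnorm_unit// uq.2.
Qed.

Lemma deformed_start t : deformed t 0 = q 0.
Proof.
rewrite /deformed; have -> : qadd (q 0) (qscale t (qscale 0 e)) = q 0.
  by case: (q 0) => a b c d; rewrite /qadd /qscale; apply: Q4_eq; rewrite /=; ring.
by rewrite qnorm_unit// uq.2//; exact: itv01_0.
Qed.

Lemma deformed_end t : deformed t 1 = qnorm (qadd (q 1) (qscale t e)).
Proof. by rewrite /deformed; congr (qnorm (qadd _ (qscale t _))); case: e => a b c d; rewrite /qscale /= !mul1r. Qed.

Lemma deformed_flux_within t : {within itv01, continuous (fun u => m u + t * mu)}.
Proof. by apply: within01D => //; exact: within01_cst. Qed.

Lemma deformation0 : deformation 0 = Theta f (x 0) q dq m.
Proof.
apply: Theta_eq => //; [exact: deformed_unit_path|exact: deformed_flux_within| |].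
  by move=> u iu; rewrite deformed0.
by move=> u iu; rewrite mul0r addr0.
Qed.

Lemma deformation_tangent : exists2 v, is_derive (0 : R) 1 deformation v &
  tangent (solutions M alpha) (Theta f (x 0) q dq m) v.
Proof.
have ct n : cls T n [::] (fun t _ _ => t).
  apply: cls_atom => //; split=> //; last by move=> t; exact: within01_cst.
  by exists 1 => // t u _; rewrite mul1r.
have cid : {within itv01, continuous (fun u : R => u)}.
  by apply: continuous_subspaceT => u; exact: cvg_id.
have [dQ cdq] := uq.1; have cq := qder_qwithin dQ.
have cz n : qcls T n [::] (fun t _ u => qadd (q u) (qscale t (qscale u e))).
  apply: qcls_add; first exact: qcls_cst.
  apply: (qcls_smul (ct n)); apply: (qcls_cst oT n (q := fun u => qscale u e)).
  by apply: qwithin_smul => //; exact: qwithin_cst.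
have cw n : qcls T n [::] (fun t _ u => qadd (dq u) (qscale t e)).
  apply: qcls_add; first exact: qcls_cst.
  by apply: (qcls_smul (ct n)); apply: (qcls_cst oT n); exact: qwithin_cst.
have TN t : T t -> exists2 r : R, 0 < r & forall s, `|s - t| < r -> T s.
  move=> Tt; have /nbhs_ballP[r r0 rT] := open_nbhs_nbhs (conj oT Tt).
  by exists r => // s sr; apply: rT; rewrite -ball_normE /= distrC.
have lower t : T t -> exists r c : R, [/\ 0 < r, 0 < c & forall s, `|s - t| < r ->
    forall (v : nat -> R) u, itv01 u -> c <= qn2 (qadd (q u) (qscale s (qscale u e)))].
  move=> /TN[r r0 rT]; exists r, (1 / 2); split=> //.
  by move=> s /rT Ts v u iu; exact: deformed_ge.
have ci n : cls T n [::] (fun t _ u => qinvn (qadd (q u) (qscale t (qscale u e)))).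
  refine (cls_inv (cls_sqrt (cls_qdot (cz n) (cz n)) lower) _).
  move=> t /TN[r r0 rT]; exists r, (Num.sqrt (1 / 2)); split=> //.
  by move=> s /rT Ts v u iu; apply: ler_wsqrtr; exact: deformed_ge.
have cQ n : qcls T n [::] (fun t _ => deformed t) by exact: (qcls_smul (ci n) (cz n)).
have cdQ n : qcls T n [::] (fun t _ => deformed_der t).
  apply: qcls_add; first exact: (qcls_smul (ci n) (cw n)).
  refine (qcls_smul (cls_mul0 (cls_opp oT (cls_mul0 (ci n) (cls_mul0 (ci n) (ci n))))
    (cls_qdot (cz n) (cw n))) (cz n)).
have cr : scls T (fun t => vnorm (x t)).
  by apply: scls_sqrt => // n; exact: cls_dot (x_cls n) (x_cls n).
have r0 t : T t -> 0 < vnorm (x t) by move=> /x_gt0; exact: vnorm_gt0.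
have [_ _ cf] := scls_target oT cr r0; have ck := scls_kappa oT cr r0.
have cX n : vcls T n [::] (fun t _ u => qrot (deformed t u) (x t)) := vcls_rot oT (cQ n) (x_cls n).
have cv n : vcls T n [::] (fun t _ u => vel (deformed t u) (deformed_der t u)) :=
  vcls_vel oT (cQ n) (cdQ n).
have cPsi : vcls T 2 [::] (fun t _ u => theta_eta f (vnorm (x t)) (qrot (deformed t u) (x t))
    (vel (deformed t u) (deformed_der t u)) (m u + t * mu)).
  apply: vcls_add.
    by apply: (vcls_smul _ (cv _)); apply: cls_mul0; [exact: cls_const|exact: cf].
  apply: (vcls_smul _ (cX _)); apply: cls_add.
    by apply: cls_mul0; [exact: ck|exact: cls_dot].
  apply: cls_add; first exact: cls_cst.
  by apply: cls_mul0 => //; exact: cls_const.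
have [dg dgP _] := family_curve_C1 oT (cX 2%N) (vcls_cross oT (cX 2%N) (cv 2%N)) cPsi.
have dg0 : is_derive (0 : R) 1 deformation (dg 0) := dgP 0 T0.
exists (dg 0) => //; exists deformation; split=> //; first exact: deformation0.
apply: filterS (open_nbhs_nbhs (conj oT T0)) => t Tt.
by apply: Theta_solutions; [|exact: deformed_unit_path|exact: deformed_flux_within|exact: x_gt0].
Qed.

End Deformation.

(** * Uniform rotations about an axis *)

Section Rotations.
Context {R : realType}.
Implicit Types (n : vec R).

(** For a unit vector n this is exp (a u n), which acts through [qrot] as a rotation about n by an
    angle of absolute value 2 |a u|. The half angle is why turns by 4 pi, not 2 pi, close up. *)
Definition qexp n (a u : R) : quat R :=
  let s := sin (a * u) in Q4 (cos (a * u)) (s * vx n) (s * vy n) (s * vz n).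
Definition qexp_der n (a u : R) : quat R :=
  let c := a * cos (a * u) in Q4 (- a * sin (a * u)) (c * vx n) (c * vy n) (c * vz n).

Lemma trig_der (a u : R) : is_derive u 1 (fun u => cos (a * u)) (- a * sin (a * u)) /\
  is_derive u 1 (fun u => sin (a * u)) (a * cos (a * u)).
Proof.
have d := dv_cmul a (dv_id u).
split; [refine (dv_eq (dv_comp (is_derive_cos (a * u)) d) _)
  |refine (dv_eq (dv_comp (is_derive_sin (a * u)) d) _)]; ring.
Qed.

Lemma qexp_n2 n (a u : R) : dot n n = 1 -> qn2 (qexp n a u) = 1.
Proof.
move=> n1; have := cos2Dsin2 (a * u); rewrite /qn2 /qdot /=.
move: (cos _) (sin _) => c s cs.
have -> : c * c + s * vx n * (s * vx n) + s * vy n * (s * vy n) + s * vz n * (s * vz n) =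
   c ^+ 2 + s ^+ 2 * dot n n by rewrite /dot; ring.
by rewrite n1 mulr1.
Qed.

Lemma trig_within (a : R) : {within itv01, continuous (fun u => cos (a * u))} /\
  {within itv01, continuous (fun u => sin (a * u))}.
Proof.
by split; apply: cont01_within => u _; have [d1 d2] := trig_der a u;
  [exact: dv_cont d1|exact: dv_cont d2].
Qed.

Lemma qexp_unit_path n (a : R) : dot n n = 1 -> unit_path (qexp n a) (qexp_der n a).
Proof.
move=> n1; have [c1 c2] := trig_within a.
split; last by move=> u _; exact: qexp_n2.
split=> [u _|].
  have [d1 d2] := trig_der a u.
  by split => /=; [|refine (dv_eq (dv_mul d2 (dv_cst u _)) _); rewrite mulr0 addr0
    |refine (dv_eq (dv_mul d2 (dv_cst u _)) _); rewrite mulr0 addr0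
    |refine (dv_eq (dv_mul d2 (dv_cst u _)) _); rewrite mulr0 addr0].
by split => /=; do ?[apply: within01M => //; try exact: within01_cst].
Qed.

Lemma qexp_vel n (a u : R) : dot n n = 1 -> vel (qexp n a u) (qexp_der n a u) = vscale (2 * a) n.
Proof.
move=> _; have := cos2Dsin2 (a * u); rewrite /vel /qexp /qexp_der /=.
move: (cos _) (sin _) => c s cs; rewrite -[vscale (2 * a) n]/(vscale (2 * a) n).
have -> : vscale (2 * a) n = vscale (2 * a * (c ^+ 2 + s ^+ 2)) n by rewrite cs mulr1.
by rewrite /vscale; apply: V3_eq; rewrite /=; ring.
Qed.

Lemma qexp_start n (a : R) : qexp n a 0 = qone.
Proof. by rewrite /qexp mulr0 sin0 cos0 /qone; apply: Q4_eq; rewrite ?mul0r. Qed.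

Lemma circle_angle (c s : R) : c ^+ 2 + s ^+ 2 = 1 -> exists a : R, cos a = c /\ sin a = s.
Proof.
move=> cs; have s2 := sqr_ge0 s; have c2 := sqr_ge0 c.
have c1 : -1 <= c <= 1 by apply/andP; split; nra.
have sE : sin (acos c) = `|s| by rewrite sin_acos// -cs [c ^+ 2 + _]addrC addrK sqrtr_sqr.
have [s0|s0] := leP 0 s.
  by exists (acos c); rewrite acosK// sE ger0_norm.
by exists (- acos c); rewrite cosN sinN acosK// sE ltr0_norm// opprK.
Qed.

Lemma unit_qexp (q : quat R) : qn2 q = 1 ->
  exists n (a : R), dot n n = 1 /\ qexp n a 1 = q.
Proof.
move=> q1; pose v := qim q; pose b := vnorm v.
have bb : b ^+ 2 = dot v v := vnorm_sqr v.
have cs : qr q ^+ 2 + b ^+ 2 = 1.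
  by rewrite bb -q1 /qn2 /qdot /v /dot /=; ring.
have [a [ca sa]] := circle_angle cs.
have [v0|v0] := eqVneq (dot v v) 0.
  (* The quaternion is 1 or -1, so any axis will do. *)
  exists (V3 1 0 0), a; split; first by rewrite /dot /=; ring.
  have := dot_eq0 v0; rewrite /v /qexp mulr1 ca sa.
  have -> : b = 0 by apply/eqP; rewrite -sqrf_eq0 bb v0.
  by case: q {q1 v b bb cs ca sa v0} => /= x0 x1 x2 x3 [-> -> ->]; rewrite !mul0r.
have b0 : b != 0 by rewrite -sqrf_eq0 bb.
exists (vscale b^-1 v), a; split.
  have -> : dot (vscale b^-1 v) (vscale b^-1 v) = (b ^+ 2)^-1 * dot v v.
    by rewrite /dot /vscale /=; field.
  by rewrite bb mulVf.
rewrite /qexp mulr1 ca sa /v /=.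
have K (z : R) : b * (b^-1 * z) = z by rewrite mulrA mulfV// mul1r.
by rewrite !K; case: (q).
Qed.

Lemma unit_path_to (q1 : quat R) : qn2 q1 = 1 -> exists q dq : R -> quat R,
  [/\ unit_path q dq, q 0 = qone & q 1 = q1].
Proof.
move=> /unit_qexp[n [a [n1 <-]]]; exists (qexp n a), (qexp_der n a).
by split; [exact: qexp_unit_path|exact: qexp_start|].
Qed.

End Rotations.

(** * Pairs of vectors as points of R^6 *)

Section SixCoordinates.
Context {R : realType}.
Implicit Types (a b : vec R) (y : 'rV[R]_6).

Definition row6 a b : 'rV[R]_6 :=
  \row_i nth 0 [:: vx a; vy a; vz a; vx b; vy b; vz b] i.
Definition left3 y : vec R := V3 (y 0 0) (y 0 1) (y 0 2).
Definition right3 y : vec R := V3 (y 0 3) (y 0 4) (y 0 5).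

Lemma left3E a b : left3 (row6 a b) = a.
Proof. by case: a => a0 a1 a2; rewrite /left3 !mxE. Qed.

Lemma right3E a b : right3 (row6 a b) = b.
Proof. by case: b => b0 b1 b2; rewrite /right3 !mxE. Qed.

Lemma row6K y : row6 (left3 y) (right3 y) = y.
Proof.
apply/rowP => i; rewrite mxE.
by case: i => -[|[|[|[|[|[|//]]]]]] ? /=; congr (y 0 _); exact: val_inj.
Qed.

Lemma row6_is_derive (a b : R -> vec R) (u : R) da db : vder a u da -> vder b u db ->
  is_derive u 1 (fun s => row6 (a s) (b s)) (row6 da db).
Proof.
move=> [[d1 e1] [d2 e2] [d3 e3]] [[d4 e4] [d5 e5] [d6 e6]].
have D i j (phi : R -> R) (d : R) : (forall s, row6 (a s) (b s) i j = phi s) ->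
    derivable phi u 1 -> 'D_1 phi u = d ->
    derivable (fun s => row6 (a s) (b s) i j) u 1 /\ 'D_1 (fun s => row6 (a s) (b s) i j) u = d.
  by move=> /funext ->.
have DD i j : derivable (fun s => row6 (a s) (b s) i j) u 1 /\
    'D_1 (fun s => row6 (a s) (b s) i j) u = row6 da db i j.
  case: j => -[|[|[|[|[|[|//]]]]]] ?; rewrite [row6 da db _ _]mxE.
  - by apply: (D _ _ _ _ _ d1 e1) => s; rewrite mxE.
  - by apply: (D _ _ _ _ _ d2 e2) => s; rewrite mxE.
  - by apply: (D _ _ _ _ _ d3 e3) => s; rewrite mxE.
  - by apply: (D _ _ _ _ _ d4 e4) => s; rewrite mxE.
  - by apply: (D _ _ _ _ _ d5 e5) => s; rewrite mxE.
  - by apply: (D _ _ _ _ _ d6 e6) => s; rewrite mxE.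
have dM : derivable (fun s => row6 (a s) (b s)) u 1.
  by apply/derivable_mxP => i j; case: (DD i j).
by split=> //; rewrite derive_mx//; apply/matrixP => i j; rewrite mxE; case: (DD i j).
Qed.

Lemma row6_smooth (E : normedModType R) (U : set E) (a b : @vfamily R E) (u : R) : open U ->
  itv01 u -> (forall n, vcls U n [::] a) -> (forall n, vcls U n [::] b) ->
  smooth_on U (fun p => row6 (a p (fun=> 0) u) (b p (fun=> 0) u)).
Proof.
move=> oU iu ca cb.
pose G (i : 'I_6) : @mfamily R E := fun p v u => nth 0 [:: vx (a p v u); vy (a p v u);
  vz (a p v u); vx (b p v u); vy (b p v u); vz (b p v u)] i.
suff cG : forall i n, cls U n [::] (G i) by exact (cls_smooth_row oU iu cG).
move=> i n; have [a1 a2 a3] := ca n; have [b1 b2 b3] := cb n.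
by case: i => -[|[|[|[|[|[|//]]]]]] ?.
Qed.

Lemma coord_cont (i : 'I_6) : continuous (fun y : 'rV[R]_6 => y 0 i).
Proof. by move=> y; exact: coord_continuous. Qed.

Lemma dot_left_cont : continuous (fun y : 'rV[R]_6 => dot (left3 y) (left3 y)).
Proof.
move=> y; have h (i : 'I_6) : {for y, continuous (fun z : 'rV[R]_6 => z 0 i)}.
  exact: coord_cont.
exact (continuousD (continuousD (continuousM (h 0) (h 0)) (continuousM (h 1) (h 1)))
  (continuousM (h 2) (h 2))).
Qed.

Lemma dot_right_cont : continuous (fun y : 'rV[R]_6 => dot (right3 y) (right3 y)).
Proof.
move=> y; have h (i : 'I_6) : {for y, continuous (fun z : 'rV[R]_6 => z 0 i)}.
  exact: coord_cont.
exact (continuousD (continuousD (continuousM (h 3) (h 3)) (continuousM (h 4) (h 4)))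
  (continuousM (h 5) (h 5))).
Qed.

(* With [sq], the pair of [r q_0] in R and a unit vector becomes a nonzero vector of R^3. *)
Definition sq (t : R) : R := t + Num.sqrt (1 + t * t).
Definition unsq (s : R) : R := (s - s^-1) / 2.

Lemma sqP (t : R) : Num.sqrt (1 + t * t) ^+ 2 = 1 + t * t.
Proof. by rewrite sqr_sqrtr// addr_ge0// -expr2 sqr_ge0. Qed.

Lemma sq_root_gt0 (t : R) : 0 < Num.sqrt (1 + t * t).
Proof. by rewrite sqrtr_gt0 ltr_pwDl// -expr2 sqr_ge0. Qed.

Lemma sq_gt0 (t : R) : 0 < sq t.
Proof.
have := sqP t; have := sq_root_gt0 t; rewrite /sq; move: (Num.sqrt _) => s s0 h.
by rewrite ltNge; apply/negP => st; nra.
Qed.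

Lemma sqK : cancel sq unsq.
Proof.
move=> t; have := sqP t; have := sq_gt0 t; rewrite /unsq /sq; move: (Num.sqrt _) => s s0 h.
have -> : (t + s)^-1 = s - t.
  apply: (mulfI (lt0r_neq0 s0)); rewrite mulfV ?lt0r_neq0//.
  by rewrite (_ : (t + s) * (s - t) = s ^+ 2 - t * t); [rewrite h; ring|ring].
by field.
Qed.

Lemma unsqK (s : R) : 0 < s -> sq (unsq s) = s.
Proof.
move=> s0; rewrite /sq (_ : 1 + _ = ((s + s^-1) / 2) ^+ 2).
  rewrite sqrtr_sqr ger0_norm; last by rewrite divr_ge0// addr_ge0// ?invr_ge0 ltW.
  by rewrite /unsq; field; exact: lt0r_neq0.
by rewrite /unsq; field; exact: lt0r_neq0.
Qed.

Lemma sq_der (t : R) : is_derive t 1 sq (sq t / Num.sqrt (1 + t * t)).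
Proof.
have p : 0 < 1 + t * t by rewrite ltr_pwDl// -expr2 sqr_ge0.
have d := dv_add (dv_id t) (@dv_comp _ Num.sqrt _ t _ _ (is_derive1_sqrt p)
  (dv_add (dv_cst t 1) (dv_mul (dv_id t) (dv_id t)))).
by refine (dv_eq d _); rewrite /sq; field; rewrite lt0r_neq0// sq_root_gt0.
Qed.

Lemma cls_sq (E : normedModType R) (U : set E) n (G : @mfamily R E) : open U ->
  cls U n [::] G -> cls U n [::] (fun x v u => sq (G x v u)).
Proof.
move=> oU cG; apply: cls_add => //; apply: cls_sqrt.
  by apply: cls_add; [exact: cls_const|exact: cls_mul0].
move=> x _; exists 1, 1; split=> // y _ v u _.
by rewrite lerDl -expr2 sqr_ge0.
Qed.

End SixCoordinates.

(** * No critical point *)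

Section RegularCase.
Context {R : realType} (f : R -> R).
Hypothesis f_smooth : forall (n : nat) (r : R), 0 < r -> derivable (f^`(n))%classic r 1.
Hypothesis f_neq0 : forall r : R, 0 < r -> f r != 0.

Local Notation Fld := (@fields R 3).
Local Notation M := [set x : 'rV[R]_3 | x != 0].
Local Notation alpha := (radial_bivector f).
Local Notation f' := (f' f).
Local Notation h' := (h' f).
Local Notation S := (solutions M alpha).
Local Notation Theta := (Theta f).
Implicit Types (x y X w eta b : vec R) (p : Fld).

Lemma nonzero_start_open : open (@nonzero_start R).
Proof.
rewrite openE => p; rewrite /nonzero_start /= /start /fpos -dot_gt0 => p0.
apply/nbhs_ballP; exists `|p.1 0| => /=; first by rewrite normr_gt0.
move=> k; rewrite -ball_normE /= -dot_gt0 => pk; apply: contraPneq pk => k0.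
have := fields_norm_ge (p + (-1) *: k) itv01_0 => -[+ _ _].
rewrite [p + _]addrC (C1_lin (-1) k.1 p.1 0) k0 scaler0 add0r addrC scaleN1r.
by rewrite leNgt => /negP.
Qed.

Lemma vcls_fpos (U : set Fld) n : open U -> vcls U n [::] (fun p _ u => fpos p u).
Proof. by move=> oU; split; apply: cls_atom => //; exact: atom_pos. Qed.

Lemma vcls_feta (U : set Fld) n : open U -> vcls U n [::] (fun p _ u => feta p u).
Proof. by move=> oU; split; apply: cls_atom => //; exact: atom_eta. Qed.

Lemma vcls_start (U : set Fld) n : open U -> vcls U n [::] (fun p _ _ => start p).
Proof.
by move=> oU; split; apply: cls_atom => //;
  [apply: (atom_at itv01_0 (atom_pos 0))|apply: (atom_at itv01_0 (atom_pos 1))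
  |apply: (atom_at itv01_0 (atom_pos 2))].
Qed.

Lemma scls_radius : scls (@nonzero_start R) (fun p => vnorm (start p)).
Proof.
have oU := nonzero_start_open; apply: scls_sqrt => // n.
by apply: cls_dot; exact: vcls_start.
Qed.

Lemma radius_gt0 p : nonzero_start p -> 0 < vnorm (start p).
Proof. exact: vnorm_gt0. Qed.

Hypothesis h'_neq0 : forall r : R, 0 < r -> h' r != 0.

(* [spin_coef] makes [spin] transform like a connection, see [spin_gauge]. *)
Definition spin_coef (r : R) : R := ((h' r)^-1 - f r) / r ^+ 2.
Definition spin (r : R) X eta : vec R :=
  vadd (vscale (f r) eta) (vscale (spin_coef r * dot eta X) X).
Definition spin_der (r : R) X dX eta deta : vec R :=
  vadd (vscale (f r) deta) (vadd (vscale (spin_coef r * (dot deta X + dot eta dX)) X)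
    (vscale (spin_coef r * dot eta X) dX)).

Lemma spin_vder (r : R) (X w : R -> vec R) (u : R) dX dw : vder X u dX -> vder w u dw ->
  vder (fun s => spin r (X s) (w s)) u (spin_der r (X u) dX (w u) dw).
Proof.
move=> hX hw.
refine (vder_eq (vder_add (vder_smul (dv_cst u (f r)) hw)
  (vder_smul (dv_cmul (spin_coef r) (dv_dot hw hX)) hX)) _).
by rewrite /spin_der /vadd /vscale; apply: V3_eq; rewrite /=; ring.
Qed.

Lemma spin_within (r : R) (X w : R -> vec R) : vwithin X -> vwithin w ->
  vwithin (fun u => spin r (X u) (w u)).
Proof.
move=> cX cw; apply: vwithin_add; apply: vwithin_smul => //; first exact: within01_cst.
by apply: within01M; [exact: within01_cst|exact: within_dot].
Qed.

(** [spin] and [theta_eta] with m = 0 are inverse to each other on the sphere of radius r: along X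
    they multiply by 1 / h' and by h', orthogonally to X by f and by 1 / f. *)
Lemma theta_spin (r : R) X eta : 0 < r -> dot X X = r ^+ 2 ->
  theta_eta f r X (spin r X eta) 0 = eta.
Proof.
move=> r0 XX; have r1 : r != 0 by rewrite gt_eqF.
have e : dot (spin r X eta) X = (h' r)^-1 * dot eta X.
  have -> : dot (spin r X eta) X = f r * dot eta X + spin_coef r * dot eta X * dot X X.
    by rewrite /spin /dot /=; ring.
  by rewrite XX /spin_coef; field; rewrite r1 h'_neq0.
rewrite /theta_eta e addr0 /spin.
have k : kappa f r = (h' r - (f r)^-1) / r ^+ 2.
  by rewrite /kappa /h'; field; rewrite r1 f_neq0.
rewrite k /spin_coef; move: (f r) (h' r) (dot eta X) (f_neq0 r0) (h'_neq0 r0) => F H d F0 H0.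
case: X eta {XX e} => a b c [a' b' c'].
by rewrite /vadd /vscale; apply: V3_eq; rewrite /=; field; rewrite r1 F0 H0.
Qed.

Lemma spin_theta (r : R) X w : 0 < r -> dot X X = r ^+ 2 ->
  spin r X (theta_eta f r X w 0) = w.
Proof.
move=> r0 XX; have r1 : r != 0 by rewrite gt_eqF.
rewrite /spin dot_theta// mulr0 addr0 /theta_eta.
have k : kappa f r = (h' r - (f r)^-1) / r ^+ 2.
  by rewrite /kappa /h'; field; rewrite r1 f_neq0.
rewrite k /spin_coef; move: (f r) (h' r) (dot w X) (f_neq0 r0) (h'_neq0 r0) => F H d F0 H0.
case: X w {XX} => a b c [a' b' c'].
by rewrite /vadd /vscale; apply: V3_eq; rewrite /=; field; rewrite r1 F0 H0.
Qed.

Lemma spin_gauge (r : R) X eta b db : 0 < r -> dot X X = r ^+ 2 ->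
  spin_der r X (vscale (f r) (cross X b)) eta (gauge_eta f r X eta b db) =
  vadd (spin_der r X (vscale (f r) (cross X eta)) b db) (cross (spin r X eta) (spin r X b)).
Proof.
move=> r0 XX; have r1 : r != 0 by rewrite gt_eqF.
(* This linear equation determines [spin_coef]; its leading coefficient is - h' f^2, which is
   nonzero here. *)
have e : f r * (f' r / r) + spin_coef r * (f' r * r - f r) = 0.
  have H := h'_neq0 r0; rewrite /spin_coef; have -> : f' r = (f r - h' r * f r ^+ 2) / r.
    by rewrite /h'; field; rewrite r1 f_neq0.
  by field; rewrite r1 H.
have e2 : f' r / r * dot X X = f' r * r by rewrite XX; field.
rewrite /spin_der /gauge_eta /spin.
move: (f r) (f' r / r) (spin_coef r) (f' r * r) e e2 => F D G D1 e e2.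
set tau := dot (cross eta b) X; set rhs := RHS.
(* The two sides of the claim differ by a multiple of X that vanishes by [e] and [e2]. *)
transitivity (vadd rhs (vscale (tau * (F * D + G * (D1 - F)) + G * tau * (D * dot X X - D1)) X)).
  rewrite /rhs /tau; case: X eta b db {XX e2 rhs tau} => x0 x1 x2 [y0 y1 y2] [b0 b1 b2] [d0 d1 d2].
  by rewrite /vadd /vscale /dot /cross; apply: V3_eq; rewrite /=; ring.
rewrite e e2 subrr !mulr0 addr0; case: rhs => a0 a1 a2.
by rewrite /vadd /vscale; apply: V3_eq; rewrite /=; ring.
Qed.

Definition holonomy_form p u : vec R := spin (vnorm (start p)) (fpos p u) (feta p u).

Lemma holonomy_within p : vwithin (holonomy_form p).
Proof. by apply: spin_within; [exact: fpos_within|exact: feta_within]. Qed.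

Lemma regular_solution p : S p -> p = Theta (start p) (qsol (holonomy_form p))
  (fun u => qhalf (qsol (holonomy_form p) u) (holonomy_form p u)) (fun=> 0).
Proof.
move=> Sp; have r0 := vnorm_gt0 (solution_start Sp).
have [] // := solution_Theta f_neq0 Sp (holonomy_within p) (@within01_cst R 0).
by move=> u iu; apply: theta_spin => //; rewrite vnorm_sqr (solution_norm Sp iu).
Qed.

(** The radius and q are merged into the nonzero quaternion r q. Its real part is stored, through
    [sq], in the length of the first vector, whose direction is that of x. In this way all pairs (x,
    q) fill an open subset of R^6, and one chart is enough. *)
Definition class_of x (q : quat R) : 'rV[R]_6 :=
  row6 (vscale (sq (vnorm x * qr q) / vnorm x) x) (vscale (vnorm x) (qim q)).
Definition regular_class p := class_of (start p) (qsol (holonomy_form p) 1).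
(** The second condition says that r q is nonzero: [sq] takes the value 1 exactly at 0. *)
Definition regular_range : set 'rV[R]_6 := [set y | 0 < dot (left3 y) (left3 y) /\
  (dot (left3 y) (left3 y) != 1 \/ 0 < dot (right3 y) (right3 y))].

Lemma vnorm_dot1 x : 0 < dot x x -> dot x x / (vnorm x * vnorm x) = 1.
Proof. by move=> x0; rewrite -expr2 vnorm_sqr divff// gt_eqF. Qed.

Lemma dot_normalized x : 0 < dot x x ->
  dot (vscale (vnorm x)^-1 x) (vscale (vnorm x)^-1 x) = 1.
Proof.
move=> x0; have rn := lt0r_neq0 (vnorm_gt0 x0); rewrite -[RHS](vnorm_dot1 x0).
by rewrite [LHS]/dot [X in _ = X / _]/dot /=; field.
Qed.

Lemma vscale_inj (a : R) x y : a != 0 -> vscale a x = vscale a y -> x = y.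
Proof.
by case: x y => x0 x1 x2 [y0 y1 y2] an [] /(mulfI an) -> /(mulfI an) -> /(mulfI an) ->.
Qed.

Lemma class_norm x q : 0 < dot x x ->
  dot (left3 (class_of x q)) (left3 (class_of x q)) = sq (vnorm x * qr q) ^+ 2.
Proof.
move=> x0; rewrite left3E.
have -> a : dot (vscale (a / vnorm x) x) (vscale (a / vnorm x) x) =
    a ^+ 2 * (dot x x / (vnorm x * vnorm x)).
  by rewrite /dot /=; field; rewrite lt0r_neq0// vnorm_gt0.
by rewrite vnorm_dot1// mulr1.
Qed.

Lemma class_inj x q x' q' : 0 < dot x x -> 0 < dot x' x' -> qn2 q = 1 -> qn2 q' = 1 ->
  class_of x q = class_of x' q' -> x = x' /\ q = q'.
Proof.
move=> x0 x0' q1 q1' e.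
have r0 := vnorm_gt0 x0; have r0' := vnorm_gt0 x0'.
have := class_norm q x0; rewrite e class_norm// => /eqP.
rewrite eqf_sqr => /orP[/eqP|/eqP] es; last first.
  exfalso; have := sq_gt0 (vnorm x * qr q); have := sq_gt0 (vnorm x' * qr q').
  by rewrite es oppr_gt0 => h1 h2; have := lt_trans h1 h2; rewrite ltxx.
have et := can_inj sqK es; have := congr1 right3 e; rewrite !right3E.
case: q q' q1 q1' e es et => a b c d [a' b' c' d']; rewrite /qn2 /qdot /vscale /=.
move=> q1 q1' e es et [e1 e2 e3].
have rr : vnorm x = vnorm x'.
  have : vnorm x ^+ 2 = vnorm x' ^+ 2.
    rewrite -[LHS]mulr1 -q1 -[RHS]mulr1 -q1'.
    have -> (r s0 s1 s2 s3 : R) : r ^+ 2 * (s0 * s0 + s1 * s1 + s2 * s2 + s3 * s3) =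
      (r * s0) ^+ 2 + (r * s1) ^+ 2 + (r * s2) ^+ 2 + (r * s3) ^+ 2 by ring.
    have -> (r s0 s1 s2 s3 : R) : r ^+ 2 * (s0 * s0 + s1 * s1 + s2 * s2 + s3 * s3) =
      (r * s0) ^+ 2 + (r * s1) ^+ 2 + (r * s2) ^+ 2 + (r * s3) ^+ 2 by ring.
    by rewrite -et e1 e2 e3.
  by move/eqP; rewrite eqf_sqr => /orP[/eqP//|/eqP]; move: r0 r0'; lra.
have rn := lt0r_neq0 r0.
split.
  have := congr1 left3 e; rewrite !left3E /= -rr -et rr; apply: vscale_inj.
  by rewrite mulf_neq0 ?invr_neq0 ?lt0r_neq0// sq_gt0.
move: et e1 e2 e3; rewrite -rr => /esym/(mulfI rn) -> /(mulfI rn) -> /(mulfI rn) -> /(mulfI rn) ->.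
by [].
Qed.

Lemma vcls_holonomy n : vcls (@nonzero_start R) n [::] (fun p _ => holonomy_form p).
Proof.
have oU := nonzero_start_open; have cr := scls_radius.
have [cf cf' cfi] := scls_target f_smooth f_neq0 oU cr radius_gt0.
have rn p : nonzero_start p -> vnorm (start p) != 0 by move=> /radius_gt0/lt0r_neq0.
have ch : scls (@nonzero_start R) (fun p => h' (vnorm (start p))).
  apply: (scls_eq (scls_mul (scls_add cf (scls_opp oU (scls_mul cr cf'))) (scls_mul cfi cfi))) => p.
  by rewrite /h' expr2 invfM.
have ch' : scls (@nonzero_start R) (fun p => (h' (vnorm (start p)))^-1).
  by apply: scls_inv => // p /radius_gt0; exact: h'_neq0.
have cri := scls_inv cr rn.
have cg : scls (@nonzero_start R) (fun p => spin_coef (vnorm (start p))).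
  apply: (scls_eq (scls_mul (scls_add ch' (scls_opp oU cf)) (scls_mul cri cri))) => p.
  by rewrite /spin_coef expr2 [(vnorm _ * _)^-1]invfM.
have cx := vcls_fpos n oU; have ce := vcls_feta n oU.
apply: vcls_add; first exact: (vcls_smul (cf n) ce).
by apply: (vcls_smul _ cx); apply: cls_mul0; [exact: cg|exact: cls_dot].
Qed.

Lemma qcls_qsol_deriv (E : normedModType R) (U : set E) n j (H H' : @vfamily R E) : open U ->
  vcls U n [::] H -> vcls U n [:: j] H' -> qcls U n [:: j] (qsol_deriv H H').
Proof.
move=> oU cH cH'; have Qn := qcls_qsol oU cH.
exact (@qcls_mul _ _ _ oU _ [:: j] [::] _ _ isT (qcls_prim (qcls_scale oU (1 / 2)
  (@qcls_mul _ _ _ oU _ [:: j] [::] _ _ isT (@qcls_mul _ _ _ oU _ [::] [:: j] _ _ isT Qn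
     (qcls_vec oU cH')) (qcls_conj oU Qn)))) Qn).
Qed.

Lemma qprim_eq0 (P c : R -> quat R) : (forall u, itv01 u -> qder P u (c u)) -> qwithin c ->
  P 0 = qzero -> P 1 = qzero -> qprim c 1 = qzero.
Proof.
move=> dP [c1 c2 c3 c4] P0 P1; have i1 : itv01 (1 : R) := itv01_1.
rewrite /qprim (prim_unique c1 (fun u iu => let: And4 d _ _ _ := dP u iu in d) i1).
rewrite (prim_unique c2 (fun u iu => let: And4 _ d _ _ := dP u iu in d) i1).
rewrite (prim_unique c3 (fun u iu => let: And4 _ _ d _ := dP u iu in d) i1).
rewrite (prim_unique c4 (fun u iu => let: And4 _ _ _ d := dP u iu in d) i1).
by rewrite P0 P1 /= !subrr.
Qed.

(** Conjugation by q turns the covariant derivative b' + w x b into an ordinary one. *)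
Lemma conjugated_der (q : R -> quat R) (b : R -> vec R) (u : R) w db :
  qder q u (qhalf (q u) w) -> vder b u db ->
  qder (fun s => conjugated (q s) (b s)) u (conjugated (q u) (vadd db (cross w (b u)))).
Proof.
move=> dq [b1 b2 b3].
have dB : qder (fun s => qvec (b s)) u (qvec db) by split=> //; exact: dv_cst.
refine (qder_eq (qder_scale (1 / 2) (qder_mul (qder_mul dq dB) (qder_conj dq))) _).
case: (q u) w db (b u) {dq b1 b2 b3 dB} => a b0 c d [w0 w1 w2] [d0 d1 d2] [x0 x1 x2].
by rewrite /conjugated /qhalf /qscale /qadd; apply: Q4_eq; rewrite /=; field.
Qed.

(** By variation of constants the derivative of q(1) along the leaf is the integral of q (b' + w x
    b) q^-1 / 2, times q(1), where b is the [spin] of the gauge parameter. By [conjugated_der] the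
    integrand is a total derivative, and b vanishes at the ends. *)
Lemma leaf_holonomy (p q : Fld) : same_leaf M alpha p q ->
  qsol (holonomy_form p) 1 = qsol (holonomy_form q) 1.
Proof.
move=> [gamma [<- <- gP]].
pose Q t := qsol (holonomy_form (path_ext gamma t)) 1.
rewrite -(path_extE gamma itv01_0) -(path_extE gamma itv01_1).
apply/esym/(@qder01_cst _ Q); last exact: itv01_1.
move=> t it; have [St /(gauge_vectorP f_smooth)[|b [db [dbE cdb b0 b1 bP]]]] := gP t it.
  by move=> w iw; have /solutionsP/(_ w iw)[] := St.
have dg := path_ext_der gamma it; have oU := nonzero_start_open.
have Ut : nonzero_start (path_ext gamma t) by rewrite path_extE//; exact: solution_start St.
have cH := vcls_holonomy; have [H' cH' dH'] : exists2 H', vcls (@nonzero_start R) 0 [:: 0%N] H' &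
    forall p, nonzero_start p -> vloc_deriv 0%N (fun p _ => holonomy_form p) H' p.
  have [h1 h2 h3] := cH 1%N.
  have [G1 g1 dg1] := cls_deriv h1 (isT : 0%N \notin [::]).
  have [G2 g2 dg2] := cls_deriv h2 (isT : 0%N \notin [::]).
  have [G3 g3 dg3] := cls_deriv h3 (isT : 0%N \notin [::]).
  exists (fun k v u => V3 (G1 k v u) (G2 k v u) (G3 k v u)); first by split.
  by move=> k Uk; split; [exact: dg1|exact: dg2|exact: dg3].
have [k1 k2 k3] := dH' _ Ut; have [c1 c2 c3] := cH'.
pose v := upd (fun=> 0) 0%N (velocity gamma t).
have dL u (iu : itv01 u) : vder (fun s => holonomy_form (path_ext gamma s) u) t
    (H' (path_ext gamma t) v u).
  by split; [exact: (cls0_chain (fun=> 0) (cls_cls0 c1) Ut iu k1 dg)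
    |exact: (cls0_chain (fun=> 0) (cls_cls0 c2) Ut iu k2 dg)
    |exact: (cls0_chain (fun=> 0) (cls_cls0 c3) Ut iu k3 dg)].
have [l1 l2 l3 l4] := qsol_loc_deriv Ut (cH 1%N) cH' (dH' _ Ut).
have [e1 e2 e3 e4] := qcls_qsol_deriv oU (cH 0%N) cH'.
have dQ : qder Q t (qsol_deriv (fun p _ => holonomy_form p) H' (path_ext gamma t) v 1).
  have i1 : itv01 (1 : R) := itv01_1.
  by split; [exact: (cls0_chain (fun=> 0) (cls_cls0 e1) Ut i1 l1 dg)
    |exact: (cls0_chain (fun=> 0) (cls_cls0 e2) Ut i1 l2 dg)
    |exact: (cls0_chain (fun=> 0) (cls_cls0 e3) Ut i1 l3 dg)
    |exact: (cls0_chain (fun=> 0) (cls_cls0 e4) Ut i1 l4 dg)].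
refine (qder_eq dQ _).
pose r := vnorm (start (gamma t)); have r0 : 0 < r := vnorm_gt0 (solution_start St).
have rE s : itv01 s -> vnorm (start (gamma s)) = r.
  move=> si; rewrite /r /start (leaf_endpoint f_smooth (or_introl erefl) gP si).
  by rewrite (leaf_endpoint f_smooth (or_introl erefl) gP it).
have XX u : itv01 u -> dot (fpos (gamma t) u) (fpos (gamma t) u) = r ^+ 2.
  by move=> iu; rewrite (solution_norm St iu) vnorm_sqr.
pose w := holonomy_form (gamma t).
(* The gauge parameter undergoes the same transformation as the one-form; [fext] supplies two-sided
   derivatives in u. *)
pose bq u := spin r (fext (gamma t) u) (b u).
pose dbq u := spin_der r (fpos (gamma t) u) (fvel (gamma t) u) (b u) (db u).
have dbqE u (iu : itv01 u) : vder bq u (dbq u).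
  refine (vder_eq (spin_vder r (fext_vder (gamma t) iu) (dbE u iu)) _).
  by rewrite /dbq fextE.
have HE u : itv01 u -> H' (path_ext gamma t) v u = vadd (dbq u) (cross (w u) (bq u)).
  move=> iu; have dS := spin_vder r (fpos_vder dg iu) (feta_vder dg iu).
  have agree s : itv01 s -> holonomy_form (path_ext gamma s) u =
      spin r (fpos (path_ext gamma s) u) (feta (path_ext gamma s) u).
    by move=> si; rewrite /holonomy_form path_extE// rE.
  rewrite (vder01_unique agree it (dL u iu) dS) path_extE//.
  have [-> ->] := bP u iu; rewrite (solution_vnorm St iu) -/r spin_gauge ?XX//.
  have /solutionsP/(_ u iu)[_ vE] := St; rewrite (solution_vnorm St iu) -/r in vE.
  by rewrite /dbq /bq /w /holonomy_form fextE// vE.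
have sw := qsolP (holonomy_within (gamma t)); have [_ dq] := sw.
have cw := holonomy_within (gamma t); have cq := qder_qwithin dq.
rewrite /qsol_deriv /= (eq_qprim _ (q := fun s => conjugated (qsol w s)
  (vadd (dbq s) (cross (w s) (bq s)))))//; last by move=> s si; rewrite HE// path_extE.
rewrite (@qprim_eq0 (fun s => conjugated (qsol w s) (bq s))).
- by rewrite /qmul /qzero /=; apply: Q4_eq; rewrite /=; ring.
- by move=> u iu; apply: conjugated_der; [exact: dq|exact: dbqE].
- have cbq := vder_within dbqE; have cX := fpos_within (gamma t).
  have cV := fvel_within (gamma t); have cb := vder_within dbE.
  have cdbq : vwithin dbq.
    apply: vwithin_add; first by apply: vwithin_smul => //; exact: within01_cst.
    apply: vwithin_add; apply: vwithin_smul => //; apply: within01M;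
      [exact: within01_cst| |exact: within01_cst|exact: within_dot].
    by apply: within01D; exact: within_dot.
  apply: qwithin_scale; apply: qwithin_mul; last exact: qwithin_conj.
  by apply: qwithin_mul => //; apply: qwithin_vec; apply: vwithin_add => //; exact: vwithin_cross.
- rewrite /bq b0 /spin /conjugated /qmul /qscale /qzero; apply: Q4_eq; rewrite /= /dot /=; ring.
- rewrite /bq b1 /spin /conjugated /qmul /qscale /qzero; apply: Q4_eq; rewrite /= /dot /=; ring.
Qed.

Lemma start_Theta x (q dq : R -> quat R) (m : R -> R) : unit_path q dq ->
  {within itv01, continuous m} -> q 0 = qone -> start (Theta x q dq m) = x.
Proof.
by move=> uq cm q0; have [e _ _] := ThetaE f x uq cm itv01_0; rewrite /start e q0 rot_one.
Qed.

Lemma regular_class_Theta x (q dq : R -> quat R) : 0 < dot x x -> unit_path q dq ->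
  q 0 = qone -> regular_class (Theta x q dq (fun=> 0)) = class_of x (q 1).
Proof.
move=> x0 uq q0; have c0 := @within01_cst R 0; have r0 := vnorm_gt0 x0.
rewrite /regular_class start_Theta//; congr class_of.
have sq' : qsolves (holonomy_form (Theta x q dq (fun=> 0))) q.
  split=> // u iu; refine (qder_eq (uq.1.1 u iu) _).
  have [e1 _ e3] := ThetaE f x uq c0 iu.
  rewrite /holonomy_form start_Theta// e1 e3 spin_theta//.
    by rewrite half_vel ?uq.2//; apply: (unit_orth uq.2 iu); exact: uq.1.1.
  by rewrite dot_rot uq.2// expr1n mul1r vnorm_sqr.
by apply: (qsolves_unique (qsolP (holonomy_within _)) sq'); exact: itv01_1.
Qed.

Lemma regular_fibres (p q : Fld) : S p -> S q ->
  regular_class p = regular_class q <-> same_leaf M alpha p q.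
Proof.
move=> Sp Sq; split=> [e|pq]; last first.
  by rewrite /regular_class (leaf_holonomy pq); have [-> _] := leaf_start f_smooth pq.
have up := qsol_unit_path (holonomy_within p); have uq := qsol_unit_path (holonomy_within q).
have sp := qsolP (holonomy_within p); have sq' := qsolP (holonomy_within q).
have [es eq] := class_inj (solution_start Sp) (solution_start Sq)
  (qsolves_unit sp itv01_1) (qsolves_unit sq' itv01_1) e.
rewrite (regular_solution Sp) (regular_solution Sq) -es.
apply: Theta_leaf => //; try exact: within01_cst.
- exact: solution_start Sp.
- by rewrite sp.1 sq'.1.
Qed.

Lemma regular_class_smooth : smooth_on (@nonzero_start R) regular_class.
Proof.
have oU := nonzero_start_open; have cr := scls_radius.
have rn p : nonzero_start p -> vnorm (start p) != 0 by move=> /radius_gt0/lt0r_neq0.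
have cQ n : qcls (@nonzero_start R) n [::] (fun p _ => qsol (holonomy_form p)).
  exact: qcls_qsol (vcls_holonomy n).
apply: (@row6_smooth _ _ _ (fun p _ u => vscale (sq (vnorm (start p) *
    qr (qsol (holonomy_form p) u)) / vnorm (start p)) (start p))
  (fun p _ u => vscale (vnorm (start p)) (qim (qsol (holonomy_form p) u))) 1 oU itv01_1) => n.
  apply: vcls_smul (vcls_start n oU); apply: cls_mul0; last exact: (scls_inv cr rn n).
  by apply: cls_sq => //; apply: cls_mul0; [exact: cr|case: (cQ n)].
by apply: vcls_smul; [exact: cr|case: (cQ n)].
Qed.

Lemma class_range x q : 0 < dot x x -> qn2 q = 1 -> regular_range (class_of x q).
Proof.
move=> x0 q1; have r0 := vnorm_gt0 x0; split.
  by rewrite class_norm// exprn_gt0// sq_gt0.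
have [e|e] := eqVneq (dot (left3 (class_of x q)) (left3 (class_of x q))) 1; last by left.
right; move: e; rewrite class_norm// => /eqP; rewrite sqrf_eq1 => /orP[|] /eqP e; last first.
  by have := sq_gt0 (vnorm x * qr q); rewrite e oppr_gt0 ltr10.
have q0 : qr q = 0.
  have : vnorm x * qr q = 0 by rewrite -[LHS]sqK e /unsq invr1 subrr mul0r.
  by move/eqP; rewrite mulf_eq0 gt_eqF//= => /eqP.
rewrite right3E; have -> : dot (vscale (vnorm x) (qim q)) (vscale (vnorm x) (qim q)) =
   vnorm x ^+ 2 * (qn2 q - qr q * qr q) by rewrite /dot /qn2 /qdot /=; ring.
by rewrite q1 q0 mul0r subr0 mulr1 exprn_gt0.
Qed.

Lemma class_surjective (y : 'rV[R]_6) : regular_range y -> exists x (q : quat R),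
  [/\ 0 < dot x x, qn2 q = 1 & class_of x q = y].
Proof.
set a := left3 y; set b := right3 y => -[a0 ab].
have rho0 := vnorm_gt0 a0; set rho := vnorm a in rho0.
have rho2 : rho ^+ 2 = dot a a := vnorm_sqr a.
(* The real part tau of r q is read off the length of a, and its imaginary part is b; r is then the
   length of this quaternion. *)
pose tau := unsq rho; have sE : sq tau = rho by exact: unsqK.
pose n2 := tau ^+ 2 + dot b b.
have n20 : 0 < n2.
  have b0 := dot_ge0 b; have t0 := sqr_ge0 tau; rewrite /n2.
  case: ab => [a1|]; last by move=> h; rewrite ltr_wpDl.
  rewrite ltr_pwDl// lt0r t0 andbT sqrf_eq0; apply: contraNneq a1 => tau0.
  by rewrite -rho2 -sE tau0 /sq mul0r addr0 sqrtr1 add0r expr1n.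
pose r := Num.sqrt n2; have r0 : 0 < r by rewrite sqrtr_gt0.
have r2 : r ^+ 2 = n2 by rewrite sqr_sqrtr// ltW.
have rn := lt0r_neq0 r0; have rhon := lt0r_neq0 rho0.
pose x := vscale (r / rho) a; pose q := Q4 (tau / r) (vx b / r) (vy b / r) (vz b / r).
have xr : vnorm x = r by rewrite vnorm_scale ?divr_ge0 ?ltW// -/rho divfK.
exists x, q; split.
- by rewrite -vnorm_sqr xr exprn_gt0.
- have -> : qn2 q = n2 / r ^+ 2.
    by rewrite /q /qn2 /qdot /n2 /dot /=; field.
  by rewrite r2 divff// gt_eqF.
rewrite -[y]row6K -/a -/b /class_of xr /q /= [r * _]mulrC divfK// sE.
congr row6.
  rewrite /x; case: (a) => a0' a1 a2; rewrite /vscale.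
  by apply: V3_eq; rewrite /=; field; rewrite rn rhon.
have bE (v : vec R) : vscale r (V3 (vx v / r) (vy v / r) (vz v / r)) = v.
  by case: v => v0 v1 v2; rewrite /vscale; apply: V3_eq; rewrite /= mulrC divfK.
exact (bE b).
Qed.

Lemma regular_range_open : open regular_range.
Proof.
have -> : regular_range = (fun y : 'rV[R]_6 => dot (left3 y) (left3 y)) @^-1` [set s | 0 < s] `&`
   ((fun y : 'rV[R]_6 => dot (left3 y) (left3 y)) @^-1` [set s | s != 1] `|`
    (fun y : 'rV[R]_6 => dot (right3 y) (right3 y)) @^-1` [set s | 0 < s]) by [].
have oC (k : 'rV[R]_6 -> R) (D : set R) : continuous k -> open D -> open (k @^-1` D).
  by move=> ck oD; apply: open_comp => // y _; exact: ck.
have o1 : open [set s : R | s != 1].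
  exact: open_neq.
by apply: openI; [|apply: openU]; apply: oC; try exact: dot_left_cont; try exact: dot_right_cont;
  try exact: open_gt.
Qed.

(** A curve of solutions is built along which the second vector of the class is affine in t with
    velocity [right3 w], and the first one has velocity [left3 w] at t = 0. *)
Lemma regular_submersion p (w : 'rV[R]_6) : S p ->
  exists2 v, tangent S p v & 'd regular_class p v = w.
Proof.
move=> Sp; set x0 := start p; have x00 : 0 < dot x0 x0 := solution_start Sp.
have r0 := vnorm_gt0 x00; set r := vnorm x0 in r0; have rn := lt0r_neq0 r0.
have up := qsol_unit_path (holonomy_within p); have pE := regular_solution Sp.
have sp := qsolP (holonomy_within p).
set q := qsol (holonomy_form p) in up sp pE; set dq := fun u => qhalf _ _ in up pE.
pose n := vscale r^-1 x0; have nn : dot n n = 1.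
  have -> : dot n n = dot x0 x0 / (r * r) by rewrite /n /dot /=; field.
  exact: vnorm_dot1.
pose tau0 := r * qr (q 1); pose s0 := sq tau0.
have s00 : 0 < s0 := sq_gt0 tau0; have s0n := lt0r_neq0 s00.
pose ds0 := s0 / Num.sqrt (1 + tau0 * tau0).
have ds0n : ds0 != 0 by rewrite mulf_neq0// invr_neq0// lt0r_neq0// sq_root_gt0.
(* The first vector moves as sq (tau0 + t tau1) times a unit vector. Here [tau1] accounts for the
   component of [left3 w] along n, and [xi] for the orthogonal one. *)
pose tau1 := dot (left3 w) n / ds0.
pose xi := vscale s0^-1 (vadd (left3 w) (vscale (- dot (left3 w) n) n)).
have xin : dot n xi = 0.
  have -> : dot n xi = s0^-1 * (dot (left3 w) n - dot (left3 w) n * dot n n).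
    by rewrite /xi /dot /=; ring.
  by rewrite nn mulr1 subrr mulr0.
pose e := Q4 (tau1 / r) (vx (right3 w) / r) (vy (right3 w) / r) (vz (right3 w) / r).
pose z (t : R) := qadd (q 1) (qscale t e).
pose k (t : R) : R := 1 + t * t * dot xi xi.
(* With |x t| equal to [rt t], the normalization of the end quaternion cancels: |x t| times it is r
   z t, which is affine in t. *)
pose rt (t : R) := r * Num.sqrt (qn2 (z t)).
pose x (t : R) := vscale (rt t / Num.sqrt (k t)) (vadd n (vscale t xi)).
have k1 t : 1 <= k t by rewrite /k lerDl mulr_ge0 ?dot_ge0// -expr2 sqr_ge0.
have k0 t : 0 < k t by exact: lt_le_trans (k1 t).
pose T : set R := ball (0 : R) (1 / 2 / (1 + qn2 e)).
have oT : open T by apply: ball_open; rewrite !divr_gt0// ltr_wpDr ?qn2_ge0.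
have T0 : T 0 by apply: ballxx; rewrite !divr_gt0// ltr_wpDr ?qn2_ge0.
have zp t : T t -> 0 < qn2 (z t).
  move=> Tt; have := deformed_ge up Tt itv01_1.
  have -> : qscale 1 e = e by rewrite /qscale /= !mul1r.
  by move=> h; apply: lt_le_trans h; rewrite divr_gt0.
have rt0 t : T t -> 0 < rt t by move=> /zp h; rewrite mulr_gt0// sqrtr_gt0.
have nE t : dot (vadd n (vscale t xi)) (vadd n (vscale t xi)) = k t.
  have -> : dot (vadd n (vscale t xi)) (vadd n (vscale t xi)) =
     dot n n + 2 * t * dot n xi + t * t * dot xi xi by rewrite /dot /=; ring.
  by rewrite nn xin mulr0 addr0.
have xr t : T t -> vnorm (x t) = rt t.
  move=> Tt; have kk : 0 < Num.sqrt (k t) by rewrite sqrtr_gt0.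
  rewrite vnorm_scale; last by rewrite divr_ge0// ltW// rt0.
  by rewrite /vnorm nE divfK// lt0r_neq0.
have xgt t : T t -> 0 < dot (x t) (x t).
  by move=> Tt; rewrite -vnorm_sqr xr// exprn_gt0// rt0.
have st : scls T (fun t => t).
  move=> j; apply: cls_atom => //; split=> //; last by move=> t; exact: within01_cst.
  by exists 1 => // t u _; rewrite mul1r.
have c := @scls_cst _ _ T oT.
have srt : scls T rt.
  apply: scls_mul; first exact: c.
  apply: scls_sqrt => //; rewrite /qn2 /qdot /z /=.
  have h (a b : R) : scls T (fun t => a + t * b).
    by apply: scls_add; [exact: c|apply: scls_mul => //; exact: c].
  by apply: scls_add; [apply: scls_add; [apply: scls_add|]|]; apply: scls_mul; exact: h.
have sk : scls T k.
  by apply: scls_add; [exact: c|apply: scls_mul; [exact: scls_mul|exact: c]].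
have ssk : scls T (fun t => (Num.sqrt (k t))^-1).
  by apply: scls_inv; [exact: scls_sqrt|move=> t _; rewrite lt0r_neq0// sqrtr_gt0].
have cx j : vcls T j [::] (fun t _ _ => x t).
  apply: vcls_smul; first exact: (scls_mul srt ssk j).
  apply: vcls_add; first by apply: vcls_cst => //; exact: vwithin_cst.
  by apply: vcls_smul => //; apply: vcls_cst => //; exact: vwithin_cst.
have c0 := @within01_cst R 0.
have [v dv tv] := deformation_tangent f_smooth f_neq0 0 up c0 cx xgt.
have x0E : x 0 = x0.
  have z0 : z 0 = q 1.
    by rewrite /z; case: (q 1) => a b c' d; rewrite /qadd /qscale; apply: Q4_eq; rewrite /=; ring.
  rewrite /x /rt /k z0 (qsolves_unit sp itv01_1) !mul0r addr0 sqrtr1 mulr1 divr1 /n.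
  have gen (s : R) (X Y : vec R) : s != 0 -> vscale s (vadd (vscale s^-1 X) (vscale 0 Y)) = X.
    by case: X => a b c' sn; rewrite /vscale /vadd; apply: V3_eq; rewrite /=; field.
  exact: gen.
rewrite x0E -pE in tv; exists v => //.
have d0 : deformation f x q dq (fun=> 0) e 0 0 = p.
  by rewrite deformation0// x0E -pE.
have := is_derive_diff dv; rewrite d0; apply.
  exact: smooth_on_diff regular_class_smooth (solution_start Sp).
pose a (t : R) := vscale (sq (tau0 + t * tau1) / Num.sqrt (k t)) (vadd n (vscale t xi)).
pose b (t : R) := vadd (vscale r (qim (q 1))) (vscale t (right3 w)).
have classE t : T t -> regular_class (deformation f x q dq (fun=> 0) e 0 t) = row6 (a t) (b t).
  move=> Tt; have -> : deformation f x q dq (fun=> 0) e 0 t =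
      Theta (x t) (deformed q e t) (deformed_der q dq e t) (fun=> 0).
    have e0 : (fun u : R => 0 + t * 0) = (fun=> 0 : R) by apply/funext => u; rewrite mulr0 addr0.
    by rewrite /deformation e0.
  rewrite regular_class_Theta; [|exact: xgt|exact: deformed_unit_path|by rewrite (deformed_start e up) sp.1].
  rewrite deformed_end -/(z t) /class_of xr// /qnorm /=.
  have szn : Num.sqrt (qn2 (z t)) != 0 by rewrite lt0r_neq0// sqrtr_gt0 zp.
  have R1 (y : R) : rt t * (qinvn (z t) * y) = r * y.
    by rewrite /rt /qinvn; field.
  congr row6.
    rewrite R1 /a (_ : r * _ = tau0 + t * tau1); last by rewrite /tau0 /e /=; field.
    rewrite /x; have kn : Num.sqrt (k t) != 0 by rewrite lt0r_neq0// sqrtr_gt0.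
    have rtn := lt0r_neq0 (rt0 t Tt).
    move: (rt t) (Num.sqrt (k t)) (sq _) (vadd _ _) kn rtn => A B C [v0 v1 v2] Bn An.
    by rewrite /vscale; apply: V3_eq; rewrite /=; field; rewrite An Bn.
  rewrite /vscale /b; apply: V3_eq; rewrite /= R1 /z /e /=; field; exact: rn.
have db : vder b 0 (right3 w).
  refine (vder_eq (vder_add (vder_cst 0 _) (vder_smul (dv_id 0) (vder_cst 0 (right3 w)))) _).
  by rewrite /vadd /vscale; apply: V3_eq; rewrite /=; ring.
have da : vder a 0 (left3 w).
  have dk : is_derive (0 : R) 1 k 0.
    refine (dv_eq (dv_add (dv_cst 0 1) (dv_mul (dv_mul (dv_id 0) (dv_id 0)) (dv_cst 0 (dot xi xi)))) _).
    by ring.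
  have k00 : k 0 = 1 by rewrite /k !mul0r addr0.
  have ds : is_derive (0 : R) 1 (fun t => Num.sqrt (k t)) 0.
    by refine (dv_eq (@dv_comp _ Num.sqrt k 0 _ _ (is_derive1_sqrt (k0 0)) dk) _); rewrite mulr0.
  have kn : Num.sqrt (k 0) != 0 by rewrite k00 sqrtr1 oner_neq0.
  have di := @dv_inv _ (fun t => Num.sqrt (k t)) 0 _ kn ds.
  have dt : is_derive (0 : R) 1 (fun t => tau0 + t * tau1) tau1.
    by refine (dv_eq (dv_add (dv_cst 0 tau0) (dv_mul (dv_id 0) (dv_cst 0 tau1))) _); ring.
  have dsq : is_derive (0 : R) 1 (fun t => sq (tau0 + t * tau1)) (ds0 * tau1).
    have e0 : tau0 + 0 * tau1 = tau0 by rewrite mul0r addr0.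
    by apply: (@dv_comp _ sq (fun t => tau0 + t * tau1) 0 _ _ _ dt); rewrite e0; exact: sq_der.
  have dn : vder (fun t => vadd n (vscale t xi)) 0 xi.
    refine (vder_eq (vder_add (vder_cst 0 n) (vder_smul (dv_id 0) (vder_cst 0 xi))) _).
    by case: (xi) => a0 a1 a2; rewrite /vadd /vscale; apply: V3_eq; rewrite /=; ring.
  refine (vder_eq (vder_smul (dv_mul dsq di) dn) _).
  have e0 : tau0 + 0 * tau1 = tau0 by rewrite mul0r addr0.
  rewrite k00 sqrtr1 e0 -/s0 /tau1 /xi; case: (n) (left3 w) => n0 n1 n2 [a0 a1 a2].
  by rewrite /vadd /vscale; apply: V3_eq; rewrite /=; field; rewrite s0n ds0n.
have := row6_is_derive da db; rewrite row6K; apply: near_eq_is_derive.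
by apply: filterS (open_nbhs_nbhs (conj oT T0)) => t Tt /=; rewrite classE.
Qed.

Lemma regular_nonsingular : ~ singular_phase_space M alpha.
Proof.
apply: (@regular_phase_space _ _ _ M alpha regular_range (@nonzero_start R) regular_class).
- exact: regular_range_open.
- exists (row6 (V3 1 0 0) (V3 1 0 0)); rewrite /regular_range /= left3E right3E /dot /=.
  by rewrite !(mul0r, mulr1, addr0) ltr01; split=> //; right.
- exact: regular_class_smooth.
- by move=> p /solution_start.
- move=> p Sp; apply: class_range (solution_start Sp) _.
  by apply: (qsolves_unit (qsolP (holonomy_within p))); exact: itv01_1.
- move=> y /class_surjective[x [q1 [x0 /unit_path_to[q [dq [uq q0 qE]]] <-]]].
  have c0 := @within01_cst R 0; exists (Theta x q dq (fun=> 0)).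
    exact: Theta_solutions.
  by rewrite regular_class_Theta// qE.
- by move=> p w; exact: regular_submersion.
- by move=> p q; exact: regular_fibres.
Qed.

End RegularCase.

(** * Constant area *)

Section ConstantAreaCase.
Context {R : realType} (f : R -> R).
Hypothesis f_smooth : forall (n : nat) (r : R), 0 < r -> derivable (f^`(n))%classic r 1.
Hypothesis f_neq0 : forall r : R, 0 < r -> f r != 0.
Hypothesis h'_eq0 : forall r : R, 0 < r -> h' f r = 0.

Local Notation Fld := (@fields R 3).
Local Notation M := [set x : 'rV[R]_3 | x != 0].
Local Notation alpha := (radial_bivector f).
Local Notation S := (solutions M alpha).
Local Notation Theta := (Theta f).
Implicit Types (x X w eta b : vec R) (p : Fld).

Lemma kappa_eq (r : R) : 0 < r -> kappa f r = - (f r)^-1 / r ^+ 2.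
Proof.
move=> r0; have rn := lt0r_neq0 r0; have := h'_eq0 r0; rewrite /h' /kappa.
have Fn := f_neq0 r0; have F2 : f r ^+ 2 != 0 by rewrite expf_neq0.
move/eqP; rewrite mulf_eq0 invr_eq0 (negbTE F2) orbF subr_eq0 => /eqP e.
by rewrite (_ : f' f r = f r / r); [field; rewrite Fn rn|rewrite {1}e mulrC mulKf].
Qed.

(** With h' = 0 a multiple of X added to w does not change [theta_eta], so w may be taken to be f
    eta. The radial component of eta is then recorded by [flat_flux]. *)
Definition flat_form p u : vec R := vscale (f (vnorm (start p))) (feta p u).
Definition flat_flux p u : R := dot (feta p u) (fpos p u) / vnorm (start p) ^+ 2.

Lemma flat_within p : vwithin (flat_form p) /\ {within itv01, continuous (flat_flux p)}.
Proof.
split; first by apply: vwithin_smul; [exact: within01_cst|exact: feta_within].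
apply: within01M; last exact: within01_cst.
by apply: within_dot; [exact: feta_within|exact: fpos_within].
Qed.

Lemma flat_solution p : S p -> p = Theta (start p) (qsol (flat_form p))
    (fun u => qhalf (qsol (flat_form p) u) (flat_form p u)) (flat_flux p) /\
  forall u, itv01 u -> fpos p u = qrot (qsol (flat_form p) u) (start p).
Proof.
move=> Sp; have r0 := vnorm_gt0 (solution_start Sp); have [c1 c2] := flat_within p.
apply: (solution_Theta f_neq0 Sp c1 c2) => u iu; have rn := lt0r_neq0 r0.
have Fn := f_neq0 r0.
rewrite /theta_eta kappa_eq// /flat_flux /flat_form.
have -> : dot (vscale (f (vnorm (start p))) (feta p u)) (fpos p u) =
   f (vnorm (start p)) * dot (feta p u) (fpos p u) by rewrite /dot /=; ring.
move: (vnorm (start p)) rn Fn => r rn; move: (f r) (dot (feta p u) (fpos p u)) => F d Fn.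
by case: (feta p u) (fpos p u) => a b c [a' b' c']; rewrite /vadd /vscale; apply: V3_eq;
  rewrite /=; field; rewrite Fn rn.
Qed.

Lemma flat_flux_prim p : S p -> flux p = vnorm (start p) ^+ 2 * prim (flat_flux p) 1.
Proof.
move=> Sp; have rn := lt0r_neq0 (vnorm_gt0 (solution_start Sp)).
have [_ c] := flat_within p; rewrite -primZ//; last exact: itv01_1.
by rewrite /flux; congr (prim _ 1); apply/funext => u; rewrite /flat_flux mulrC divfK// expf_neq0.
Qed.

(* Two lifts of a solution to unit quaternions differ by an element of this circle. *)
Lemma stabilizer x (s : quat R) : 0 < dot x x -> qn2 s = 1 -> qrot s x = x ->
  exists a : R, s = qexp (vscale (vnorm x)^-1 x) a 1.
Proof.
move=> x0 s1 sx; have r0 := vnorm_gt0 x0; have rn := lt0r_neq0 r0.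
pose n := vscale (vnorm x)^-1 x.
have nn : dot n n = 1 := dot_normalized x0.
(* A unit quaternion that fixes x commutes with it, so its imaginary part is parallel to x. *)
have com : qmul s (qvec x) = qmul (qvec x) s.
  rewrite -{1}sx -[RHS]qmul1q -(qmulKq s1) -!qmulA; congr qmul.
  by rewrite /qrot; case: s x {s1 sx x0 r0 rn n nn} => a b c d [x0 x1 x2]; rewrite /qmul /qvec;
    apply: Q4_eq; rewrite /=; ring.
have [k1 k2 k3] : [/\ vy (qim s) * vz x = vz (qim s) * vy x,
    vz (qim s) * vx x = vx (qim s) * vz x & vx (qim s) * vy x = vy (qim s) * vx x].
  move: com; case: s x {s1 sx x0 r0 rn n nn} => a b c d [x0 x1 x2].
  by rewrite /qmul /qvec /= => -[_ h1 h2 h3]; split; lra.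
pose be := dot (qim s) n.
have vE : qim s = vscale be n.
  have e1 : vscale (dot x x) (qim s) = vscale (dot (qim s) x) x.
    have -> : vscale (dot x x) (qim s) =
        vadd (vscale (dot (qim s) x) x) (cross x (cross (qim s) x)).
      by rewrite /vadd /vscale /dot /cross; apply: V3_eq; rewrite /=; ring.
    have -> : cross (qim s) x = V3 0 0 0.
      by rewrite /cross k1 k2 k3 !subrr.
    by case: (x) (dot _ _) => a b c d; rewrite /vadd /vscale /cross; apply: V3_eq; rewrite /=; ring.
  apply: (@vscale_inj _ (dot x x)); first by rewrite gt_eqF.
  rewrite e1 /be /n; move: (dot x x) (vnorm x) rn (vnorm_sqr x) => d r rn rd.
  have -> a : dot (qim s) (vscale a x) = a * dot (qim s) x by rewrite /dot /=; ring.
  by rewrite -rd; case: (x) (dot (qim s) _) => a b c k; rewrite /vscale; apply: V3_eq; rewrite /=; field.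
have cs : qr s ^+ 2 + be ^+ 2 = 1.
  rewrite -s1; have -> : qn2 s = qr s ^+ 2 + dot (qim s) (qim s) by rewrite /qn2 /qdot /dot /=; ring.
  rewrite vE; have -> : dot (vscale be n) (vscale be n) = be ^+ 2 * dot n n by rewrite /dot /=; ring.
  by rewrite nn mulr1.
have [a [ca sa]] := circle_angle cs; exists a.
rewrite /qexp mulr1 ca sa -/n.
have := congr1 (@vx R) vE; have := congr1 (@vy R) vE; have := congr1 (@vz R) vE.
by rewrite /=; case: (s) => a0 a1 a2 a3 /= -> -> ->.
Qed.

Definition twisted n (a : R) (q : R -> quat R) (u : R) := qmul (qexp n a u) (q u).
Definition twisted_der n (a : R) (q dq : R -> quat R) (u : R) :=
  qadd (qmul (qexp_der n a u) (q u)) (qmul (qexp n a u) (dq u)).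

Lemma twisted_unit_path n (a : R) (q dq : R -> quat R) : dot n n = 1 -> unit_path q dq ->
  unit_path (twisted n a q) (twisted_der n a q dq).
Proof.
move=> n1 uq; have [[de ce] e1] := qexp_unit_path a n1; have [[dQ cdq] q1] := uq.
have ceq := qder_qwithin de; have cq := qder_qwithin dQ.
split; last by move=> u iu; rewrite qn2_mul e1// q1// mulr1.
split; first by move=> u iu; exact: qder_mul (de u iu) (dQ u iu).
by apply: qwithin_add; exact: qwithin_mul.
Qed.

Lemma twisted_rot n (a c : R) (q : R -> quat R) u : dot n n = 1 ->
  qrot (twisted n a q u) (vscale c n) = qrot (q u) (vscale c n).
Proof.
move=> n1; rewrite /twisted rot_mul; congr qrot.
have := qexp_n2 a u n1; rewrite /qexp /= => e1.
set E := Q4 _ _ _ _ in e1 *.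
have -> : qrot E (vscale c n) = vscale (qn2 E) (vscale c n).
  by rewrite /qrot /E /qn2 /qdot /vscale; apply: V3_eq; rewrite /=; ring.
by rewrite e1 /vscale; apply: V3_eq; rewrite /= mul1r.
Qed.

Lemma twisted_vel n (a : R) (q dq : R -> quat R) u : dot n n = 1 -> qn2 (q u) = 1 ->
  vel (twisted n a q u) (twisted_der n a q dq u) = vadd (vel (q u) (dq u)) (vscale (2 * a) (qrot (q u) n)).
Proof.
move=> n1 q1; have E1 := qexp_n2 a u n1; have Ev := qexp_vel a u n1.
rewrite /twisted /twisted_der -rot_scale -Ev.
move: (qexp n a u) (qexp_der n a u) E1 => E D E1.
have -> : vel (qmul E (q u)) (qadd (qmul D (q u)) (qmul E (dq u))) =
   vadd (vscale (qn2 E) (vel (q u) (dq u))) (vadd (qrot (q u) (vel E D)) (vscale (2 * qdot E D) (qim (qmul (qconj (q u)) (q u))))).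
  by rewrite /vel /qrot /qn2 /qdot /vadd /vscale; apply: V3_eq; rewrite /=; ring.
rewrite E1 (qmulqK q1) /vadd /vscale /=; apply: V3_eq; ring.
Qed.

(** The twist leaves X in place and adds a multiple of X to the angular velocity; with h' = 0 such a
    multiple has no effect on eta. *)
Lemma twisted_Theta x (a : R) (q dq : R -> quat R) (m : R -> R) : 0 < dot x x ->
  unit_path q dq -> {within itv01, continuous m} ->
  let n := vscale (vnorm x)^-1 x in
  Theta x (twisted n a q) (twisted_der n a q dq) m = Theta x q dq m.
Proof.
move=> x0 uq cm n; have r0 := vnorm_gt0 x0; have rn := lt0r_neq0 r0.
have nn : dot n n = 1 := dot_normalized x0.
have xn : x = vscale (vnorm x) n.
  rewrite /n; case: (x) (vnorm x) rn => b c d r rn; rewrite /vscale.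
  by apply: V3_eq; rewrite /= mulrA mulfV// mul1r.
have ut := twisted_unit_path a nn uq.
have rotx u : qrot (twisted n a q u) x = qrot (q u) x by rewrite xn twisted_rot.
have rotn u : qrot (q u) n = vscale (vnorm x)^-1 (qrot (q u) x) by rewrite rot_scale.
apply: fields_eq => u iu; have [a1 a2 a3] := ThetaE f x ut cm iu;
  have [b1 b2 b3] := ThetaE f x uq cm iu; rewrite ?a1 ?a2 ?a3 ?b1 ?b2 ?b3 {a1 a2 a3 b1 b2 b3}.
1: by rewrite rotx.
all: rewrite twisted_vel ?uq.2// rotx rotn.
  by rewrite /cross /vadd /vscale; apply: V3_eq; rewrite /=; ring.
have XX : dot (qrot (q u) x) (qrot (q u) x) = vnorm x ^+ 2.
    by rewrite dot_rot uq.2// expr1n mul1r vnorm_sqr.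
rewrite /theta_eta; have -> w c X : dot (vadd w (vscale c (vscale (vnorm x)^-1 X))) X =
    dot w X + c / vnorm x * dot X X by rewrite /dot /=; ring.
rewrite XX kappa_eq//; have Fn := f_neq0 r0.
move: (vnorm x) rn Fn => r rn; move: (f r) (dot _ _) => F d Fn.
by case: (vel _ _) (qrot _ _) => a0 a1 a2 [b0 b1 b2]; rewrite /vadd /vscale; apply: V3_eq;
  rewrite /=; field; rewrite Fn rn.
Qed.

(** X(1) has the same norm as X(0), so the length of the second vector is free to carry the flux,
    through [sq]. *)
Definition flat_class p : 'rV[R]_6 := row6 (start p) (vscale (sq (flux p)) (fpos p 1)).
Definition flat_range : set 'rV[R]_6 :=
  [set y | 0 < dot (left3 y) (left3 y) /\ 0 < dot (right3 y) (right3 y)].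

(** Two solutions with the same end points may have lifts with different values q(1). These differ
    by a rotation fixing x, which a twist absorbs without changing the configuration; after that
    [Theta_leaf] applies. *)
Lemma flat_fibres (p q : Fld) : S p -> S q ->
  flat_class p = flat_class q <-> same_leaf M alpha p q.
Proof.
move=> Sp Sq; split=> [e|pq]; last first.
  have [es ee] := leaf_start f_smooth pq; rewrite /flat_class es ee.
  by rewrite (leaf_flux f_smooth f_neq0 pq)// h'_eq0//; exact: vnorm_gt0 (solution_start Sp).
have es : start p = start q by have := congr1 left3 e; rewrite !left3E.
have x0 := solution_start Sp; set x := start p in x0 *.
have nE (k : Fld) : S k -> start k = x -> vnorm (fpos k 1) = vnorm x.
  by move=> Sk sk; rewrite (solution_vnorm Sk itv01_1) sk.
have eR : vscale (sq (flux p)) (fpos p 1) = vscale (sq (flux q)) (fpos q 1).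
  by have := congr1 right3 e; rewrite !right3E.
have r0 := vnorm_gt0 x0; have rn := lt0r_neq0 r0.
have ec : flux p = flux q.
  apply: (can_inj sqK); have := congr1 (@vnorm R) eR.
  by rewrite !vnorm_scale ?ltW ?sq_gt0// !nE// => /(mulIf rn).
have e1 : fpos p 1 = fpos q 1.
  by move: eR; rewrite ec; apply: vscale_inj; rewrite lt0r_neq0// sq_gt0.
have [pE pR] := flat_solution Sp; have [qE qR] := flat_solution Sq.
have [cp mp] := flat_within p; have [cq mq] := flat_within q.
have up := qsol_unit_path cp; have uq := qsol_unit_path cq.
have sp := qsolP cp; have sq' := qsolP cq.
have i1 : itv01 (1 : R) := itv01_1.
pose s := qmul (qsol (flat_form q) 1) (qconj (qsol (flat_form p) 1)).
have p1 := qsolves_unit sp i1; have q1 := qsolves_unit sq' i1.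
have s1 : qn2 s = 1 by rewrite /s qn2_mul qn2_conj p1 q1 mulr1.
have sx : qrot s x = x.
  have xq : qrot (qsol (flat_form q) 1) x = fpos q 1 by rewrite (qR 1 i1) /x es.
  have xp : qrot (qsol (flat_form p) 1) x = fpos p 1 by rewrite (pR 1 i1).
  by rewrite /s rot_mul xq -e1 -xp -rot_mul qmulKq// rot_one.
have [a sE] := stabilizer x0 s1 sx.
rewrite pE qE -/x -es -/x -(twisted_Theta a x0 up mp).
set n := vscale _ _.
have nn : dot n n = 1 := dot_normalized x0.
apply: Theta_leaf => //; first exact: twisted_unit_path.
- by rewrite /twisted qexp_start sp.1 sq'.1 qmul1q.
- by rewrite /twisted -/n -sE /s -qmulA qmulqK// qmulq1.
have := ec; rewrite !flat_flux_prim// -es -/x; apply: mulfI.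
by rewrite expf_neq0.
Qed.

Lemma flat_class_smooth : smooth_on (@nonzero_start R) flat_class.
Proof.
have oU := @nonzero_start_open R.
have c1 n : vcls (@nonzero_start R) n [::] (fun p _ _ => fpos p 1).
  by split; apply: cls_atom => //;
    [apply: (atom_at itv01_1 (atom_pos 0))|apply: (atom_at itv01_1 (atom_pos 1))
    |apply: (atom_at itv01_1 (atom_pos 2))].
apply: (@row6_smooth _ _ _ (fun p _ _ => start p)
  (fun p _ u => vscale (sq (prim (fun u => dot (feta p u) (fpos p u)) u)) (fpos p 1)) 1 oU itv01_1) => n.
  exact: vcls_start.
exact (vcls_smul (cls_sq oU (cls_prim (cls_dot (vcls_feta n oU) (vcls_fpos n oU)))) (c1 n)).
Qed.

Lemma flat_class_Theta x (q dq : R -> quat R) (m : R -> R) : 0 < dot x x -> unit_path q dq ->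
  {within itv01, continuous m} -> q 0 = qone ->
  flat_class (Theta x q dq m) = row6 x (vscale (sq (dot x x * prim m 1)) (qrot (q 1) x)).
Proof.
move=> x0 uq cm q0; rewrite /flat_class start_Theta// flux_Theta//; last first.
  by rewrite h'_eq0// vnorm_gt0.
by have [-> _ _] := ThetaE f x uq cm itv01_1.
Qed.

Lemma flat_range_open : open flat_range.
Proof.
have oC (k : 'rV[R]_6 -> R) (D : set R) : continuous k -> open D -> open (k @^-1` D).
  by move=> ck oD; apply: open_comp => // y _; exact: ck.
have -> : flat_range = (fun y : 'rV[R]_6 => dot (left3 y) (left3 y)) @^-1` [set s | 0 < s] `&`
   (fun y : 'rV[R]_6 => dot (right3 y) (right3 y)) @^-1` [set s | 0 < s] by [].
by apply: openI; apply: oC; try exact: dot_left_cont; try exact: dot_right_cont; exact: open_gt.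
Qed.

Lemma rotation_of x y (q : quat R) : 0 < qn2 q -> qmul (qvec x) q = qmul q (qvec y) ->
  qrot (qnorm q) x = y.
Proof.
move=> q0 e.
have -> : qrot (qnorm q) x = vscale (qinvn q * qinvn q) (qim (qmul (qconj q) (qmul (qvec x) q))).
  by rewrite /qnorm /qrot /vscale; apply: V3_eq; rewrite /=; ring.
have -> : qim (qmul (qconj q) (qmul (qvec x) q)) = vscale (qn2 q) y.
  by rewrite e /qn2 /qdot /vscale; apply: V3_eq; rewrite /=; ring.
have := qinvn_sqr q0; move: (qinvn q) (qn2 q) => c d cd.
by case: y {e} => y0 y1 y2; rewrite /vscale; apply: V3_eq; rewrite /= mulrA cd mul1r.
Qed.

(* [r^2 - x y] intertwines [x] and [y]; it vanishes only if [y = - x]. *)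
Lemma rotation_transitive x y : 0 < dot x x -> dot y y = dot x x ->
  exists2 q : quat R, qn2 q = 1 & qrot q x = y.
Proof.
move=> x0 yx; pose q := qadd (Q4 (dot x x) 0 0 0) (qscale (-1) (qmul (qvec x) (qvec y))).
have com : qmul (qvec x) q = qmul q (qvec y).
  transitivity (qadd (qvec (vscale (dot x x) x)) (qvec (vscale (dot x x) y))).
    by rewrite /q /qmul /qadd /qscale /dot /vscale; apply: Q4_eq; rewrite /=; ring.
  transitivity (qadd (qvec (vscale (dot y y) x)) (qvec (vscale (dot x x) y))); first by rewrite yx.
  by rewrite /q /qmul /qadd /qscale /dot /vscale; apply: Q4_eq; rewrite /=; ring.
have [q0|q0] := ltP 0 (qn2 q).
  by exists (qnorm q); [exact: qn2_norm|exact: rotation_of].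
have yN : y = vscale (-1) x.
  have n2E : qn2 q = dot x x * dot (vadd x y) (vadd x y).
    transitivity (dot x x * dot x x + 2 * dot x x * dot x y + dot x x * dot y y).
      by rewrite /q /qn2 /qdot /dot /=; ring.
    by rewrite /dot /=; ring.
  have : dot (vadd x y) (vadd x y) = 0.
    by apply/eqP; rewrite eq_le dot_ge0 andbT -(pmulr_rle0 _ x0) -n2E.
  move/dot_eq0; rewrite /vadd => -[h1 h2 h3].
  by case: y h1 h2 h3 {yx com q n2E q0} => y0 y1 y2 /= h1 h2 h3; rewrite /vscale; apply: V3_eq; lra.
have h (v : quat R) : 0 < qn2 v -> qmul (qvec x) v = qmul v (qvec y) ->
    exists2 q : quat R, qn2 q = 1 & qrot q x = y.
  by move=> v0 vc; exists (qnorm v); [exact: qn2_norm|exact: rotation_of].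
rewrite {}yN {yx com q q0} in h *.
case: x x0 h => a b c; rewrite /dot /= -!expr2 => abc h.
have [ab|ab] := eqVneq (a ^+ 2 + b ^+ 2) 0.
  have a2 := sqr_ge0 a; have b2 := sqr_ge0 b.
  have a0 : a = 0 by apply/eqP; rewrite -sqrf_eq0; apply/eqP; lra.
  have b0 : b = 0 by apply/eqP; rewrite -sqrf_eq0; apply/eqP; lra.
  apply: (h (Q4 0 1 0 0)); first by rewrite /qn2 /qdot /= !mul0r mulr1 !addr0 add0r ltr01.
  by rewrite a0 b0 /qmul /vscale; apply: Q4_eq; rewrite /=; ring.
apply: (h (Q4 0 (- b) a 0)).
  have -> : qn2 (Q4 0 (- b) a 0) = a ^+ 2 + b ^+ 2 by rewrite /qn2 /qdot /=; ring.
  by rewrite lt0r ab addr_ge0// sqr_ge0.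
by rewrite /qmul /vscale; apply: Q4_eq; rewrite /=; ring.
Qed.

Lemma prim_cst (c : R) : prim (fun=> c) 1 = c.
Proof.
have dF u (_ : itv01 u) : is_derive u 1 (fun s : R => c * s) c.
  by refine (dv_eq (dv_cmul c (dv_id u)) _); rewrite mulr1.
by rewrite (prim_unique (@within01_cst R c) dF itv01_1) mulr1 mulr0 subr0.
Qed.

Lemma flat_surjective y : flat_range y -> exists2 p, S p & flat_class p = y.
Proof.
set a := left3 y; set b := right3 y => -[a0 b0].
have ra := vnorm_gt0 a0; have rb := vnorm_gt0 b0.
have ran := lt0r_neq0 ra; have rbn := lt0r_neq0 rb.
(* The ratio of the lengths encodes the flux, and the direction of b gives the end point. *)
pose c := vnorm b / vnorm a; have c0 : 0 < c by rewrite divr_gt0.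
have cn := lt0r_neq0 c0.
have [|q1 q11 qE] := @rotation_transitive a (vscale c^-1 b) a0.
  have -> : dot (vscale c^-1 b) (vscale c^-1 b) = c^-1 * c^-1 * dot b b.
    by rewrite /dot /=; ring.
  by rewrite -[dot b b]vnorm_sqr -[dot a a]vnorm_sqr /c; field; rewrite ran rbn.
have [q [dq [uq q0 q1E]]] := unit_path_to q11.
pose m := fun _ : R => unsq c / dot a a; have cm : {within itv01, continuous m}.
  exact: within01_cst.
exists (Theta a q dq m); first exact: Theta_solutions.
rewrite flat_class_Theta// prim_cst mulrC divfK ?lt0r_neq0// unsqK// q1E qE.
rewrite -[RHS]row6K -/a -/b; congr row6.
have gen (s : R) (v : vec R) : s != 0 -> vscale s (vscale s^-1 v) = v.
  by case: v => v0 v1 v2 sn; rewrite /vscale; apply: V3_eq; rewrite /= mulrA mulfV// mul1r.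
exact (gen _ _ cn).
Qed.

Lemma flat_submersion p (w : 'rV[R]_6) : S p ->
  exists2 v, tangent S p v & 'd flat_class p v = w.
Proof.
move=> Sp; set x0 := start p; have x00 : 0 < dot x0 x0 := solution_start Sp.
have r2n : dot x0 x0 != 0 by rewrite gt_eqF.
have [cw cm] := flat_within p; have up := qsol_unit_path cw.
have [pE pR] := flat_solution Sp; have sp := qsolP cw.
set q := qsol (flat_form p) in up sp pE pR; set dq := fun u => qhalf _ _ in up pE.
set m := flat_flux p in cm pE.
have i1 : itv01 (1 : R) := itv01_1.
have q1 : qn2 (q 1) = 1 := qsolves_unit sp i1.
pose J := prim m 1; pose X1 := qrot (q 1) x0.
have XX : dot X1 X1 = dot x0 x0 by rewrite dot_rot q1 expr1n mul1r.
pose lam := dot x0 x0 * J; pose s0 := sq lam.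
have s0n : s0 != 0 by rewrite lt0r_neq0// sq_gt0.
pose ds0 := s0 / Num.sqrt (1 + lam * lam).
have ds0n : ds0 != 0 by rewrite mulf_neq0// invr_neq0// lt0r_neq0// sq_root_gt0.
set w1 := left3 w; set w2 := right3 w.
(* The required velocity of the flux. Since |X(1)| = |x| along the curve, X1 . dX1 has to be x0 .
   w1, and the component of w2 along X1 then determines [dlam]. This is what makes [zeta] orthogonal
   to X1. *)
pose dlam := (dot w2 X1 - s0 * dot x0 w1) / (ds0 * dot x0 x0).
pose dX1 := vscale s0^-1 (vadd w2 (vscale (- (ds0 * dlam)) X1)).
pose zeta := vadd dX1 (vscale (-1) (qrot (q 1) w1)).
have zX : dot X1 zeta = 0.
  have -> : dot X1 zeta = s0^-1 * (dot w2 X1 - ds0 * dlam * dot X1 X1) - dot (qrot (q 1) x0) (qrot (q 1) w1).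
    by rewrite /zeta /dX1 /X1 /dot /=; ring.
  rewrite dot_rot q1 expr1n mul1r XX /dlam; move: (dot w2 X1) (dot x0 x0) (dot x0 w1) r2n => A B C Bn.
  by field; rewrite s0n ds0n Bn.
(* The angular velocity that moves X1 with velocity [zeta]; it exists because [zeta] is orthogonal
   to X1. *)
pose om := vscale (dot x0 x0)^-1 (cross zeta X1).
have omE : cross X1 om = zeta.
  have -> : cross X1 om = vscale (dot x0 x0)^-1 (vadd (vscale (dot X1 X1) zeta) (vscale (- dot X1 zeta) X1)).
    by rewrite /om /cross /vadd /vscale /dot; apply: V3_eq; rewrite /=; ring.
  rewrite zX XX oppr0; case: (zeta) (X1) => a b c [a' b' c']; rewrite /vadd /vscale.
  by apply: V3_eq; rewrite /= mul0r addr0 mulrA mulVf// mul1r.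
pose e := qhalf (q 1) om.
have qe : qdot (q 1) e = 0 by rewrite /e /qhalf /qdot /=; ring.
(* Chosen so that |x|^2 (J + t mu) has derivative [dlam] at t = 0. Next, [al] and [xi] split w1 into
   its radial and tangential parts. *)
pose mu := (dlam - 2 * dot x0 w1 * J) / dot x0 x0.
pose al := dot x0 w1 / dot x0 x0; pose xi := vadd w1 (vscale (- al) x0).
have xin : dot x0 xi = 0.
  have -> : dot x0 xi = dot x0 w1 - al * dot x0 x0 by rewrite /xi /dot /=; ring.
  by rewrite /al divfK// subrr.
(* [sq] is positive with value and derivative 1 at 0, so x t never vanishes and has the radial
   velocity al x0 at t = 0. *)
pose x (t : R) := vscale (sq (t * al)) (vadd x0 (vscale t xi)).
pose T : set R := ball (0 : R) (1 / 2 / (1 + qn2 e)).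
have oT : open T by apply: ball_open; rewrite !divr_gt0// ltr_wpDr ?qn2_ge0.
have T0 : T 0 by apply: ballxx; rewrite !divr_gt0// ltr_wpDr ?qn2_ge0.
have xgt t : T t -> 0 < dot (x t) (x t).
  move=> _; have -> : dot (x t) (x t) = sq (t * al) ^+ 2 *
     (dot x0 x0 + 2 * t * dot x0 xi + t * t * dot xi xi) by rewrite /x /dot /=; ring.
  rewrite xin mulr0 addr0 mulr_gt0 ?exprn_gt0 ?sq_gt0// ltr_pwDl//.
  by rewrite mulr_ge0 ?dot_ge0// -expr2 sqr_ge0.
have st : scls T (fun t => t).
  move=> j; apply: cls_atom => //; split=> //; last by move=> t; exact: within01_cst.
  by exists 1 => // t u _; rewrite mul1r.
have c := @scls_cst _ _ T oT.
have cx j : vcls T j [::] (fun t _ _ => x t).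
  apply: vcls_smul.
    by apply: cls_sq => //; apply: (scls_mul st (c al) j).
  apply: vcls_add; first by apply: vcls_cst => //; exact: vwithin_cst.
  by apply: vcls_smul => //; apply: vcls_cst => //; exact: vwithin_cst.
have [v dv tv] := deformation_tangent f_smooth f_neq0 mu up cm cx xgt.
have sq0 : sq (0 : R) = 1 by rewrite /sq mulr0 addr0 sqrtr1 add0r.
have x0E : x 0 = x0.
  rewrite /x mul0r sq0; case: (x0) => a b c'; rewrite /vscale /vadd.
  by apply: V3_eq; rewrite /=; ring.
rewrite x0E -pE in tv; exists v => //.
have d0 : deformation f x q dq m e mu 0 = p by rewrite deformation0// x0E -pE.
have := is_derive_diff dv; rewrite d0; apply.
  exact: smooth_on_diff flat_class_smooth (solution_start Sp).
pose z (t : R) := qadd (q 1) (qscale t e).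
pose b (t : R) := vscale (sq (dot (x t) (x t) * (J + t * mu))) (qrot (qnorm (z t)) (x t)).
have classE t : T t -> flat_class (deformation f x q dq m e mu t) = row6 (x t) (b t).
  move=> Tt; rewrite flat_class_Theta; [|exact: xgt|exact: deformed_unit_path
    |exact: deformed_flux_within|by rewrite (deformed_start e up) sp.1].
  rewrite deformed_end -/(z t) /b primD//; [|exact: within01_cst].
  by rewrite prim_cst.
have dx : vder x 0 w1.
  have ds : is_derive (0 : R) 1 (fun t : R => sq (t * al)) al.
    have dt := dv_mul (dv_id (0 : R)) (dv_cst 0 al).
    have ds := sq_der (0 * al); rewrite mul0r sq0 mulr0 addr0 sqrtr1 divr1 in ds.
    have ds' : is_derive (0 * al) 1 sq 1 by rewrite mul0r.
    by refine (dv_eq (@dv_comp _ sq (fun t => t * al) 0 _ _ ds' dt) _); ring.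
  refine (vder_eq (vder_smul ds (vder_add (vder_cst 0 x0) (vder_smul (dv_id 0) (vder_cst 0 xi)))) _).
  rewrite mul0r sq0 /xi; case: (w1) (x0) => a0 a1 a2 [b0 b1 b2].
  by rewrite /vadd /vscale; apply: V3_eq; rewrite /=; ring.
have z0 : z 0 = q 1.
  by rewrite /z; case: (q 1) => a b' c' d; rewrite /qadd /qscale; apply: Q4_eq; rewrite /=; ring.
have dz : qder z 0 e.
  refine (qder_eq (qder_add (qder_cst 0 (q 1)) (qder_smul (dv_id 0) (qder_cst 0 e))) _).
  by case: (e) => a b' c' d; rewrite /qadd /qscale; apply: Q4_eq; rewrite /=; ring.
have dQ : qder (fun t => qnorm (z t)) 0 (qhalf (qnorm (z 0)) om).
  have z0p : 0 < qn2 (z 0) by rewrite z0 q1 ltr01.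
  refine (qder_eq (qnorm_vder z0p dz) _); rewrite z0 qnorm_unit// -/e /qnorm_der qe /qinvn q1 sqrtr1 invr1.
  by case: (e) (q 1) => a b' c' d [a' b'' c'' d']; rewrite /qadd /qscale; apply: Q4_eq; rewrite /=; ring.
have dl : is_derive (0 : R) 1 (fun t => dot (x t) (x t) * (J + t * mu)) dlam.
  refine (dv_eq (dv_mul (dv_dot dx dx) (dv_add (dv_cst 0 J) (dv_mul (dv_id 0) (dv_cst 0 mu)))) _).
  rewrite x0E (_ : dot w1 x0 = dot x0 w1); last by rewrite /dot; ring.
  by rewrite /mu; move: (dot x0 x0) (dot x0 w1) r2n => A B An; field.
have db : vder b 0 w2.
  have l0 : dot (x 0) (x 0) * (J + 0 * mu) = lam by rewrite x0E mul0r addr0.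
  have ds : is_derive (0 : R) 1 (fun t => sq (dot (x t) (x t) * (J + t * mu))) (ds0 * dlam).
    apply: (@dv_comp _ sq (fun t => dot (x t) (x t) * (J + t * mu)) 0 _ _ _ dl).
    by rewrite l0; exact: sq_der.
  refine (vder_eq (vder_smul ds (vder_rot dQ dx)) _).
  rewrite l0 x0E z0 qnorm_unit// -/X1 omE -/s0 /zeta /dX1.
  case: (w2) (X1) (qrot (q 1) w1) => a0 a1 a2 [b0 b1 b2] [c0 c1 c2].
  by rewrite /vadd /vscale; apply: V3_eq; rewrite /=; field; exact: s0n.
have := row6_is_derive dx db; rewrite row6K; apply: near_eq_is_derive.
by apply: filterS (open_nbhs_nbhs (conj oT T0)) => t Tt /=; rewrite classE.
Qed.

Lemma flat_nonsingular : ~ singular_phase_space M alpha.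
Proof.
apply: (@regular_phase_space _ _ _ M alpha flat_range (@nonzero_start R) flat_class).
- exact: flat_range_open.
- exists (row6 (V3 1 0 0) (V3 1 0 0)); rewrite /flat_range /= left3E right3E /dot /=.
  by rewrite !(mul0r, mulr1, addr0) ltr01.
- exact: flat_class_smooth.
- by move=> p /solution_start.
- move=> p Sp; rewrite /flat_range /= left3E right3E; split; first exact: solution_start Sp.
  have -> : dot (vscale (sq (flux p)) (fpos p 1)) (vscale (sq (flux p)) (fpos p 1)) =
     sq (flux p) ^+ 2 * dot (fpos p 1) (fpos p 1) by rewrite /dot /=; ring.
  rewrite (solution_norm Sp itv01_1) mulr_gt0 ?exprn_gt0 ?sq_gt0//.
  exact: solution_start Sp.
- exact: flat_surjective.
- by move=> p w; exact: flat_submersion.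
- by move=> p q; exact: flat_fibres.
Qed.

End ConstantAreaCase.

(** Continuity on the solutions is all that the critical case takes from a submersion; the rest is
    Hausdorffness of N. *)
Lemma submersion_continuous (R : realType) (E : normedModType R) (S : set E)
    (N : smooth_manifold R) (pr : E -> N) (p : E) (W : set N) :
  smooth_submersion S pr -> S p -> nbhs (pr p) W ->
  exists2 d : R, 0 < d & forall q, S q -> `|q - p| < d -> W (pr q).
Proof.
move=> sub Sp nW; have [c atc domc] := mfd_cover (pr p).
have [U [g [Up gs gS _]]] := sub p Sp c atc domc.
have [odom oimg cK _ cinv] := mfd_charts atc.
have [_ gp] := gS p Sp Up.
have imgp : chart_img c (g p) by rewrite -gp; exists (pr p).
have invp : chart_inv c (g p) = pr p by rewrite -gp cK// inE.
have cg : {for p, continuous g} by exact/differentiable_continuous/(smooth_on_diff gs Up).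
have ci : {for g p, continuous (chart_inv c)}.
  by move: cinv; rewrite continuous_open_subspace// => /(_ (g p)); apply; rewrite inE.
have nV : nbhs p (U `&` (fun q => W (chart_inv c (g q)))).
  apply: filterI; first by apply: open_nbhs_nbhs; split=> //; exact: gs.1.
  have nW' : nbhs (g p) (chart_inv c @^-1` W).
    by have := ci W; rewrite /= invp; apply.
  exact (cg _ nW').
have /nbhs_ballP[d d0 dV] := nV; exists d => // q Sq qd.
have [Uq Wq] : (U `&` (fun q => W (chart_inv c (g q)))) q.
  by apply: dV; rewrite -ball_normE /= distrC.
have [domq gq] := gS q Sq Uq.
by rewrite -gq cK ?inE in Wq.
Qed.

(** * A critical point of a non-constant area *)

Section CriticalPoint.
Context {R : realType} (f : R -> R).
Hypothesis f_smooth : forall (n : nat) (r : R), 0 < r -> derivable (f^`(n))%classic r 1.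
Hypothesis f_neq0 : forall r : R, 0 < r -> f r != 0.

Local Notation Fld := (@fields R 3).
Local Notation M := [set x : 'rV[R]_3 | x != 0].
Local Notation alpha := (radial_bivector f).
Local Notation S := (solutions M alpha).
Local Notation h' := (h' f).

Let e1 : vec R := V3 1 0 0.

Let e11 : dot e1 e1 = 1.
Proof. by rewrite /dot /=; ring. Qed.

(** Constant X forces eta to be parallel to X. These configurations suffice to exhibit the
    singularity. *)
Definition radial_field (r c : R) : Fld :=
  mkF (vscale r e1) (fun=> V3 0 0 0) (fun=> vscale c e1).

Lemma radial_fieldE (r c u : R) : itv01 u -> [/\ fpos (radial_field r c) u = vscale r e1,
  fvel (radial_field r c) u = V3 0 0 0 & feta (radial_field r c) u = vscale c e1].
Proof.
move=> iu; split; [|by rewrite mkF_vel//; exact: vwithin_cst|by rewrite mkF_eta//; exact: vwithin_cst].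
rewrite mkF_pos//; last exact: vwithin_cst.
have p0 : prim (fun=> 0 : R) u = 0.
  have dF s (_ : itv01 s) : is_derive s 1 (fun=> 0 : R) 0 := dv_cst s 0.
  by rewrite (prim_unique (@within01_cst R 0) dF iu) subrr.
by rewrite /vprim p0 /vadd; apply: V3_eq; rewrite /= addr0.
Qed.

Lemma radial_norm (r : R) : 0 < r -> vnorm (vscale r e1) = r.
Proof. by move=> r0; rewrite vnorm_scale ?ltW// /vnorm e11 sqrtr1 mulr1. Qed.

Lemma radial_solution (r c : R) : 0 < r -> S (radial_field r c).
Proof.
move=> r0; apply/solutionsP => u iu; have [-> -> ->] := radial_fieldE r c iu; split.
  by rewrite /dot /= !mulr0 !mulr1 !addr0 mulr_gt0.
by rewrite /vscale /cross; apply: V3_eq; rewrite /=; ring.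
Qed.

Lemma radial_flux (r c : R) : flux (radial_field r c) = c * r.
Proof.
rewrite -[RHS]prim_cst; rewrite /flux (@eq_prim _ _ (fun=> c * r))// => u iu.
by have [-> _ ->] := radial_fieldE r c iu; rewrite /dot /=; ring.
Qed.

(** A uniform rotation about e1 does not move r e1, but it contributes 2 a h' to the radial
    component of eta; compare [dot_theta]. *)
Lemma radial_Theta (r a : R) : 0 < r ->
  radial_field r (2 * a * h' r) = Theta f (vscale r e1) (qexp e1 a) (qexp_der e1 a) (fun=> 0).
Proof.
move=> r0; have uq := qexp_unit_path a e11; have c0 := @within01_cst R 0.
have rn := lt0r_neq0 r0; have Fn := f_neq0 r0.
have rotE u : qrot (qexp e1 a u) (vscale r e1) = vscale r e1.
  have := twisted_rot a r (fun=> qone) u e11; rewrite /twisted qmulq1 => ->.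
  by rewrite rot_one.
apply: fields_eq => u iu; have [a1 a2 a3] := radial_fieldE r (2 * a * h' r) iu;
  have [b1 b2 b3] := ThetaE f (vscale r e1) uq c0 iu;
  rewrite ?a1 ?a2 ?a3 ?b1 ?b2 ?b3 ?rotE// ?qexp_vel//.
  by rewrite /cross /vscale; apply: V3_eq; rewrite /=; ring.
rewrite radial_norm// /theta_eta /kappa /h' /dot /vadd /vscale.
by apply: V3_eq; rewrite /=; field; rewrite rn Fn.
Qed.

(* Going around the circle that fixes [e1] an integer number of times does not
   change the holonomy, but it shifts the radial component of the one-form. *)
Lemma radial_leaf (r a : R) : 0 < r -> cos a = 1 -> sin a = 0 ->
  same_leaf M alpha (radial_field r 0) (radial_field r (2 * a * h' r)).
Proof.
move=> r0 ca sa; have -> : radial_field r 0 = radial_field r (2 * 0 * h' r).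
  by rewrite mulr0 mul0r.
rewrite !radial_Theta//; apply: Theta_leaf => //; try exact: qexp_unit_path;
  try exact: within01_cst.
- by rewrite /dot /= !mulr0 !mulr1 !addr0 mulr_gt0.
- by rewrite !qexp_start.
- by rewrite /qexp !mulr1 ca sa cos0 sin0.
Qed.

Lemma radial_dist (r c r' c' d : R) : `|r' - r| <= d -> `|c' - c| <= d ->
  `|radial_field r' c' - radial_field r c| <= d.
Proof.
move=> rd cd; have d0 : 0 <= d by exact: le_trans rd.
have coord (s t : R) : `|s - t| <= d -> vle (vadd (vscale s e1) (vscale (-1) (vscale t e1))) d.
  by move=> st; split; [rewrite /= !mulr1 mulN1r|rewrite /= !mulr0 addr0 normr0
    |rewrite /= !mulr0 addr0 normr0].
apply: fields_norm_le => u iu.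
have [k1 k2 k3] := fields_comb (radial_field r' c') (radial_field r c) (-1) u.
rewrite -scaleN1r; have [a1 a2 a3] := radial_fieldE r' c' iu; have [b1 b2 b3] := radial_fieldE r c iu.
move: (_ + _) k1 k2 k3 => P k1 k2 k3; split.
- by rewrite -[P.1 u]vrowK -/(fpos P u) k1 a1 b1; exact/rowv_le/coord.
- rewrite -[velocity P.1 u]vrowK -/(fvel P u) k2 a2 b2; apply: rowv_le.
  by split; rewrite /= mulr0 addr0 normr0.
- by rewrite -[P.2 u]vrowK -/(feta P u) k3 a3 b3; exact/rowv_le/coord.
Qed.

Lemma turns (j : nat) : cos (2 * pi * j%:R) = 1 :> R /\ sin (2 * pi * j%:R) = 0 :> R.
Proof.
elim: j => [|j [cj sj]]; first by rewrite mulr0 cos0 sin0.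
have -> : 2 * pi * j.+1%:R = 2 * pi * j%:R + pi + pi :> R by rewrite -natr1; ring.
by rewrite !cosDpi !sinDpi cj sj !opprK.
Qed.

Lemma h'_continuous (r : R) : 0 < r -> {for r, continuous h'}.
Proof.
move=> r0; have F2 : f r ^+ 2 != 0 by rewrite expf_neq0// f_neq0.
have d0 := f_der f_smooth r0; have d1 : is_derive r 1 (f' f) _ := f_tower f_smooth 1 r0.
have dn := dv_sub d0 (dv_mul (dv_id r) d1).
have dd : is_derive r 1 (fun s => f s ^+ 2) (f' f r * f r + f r * f' f r).
  by under eq_fun do rewrite expr2; exact: dv_mul.
have d := dv_mul dn (@dv_inv _ (fun s => f s ^+ 2) r _ F2 dd); exact (dv_cont d).
Qed.

(* [r0] is the last zero of [h'] on the way from [r1] to [r2]. *)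
Lemma critical_boundary (r1 r2 : R) : 0 < r1 -> 0 < r2 -> h' r1 = 0 -> h' r2 != 0 ->
  exists r0 : R, [/\ 0 < r0, h' r0 = 0 & forall d : R, 0 < d -> exists r : R,
    [/\ 0 < r, `|r - r0| < d, h' r != 0 & `|h' r| < d]].
Proof.
move=> r10 r20 z1 z2; pose ell (t : R) := r1 + t * (r2 - r1).
have ellp t : 0 <= t -> t <= 1 -> 0 < ell t by rewrite /ell => *; nra.
pose E := [set t : R | 0 <= t <= 1 /\ h' (ell t) = 0].
have E0 : E 0 by split; rewrite ?lexx ?ler01// /ell mul0r addr0.
have hE : has_sup E by split; [exists 0|exists 1 => t [/andP[]]].
pose s := sup E.
have s0 : 0 <= s by exact: sup_upper_bound.
have s1 : s <= 1 by apply: ge_sup; [exists 0|move=> t [/andP[]]].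
have r00 := ellp s s0 s1.
have cont (d : R) : 0 < d -> exists2 e : R, 0 < e & forall t, `|t - s| < e ->
    `|h' (ell t) - h' (ell s)| < d.
  move=> d0; have /cvgrPdist_lt/(_ d d0)/nbhs_ballP[e e0 eH] := h'_continuous r00.
  have k0 : 0 < `|r2 - r1| + 1 by rewrite ltr_wpDl.
  exists (e / (`|r2 - r1| + 1)); first by rewrite divr_gt0.
  move=> t; rewrite ltr_pdivlMr// => te; rewrite distrC; apply: eH.
  rewrite -ball_normE /= /ell opprD addrACA subrr add0r -mulrBl normrM distrC.
  by apply: le_lt_trans te; rewrite ler_wpM2l// lerDl.
have zs : h' (ell s) = 0.
  apply/eqP/contraT => hs; have := hs; rewrite -normr_gt0 => /cont[e e0 eH].
  have [t Et st] := sup_adherent e0 hE; have ts : t <= s by exact: sup_upper_bound.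
  have [_ zt] := Et; have : `|t - s| < e by rewrite ltr_norml; apply/andP; split; move: st ts; rewrite -/s; lra.
  by move/eH; rewrite zt sub0r normrN ltxx.
have s1' : s < 1.
  rewrite lt_neqAle s1 andbT; apply: contraNneq z2 => se; move: zs; rewrite se /ell mul1r.
  by rewrite addrC subrK => ->.
exists (ell s); split=> // d d0; have [e e0 eH] := cont d d0.
have k0 : 0 < `|r2 - r1| + 1 by rewrite ltr_wpDl.
(* A step beyond the last zero, short enough for the continuity of h', for the end of the segment
   and for the distance to r0. *)
pose k := Num.min (e / 2) (Num.min (1 - s) (d / (`|r2 - r1| + 1) / 2)).
have kp : 0 < k by rewrite !lt_min subr_gt0 s1' !divr_gt0.
have ke : k < e by rewrite gt_min ltr_pdivrMr// ltr_pMr// ltr1n.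
have ks : k <= 1 - s by rewrite /k !ge_min lexx orbT.
have kd : k * (`|r2 - r1| + 1) < d.
  rewrite -ltr_pdivlMr//; apply: (@le_lt_trans _ _ (d / (`|r2 - r1| + 1) / 2)).
    by rewrite /k !ge_min lexx !orbT.
  by rewrite ltr_pdivrMr// ltr_pMr ?ltr1n// divr_gt0.
have t1 : s + k <= 1 by move: ks; lra.
have t0 : 0 <= s + k by rewrite addr_ge0// ltW.
exists (ell (s + k)); split.
- exact: ellp.
- rewrite /ell opprD addrACA subrr add0r -mulrBl addrAC subrr add0r normrM gtr0_norm//.
  by apply: le_lt_trans kd; rewrite (ler_wpM2l (ltW kp))// lerDl.
- apply/eqP => z; have : E (s + k) by split; [apply/andP|].
  by move/(sup_upper_bound hE); rewrite -/s gerDl leNgt kp.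
- by have := eH (s + k); rewrite addrAC subrr add0r gtr0_norm// zs subr0; apply.
Qed.

Lemma critical_singular (r0 : R) : 0 < r0 -> h' r0 = 0 ->
  (forall d : R, 0 < d -> exists r : R, [/\ 0 < r, `|r - r0| < d, h' r != 0 & `|h' r| < d]) ->
  singular_phase_space M alpha.
Proof.
move=> r00 z acc [N [pr [sub _ fib]]].
have Sp := radial_solution 0 r00; have Sq := radial_solution (4 * pi) r00.
have pi0 := pi_gt0 R.
suff : pr (radial_field r0 0) = pr (radial_field r0 (4 * pi)).
  move/(fib _ _ Sp Sq)/(leaf_flux f_smooth f_neq0); rewrite !radial_flux.
  have -> : start (radial_field r0 0) = vscale r0 e1.
    by have [e _ _] := radial_fieldE r0 0 itv01_0.
  rewrite radial_norm// => /(_ z)/eqP; rewrite mul0r eq_sym mulf_eq0 (gt_eqF r00) orbF.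
  by rewrite mulf_eq0 (gt_eqF pi0) orbF pnatr_eq0.
apply: (@mfd_hausdorff _ N) => A B nA nB.
have [d1 d10 dA] := submersion_continuous sub Sp nA.
have [d2 d20 dB] := submersion_continuous sub Sq nB.
(* A margin for both neighbourhoods: [d] bounds the change of the radius, and 4 pi d the change of
   the radial component. *)
pose d := Num.min d1 d2 / 2 / (4 * pi + 1).
have pp : 0 < 4 * pi + 1 :> R by rewrite ltr_wpDl// mulr_ge0// ltW.
have p4 : 0 <= 4 * pi :> R by rewrite mulr_ge0// ltW.
have dm : 0 < Num.min d1 d2 by rewrite lt_min d10.
have d0 : 0 < d by rewrite !divr_gt0.
have [r [rp rr hn hd]] := acc d d0.
have hp : 0 < `|h' r| by rewrite normr_gt0.
(* The largest number of turns with j |h' r| <= 1, so that 1 - j |h' r| < |h' r| < d. The sign in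
   [a] makes the shift 4 pi j |h' r|. *)
pose j := Num.truncn (`|h' r|^-1).
have /andP[j1 j2] : j%:R <= `|h' r|^-1 < j.+1%:R by apply: truncn_itv; rewrite invr_ge0.
pose a : R := Num.sg (h' r) * (2 * pi * j%:R).
have [cj sj] := turns j.
have [ca sa] : cos a = 1 /\ sin a = 0.
  rewrite /a; have [h0|h0] := ltP 0 (h' r).
    by rewrite gtr0_sg// mul1r.
  rewrite ltr0_sg ?mulN1r ?cosN ?sinN ?cj ?sj ?oppr0//.
  by rewrite lt_neqAle hn.
have leaf := radial_leaf rp ca sa.
have cE : 2 * a * h' r = 4 * pi * (j%:R * `|h' r|).
  by rewrite /a normrEsg; ring.
have ph : pr (radial_field r 0) = pr (radial_field r (2 * a * h' r)).
  exact (proj2 (fib _ _ (radial_solution 0 rp) (radial_solution (2 * a * h' r) rp)) leaf).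
have dd : d * (4 * pi + 1) < Num.min d1 d2.
  by rewrite /d divfK ?gt_eqF// ltr_pdivrMr// ltr_pMr// ltr1n.
have dle : d <= d * (4 * pi + 1) by rewrite (ler_peMr (ltW d0))// lerDr.
exists (pr (radial_field r 0)); split.
  apply: dA; first exact: radial_solution.
  apply: (@le_lt_trans _ _ (d * (4 * pi + 1))); last by move: dd; rewrite lt_min => /andP[].
  by apply: radial_dist; [exact: le_trans (ltW rr) dle|rewrite subrr normr0 (le_trans (ltW d0))].
rewrite ph; apply: dB; first exact: radial_solution.
apply: (@le_lt_trans _ _ (d * (4 * pi + 1))); last by move: dd; rewrite lt_min => /andP[].
apply: radial_dist; first exact: le_trans (ltW rr) dle.
have h1 : j%:R * `|h' r| <= 1 by rewrite -ler_pdivlMr// mul1r.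
have h2 : 1 < (j%:R + 1) * `|h' r| by rewrite -ltr_pdivrMr// mul1r natr1.
rewrite cE -[X in _ - X]mulr1 -mulrBr normrM gtr0_norm ?mulr_gt0//.
apply: (@le_trans _ _ (4 * pi * d)).
  rewrite (ler_wpM2l p4)// ler_norml; apply/andP; split; move: h1 h2 hd d0.
    by rewrite mulrDl mul1r; lra.
  by move=> *; lra.
by rewrite [leLHS]mulrC (ler_wpM2l (ltW d0))// lerDl.
Qed.

Lemma area_is_derive (r : R) : 0 < r -> is_derive r 1 (symplectic_area f) (4 * pi * h' r).
Proof.
move=> r0; refine (dv_eq (dv_mul (dv_cmul (4 * pi) (dv_id r)) (dv_inv (f_neq0 r0) (f_der f_smooth r0))) _).
by rewrite /h'; field; exact: f_neq0.
Qed.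

Lemma area_constant : (forall r : R, 0 < r -> h' r = 0) ->
  exists c : R, forall r : R, 0 < r -> symplectic_area f r = c.
Proof.
move=> z; exists (symplectic_area f 1) => r r0.
pose ell (t : R) := 1 + t * (r - 1).
have -> : r = ell 1 by rewrite /ell mul1r addrC subrK.
have -> : symplectic_area f 1 = symplectic_area f (ell 0) by rewrite /ell mul0r addr0.
apply: (@der01_cst _ (fun t => symplectic_area f (ell t))); last exact: itv01_1.
move=> t /itv01P/andP[t0 t1]; have lp : 0 < ell t by rewrite /ell; nra.
have dl : is_derive t 1 ell (r - 1).
  by refine (dv_eq (dv_add (dv_cst t 1) (dv_mul (dv_id t) (dv_cst t (r - 1)))) _); ring.
by refine (dv_eq (dv_comp (area_is_derive lp) dl) _); rewrite z// mulr0 mul0r.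
Qed.

Lemma constant_area (c : R) : (forall r : R, 0 < r -> symplectic_area f r = c) ->
  forall r : R, 0 < r -> h' r = 0.
Proof.
move=> ac r r0; have dc : is_derive r 1 (symplectic_area f) 0.
  apply: (near_eq_is_derive _ (dv_cst r c)).
  by apply: filterS (open_nbhs_nbhs (conj (@open_gt R 0) r0)) => s /= s0; rewrite ac.
have /eqP := dv_unique (area_is_derive r0) dc.
by rewrite mulf_eq0 mulf_eq0 pnatr_eq0 (gt_eqF (pi_gt0 R)) /= => /eqP.
Qed.

End CriticalPoint.

Theorem theorem6p1 (R : realType) (f : R -> R)
    (f_smooth : forall (n : nat) (r : R), 0 < r -> derivable (f^`(n))%classic r 1)
    (f_neq0 : forall r : R, 0 < r -> f r != 0) :
  singular_phase_space [set x : 'rV[R]_3 | x != 0] (radial_bivector f) <->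
  ~ (exists c : R, forall r : R, 0 < r -> symplectic_area f r = c) /\
  (exists2 r : R, 0 < r & ((symplectic_area f)^`())%classic r = 0).
Proof.
have crit r : 0 < r -> ((symplectic_area f)^`())%classic r = 0 <-> h' f r = 0.
  move=> r0; rewrite derive1E; have [_ ->] := area_is_derive f_smooth f_neq0 r0.
  split=> [/eqP|->]; last by rewrite mulr0.
  by rewrite mulf_eq0 mulf_eq0 pnatr_eq0 (gt_eqF (pi_gt0 R)) /= => /eqP.
split=> [sing|[nonconst [r1 r10 /(crit r1 r10) z1]]].
  split=> [[c ac]|]; first exact: flat_nonsingular (constant_area f_smooth f_neq0 ac) sing.
  apply: contrapT => nocrit; move: sing; apply: (regular_nonsingular f_smooth f_neq0).
  by move=> r r0; apply/eqP => z; apply: nocrit; exists r => //; exact/crit.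
have [r2 r20 z2] : exists2 r2 : R, 0 < r2 & h' f r2 != 0.
  apply: contrapT => none; apply: nonconst; apply: (area_constant f_smooth f_neq0) => r r0.
  by apply/eqP/contraT => z; exfalso; apply: none; exists r.
have [r0 [r00 z0 acc]] := critical_boundary f_smooth f_neq0 r10 r20 z1 z2.
exact: critical_singular z0 acc.
Qed.
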